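(* Let $\mu$ be a probability measure on $\mathbb R$, let $x^*\in\mathbb R$ be ($n$-independent), and let $I_\mu(x^* ):=\int\frac{d\mu(s)}{(x^*-s)^3}$. Let $\mu_n=\frac1n\sum_{j=1}^n\delta_{X_j(0)}$ be empirical measures of deterministic initial points converging weakly to $\mu$, and let $d(\mu_n,\mu)$ be the Kolmogorov distance. With the definitions in the context: (1) Suppose that $I_\mu(x^* )>0$, $\liminf_{n\to\infty}\mathrm{dist}(x^*,\mathrm{supp}(\mu_n))>0$ and $d(\mu_n,\mu)=o(n^{-2/3})$ as $n\to\infty$. Then, with gauge point $x_n^*=x^*$, $$\frac{1}{c_{2,\mu}n^{2/3}}\tilde K_{n,t_{n,\mu}^{\rm E}(\tau_1),t_{n,\mu}^{\rm E}(\tau_2)}\Big(x_\mu^*(t_{n,\mu}^{\rm E}(\tau_1))+\frac{u}{c_{2,\mu}n^{2/3}},\,x_\mu^*(t_{n,\mu}^{\rm E}(\tau_2))+\frac{v}{c_{2,\mu}n^{2/3}}\Big)=\mathbb K^{\rm Ai}_{\tau_1,\tau_2}(u,v)+o(1)$$ as $n\to\infty$, uniformly for $\tau_1,\tau_2$ and $u,v$ in compacts of $\mathbb R$. (2) Suppose that $I_\mu(x^* )=0$, $\liminf_{n\to\infty}\mathrm{dist}(x^*,\mathrm{supp}(\mu_n))>0$ and $d(\mu_n,\mu)=o(n^{-3/4})$ as $n\to\infty$. Then, with gauge point $x_n^*=x^*$, $$\frac{1}{c_{3,\mu}n^{3/4}}\tilde K_{n,t_{n,\mu}^{\rm M}(\tau_1),t_{n,\mu}^{\rm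 M}(\tau_2)}\Big(x_\mu^*(t_{n,\mu}^{\rm M}(\tau_1))+\frac{u}{c_{3,\mu}n^{3/4}},\,x_\mu^*(t_{n,\mu}^{\rm M}(\tau_2))+\frac{v}{c_{3,\mu}n^{3/4}}\Big)=\mathbb K^{\rm P}_{\tau_1,\tau_2}(u,v)+o(1)$$ as $n\to\infty$, uniformly for $u,v,\tau_1,\tau_2$ in arbitrary compact subsets of $\mathbb R$. (3) Suppose that $I_\mu(x^* )=0$ with $\mathrm{dist}(x^*,\mathrm{supp}(\mu))>0$ and let $a\ge0$. Then there is a sequence $(\mu_n)_{n\ge1}$ of such empirical measures converging weakly to $\mu$ (together with gauge points $x_n^*\in\mathbb R\setminus\{X_1(0),\dots,X_n(0)\}$) such that $$\frac{1}{c_{3,\mu}n^{3/4}}\tilde K_{n,t_{n,\mu}^{\rm M}(\tau_1),t_{n,\mu}^{\rm M}(\tau_2)}\Big(x_\mu^*(t_{n,\mu}^{\rm M}(\tau_1))+\frac{u}{c_{3,\mu}n^{3/4}},\,x_\mu^*(t_{n,\mu}^{\rm M}(\tau_2))+\frac{v}{c_{3,\mu}n^{3/4}}\Big)=\mathbb K^{a}_{\tau_1,\tau_2}(u+\tau_1b,\,v+\tau_2b)+o(1)$$ as $n\to\infty$, where $b\in\mathbb R$ is a constant depending on the initial configurations $(\mu_n)_{n\ge1}$; the convergence is uniform for $u,v,\tau_1,\tau_2$ in arbitrary compact subsets of $\mathbb R$.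
   Context: Initial data and kernel. For each $n$, $X_1(0)\le\dots\le X_n(0)$ are deterministic reals (depending on $n$) and $\mu_n:=\frac1n\sum_{j=1}^n\delta_{X_j(0)}$. The $n$ non-intersecting Brownian motions (eigenvalues of $n^{-1/2}$ times an $n\times n$ Hermitian Brownian motion) started from these points have space-time correlation kernel, for $s,t>0$, $x,y\in\mathbb R$, $$K_{n,s,t}(x,y):=\frac{n}{(2\pi i)^2\sqrt{st}}\int_{x_0+i\mathbb R}dz\int_{\Gamma}dw\,\frac{\exp\big(\frac{n}{2t}[(z-y)^2+2tg_{\mu_n}(z)]-\frac{n}{2s}[(w-x)^2+2sg_{\mu_n}(w)]\big)}{z-w}-1(s>t)\frac{\sqrt n}{\sqrt{2\pi(s-t)}}\exp\Big(-\frac{n(x-y)^2}{2(s-t)}\Big),$$ where $g_{\mu_n}(z):=\int\log(z-s)\,d\mu_n(s)$ (principal branch), $x_0+i\mathbb R$ is a vertical line (oriented upwards) and $\Gamma$ is a positively oriented closed curve encircling $X_1(0),\dots,X_n(0)$ and not intersecting $x_0+i\mathbb R$. For a gauge point $x_n^*\in\mathbb R\setminus\{X_1(0),\dots,X_n(0)\}$ set $G_n^{(0)}:=\int\frac{d\mu_n(s)}{x_n^*-s}$, $f_n(s,x):=-nG_n^{(0)}x+\frac{n(G_n^{(0)})^2s}{2}$, and $\tilde K_{n,s,t}(x,y):=K_{n,s,t}(x,y)\exp(f_n(t,y)-f_n(s,x))$. Kolmogorov distance: $d(\mu_n,\mu):=\sup_{x\in\mathbb R}|F_n(x)-F(x)|$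 with $F_n,F$ the distribution functions of $\mu_n,\mu$. Quantities from $\mu$ (their existence is assumed): $G_\mu(z):=\int\frac{d\mu(s)}{z-s}$; $x_\mu^*(t):=x^*+t\int\frac{d\mu(s)}{x^*-s}$; $t_{\rm cr,\mu}:=t_{\rm cr,\mu}(x^* ):=\big(\int\frac{d\mu(s)}{(x^*-s)^2}\big)^{-1}$; $$c_{2,\mu}:=\frac1{t_{\rm cr,\mu}}\Big(\frac{G_\mu''(x^* )}2\Big)^{-1/3},\ t_{n,\mu}^{\rm E}(\tau):=t_{\rm cr,\mu}+\frac{2\tau}{c_{2,\mu}^2n^{1/3}},\quad c_{3,\mu}:=\frac1{t_{\rm cr,\mu}}\Big(-\frac{G_\mu'''(x^* )}6\Big)^{-1/4},\ t_{n,\mu}^{\rm M}(\tau):=t_{\rm cr,\mu}+\frac{\tau}{c_{3,\mu}^2n^{1/2}}.$$ Limit kernels ($\tau_1,\tau_2,u,v\in\mathbb R$). Extended Airy kernel: $$\mathbb K^{\rm Ai}_{\tau_1,\tau_2}(u,v):=\frac1{(2\pi i)^2}\int_{\Sigma^{\rm Ai}}d\zeta\int_{\Gamma^{\rm Ai}}d\omega\,\frac{\exp(\frac{\zeta^3}3-\zeta v-\tau_2\zeta^2-\frac{\omega^3}3+\omega u+\tau_1\omega^2)}{\zeta-\omega}-1(\tau_1>\tau_2)\frac{\exp(-\frac{(u-v)^2}{4(\tau_1-\tau_2)})}{\sqrt{4\pi(\tau_1-\tau_2)}},$$ where $\Sigma^{\rm Ai}$ consists of the rays from $\infty e^{-i\pi/3}$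 to $0$ and from $0$ to $\infty e^{i\pi/3}$, and $\Gamma^{\rm Ai}$ of the rays from $\infty e^{-2i\pi/3}$ to $0$ and from $0$ to $\infty e^{2i\pi/3}$. Transition kernel with parameter $a\ge0$: $$\mathbb K^a_{\tau_1,\tau_2}(u,v):=\frac1{(2\pi i)^2}\int_{i\mathbb R}d\zeta\int_{\Gamma^{\rm P}}d\omega\,\frac{\exp(-\frac{\zeta^4}4+\frac{a\zeta^3}3-\frac{\tau_2\zeta^2}2-v\zeta+\frac{\omega^4}4-\frac{a\omega^3}3+\frac{\tau_1\omega^2}2+u\omega)}{\zeta-\omega}-1(\tau_1>\tau_2)\frac{\exp(-\frac{(u-v)^2}{2(\tau_1-\tau_2)})}{\sqrt{2\pi(\tau_1-\tau_2)}},$$ where $i\mathbb R$ is oriented upwards and $\Gamma^{\rm P}$ consists of four rays, two from the origin to $\pm\infty e^{-i\pi/4}$ and two from $\pm\infty e^{i\pi/4}$ to the origin. The extended Pearcey kernel $\mathbb K^{\rm P}$ is $\mathbb K^a$ with $a=0$. *)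

(* Defs.v *)
From HB Require Import structures.
From mathcomp Require Import all_boot all_order all_algebra.
From mathcomp Require Import complex.
From mathcomp Require Import all_classical all_reals all_analysis.

Set Implicit Arguments.
Unset Strict Implicit.
Unset Printing Implicit Defensive.

Import Order.TTheory GRing.Theory Num.Theory.
Import numFieldNormedType.Exports.

Local Open Scope classical_set_scope.
Local Open Scope ring_scope.

Local Notation "x %:C" := (real_complex _ x) (format "x %:C") : ring_scope.
Local Notation "x +i* y" := (Complex x y) : ring_scope.
Local Notation Re := (@complex.Re _).
Local Notation Im := (@complex.Im _).

Section ComplexAnalysis.
Context {R : realType}.
Implicit Types (z : R[i]) (f : R[i] -> R[i]) (D : set R).

Definition Cexp z : R[i] :=
  (expR (Re z) * cos (Im z)) +i* (expR (Re z) * sin (Im z)).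

(* Values in ]-pi, pi]. *)
Definition Arg z : R :=
  let theta := acos (Re z / Normc.normc z) in
  if 0 <= Im z then theta else - theta.

Definition Clog z : R[i] := ln (Normc.normc z) +i* Arg z.

Definition Cintegral (m : {measure set (measurableTypeR R) -> \bar R}) D
    (h : R -> R[i]) : R[i] :=
  (\int[m]_(t in D) Re (h t)) +i* (\int[m]_(t in D) Im (h t)).

Definition path_derive (gamma : R -> R[i]) (t : R) : R[i] :=
  derive1 (Re \o gamma) t +i* derive1 (Im \o gamma) t.

Definition contour_integral D (gamma : R -> R[i]) f : R[i] :=
  Cintegral lebesgue_measure D (fun t => f (gamma t) * path_derive gamma t).

Definition vline (x0 : R) (y : R) : R[i] := x0 +i* y.

Definition vline_integral (x0 : R) f : R[i] :=
  contour_integral setT (vline x0) f.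

(* The ray from the origin to infinity in the direction exp(i theta). *)
Definition ray_integral (theta : R) f : R[i] :=
  contour_integral [set r | 0 <= r]
    (fun r => (r * cos theta) +i* (r * sin theta)) f.

Definition C1 (h : R -> R) : Prop :=
  (forall x, derivable h x 1) /\ continuous (derive1 h).

(* A C^1 function on a compact interval is the restriction of a C^1 function on
   the line; the pieces are given by such extensions. *)
Definition piecewise_C1 (gamma : R -> R[i]) : Prop :=
  exists2 p : seq R, itv_partition 0 1 p &
    forall k, (k < size p)%N ->
      exists g : R -> R[i],
        [/\ C1 (Re \o g), C1 (Im \o g) &
            forall t, nth 0 (0 :: p) k <= t <= nth 0 p k -> gamma t = g t].

Definition closed_curve (gamma : R -> R[i]) : Prop :=
  piecewise_C1 gamma /\ gamma 0 = gamma 1.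

Definition curve_integral (gamma : R -> R[i]) f : R[i] :=
  contour_integral [set t | 0 <= t <= 1] gamma f.

Definition winding_number (gamma : R -> R[i]) (a : R[i]) : R[i] :=
  ((2 * pi)%:C * 'i%C)^-1 * curve_integral gamma (fun w => (w - a)^-1).

End ComplexAnalysis.

Section Measures.
Context {R : realType}.
Implicit Types m : {measure set (measurableTypeR R) -> \bar R}.

Definition empirical n (X : n.-tuple R) :
    {measure set (measurableTypeR R) -> \bar R} :=
  mscale (n%:R^-1)%:nng (msum (fun k => \d_(X`_k : measurableTypeR R)) n).

Definition weakly_converges
    (ms : nat -> {measure set (measurableTypeR R) -> \bar R}) m : Prop :=
  forall h : R -> R, continuous h -> bounded_fun h ->
    (\int[ms n]_x h x) @[n --> \oo] --> \int[m]_x h x.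

Definition msupport m : set R :=
  [set x | forall U : set R, open_nbhs x U -> (0 < m U)%E].

Definition distr_fun m (x : R) : R := fine (m [set y | y <= x]).

Definition kolmogorov_dist m m' : R :=
  sup [set `|distr_fun m x - distr_fun m' x| | x in [set: R]].

(* On the real line outside the support, the complex derivatives of G_mu are the
   derivatives of this real function. *)
Definition stieltjes m (x : R) : R := \int[m]_s (x - s)^-1.

Definition log_potential m (z : R[i]) : R[i] :=
  Cintegral m setT (fun s => Clog (z - s%:C)).

Definition inv_cube_integral m (x : R) : R := \int[m]_s ((x - s) ^+ 3)^-1.

Definition t_cr m (xs : R) : R := (\int[m]_s ((xs - s) ^+ 2)^-1)^-1.

Definition x_star m (xs t : R) : R := xs + t * \int[m]_s (xs - s)^-1.

Definition c2 m (xs : R) : R :=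
  (t_cr m xs)^-1 * (derive1n 2 (stieltjes m) xs / 2) `^ (- 3^-1).

Definition c3 m (xs : R) : R :=
  (t_cr m xs)^-1 * (- derive1n 3 (stieltjes m) xs / 6) `^ (- 4^-1).

Definition t_edge m (xs : R) (n : nat) (tau : R) : R :=
  t_cr m xs + 2 * tau / (c2 m xs ^+ 2 * n%:R `^ 3^-1).

Definition t_merge m (xs : R) (n : nat) (tau : R) : R :=
  t_cr m xs + tau / (c3 m xs ^+ 2 * n%:R `^ 2^-1).

End Measures.

Section Kernels.
Context {R : realType}.

(* "Positively oriented, encircling the points": winding number 1. *)
Definition admissible n (X : n.-tuple R) (x0 : R) (gamma : R -> R[i]) : Prop :=
  [/\ closed_curve gamma,
      forall t, 0 <= t <= 1 -> Re (gamma t) != x0,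
      forall a t, a \in X -> 0 <= t <= 1 -> gamma t != a%:C &
      forall a, a \in X -> winding_number gamma a%:C = 1].

Definition BM_kernel n (X : n.-tuple R) (x0 : R) (gamma : R -> R[i])
    (s t x y : R) : R[i] :=
  let g := log_potential (empirical X) in
  n%:R / (((2 * pi)%:C * 'i%C) ^+ 2 * (Num.sqrt (s * t))%:C) *
  vline_integral x0 (fun z => curve_integral gamma (fun w =>
    Cexp ((n%:R / (2 * t))%:C * ((z - y%:C) ^+ 2 + (2 * t)%:C * g z)
          - (n%:R / (2 * s))%:C * ((w - x%:C) ^+ 2 + (2 * s)%:C * g w))
    / (z - w)))
  - (if t < s
     then Num.sqrt n%:R / Num.sqrt (2 * pi * (s - t))
          * expR (- (n%:R * (x - y) ^+ 2 / (2 * (s - t))))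
     else 0)%:C.

Definition gauge_fun n (X : n.-tuple R) (xg s x : R) : R :=
  let G0 := stieltjes (empirical X) xg in
  - n%:R * G0 * x + n%:R * G0 ^+ 2 * s / 2.

Definition gauged_kernel n (X : n.-tuple R) (xg x0 : R) (gamma : R -> R[i])
    (s t x y : R) : R[i] :=
  BM_kernel X x0 gamma s t x y
  * (expR (gauge_fun X xg t y - gauge_fun X xg s x))%:C.

(* Time parametrisation [tn], spatial centring [xc] (a function of time) and
   spatial scale [sc]. *)
Definition rescaled_kernel (tn xc : R -> R) (sc : R) n (X : n.-tuple R)
    (xg x0 : R) (gamma : R -> R[i]) (tau1 tau2 u v : R) : R[i] :=
  (sc^-1)%:C * gauged_kernel X xg x0 gamma (tn tau1) (tn tau2)
                 (xc (tn tau1) + u / sc) (xc (tn tau2) + v / sc).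

Definition airy_Sigma_integral (f : R[i] -> R[i]) : R[i] :=
  ray_integral (pi / 3) f - ray_integral (- (pi / 3)) f.

Definition airy_Gamma_integral (f : R[i] -> R[i]) : R[i] :=
  ray_integral (2 * pi / 3) f - ray_integral (- (2 * pi / 3)) f.

(* Outgoing along the directions exp(-i pi/4) and - exp(-i pi/4), incoming
   along exp(i pi/4) and - exp(i pi/4). *)
Definition pearcey_Gamma_integral (f : R[i] -> R[i]) : R[i] :=
  ray_integral (- (pi / 4)) f + ray_integral (3 * pi / 4) f
  - ray_integral (pi / 4) f - ray_integral (- (3 * pi / 4)) f.

Definition airy_kernel (tau1 tau2 u v : R) : R[i] :=
  (((2 * pi)%:C * 'i%C) ^+ 2)^-1 *
  airy_Sigma_integral (fun zeta => airy_Gamma_integral (fun omega =>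
    Cexp (zeta ^+ 3 / 3 - zeta * v%:C - tau2%:C * zeta ^+ 2
          - omega ^+ 3 / 3 + omega * u%:C + tau1%:C * omega ^+ 2)
    / (zeta - omega)))
  - (if tau2 < tau1
     then expR (- ((u - v) ^+ 2 / (4 * (tau1 - tau2))))
          / Num.sqrt (4 * pi * (tau1 - tau2))
     else 0)%:C.

Definition transition_kernel (a tau1 tau2 u v : R) : R[i] :=
  (((2 * pi)%:C * 'i%C) ^+ 2)^-1 *
  vline_integral 0 (fun zeta => pearcey_Gamma_integral (fun omega =>
    Cexp (- (zeta ^+ 4 / 4) + a%:C * zeta ^+ 3 / 3 - tau2%:C * zeta ^+ 2 / 2
          - v%:C * zeta
          + omega ^+ 4 / 4 - a%:C * omega ^+ 3 / 3 + tau1%:C * omega ^+ 2 / 2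
          + u%:C * omega)
    / (zeta - omega)))
  - (if tau2 < tau1
     then expR (- ((u - v) ^+ 2 / (2 * (tau1 - tau2))))
          / Num.sqrt (2 * pi * (tau1 - tau2))
     else 0)%:C.

Definition pearcey_kernel : R -> R -> R -> R -> R[i] := transition_kernel 0.

Definition cvg_unif_compact (K : nat -> R -> R -> R -> R -> R[i])
    (L : R -> R -> R -> R -> R[i]) : Prop :=
  forall T U : set R, compact T -> compact U ->
  forall eps : R, 0 < eps ->
  \forall n \near \oo, forall tau1 tau2 u v : R,
    T tau1 -> T tau2 -> U u -> U v ->
    Normc.normc (K n tau1 tau2 u v - L tau1 tau2 u v) < eps.

End Kernels.

(* Main.v *)
Require Import Defs.
From HB Require Import structures.
From mathcomp Require Import all_boot all_order all_algebra.
From mathcomp Require Import complex.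
From mathcomp Require Import all_classical all_reals all_analysis measurable_realfun.
From mathcomp Require Import ring lra.
Import Order.TTheory GRing.Theory Num.Theory.
Import numFieldNormedType.Exports.
Local Open Scope classical_set_scope.
Local Open Scope ring_scope.

(* The w-integrand is exp(polynomial) divided by P(w) = prod_j (w - X_j), so
   the inner integral depends on the closed curve only through its winding
   numbers and may be replaced by four rays issuing from a real base point p
   at the angles +-pi/6, +-5pi/6, the z-line being moved to p + iR. On these
   contours each factor 1 + e xi, e = eps/(p - X_j), is controlled by its own
   fourth order expansion, which gives one Gaussian majorant valid on the
   whole contour. Weighting by |eta|^(-1/2) r^(-1/2) absorbs the Cauchy
   kernel, and dominated convergence yields exp(-g xi + b xi^2 + a3 xi^3 - a4
   xi^4), whose parameters are limits of power sums of the e's. In the edge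
   regime p = x* + c eps with c large makes b > 0, and the wedges are moved
   back afterwards. The power sums of mu_n and mu are compared through bounded
   monotone functions and the Kolmogorov distance. The third part uses affine
   images of quantiles. *)

Local Notation "x %:C" := (real_complex _ x) (format "x %:C") : ring_scope.
Local Notation "x +i* y" := (Complex x y) : ring_scope.
Local Notation Re := (@complex.Re _).
Local Notation Im := (@complex.Im _).
Local Notation nc := Normc.normc.

(** * Complex calculus *)

Section ComplexCalculus.
Context {R : realType}.
Local Notation C := R[i].
Implicit Types (z w : C) (g h : R -> C) (t : R).

(** The angle pi/6 is dictated by uniformity in n. On rays at that angle, as on p + iR, the cube of
    the local variable is purely imaginary, so the third power sum, which has no sign, drops out of
    the modulus, and the fourth power alone produces decay on both contours. Thus no descent paths
    depending on mu_n are needed. The price is that the contours meet at p, where the Cauchy kernel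
    is singular. The z-line can cross the closed curve and the points X_j because the inner integral
    times P(z) is a polynomial in z, whose coefficients see the curve only through its winding
    numbers around the X_j. In the edge regime the limit has no quartic term. Displacing p by c eps
    turns the positive cubic coefficient into a quadratic one of size c, which has to beat the
    bounded time parameters. The parameters run along arbitrary bounded sequences, so limits are
    replaced by asymptotic equality of two sequences. In the third part the affine map fixes the
    first two moments, and a displacement of order n^(-1/4) creates the third one. *)

Lemma complexP z w : Re z = Re w -> Im z = Im w -> z = w.
Proof. by case: z w => a b [c d] /= -> ->. Qed.

Lemma ReD z w : Re (z + w) = Re z + Re w. Proof. by case: z w => ? ? [? ?]. Qed.
Lemma ImD z w : Im (z + w) = Im z + Im w. Proof. by case: z w => ? ? [? ?]. Qed.
Lemma ReN z : Re (- z) = - Re z. Proof. by case: z. Qed.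
Lemma ImN z : Im (- z) = - Im z. Proof. by case: z. Qed.
Lemma ReB z w : Re (z - w) = Re z - Re w. Proof. by rewrite ReD ReN. Qed.
Lemma ImB z w : Im (z - w) = Im z - Im w. Proof. by rewrite ImD ImN. Qed.
Lemma ReM z w : Re (z * w) = Re z * Re w - Im z * Im w.
Proof. by case: z w => ? ? [? ?]. Qed.
Lemma ImM z w : Im (z * w) = Re z * Im w + Im z * Re w.
Proof. by case: z w => ? ? [? ?]. Qed.
Lemma ReC (x : R) : Re x%:C = x. Proof. by []. Qed.
Lemma ImC (x : R) : Im x%:C = 0. Proof. by []. Qed.
Lemma ReMC (x : R) z : Re (x%:C * z) = x * Re z.
Proof. by rewrite ReM /= mul0r subr0. Qed.
Lemma ImMC (x : R) z : Im (x%:C * z) = x * Im z.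
Proof. by rewrite ImM /= mul0r addr0. Qed.
Lemma ReV z : Re z^-1 = Re z / (Re z ^+ 2 + Im z ^+ 2). Proof. by case: z. Qed.
Lemma ImV z : Im z^-1 = - (Im z / (Re z ^+ 2 + Im z ^+ 2)).
Proof. by case: z => a b; rewrite /=. Qed.
Lemma ReK (a b : R) : Re (a +i* b) = a. Proof. by []. Qed.
Lemma ImK (a b : R) : Im (a +i* b) = b. Proof. by []. Qed.
Definition ReImE := (ReK, ImK, ReD, ImD, ReN, ImN, ReMC, ImMC, ReM, ImM, ReC, ImC).

Lemma natC (n : nat) : (n%:R : C) = (n%:R)%:C.
Proof. by rewrite rmorph_nat. Qed.
Lemma sq_neq0 z : z != 0 -> Re z ^+ 2 + Im z ^+ 2 != 0.
Proof.
case: z => a b /=; apply: contra_neq => /eqP.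
by rewrite paddr_eq0 ?sqr_ge0// !sqrf_eq0 => /andP[/eqP -> /eqP ->].
Qed.

Lemma ncE z : nc z = Num.sqrt (Re z ^+ 2 + Im z ^+ 2). Proof. by case: z. Qed.
Lemma nc_sq z : nc z ^+ 2 = Re z ^+ 2 + Im z ^+ 2.
Proof. by rewrite ncE sqr_sqrtr// addr_ge0// sqr_ge0. Qed.
Lemma nc_ge0 z : 0 <= nc z. Proof. by rewrite ncE sqrtr_ge0. Qed.
Lemma nc_gt0 z : z != 0 -> 0 < nc z.
Proof.
by move=> z0; rewrite lt_def nc_ge0 andbT; apply: contra_neq z0 => /Normc.eq0_normc.
Qed.
Lemma nc_eq0 z : (nc z == 0) = (z == 0).
Proof.
by apply/eqP/eqP => [/Normc.eq0_normc//|->]; rewrite ncE /= expr0n addr0 sqrtr0.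
Qed.
Lemma nc0 : nc (0 : C) = 0. Proof. by apply/eqP; rewrite nc_eq0. Qed.
Lemma nc1 : nc (1 : C) = 1. Proof. by rewrite ncE /= expr0n expr1n addr0 sqrtr1. Qed.
Lemma ncM z w : nc (z * w) = nc z * nc w. Proof. exact: Normc.normcM. Qed.
Lemma ncV z : nc z^-1 = (nc z)^-1. Proof. exact: Normc.normcV. Qed.
Lemma ncD z w : nc (z + w) <= nc z + nc w.
Proof. exact: (@le_normcD R). Qed.
Lemma ncN z : nc (- z) = nc z. Proof. by rewrite !ncE !ReImE !sqrrN. Qed.
Lemma ncBC z w : nc (z - w) = nc (w - z). Proof. by rewrite -ncN opprB. Qed.
Lemma ncB z w : nc (z - w) <= nc z + nc w. Proof. by rewrite -(ncN w) ncD. Qed.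
Lemma ncX z n : nc (z ^+ n) = nc z ^+ n.
Proof. by elim: n => [|n ih]; rewrite ?expr0 ?nc1// !exprS ncM ih. Qed.
Lemma ncC (x : R) : nc x%:C = `|x|.
Proof. by rewrite ncE /= expr0n addr0 sqrtr_sqr. Qed.
Lemma nc_nat (n : nat) : nc (n%:R : C) = n%:R.
Proof. by rewrite natC ncC ger0_norm. Qed.
Lemma nc_Re z : `|Re z| <= nc z.
Proof. by rewrite -sqrtr_sqr ncE ler_wsqrtr// lerDl sqr_ge0. Qed.
Lemma nc_Im z : `|Im z| <= nc z.
Proof. by rewrite -sqrtr_sqr ncE ler_wsqrtr// lerDr sqr_ge0. Qed.
Lemma nc_le z : nc z <= `|Re z| + `|Im z|.
Proof.
rewrite ncE -(@ger0_norm _ (`|Re z| + `|Im z|)) ?addr_ge0// -sqrtr_sqr.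
rewrite ler_wsqrtr// sqrrD !real_normK ?num_real// lerD2r lerDl.
by rewrite mulrn_wge0 ?mulr_ge0.
Qed.
Lemma nc_prod (I : Type) (r : seq I) (F : I -> C) :
 nc (\prod_(i <- r) F i) = \prod_(i <- r) nc (F i).
Proof. by elim/big_rec2: _ => [|i y x _ <-]; rewrite ?nc1 ?ncM. Qed.

Lemma CexpD z w : Cexp (z + w) = Cexp z * Cexp w.
Proof.
case: z w => a b [c d]; rewrite /Cexp /=; apply: complexP => /=.
 by rewrite expRD cosD; ring.
by rewrite expRD sinD; ring.
Qed.
Lemma Cexp0 : Cexp (0 : C) = 1.
Proof. by apply: complexP; rewrite /= expR0 ?cos0 ?sin0 mul1r. Qed.
Lemma Cexp_neq0 z : Cexp z != 0.
Proof.
apply/eqP => h; have := CexpD z (- z).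
by rewrite subrr Cexp0 h mul0r => /eqP; rewrite oner_eq0.
Qed.
Lemma CexpN z : Cexp (- z) = (Cexp z)^-1.
Proof.
apply: (mulfI (Cexp_neq0 z)); rewrite mulfV ?Cexp_neq0//.
by rewrite -CexpD subrr Cexp0.
Qed.
Lemma nc_Cexp z : nc (Cexp z) = expR (Re z).
Proof.
rewrite ncE /= !exprMn -mulrDr cos2Dsin2 mulr1 sqrtr_sqr ger0_norm// expR_ge0.
Qed.
Lemma CexpC (x : R) : Cexp x%:C = (expR x)%:C.
Proof. by apply: complexP; rewrite /= ?cos0 ?sin0 ?mulr1 ?mulr0. Qed.
Lemma Cexp_sum (I : Type) (r : seq I) (F : I -> C) :
 Cexp (\sum_(i <- r) F i) = \prod_(i <- r) Cexp (F i).
Proof. by elim/big_rec2: _ => [|i y x _ <-]; rewrite ?Cexp0 ?CexpD. Qed.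
Lemma CexpMn z n : Cexp (z *+ n) = Cexp z ^+ n.
Proof. by elim: n => [|n ih]; rewrite ?mulr0n ?Cexp0// mulrS exprS CexpD ih. Qed.

(** Curves are differentiated componentwise with the derivative [l] as a parameter; differentiation
    on [R[i]] itself never occurs. *)
Definition is_cderive g t (l : C) : Prop :=
 is_derive t 1 (Re \o g) (Re l) /\ is_derive t 1 (Im \o g) (Im l).
Definition ccts g t : Prop :=
 {for t, continuous (Re \o g)} /\ {for t, continuous (Im \o g)}.

Lemma is_cderive_cts g t l : is_cderive g t l -> ccts g t.
Proof.
by move=> [[h1 _] [h2 _]]; split; apply: differentiable_continuous; exact/derivable1_diffP.
Qed.

Lemma is_cderive_ext g h t l l' : g =1 h -> l = l' -> is_cderive g t l -> is_cderive h t l'.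
Proof. by move=> /funext -> ->. Qed.

Lemma is_cderive_cst (c : C) t : is_cderive (fun=> c) t 0.
Proof. by split; exact: is_derive_cst. Qed.

Lemma is_cderiveD g h t l m : is_cderive g t l -> is_cderive h t m ->
 is_cderive (fun t => g t + h t) t (l + m).
Proof.
move=> [h1 h2] [k1 k2]; split; rewrite !ReImE.
 have -> : Re \o (fun t => g t + h t) = (Re \o g) + (Re \o h).
  by apply/funext => x; rewrite /= ReD.
 exact: is_deriveD.
have -> : Im \o (fun t => g t + h t) = (Im \o g) + (Im \o h).
 by apply/funext => x; rewrite /= ImD.
exact: is_deriveD.
Qed.

Lemma is_cderiveM g h t l m : is_cderive g t l -> is_cderive h t m ->
 is_cderive (fun t => g t * h t) t (l * h t + g t * m).
Proof.
move=> [h1 h2] [k1 k2]; split.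
 have -> : Re \o (fun t => g t * h t) = (Re \o g) * (Re \o h) - (Im \o g) * (Im \o h).
  by apply/funext => x; rewrite /= ReM.
 apply: (is_derive_eq (is_deriveB (is_deriveM h1 k1) (is_deriveM h2 k2))); rewrite !ReImE /GRing.scale /=; ring.
have -> : Im \o (fun t => g t * h t) = (Re \o g) * (Im \o h) + (Im \o g) * (Re \o h).
 by apply/funext => x; rewrite /= ImM.
apply: (is_derive_eq (is_deriveD (is_deriveM h1 k2) (is_deriveM h2 k1))); rewrite !ReImE /GRing.scale /=; ring.
Qed.

Lemma is_cderiveV g t l : g t != 0 -> is_cderive g t l ->
 is_cderive (fun t => (g t)^-1) t (- (g t ^+ 2)^-1 * l).
Proof.
move=> g0 [h1 h2].
pose q : R -> R := (Re \o g) * (Re \o g) + (Im \o g) * (Im \o g).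
have qE : q t = Re (g t) ^+ 2 + Im (g t) ^+ 2 by rewrite !expr2.
have q0 : q t != 0 by rewrite qE sq_neq0.
have qd : is_derive t 1 q (2 * (Re (g t) * Re l + Im (g t) * Im l)).
 by apply: (is_derive_eq (is_deriveD (is_deriveM h1 h1) (is_deriveM h2 h2))); rewrite /GRing.scale /=; ring.
have qV : is_derive t 1 (fun x => (q x)^-1)
  (- (q t ^+ 2)^-1 * (2 * (Re (g t) * Re l + Im (g t) * Im l))).
 by have := is_deriveV q0 qd; rewrite /GRing.scale /=.
have [E1 E2] : Re (g t ^+ 2)^-1 = (Re (g t) ^+ 2 - Im (g t) ^+ 2) / (q t) ^+ 2 /\
   Im (g t ^+ 2)^-1 = - (2 * Re (g t) * Im (g t)) / (q t) ^+ 2.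
 have dE : (Re (g t ^+ 2)) ^+ 2 + (Im (g t ^+ 2)) ^+ 2 = q t ^+ 2.
  by rewrite qE !(expr2 (g t)) !ReImE; ring.
 rewrite ReV ImV dE !(expr2 (g t)) !ReImE .
 by split; [congr (_ / _) | rewrite -[LHS]mulNr; congr (_ / _)]; ring.
split.
 have -> : Re \o (fun t => (g t)^-1) = (Re \o g) * (fun x => (q x)^-1).
  by apply/funext => x; rewrite /q !fctE /= ReV !expr2.
 apply: is_derive_eq; rewrite ReM ReN ImN E1 E2 /GRing.scale /=.
 by rewrite [q t in RHS]lock; move: q0 => /=; rewrite -lock; move: (q t) qE => y -> y0; field.
have -> : Im \o (fun t => (g t)^-1) = - ((Im \o g) * (fun x => (q x)^-1)).
 by apply/funext => x; rewrite /q !fctE /= ImV !expr2.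
apply: is_derive_eq; rewrite ImM ReN ImN E1 E2 /GRing.scale /=.
by move: (q t) qE q0 => y -> y0; field.
Qed.

Lemma is_cderive_Cexp g t l : is_cderive g t l ->
 is_cderive (fun t => Cexp (g t)) t (Cexp (g t) * l).
Proof.
move=> [h1 h2].
have e1 : is_derive t 1 (expR \o (Re \o g)) (expR (Re (g t)) * Re l).
 by apply: is_derive_eq; rewrite /GRing.scale /= mulrC.
have e2 : is_derive t 1 (cos \o (Im \o g)) (- sin (Im (g t)) * Im l).
 by apply: is_derive_eq; rewrite /GRing.scale /= mulrC.
have e3 : is_derive t 1 (sin \o (Im \o g)) (cos (Im (g t)) * Im l).
 by apply: is_derive_eq; rewrite /GRing.scale /= mulrC.
split.
 have -> : Re \o (fun t => Cexp (g t)) = (expR \o (Re \o g)) * (cos \o (Im \o g)) by [].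
 by apply: is_derive_eq; rewrite ReM /GRing.scale /=; ring.
have -> : Im \o (fun t => Cexp (g t)) = (expR \o (Re \o g)) * (sin \o (Im \o g)) by [].
by apply: is_derive_eq; rewrite ImM /GRing.scale /=; ring.
Qed.

End ComplexCalculus.

Ltac complex_ring := apply: complexP; rewrite !ReImE; ring.

(** * Integrals of complex-valued functions of a real variable *)

Section ComplexIntegral.
Context {R : realType}.
Local Notation C := R[i].
Local Notation mu := (@lebesgue_measure R).
Implicit Types (h k : R -> C) (D : set (measurableTypeR R)).

Definition cintegrable D h : Prop :=
 mu.-integrable D (EFin \o (Re \o h)) /\ mu.-integrable D (EFin \o (Im \o h)).
Definition cmeas D h : Prop :=
 measurable_fun D (Re \o h) /\ measurable_fun D (Im \o h).
Local Notation Cint := (Cintegral mu).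

Lemma cintegrable_cmeas D h : cintegrable D h -> cmeas D h.
Proof. by move=> [/measurable_int/measurable_EFinP ? /measurable_int/measurable_EFinP ?]. Qed.

Lemma eq_cintegrable D h k : measurable D -> (forall t, D t -> h t = k t) ->
 cintegrable D h -> cintegrable D k.
Proof.
by move=> mD hk [h1 h2]; split; [apply: (eq_integrable mD _ _ _ h1) | apply: (eq_integrable mD _ _ _ h2)] => //;
  move=> t /set_mem /hk /= ->.
Qed.

Lemma eq_Cint D h k : (forall t, D t -> h t = k t) -> Cint D h = Cint D k.
Proof.
by move=> hk; rewrite /Cintegral; congr Complex; apply: eq_Rintegral => t /set_mem /hk ->.
Qed.

Lemma cintegrableD D h k : measurable D -> cintegrable D h -> cintegrable D k ->
 cintegrable D (fun t => h t + k t).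
Proof.
move=> mD [h1 h2] [k1 k2]; split.
 by apply: (eq_integrable mD _ _ _ (integrableD mD h1 k1)) => // t _; rewrite /= ReD EFinD.
by apply: (eq_integrable mD _ _ _ (integrableD mD h2 k2)) => // t _; rewrite /= ImD EFinD.
Qed.

Lemma CintD D h k : measurable D -> cintegrable D h -> cintegrable D k ->
 Cint D (fun t => h t + k t) = Cint D h + Cint D k.
Proof.
move=> mD [h1 h2] [k1 k2]; apply: complexP; rewrite ReImE /=.
 by rewrite -RintegralD//; apply: eq_Rintegral => t _; rewrite ReD.
by rewrite -RintegralD//; apply: eq_Rintegral => t _; rewrite ImD.
Qed.

Lemma cintegrableZ D h (c : C) : measurable D -> cintegrable D h ->
 cintegrable D (fun t => c * h t).
Proof.
move=> mD [h1 h2]; split.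
 apply: (eq_integrable mD _ _ _ (integrableB mD (integrableZl mD (Re c) h1) (integrableZl mD (Im c) h2))) => //.
 by move=> t _; rewrite /= ReM EFinB !EFinM.
apply: (eq_integrable mD _ _ _ (integrableD mD (integrableZl mD (Re c) h2) (integrableZl mD (Im c) h1))) => //.
by move=> t _; rewrite /= ImM EFinD !EFinM.
Qed.

Lemma CintZ D h (c : C) : measurable D -> cintegrable D h ->
 Cint D (fun t => c * h t) = c * Cint D h.
Proof.
move=> mD [h1 h2].
have I1 r (f : R -> R) : mu.-integrable D (EFin \o f) ->
  mu.-integrable D (EFin \o (fun x => r * f x)) by move=> /(integrableZl mD r).
apply: complexP.
 rewrite ReM /Cintegral /= -(RintegralZl (Re c) mD h1) -(RintegralZl (Im c) mD h2).
 rewrite -(RintegralB mD (I1 _ _ h1) (I1 _ _ h2)).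
 by apply: eq_Rintegral => t _; rewrite ReM.
rewrite ImM /Cintegral /= -(RintegralZl (Re c) mD h2) -(RintegralZl (Im c) mD h1).
rewrite -(RintegralD mD (I1 _ _ h2) (I1 _ _ h1)).
by apply: eq_Rintegral => t _; rewrite ImM.
Qed.

Lemma Cint0 D : Cint D (fun=> 0) = 0.
Proof. by apply: complexP => /=; rewrite /Rintegral integral0. Qed.

Lemma cintegrable0 D : measurable D -> cintegrable D (fun=> 0).
Proof. by move=> mD; split; exact: integrable0. Qed.

Lemma cintegrableN D h : measurable D -> cintegrable D h -> cintegrable D (fun t => - h t).
Proof.
by move=> mD ih; apply: eq_cintegrable (cintegrableZ _ _ (-1) mD ih) => // t _; rewrite mulN1r.
Qed.

Lemma CintN D h : measurable D -> cintegrable D h -> Cint D (fun t => - h t) = - Cint D h.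
Proof.
by move=> mD ih; rewrite -mulN1r -CintZ//; apply: eq_Cint => t _; rewrite mulN1r.
Qed.

Lemma cintegrableB D h k : measurable D -> cintegrable D h -> cintegrable D k ->
 cintegrable D (fun t => h t - k t).
Proof. by move=> mD ih ik; apply: cintegrableD => //; exact: cintegrableN. Qed.

Lemma CintB D h k : measurable D -> cintegrable D h -> cintegrable D k ->
 Cint D (fun t => h t - k t) = Cint D h - Cint D k.
Proof. by move=> mD ih ik; rewrite CintD// ?CintN//; exact: cintegrableN. Qed.

Lemma le_cintegrable D h (b : R -> R) : measurable D -> cmeas D h ->
 mu.-integrable D (EFin \o b) -> (forall t, D t -> nc (h t) <= b t) -> cintegrable D h.
Proof.
move=> mD [m1 m2] ib hb; split; apply: (le_integrable mD _ _ ib) => //=.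
- exact/measurable_EFinP.
- move=> t Dt; rewrite lee_fin (le_trans (nc_Re _))// (le_trans (hb t Dt))//.
 exact: ler_norm.
- exact/measurable_EFinP.
- move=> t Dt; rewrite lee_fin (le_trans (nc_Im _))// (le_trans (hb t Dt))//.
 exact: ler_norm.
Qed.

(** The factor 2 is the price of bounding the real and imaginary parts separately; all later uses
    tolerate a constant. *)
Lemma nc_Cint_le D h (b : R -> R) : measurable D -> cintegrable D h ->
 mu.-integrable D (EFin \o b) -> (forall t, D t -> nc (h t) <= b t) ->
 nc (Cint D h) <= 2 * \int[mu]_(t in D) b t.
Proof.
move=> mD [i1 i2] ib hb; rewrite (le_trans (nc_le _))// mulr_natl mulr2n /=.
have H f : mu.-integrable D (EFin \o f) -> (forall t, D t -> `|f t| <= b t) ->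
  `|\int[mu]_(t in D) f t| <= \int[mu]_(t in D) b t.
 move=> fi fb; rewrite (le_trans (le_normr_Rintegral mD fi))// le_Rintegral//.
 exact: (integrable_norm fi).
apply: lerD; apply: H => // t Dt; apply: le_trans (hb t Dt); [exact: nc_Re|exact: nc_Im].
Qed.

Lemma Cint_setU (A B : set (measurableTypeR R)) h : measurable A -> measurable B ->
 cintegrable (A `|` B) h -> [disjoint A & B] -> Cint (A `|` B) h = Cint A h + Cint B h.
Proof.
move=> mA mB [i1 i2] AB; apply: complexP.
 by rewrite ReD /Cintegral /= Rintegral_setU.
by rewrite ImD /Cintegral /= Rintegral_setU.
Qed.

Lemma ccts_within D h : (forall t, D t -> ccts h t) ->
 {within D, continuous (Re \o h)} /\ {within D, continuous (Im \o h)}.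
Proof.
move=> ch; split; apply/subspace_continuousP => x Dx;
 apply: cvg_within_filter; [exact: (ch x Dx).1|exact: (ch x Dx).2].
Qed.

Lemma ccts_cmeas D h : measurable D -> (forall t, D t -> ccts h t) -> cmeas D h.
Proof.
by move=> mD /ccts_within[c1 c2]; split; apply: subspace_continuous_measurable_fun.
Qed.

Lemma ccts_cintegrable a b h : (forall t, a <= t <= b -> ccts h t) ->
 cintegrable `[a, b] h.
Proof.
move=> ch; have /ccts_within[c1 c2] : forall t, `[a, b]%classic t -> ccts h t.
 by move=> t; rewrite /= in_itv /=; exact: ch.
by split; apply: continuous_compact_integrable => //; exact: segment_compact.
Qed.

Lemma Cint_FTC a b (F f : R -> C) : a <= b ->
 (forall t, a <= t <= b -> is_cderive F t (f t)) ->
 (forall t, a <= t <= b -> ccts f t) ->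
 Cint `[a, b] f = F b - F a.
Proof.
rewrite le_eqVlt => /predU1P[->|ab] dF cf.
 by rewrite set_itv1 subrr; apply: complexP => /=; rewrite Rintegral_set1.
have H (p : C -> R) (pl : forall t l, is_cderive F t l -> is_derive t 1 (p \o F) (p l)) :
  {within `[a, b], continuous (p \o f)} ->
  \int[mu]_(t in `[a, b]) p (f t) = p (F b) - p (F a).
 move=> cpf; rewrite /Rintegral (@continuous_FTC2 _ (p \o f) (p \o F))//.
 - have D t : a <= t <= b -> derivable (p \o F) t 1.
   by move=> /dF/pl [].
  have Cc t : a <= t <= b -> {for t, continuous (p \o F)}.
   by move=> /D Dt; apply: differentiable_continuous; exact/derivable1_diffP.
  split.
  + by move=> t; rewrite in_itv /= => /andP[/ltW ? /ltW ?]; apply: D; apply/andP.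
  + by apply: cvg_at_right_filter; apply: Cc; rewrite lexx ltW.
  + by apply: cvg_at_left_filter; apply: Cc; rewrite lexx ltW.
 - move=> t; rewrite in_itv /= => /andP[/ltW h1 /ltW h2].
  by rewrite derive1E; apply: derive_val; apply: pl; apply: dF; rewrite h1.
have /ccts_within[c1 c2] : forall t, `[a, b]%classic t -> ccts f t.
 by move=> t; rewrite /= in_itv /=; exact: cf.
apply: complexP.
 by rewrite ReB /Cintegral /=; apply: (H (@complex.Re R)) => // t l [].
by rewrite ImB /Cintegral /=; apply: (H (@complex.Im R)) => // t l [].
Qed.

(** Endpoints are negligible. A piecewise C1 curve agrees with its smooth pieces on closed
    intervals, but its derivative agrees with theirs only on the open ones. *)
Lemma Cint_eq_oo a b h k : (forall t, a < t < b -> h t = k t) ->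
 cintegrable `[a, b] k -> cintegrable `[a, b] h /\ Cint `[a, b] h = Cint `[a, b] k.
Proof.
move=> hk ik.
have ik' : cintegrable `]a, b[ k.
 by case: ik => k1 k2; split; [apply: integrableS k1|apply: integrableS k2] => //;
   exact: subset_itv_oo_cc.
have ih' : cintegrable `]a, b[ h.
 apply: eq_cintegrable ik' => // t /=; rewrite in_itv /= => /hk ->//.
have mh : cmeas `[a, b] h.
 by have [m1 m2] := cintegrable_cmeas _ _ ih'; split; apply: measurable_fun_itv_cc; eassumption.
have E f : measurable_fun `]a, b[ f -> \int[mu]_(t in `[a, b]) f t = \int[mu]_(t in `]a, b[) f t.
 by move=> mf; rewrite /Rintegral integral_itv_bndoo//; exact/measurable_EFinP.
have dI f : measurable_fun `[a, b] f -> mu.-integrable `]a, b[ (EFin \o f) ->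
  mu.-integrable `[a, b] (EFin \o f).
 move=> mf /integrableP[mf' fi]; apply/integrableP; split; first exact/measurable_EFinP.
 by rewrite integral_itv_bndoo//; apply: measurableT_comp.
split; first by split; apply: dI => //; [exact: mh.1|exact: ih'.1|exact: mh.2|exact: ih'.2].
have [m1 m2] := cintegrable_cmeas _ _ ih'; have [m3 m4] := cintegrable_cmeas _ _ ik'.
rewrite /Cintegral !E//; congr Complex; apply: eq_Rintegral => t /set_mem /=;
 by rewrite in_itv /= => /hk ->.
Qed.

Lemma integrable_setU (A B : set (measurableTypeR R)) (f : R -> \bar R) : measurable A -> measurable B ->
 [disjoint A & B] -> mu.-integrable A f -> mu.-integrable B f -> mu.-integrable (A `|` B) f.
Proof.
move=> mA mB AB /integrableP[m1 i1] /integrableP[m2 i2].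
have mf : measurable_fun (A `|` B) f by apply/measurable_funU.
apply/integrableP; split => //.
rewrite ge0_integral_setU//; last by apply: measurableT_comp.
by rewrite lte_add_pinfty.
Qed.

Lemma cintegrable_itv_cat a b c h : a <= b <= c ->
 cintegrable `[a, b] h -> cintegrable `[b, c] h ->
 cintegrable `[a, c] h /\ Cint `[a, c] h = Cint `[a, b] h + Cint `[b, c] h.
Proof.
move=> /andP[ab bc] iab ibc.
have U : `[a, c]%classic = `[a, b]%classic `|` `]b, c]%classic.
 by rewrite (@itv_bndbnd_setU _ _ _ (BRight b))// bnd_simp.
have ibc' : cintegrable `]b, c] h.
 by case: ibc => k1 k2; split; [apply: integrableS k1|apply: integrableS k2] => //;
   apply: subset_itvr; rewrite bnd_simp.
have dis : [disjoint `[a, b]%classic & `]b, c]%classic].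
 apply/disj_setPS => y [/=]; rewrite !in_itv /= => /andP[_ yx] /andP[].
 by rewrite ltNge yx.
have ih : cintegrable `[a, c] h.
 have H f : mu.-integrable `[a, b] f -> mu.-integrable `]b, c] f -> mu.-integrable `[a, c] f.
  by move=> i1 i2; rewrite U; exact: integrable_setU.
 by split; apply: H; [exact: iab.1|exact: ibc'.1|exact: iab.2|exact: ibc'.2].
split => //; rewrite U Cint_setU//; last by rewrite -U.
congr (_ + _); have [m1 m2] := ibc'.
by rewrite /Cintegral; congr Complex; rewrite Rintegral_itv_obnd_cbnd.
Qed.

End ComplexIntegral.

(** * Chains of curve pieces and Cauchy's theorem for exponential times rational integrands *)

Section Chains.
Context {R : realType}.
Local Notation C := R[i].
Local Notation mu := (@lebesgue_measure R).
Local Notation Cint := (Cintegral mu).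
Implicit Types (f : C -> C) (g h : R -> C) (S : C -> Prop).

Lemma ccts_cst (c : C) t : ccts (fun=> c) t.
Proof. by split; exact: cst_continuous. Qed.
Lemma cctsD g h t : ccts g t -> ccts h t -> ccts (fun t => g t + h t) t.
Proof.
move=> [g1 g2] [h1 h2]; split.
 have -> : Re \o (fun t => g t + h t) = (Re \o g) \+ (Re \o h).
  by apply/funext => x; rewrite /= ReD.
 exact: continuousD.
have -> : Im \o (fun t => g t + h t) = (Im \o g) \+ (Im \o h).
 by apply/funext => x; rewrite /= ImD.
exact: continuousD.
Qed.
Lemma cctsM g h t : ccts g t -> ccts h t -> ccts (fun t => g t * h t) t.
Proof.
move=> [g1 g2] [h1 h2]; split.
 have -> : Re \o (fun t => g t * h t) =
   ((Re \o g) \* (Re \o h)) \- ((Im \o g) \* (Im \o h)).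
  by apply/funext => x; rewrite /= ReM.
 by apply: continuousB; exact: continuousM.
have -> : Im \o (fun t => g t * h t) =
  ((Re \o g) \* (Im \o h)) \+ ((Im \o g) \* (Re \o h)).
 by apply/funext => x; rewrite /= ImM.
by apply: continuousD; exact: continuousM.
Qed.
Lemma cctsN g t : ccts g t -> ccts (fun t => - g t) t.
Proof.
have -> : (fun t => - g t) = (fun t => (-1) * g t) by apply/funext => x; rewrite mulN1r.
by apply: cctsM; exact: ccts_cst.
Qed.
Lemma cctsB g h t : ccts g t -> ccts h t -> ccts (fun t => g t - h t) t.
Proof. by move=> cg ch; apply: cctsD => //; exact: cctsN. Qed.
Lemma cctsV g t : g t != 0 -> ccts g t -> ccts (fun t => (g t)^-1) t.
Proof.
move=> g0 [g1 g2].
have q0 : Re (g t) ^+ 2 + Im (g t) ^+ 2 != 0 by exact: sq_neq0.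
have qc : {for t, continuous (fun x => (Re (g x) ^+ 2 + Im (g x) ^+ 2)^-1)}.
 apply: (@continuousV _ _ (fun x => Re (g x) ^+ 2 + Im (g x) ^+ 2)) => //.
 apply: continuousD.
  by apply: (@continuousM _ _ (Re \o g) (Re \o g)).
 by apply: (@continuousM _ _ (Im \o g) (Im \o g)).
split.
 have -> : Re \o (fun t => (g t)^-1) =
   (Re \o g) \* (fun x => (Re (g x) ^+ 2 + Im (g x) ^+ 2)^-1).
  by apply/funext => x; rewrite /= ReV.
 exact: continuousM.
have -> : Im \o (fun t => (g t)^-1) =
  \- ((Im \o g) \* (fun x => (Re (g x) ^+ 2 + Im (g x) ^+ 2)^-1)).
 by apply/funext => x; rewrite /= ImV.
by apply: continuousN; exact: continuousM.
Qed.
Lemma cctsX g t n : ccts g t -> ccts (fun t => g t ^+ n) t.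
Proof.
move=> cg; elim: n => [|n ih]; first exact: (ccts_cst 1).
have -> : (fun t => g t ^+ n.+1) = (fun t => g t * g t ^+ n).
 by apply/funext => x; rewrite exprS.
exact: cctsM.
Qed.
Lemma ccts_Cexp g t : ccts g t -> ccts (fun t => Cexp (g t)) t.
Proof.
move=> [g1 g2].
have e : {for t, continuous (expR \o (Re \o g))}.
 by apply: continuous_comp => //; exact: continuous_expR.
split.
 have -> : Re \o (fun t => Cexp (g t)) = (expR \o (Re \o g)) \* (cos \o (Im \o g)) by [].
 by apply: continuousM => //; apply: continuous_comp => //; exact: continuous_cos.
have -> : Im \o (fun t => Cexp (g t)) = (expR \o (Re \o g)) \* (sin \o (Im \o g)) by [].
by apply: continuousM => //; apply: continuous_comp => //; exact: continuous_sin.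
Qed.
Lemma ccts_horner g t (q : {poly C}) : ccts g t -> ccts (fun t => q.[g t]) t.
Proof.
move=> cg; elim/poly_ind: q => [|q c ih].
 have -> : (fun t => (0 : {poly C}).[g t]) = (fun=> 0).
  by apply/funext => x; rewrite horner0.
 exact: ccts_cst.
have -> : (fun t => (q * 'X + c%:P).[g t]) = (fun t => q.[g t] * g t + c).
 by apply/funext => x; rewrite !hornerE.
by apply: cctsD; [exact: cctsM|exact: ccts_cst].
Qed.
Lemma nc_cts g t : ccts g t -> {for t, continuous (fun t => nc (g t))}.
Proof.
move=> [g1 g2].
have -> : (fun t => nc (g t)) = Num.sqrt \o (fun t => Re (g t) ^+ 2 + Im (g t) ^+ 2).
 by apply/funext => x; rewrite /= ncE.
apply: continuous_comp; last exact: sqrt_continuous.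
apply: continuousD.
 by apply: (@continuousM _ _ (Re \o g) (Re \o g)).
by apply: (@continuousM _ _ (Im \o g) (Im \o g)).
Qed.

(* Continuity and complex antidifferentiation are tested along curves, which is
  all that path integrals need. *)
Definition fcts S f := forall h t, S (h t) -> ccts h t -> ccts (f \o h) t.
Definition rcts S (H : C -> R) := forall h t, S (h t) -> ccts h t ->
 {for t, continuous (H \o h)}.
Definition prim S (F f : C -> C) := forall h t l, S (h t) -> is_cderive h t l ->
 is_cderive (F \o h) t (f (h t) * l).

(** The curve and its derivative live on the whole line and are used on [[pl, pr]], which avoids
    one-sided derivatives at the ends. *)
Record piece := Piece { pgm : R -> C; pdr : R -> C; pl : R; pr : R }.
Definition wfp (p : piece) :=
 [/\ pl p <= pr p, forall t, is_cderive (pgm p) t (pdr p t) & forall t, ccts (pdr p) t].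
Definition pint (p : piece) f : C := Cint `[pl p, pr p] (fun t => f (pgm p t) * pdr p t).
Definition ptrace S (p : piece) := forall t, pl p <= t <= pr p -> S (pgm p t).

(** The set [S] is a parameter because one chain is used with several sets, according to the points
    that the integrand at hand must avoid. *)
Fixpoint chain_in S (ch : seq (C * piece)) : Prop :=
 if ch is cp :: r then [/\ wfp cp.2, ptrace S cp.2 & chain_in S r] else True.
Definition cint (ch : seq (C * piece)) f : C := \sum_(cp <- ch) cp.1 * pint cp.2 f.
Definition bdry (ch : seq (C * piece)) (F : C -> C) : C :=
 \sum_(cp <- ch) cp.1 * (F (pgm cp.2 (pr cp.2)) - F (pgm cp.2 (pl cp.2))).
(** Vanishing boundary, tested against every function instead of being a formal sum of points: with
    a primitive as test function this is the vanishing of the integral. *)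
Definition closed_chain ch := forall F, bdry ch F = 0.

Lemma chain_in_cat S c1 c2 : chain_in S c1 -> chain_in S c2 -> chain_in S (c1 ++ c2).
Proof. by elim: c1 => //= cp r ih [? ? ?] ?; split => //; exact: ih. Qed.
Lemma chain_in_sub S S' ch : (forall w, S w -> S' w) -> chain_in S ch -> chain_in S' ch.
Proof.
by move=> SS; elim: ch => //= cp r ih [? h ?]; split; [|move=> t /h /SS|exact: ih].
Qed.
Lemma cint_cat c1 c2 f : cint (c1 ++ c2) f = cint c1 f + cint c2 f.
Proof. by rewrite /cint big_cat. Qed.

Lemma pint_ccts S p f : wfp p -> ptrace S p -> fcts S f ->
 forall t, pl p <= t <= pr p -> ccts (fun t => f (pgm p t) * pdr p t) t.
Proof.
move=> [_ dp cp] Sp cf t tp; apply: cctsM => //.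
by apply: cf; [exact: Sp|exact: is_cderive_cts (dp t)].
Qed.

Lemma pint_integrable S p f : wfp p -> ptrace S p -> fcts S f ->
 cintegrable `[pl p, pr p] (fun t => f (pgm p t) * pdr p t).
Proof. by move=> wp Sp cf; apply: ccts_cintegrable; exact: (pint_ccts S). Qed.

Lemma cintD S ch f k : chain_in S ch -> fcts S f -> fcts S k ->
 cint ch (fun w => f w + k w) = cint ch f + cint ch k.
Proof.
move=> + cf ck; elim: ch => [|cp r ih] /=; first by rewrite /cint !big_nil addr0.
move=> [wp Sp Sr]; rewrite /cint !big_cons; have := ih Sr; rewrite /cint => ->.
rewrite addrACA -mulrDr; congr (_ * _ + _).
rewrite /pint -CintD//; [|exact: pint_integrable Sp cf|exact: pint_integrable Sp ck].
by apply: eq_Cint => t _; rewrite mulrDl.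
Qed.

Lemma cintZ S ch f (c : C) : chain_in S ch -> fcts S f ->
 cint ch (fun w => c * f w) = c * cint ch f.
Proof.
move=> + cf; elim: ch => [|cp r ih] /=; first by rewrite /cint !big_nil mulr0.
move=> [wp Sp Sr]; rewrite /cint !big_cons; have := ih Sr; rewrite /cint => ->.
rewrite mulrDr mulrCA; congr (_ * _ + _).
rewrite /pint -CintZ//; last exact: pint_integrable Sp cf.
by apply: eq_Cint => t _; rewrite mulrA.
Qed.

Lemma eq_cint S ch f k : chain_in S ch -> (forall w, S w -> f w = k w) ->
 cint ch f = cint ch k.
Proof.
move=> + fk; elim: ch => [|cp r ih] /=; first by rewrite /cint !big_nil.
move=> [wp Sp Sr]; rewrite /cint !big_cons; have := ih Sr; rewrite /cint => ->.
congr (_ * _ + _); apply: eq_Cint => t; rewrite /= in_itv /= => /Sp/fk.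
by case: wp => _ _ _ -> .
Qed.

Lemma cint_prim S ch F f : chain_in S ch -> fcts S f -> prim S F f ->
 cint ch f = bdry ch F.
Proof.
move=> + cf dF; elim: ch => [|cp r ih] /=; first by rewrite /cint /bdry !big_nil.
move=> [wp Sp Sr]; rewrite /cint /bdry !big_cons.
have := ih Sr; rewrite /cint /bdry => ->; congr (_ * _ + _).
rewrite /pint (@Cint_FTC _ _ _ (F \o pgm cp.2)) //; last exact: (pint_ccts S).
 by case: wp.
by move=> t tp; apply: dF; [exact: Sp|case: wp].
Qed.

(** [M] depends on the chain and on [H] only, so one constant serves a whole sequence of integrands
    while [e] tends to 0. *)
Lemma cint_bound S ch (H : C -> R) : chain_in S ch -> rcts S H ->
 exists2 M : R, 0 <= M & forall f e, 0 <= e -> fcts S f ->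
  (forall w, S w -> nc (f w) <= e * H w) -> nc (cint ch f) <= e * M.
Proof.
move=> + cH; elim: ch => [|cp r ih] /=.
 by exists 0 => // f e _ _ _; rewrite /cint big_nil nc0 mulr0.
move=> [wp Sp Sr]; have [M M0 hM] := ih Sr.
pose b t := H (pgm cp.2 t) * nc (pdr cp.2 t).
have ib : mu.-integrable `[pl cp.2, pr cp.2] (EFin \o b).
 apply: continuous_compact_integrable; first exact: segment_compact.
 apply/subspace_continuousP => x /=; rewrite in_itv /= => xp.
 apply: cvg_within_filter; apply: continuousM.
  by case: wp => _ dp _; apply: cH; [exact: Sp|exact: is_cderive_cts (dp x)].
 by apply: nc_cts; case: wp.
exists (nc cp.1 * (2 * `|\int[mu]_(t in `[pl cp.2, pr cp.2]) b t|) + M).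
 by rewrite addr_ge0// mulr_ge0 ?nc_ge0// mulr_ge0.
move=> f e e0 cf fH; rewrite /cint big_cons (le_trans (ncD _ _))// mulrDr.
apply: lerD; last exact: hM.
rewrite ncM mulrCA ler_wpM2l ?nc_ge0//.
have ib' : mu.-integrable `[pl cp.2, pr cp.2] (EFin \o (fun t => e * b t)).
 by apply: (integrableZl _ e ib).
have := @nc_Cint_le _ `[pl cp.2, pr cp.2] _ (fun t => e * b t) _ (pint_integrable _ _ _ wp Sp cf) ib'.
rewrite RintegralZl// => /(_ _ _)/le_trans; apply => //.
 move=> t; rewrite /= in_itv /= => tp; rewrite ncM /b mulrA ler_wpM2r ?nc_ge0//.
 by apply: fH; exact: Sp.
by rewrite mulrCA ler_wpM2l// ler_wpM2l// ler_norm.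
Qed.

Lemma fcts_cst S (c : C) : fcts S (fun=> c).
Proof. by move=> h t _ _; exact: ccts_cst. Qed.
Lemma fcts_id S : fcts S id.
Proof. by []. Qed.
Lemma fctsD S f k : fcts S f -> fcts S k -> fcts S (fun w => f w + k w).
Proof. by move=> cf ck h t Sh ch; apply: cctsD; [exact: cf|exact: ck]. Qed.
Lemma fctsB S f k : fcts S f -> fcts S k -> fcts S (fun w => f w - k w).
Proof. by move=> cf ck h t Sh ch; apply: cctsB; [exact: cf|exact: ck]. Qed.
Lemma fctsM S f k : fcts S f -> fcts S k -> fcts S (fun w => f w * k w).
Proof. by move=> cf ck h t Sh ch; apply: cctsM; [exact: cf|exact: ck]. Qed.
Lemma fctsV S f : (forall w, S w -> f w != 0) -> fcts S f -> fcts S (fun w => (f w)^-1).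
Proof. by move=> f0 cf h t Sh ch; apply: cctsV; [exact: f0|exact: cf]. Qed.
Lemma fcts_Cexp S f : fcts S f -> fcts S (fun w => Cexp (f w)).
Proof. by move=> cf h t Sh ch; apply: ccts_Cexp; exact: cf. Qed.
Lemma fcts_horner S (q : {poly C}) : fcts S (fun w => q.[w]).
Proof. by move=> h t Sh ch; apply: ccts_horner. Qed.
Lemma fcts_XsubV S (a : C) : (forall w, S w -> w != a) -> fcts S (fun w => (w - a)^-1).
Proof.
move=> Sa; apply: fctsV => [w /Sa|]; first by rewrite subr_eq0.
by apply: fctsB; [exact: fcts_id|exact: fcts_cst].
Qed.
Definition invp (l : seq C) (w : C) : C := \prod_(a <- l) (w - a)^-1.
Lemma fcts_invp S (l : seq C) : (forall a w, a \in l -> S w -> w != a) -> fcts S (invp l).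
Proof.
elim: l => [|a l ih] Sl.
 have -> : invp [::] = (fun=> 1) by apply/funext => w; rewrite /invp big_nil.
 exact: fcts_cst.
have -> : invp (a :: l) = (fun w => (w - a)^-1 * invp l w).
 by apply/funext => w; rewrite /invp big_cons.
apply: fctsM; first by apply: fcts_XsubV => w; apply: Sl; rewrite mem_head.
by apply: ih => b w bl; apply: Sl; rewrite inE bl orbT.
Qed.

Lemma is_cderiveX h t l n : is_cderive h t l ->
 is_cderive (fun t => h t ^+ n.+1) t (n.+1%:R * h t ^+ n * l).
Proof.
move=> dh; elim: n => [|n ih].
 by apply: is_cderive_ext dh => [x|]; rewrite ?expr1// expr0 !mul1r.
apply: is_cderive_ext (is_cderiveM _ _ _ _ _ dh ih) => [x|]; first by rewrite [RHS]exprS.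
by rewrite -[in RHS](add1n n.+1) natrD !exprS /=; ring.
Qed.

Lemma prim_X S n : prim S (fun w => n.+1%:R^-1 * w ^+ n.+1) (fun w => w ^+ n).
Proof.
move=> h t l _ dh.
have n0 : n.+1%:R != 0 :> C by rewrite pnatr_eq0.
apply: is_cderive_ext (is_cderiveM _ _ _ _ _ (is_cderive_cst n.+1%:R^-1 t) (is_cderiveX _ _ _ n dh)) => //.
by rewrite mul0r add0r !mulrA mulVf// mul1r.
Qed.

Lemma prim_XsubVX S a n : (forall w, S w -> w != a) ->
 prim S (fun w => - n.+1%:R^-1 * (w - a)^-1 ^+ n.+1) (fun w => (w - a)^-1 ^+ n.+2).
Proof.
move=> Sa h t l Sh dh.
have n0 : n.+1%:R != 0 :> C by rewrite pnatr_eq0.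
have ha : h t - a != 0 by rewrite subr_eq0; exact: Sa.
have d1 : is_cderive (fun t => h t - a) t l.
 by apply: is_cderive_ext (is_cderiveD _ _ _ _ _ dh (is_cderive_cst (- a) t)) => //; rewrite addr0.
have d2 := is_cderiveX _ _ _ n (is_cderiveV _ _ _ ha d1).
apply: is_cderive_ext (is_cderiveM _ _ _ _ _ (is_cderive_cst (- n.+1%:R^-1) t) d2) => //.
rewrite mul0r add0r -exprVn [in RHS]exprS [in RHS]exprS expr2.
by move: ((h t - a)^-1) (n.+1%:R) n0 => u N N0; field.
Qed.

Lemma fctsX S n : fcts S (fun w => w ^+ n).
Proof. by move=> h t _ ?; exact: cctsX. Qed.
Lemma fcts_XsubVX S a n : (forall w, S w -> w != a) -> fcts S (fun w => (w - a)^-1 ^+ n).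
Proof. by move=> Sa h t Sh ch; apply: cctsX; exact: (fcts_XsubV _ _ Sa). Qed.
Lemma rctsP S (H : C -> R) : (forall h t, S (h t) -> ccts h t ->
 {for t, continuous (fun t => H (h t))}) -> rcts S H.
Proof. by []. Qed.
Lemma fcts_ccts S f h t : fcts S f -> S (h t) -> ccts h t -> ccts (fun t => f (h t)) t.
Proof. by move=> cf Sh ch; exact: cf. Qed.

(* Otherwise [done] unfolds these predicates down to filters. *)
#[local] Opaque fcts rcts prim ccts is_cderive chain_in.

Section Null.
Variables (S : C -> Prop) (ch : seq (C * piece)).
Hypotheses (Sch : chain_in S ch) (cch : closed_chain ch).

(** Induction on the number of poles. If all poles coincide, a power of order at least 2 has a
    primitive and order 1 is the hypothesis; two distinct poles a and b are separated by partial
    fractions, each term losing one pole. *)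
Lemma cint_invp (l : seq C) : (forall a w, a \in l -> S w -> w != a) ->
 (forall a, a \in l -> cint ch (fun w => (w - a)^-1) = 0) ->
 forall c, cint ch (fun w => c * invp l w) = 0.
Proof.
move=> Sl Wl c; rewrite (cintZ S)//; last exact: fcts_invp.
suff -> : cint ch (invp l) = 0 by rewrite mulr0.
move: {2}(size l) (leqnn (size l)) => n; elim: n l Sl Wl => [|n ih] l Sl Wl sl.
 have -> : invp l = (fun w => w ^+ 0).
  by apply/funext => w; case: l sl {Sl Wl} => // _; rewrite /invp big_nil.
 rewrite (cint_prim S _ _ _ Sch _ (prim_X S 0)) ?cch//.
 exact: (fctsX S 0).
case: l sl Sl Wl => [|a l] sl Sl Wl; first exact: ih.
have [/allP al|] := boolP (all (pred1 a) l).
 have E w : invp (a :: l) w = (w - a)^-1 ^+ (size l).+1.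
  rewrite /invp big_cons exprS; congr (_ * _).
  rewrite (eq_big_seq (fun=> (w - a)^-1)) => [|b /al /eqP -> //].
  by rewrite big_const_seq count_predT -Monoid.iteropE.
 have -> : invp (a :: l) = (fun w => (w - a)^-1 ^+ (size l).+1) by exact/funext.
 have Sa w : S w -> w != a by apply: Sl; rewrite mem_head.
 case: (size l) => [|m].
  by rewrite -[RHS](Wl a (mem_head _ _)); congr cint; apply/funext => w; rewrite expr1.
 rewrite (cint_prim S _ _ _ Sch _ (prim_XsubVX S a m Sa)) ?cch//.
 exact: fcts_XsubVX.
rewrite -has_predC => /hasP[b bl /= ba].
have P : perm_eq (a :: l) (a :: b :: rem b l) by rewrite perm_cons perm_to_rem.
have sr : (size (rem b l)).+1 = size l by rewrite size_rem// prednK//; case: (l) bl.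
have rl x : x \in rem b l -> x \in a :: l by move=> /mem_rem xl; rewrite inE xl orbT.
have bal : b \in a :: l by rewrite inE bl orbT.
have aal : a \in a :: l by rewrite mem_head.
have L1 d : d \in a :: l -> forall x, x \in d :: rem b l -> x \in a :: l.
 by move=> dl x; rewrite inE => /predU1P[-> //|]; exact: rl.
have I1 d : d \in a :: l -> cint ch (invp (d :: rem b l)) = 0.
 move=> dl; apply: ih => [x w xd|x xd|]; last by rewrite /= sr.
  by apply: Sl; exact: (L1 d).
 by apply: Wl; exact: (L1 d).
have c1 d : d \in a :: l -> fcts S (invp (d :: rem b l)).
 by move=> dl; apply: fcts_invp => x w xd; apply: Sl; exact: (L1 d).
have E w : S w -> invp (a :: l) w =
  (a - b)^-1 * invp (a :: rem b l) w + (- (a - b)^-1) * invp (b :: rem b l) w.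
 move=> Sw; rewrite /invp (perm_big _ P) /= !big_cons.
 have wa : w - a != 0 by rewrite subr_eq0 (Sl a w).
 have wb : w - b != 0 by rewrite subr_eq0 (Sl b w).
 have ab : a - b != 0 by rewrite subr_eq0 eq_sym.
 by field; rewrite wa wb ab.
rewrite (eq_cint _ _ _ _ Sch E) (cintD S)//; last 2 first.
- by apply: fctsM; [exact: fcts_cst|exact: c1].
- by apply: fctsM; [exact: fcts_cst|exact: c1].
by rewrite !(cintZ S) ?I1 ?mulr0 ?addr0//; exact: c1.
Qed.

(** The monomial factor is the generalisation under which the induction on [q * 'X + c] closes. *)
Lemma cint_monom_horner n (q : {poly C}) : cint ch (fun w => w ^+ n * q.[w]) = 0.
Proof.
have cX k := fctsX S k.
elim/poly_ind: q n => [|q c ihq] n.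
 rewrite (_ : (fun w => _) = (fun w => 0 * w ^+ n)); last first.
  by apply/funext => w; rewrite horner0 mulr0 mul0r.
 by rewrite (cintZ S)// mul0r.
rewrite (_ : (fun w => _) = (fun w => w ^+ n.+1 * q.[w] + c * w ^+ n)); last first.
 by apply/funext => w; rewrite !hornerE exprS; ring.
rewrite (cintD S)//; last 2 first.
- by apply: fctsM => //; exact: fcts_horner.
- by apply: fctsM => //; exact: fcts_cst.
rewrite ihq add0r (cintZ S)//.
by rewrite (cint_prim S _ _ _ Sch _ (prim_X S n)) ?cch ?mulr0.
Qed.

(** Dividing the numerator by X - a removes one pole from the quotient part and leaves a constant
    numerator in the remainder part. *)
Lemma cint_horner_invp (l : seq C) : (forall a w, a \in l -> S w -> w != a) ->
 (forall a, a \in l -> cint ch (fun w => (w - a)^-1) = 0) ->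
 forall q : {poly C}, cint ch (fun w => q.[w] * invp l w) = 0.
Proof.
elim: l => [|a l ih] Sl Wl q.
 rewrite -[RHS](cint_monom_horner 0 q); congr cint; apply/funext => w.
 by rewrite /invp big_nil mulr1 mul1r.
have Sl' b w : b \in l -> S w -> w != b by move=> bl; apply: Sl; rewrite inE bl orbT.
have E w : S w -> q.[w] * invp (a :: l) w =
  (q %/ ('X - a%:P)).[w] * invp l w + q.[a] * invp (a :: l) w.
 move=> Sw; have wa : w - a != 0 by rewrite subr_eq0 (Sl a w)// mem_head.
 rewrite {1}(divp_eq q ('X - a%:P)) modp_XsubC !hornerE /invp big_cons.
 by field.
rewrite (eq_cint _ _ _ _ Sch E) (cintD S)//; last 2 first.
- by apply: fctsM; [exact: fcts_horner|exact: fcts_invp].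
- by apply: fctsM; [exact: fcts_cst|exact: fcts_invp].
rewrite cint_invp// addr0 ih// => b bl; apply: Wl; by rewrite inE bl orbT.
Qed.
End Null.

Lemma nc_increment (h h' : R -> C) (B : R) :
 (forall t, 0 <= t <= 1 -> is_cderive h t (h' t)) ->
 (forall t, 0 <= t <= 1 -> ccts h' t) ->
 (forall t, 0 <= t <= 1 -> nc (h' t) <= B) -> nc (h 1 - h 0) <= 2 * B.
Proof.
move=> dh ch hB; rewrite -(Cint_FTC _ _ _ _ ler01 dh ch).
have iB : mu.-integrable `[(0:R), 1] (EFin \o (fun=> B)).
 apply: continuous_compact_integrable; first exact: segment_compact.
 by move=> x; exact: cst_continuous.
have hB' t : `[0 : R, 1]%classic t -> nc (h' t) <= B.
 by rewrite /= in_itv /=; exact: hB.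
have := nc_Cint_le `[0 : R, 1] _ _ (measurable_itv _) (ccts_cintegrable _ _ _ ch) iB hB'.
by rewrite Rintegral_cst//= lebesgue_measure_itv/= lte_fin ltr01/= subr0 mulr1.
Qed.

Lemma is_cderive_line (v : C) t : is_cderive (fun t => t%:C * v) t v.
Proof.
have d1 : is_cderive (fun t : R => t%:C : C) t 1.
 by split => /=; [exact: is_derive_id|exact: is_derive_cst].
by apply: is_cderive_ext (is_cderiveM _ _ _ _ _ d1 (is_cderive_cst v t)) => //;
 rewrite mul1r mulr0 addr0.
Qed.

Lemma expR_ncM (t : R) (v : C) : 0 <= t <= 1 -> expR (Re (t%:C * v)) <= expR (nc v).
Proof.
move=> /andP[t0 t1]; rewrite ler_expR ReMC (le_trans (ler_norm _))// normrM ger0_norm//.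
rewrite (le_trans _ (nc_Re v))//; by rewrite ler_piMl.
Qed.

Lemma nc_Cexp_sub1 (v : C) : nc (Cexp v - 1) <= 2 * (nc v * expR (nc v)).
Proof.
have := @nc_increment (fun t => Cexp (t%:C * v)) (fun t => Cexp (t%:C * v) * v) (nc v * expR (nc v)).
rewrite rmorph1 rmorph0 mul1r mul0r Cexp0; apply => t t01.
- by apply: is_cderive_Cexp; exact: is_cderive_line.
- apply: cctsM; last exact: ccts_cst.
 apply: ccts_Cexp; exact: is_cderive_cts (is_cderive_line v t).
- by rewrite ncM mulrC ler_wpM2l ?nc_ge0// nc_Cexp expR_ncM.
Qed.

Lemma nc_Cexp_sub2 (v : C) : nc (Cexp v - 1 - v) <= 4 * (nc v ^+ 2 * expR (nc v)).
Proof.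
have := @nc_increment (fun t => Cexp (t%:C * v) - t%:C * v) (fun t => (Cexp (t%:C * v) - 1) * v)
 (2 * (nc v ^+ 2 * expR (nc v))).
have -> : 4 * (nc v ^+ 2 * expR (nc v)) = 2 * (2 * (nc v ^+ 2 * expR (nc v))) by ring.
rewrite rmorph1 rmorph0 !mul1r !mul0r Cexp0 subr0 addrAC; apply => t t01.
- apply: is_cderive_ext (is_cderiveD _ _ _ _ _ (is_cderive_Cexp _ _ _ (is_cderive_line v t))
   (is_cderiveM _ _ _ _ _ (is_cderive_cst (-1) t) (is_cderive_line v t))) => [x|].
  by rewrite mulN1r.
 by rewrite mul0r add0r mulrBl mulN1r mul1r.
- apply: cctsM; last exact: ccts_cst.
 apply: cctsB; last exact: ccts_cst.
 apply: ccts_Cexp; exact: is_cderive_cts (is_cderive_line v t).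
- rewrite ncM expr2 -mulrA mulrC [X in _ <= X]mulrCA ler_wpM2l ?nc_ge0//.
 rewrite (le_trans (nc_Cexp_sub1 _))// ler_wpM2l//.
 have /andP[t0 t1] := t01.
 have nt : nc (t%:C * v) <= nc v by rewrite ncM ncC ger0_norm// ler_piMl ?nc_ge0.
 by rewrite ler_pM ?nc_ge0 ?expR_ge0// ler_expR.
Qed.

Lemma nc_subX (a b : C) (K : R) n : 1 <= K -> nc a <= K -> nc b <= K ->
 nc (a ^+ n - b ^+ n) <= n%:R * nc (a - b) * K ^+ n.
Proof.
move=> K1 aK bK; elim: n => [|n ih]; first by rewrite subrr nc0 !mul0r.
have -> : a ^+ n.+1 - b ^+ n.+1 = a * (a ^+ n - b ^+ n) + (a - b) * b ^+ n.
 by rewrite !exprS; ring.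
have K0 : 0 <= K by rewrite (le_trans ler01).
rewrite (le_trans (ncD _ _))// !ncM ncX -natr1 !mulrDl mul1r.
apply: lerD.
 rewrite (le_trans (ler_pM (nc_ge0 _) (nc_ge0 _) aK ih))//.
 by rewrite exprS mulrCA.
rewrite ler_wpM2l ?nc_ge0// (@le_trans _ _ (K ^+ n))//.
 by rewrite lerXn2r ?nnegrE ?nc_ge0.
by rewrite exprS ler_peMl// exprn_ge0.
Qed.

(** Both sides are m-th powers, of exp(u/m) and of 1 + u/m, which differ by O(|u|^2/m^2) and have
    modulus at most exp(|u|/m). *)
Lemma nc_Cexp_lim (u : C) (m : nat) : (0 < m)%N ->
 nc (Cexp u - (1 + u / m%:R) ^+ m) <= m%:R^-1 * (4 * (nc u ^+ 2 * expR (2 * nc u))).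
Proof.
move=> m0; have m0' : 0 < m%:R :> R by rewrite ltr0n.
have mC : m%:R != 0 :> C by rewrite pnatr_eq0 -lt0n.
pose v := u / m%:R.
have uE : u = v *+ m by rewrite /v -mulr_natr divfK.
have nv : nc u = m%:R * nc v by rewrite /v ncM ncV nc_nat mulrCA divff ?mulr1// gt_eqF.
have K1 : 1 <= expR (nc v) by rewrite -expR0 ler_expR nc_ge0.
have a1 : nc (Cexp v) <= expR (nc v).
 by rewrite nc_Cexp ler_expR (le_trans (ler_norm _))// nc_Re.
have b1 : nc (1 + v) <= expR (nc v).
 by rewrite (le_trans (ncD _ _))// nc1 expR_ge1Dx.
rewrite {1}uE CexpMn (le_trans (nc_subX _ _ _ m K1 a1 b1))//.
rewrite opprD addrA -expRM_natl -nv.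
have h := nc_Cexp_sub2 v.
have vu : expR (nc v) <= expR (nc u).
 by rewrite ler_expR nv ler_peMl ?nc_ge0// ler1n.
have -> : expR (2 * nc u) = expR (nc u) * expR (nc u).
 by rewrite -expRD mulr_natl mulr2n.
have -> : m%:R^-1 * (4 * (nc u ^+ 2 * (expR (nc u) * expR (nc u)))) =
  m%:R * (4 * (nc v ^+ 2 * expR (nc u))) * expR (nc u).
 by rewrite nv; field; rewrite gt_eqF.
rewrite ler_wpM2r ?expR_ge0// ler_wpM2l ?ler0n// (le_trans h)//.
by rewrite ler_wpM2l// ler_wpM2l// sqr_ge0.
Qed.

(** Cauchy's theorem without holomorphic functions: exp(Q) is the limit of the polynomials (1 +
    Q/m)^m, uniformly enough for [cint_bound], and with a polynomial in its place the integral
    vanishes. *)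
Lemma cint_Cexp_invp S ch (l : seq C) (Q q : {poly C}) :
 chain_in S ch -> closed_chain ch -> (forall a w, a \in l -> S w -> w != a) ->
 (forall a, a \in l -> cint ch (fun w => (w - a)^-1) = 0) ->
 cint ch (fun w => Cexp Q.[w] * q.[w] * invp l w) = 0.
Proof.
move=> Sch cch Sl Wl.
pose H w := 4 * (nc Q.[w] ^+ 2 * expR (2 * nc Q.[w])) * nc (q.[w] * invp l w).
have cH : rcts S H.
 apply: rctsP => h t Sh ch'.
 have c1 := nc_cts _ _ (ccts_horner _ _ Q ch').
 apply: (@continuousM _ _ (fun t => 4 * (nc Q.[h t] ^+ 2 * expR (2 * nc Q.[h t])))
  (fun t => nc (q.[h t] * invp l (h t)))).
  apply: continuousM; first exact: cst_continuous.
  apply: (@continuousM _ _ (fun t => nc Q.[h t] ^+ 2) (fun t => expR (2 * nc Q.[h t]))).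
   exact: (@continuousM _ _ (fun t => nc Q.[h t]) (fun t => nc Q.[h t])).
  apply: (@continuous_comp _ _ _ (fun t => 2 * nc Q.[h t]) expR); last exact: continuous_expR.
  by apply: continuousM => //; exact: cst_continuous.
 apply: nc_cts; apply: cctsM; first exact: ccts_horner.
 exact: (fcts_ccts S) (fcts_invp S l Sl) Sh ch'.
have ci : fcts S (invp l) by exact: fcts_invp.
have cq : fcts S (fun w => q.[w]) by exact: fcts_horner.
have cE : fcts S (fun w => Cexp Q.[w]) by apply: fcts_Cexp; exact: fcts_horner.
have [M M0 hM] := cint_bound S ch H Sch cH.
have B m : (0 < m)%N -> nc (cint ch (fun w => Cexp Q.[w] * q.[w] * invp l w)) <= m%:R^-1 * M.
 move=> m0; pose P := (1 + (m%:R^-1)%:P * Q) ^+ m * q.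
 have EP w : P.[w] = (1 + Q.[w] / m%:R) ^+ m * q.[w].
  by rewrite /P !(hornerE, horner_exp) [_^-1 * _]mulrC.
 have cP : fcts S (fun w => P.[w]) by exact: fcts_horner.
 rewrite (_ : (fun w => _) = (fun w => (Cexp Q.[w] * q.[w] - P.[w]) * invp l w +
    P.[w] * invp l w)); last first.
  by apply/funext => w; rewrite mulrBl subrK.
 rewrite (cintD S)//; last 2 first.
 - by apply: fctsM => //; apply: fctsB => //; exact: fctsM.
 - exact: fctsM.
 rewrite (cint_horner_invp S ch)// addr0; apply: hM.
 - by rewrite invr_ge0.
 - by apply: fctsM => //; apply: fctsB => //; exact: fctsM.
 - move=> w Sw; rewrite EP -mulrBl -mulrA ncM /H [X in _ <= X]mulrA ler_wpM2r ?nc_ge0//.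
  exact: nc_Cexp_lim.
apply: Normc.eq0_normc; apply/eqP; rewrite eq_le nc_ge0 andbT leNgt; apply/negP => h0.
have /archi_boundP := divr_ge0 M0 (ltW h0); set m := Num.Def.archi_bound _ => hm.
have m0 : 0 < m%:R :> R by rewrite (le_lt_trans _ hm)// divr_ge0// ltW.
have := B m; rewrite -(ltr0n R) => /(_ m0); apply/negP; rewrite -ltNge.
by rewrite mulrC ltr_pdivrMr// mulrC -ltr_pdivrMr.
Qed.

End Chains.

(** * Piecewise C1 closed curves as chains *)

Section Curves.
Context {R : realType}.
Local Notation C := R[i].
Local Notation mu := (@lebesgue_measure R).
Local Notation Cint := (Cintegral mu).
Implicit Types (f : C -> C) (g h : R -> C) (S : C -> Prop).

Lemma is_cderive_path_derive g t : derivable (Re \o g) t 1 -> derivable (Im \o g) t 1 ->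
 is_cderive g t (path_derive g t).
Proof.
move=> d1 d2; split; rewrite /path_derive /= derive1E; [exact: DeriveDef d1 erefl|exact: DeriveDef d2 erefl].
Qed.

Lemma is_cderive_path_deriveE g t l : is_cderive g t l -> path_derive g t = l.
Proof.
move=> [d1 d2]; apply: complexP; rewrite /path_derive /= derive1E; exact: derive_val.
Qed.

Lemma path_derive_near g h a b t : a < t < b ->
 (forall u, a < u < b -> g u = h u) -> path_derive g t = path_derive h t.
Proof.
move=> tab gh; have N : \forall u \near t, g u = h u.
 near=> u; apply: gh; near: u; exact: near_in_itvoo.
by rewrite /path_derive !derive1E; congr Complex; apply: near_eq_derive => //;
 near=> u; rewrite /= (near N u).
Unshelve. all: end_near. Qed.

(** Each C1 extension supplied by the definition of a piecewise C1 curve becomes one piece. The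
    boundary telescopes because consecutive extensions agree with [gamma] at the common point. *)
Lemma partition_chain (gamma : R -> C) a (s : seq R) : path <%R a s ->
 (forall k, (k < size s)%N -> exists g : R -> C,
   [/\ C1 (Re \o g), C1 (Im \o g) &
    forall t, nth 0 (a :: s) k <= t <= nth 0 s k -> gamma t = g t]) ->
 exists ch : seq (C * @piece R),
 [/\ forall S, (forall t, a <= t <= last a s -> S (gamma t)) -> chain_in S ch,
   forall F, bdry ch F = F (gamma (last a s)) - F (gamma a)
  & forall S f, chain_in S ch -> fcts S f ->
    let h t := f (gamma t) * path_derive gamma t in
    cintegrable `[a, last a s] h /\ Cint `[a, last a s] h = cint ch f].
Proof.
elim: s a => [|c s ih] a /=.
 move=> _ _; exists [::]; split; first by [].
 - by move=> F; rewrite /bdry big_nil subrr.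
 - move=> S f _ _; rewrite /cint big_nil -(Cint0 `[a, a]).
  apply: Cint_eq_oo => [t /andP[h1 h2]|]; last exact: cintegrable0.
  by have := lt_trans h1 h2; rewrite ltxx.
move=> /andP[ac ps] H.
have [ch [Sch bch ich]] := ih c ps (fun k hk => H k.+1 hk).
have [g [[dg1 cg1] [dg2 cg2] gE]] := H 0%N isT.
rewrite /= in gE.
have cl : c <= last c s.
 have := mem_last c s; rewrite inE => /orP[/eqP ->//|ls].
 by have /allP/(_ _ ls)/ltW := order_path_min lt_trans ps.
pose p := Piece g (path_derive g) a c.
have wp : wfp p.
 split; first exact: ltW.
 - by move=> t; exact: is_cderive_path_derive (dg1 t) (dg2 t).
 - by move=> t; split; [exact: cg1|exact: cg2].
exists ((1, p) :: ch); split.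
- move=> S Sg; split; [exact: wp| |].
 + by move=> t /= /andP[h1 h2]; rewrite -gE ?h1//; apply: Sg; rewrite h1 (le_trans h2).
 + by apply: Sch => t /andP[h1 h2]; apply: Sg; rewrite h2 (le_trans (ltW ac)).
- move=> F; rewrite /bdry big_cons /= mul1r; have := bch F; rewrite /bdry => ->.
 by rewrite -!gE ?lexx ?(ltW ac)// addrC addrA subrK.
- move=> S f /= [_ Sp Sr] cf.
 have [i1 e1] := ich S f Sr cf.
 have ip := pint_integrable S p f wp Sp cf.
 have [i2 e2] : cintegrable `[a, c] (fun t => f (gamma t) * path_derive gamma t) /\
   Cint `[a, c] (fun t => f (gamma t) * path_derive gamma t) = pint p f.
  apply: Cint_eq_oo => //= t tac; have /andP[h1 h2] := tac.
  rewrite gE ?ltW//; congr (_ * _); apply: (path_derive_near _ _ a c) => // u /andP[u1 u2].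
  by rewrite gE// !ltW.
 have [i3 e3] := cintegrable_itv_cat a c (last c s) _ (introT andP (conj (ltW ac) cl)) i2 i1.
 split; [exact: i3|by rewrite e3 e2 e1 /cint big_cons mul1r].
Qed.

(** The chain is produced before [S], so that it can be placed in the complement of the poles as
    well as in the complement of the vertical line. *)
Lemma closed_curve_chain (gamma : R -> C) : closed_curve gamma ->
 exists ch : seq (C * @piece R),
 [/\ forall S, (forall t, 0 <= t <= 1 -> S (gamma t)) -> chain_in S ch,
   closed_chain ch
  & forall S f, chain_in S ch -> fcts S f -> curve_integral gamma f = cint ch f].
Proof.
move=> [[p [pp /eqP lp] H] g01].
have [ch [h1 h2 h3]] := partition_chain gamma 0 p pp H.
rewrite lp in h1 h2 h3; exists ch; split; first exact: h1.
- by move=> F; rewrite h2 g01 subrr.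
- move=> S f Sch cf; have [_ <-] := h3 S f Sch cf.
 by rewrite /curve_integral /contour_integral set_itvcc.
Qed.

Definition lin (a e : C) (l1 l2 : R) : piece :=
 Piece (fun r => a + r%:C * e) (fun=> e) l1 l2.

Lemma is_cderive_lin (a e : C) t : is_cderive (fun r => a + r%:C * e) t e.
Proof.
by apply: is_cderive_ext (is_cderiveD _ _ _ _ _ (is_cderive_cst a t) (is_cderive_line e t)) => //;
 rewrite add0r.
Qed.

Lemma wfp_lin a e l1 l2 : l1 <= l2 -> wfp (lin a e l1 l2).
Proof.
by move=> l12; split => //= t; [exact: is_cderive_lin|exact: ccts_cst].
Qed.

End Curves.

(** * Winding numbers and Cauchy's theorem for a half-plane *)

Section Winding.
Context {R : realType}.
Local Notation C := R[i].
Implicit Types (f : C -> C) (g h : R -> C) (S : C -> Prop).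

(** The hypothesis is the tangent addition formula and makes the sine of the sum vanish. The sum
    lies strictly between 0 and 3 pi/2, where pi is the only zero of the sine. *)
Lemma atan_sum_pi (a b c : R) : 0 < a -> 0 < b -> 0 < c -> c * (a * b - 1) = a + b ->
 atan a + atan b + atan c = pi.
Proof.
move=> a0 b0 c0 abc.
have at0 (x : R) : 0 < x -> 0 < atan x < pi / 2.
 by move=> /(@lt_atan R); rewrite atan0 => ->; rewrite atan_ltpi2.
have snE (x : R) : sin (atan x) = x * cos (atan x).
 have cx : cos (atan x) != 0 by rewrite cos_atan gt_eqF// invr_gt0 sqrtr_gt0; nra.
 by rewrite -[X in _ = X * _]atanK /tan divfK.
have /andP[A0 A1] := at0 _ a0; have /andP[B0 B1] := at0 _ b0; have /andP[C0 C1] := at0 _ c0.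
have sn0 : sin (atan a + atan b + atan c) = 0.
 rewrite !(sinD, cosD) !snE.
 set u := cos (atan a); set v := cos (atan b); set w := cos (atan c).
 transitivity (u * v * w * (a + b - c * (a * b - 1))); first by ring.
 by rewrite abc subrr mulr0.
set T := atan a + atan b + atan c in sn0 *.
have T0 : 0 < T by rewrite /T; lra.
have T1 : T < pi + pi / 2 by rewrite /T; lra.
have pi0 := pi_gt0 R.
case: (ltgtP T pi) => // h.
- by have := @sin_gt0_pi R T; rewrite sn0 ltxx => /(_ _); rewrite T0 h => /(_ isT).
- have hT : 0 < T - pi < pi by apply/andP; split; lra.
 by have := sin_gt0_pi hT; rewrite sinB sn0 sinpi mul0r mulr0 subr0 ltxx.
Qed.

(** A primitive of 1/u away from the imaginary axis, smoother to handle than [Clog]; on the left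
    half-plane it differs from a logarithm by a constant, which is harmless for a primitive. *)
Definition clog (u : C) : C :=
 (ln (Re u ^+ 2 + Im u ^+ 2) / 2) +i* atan (Im u / Re u).

Lemma is_cderive_clog g t l : Re (g t) != 0 -> is_cderive g t l ->
 is_cderive (fun t => clog (g t)) t ((g t)^-1 * l).
Proof.
move=> r0 [d1 d2].
have q0 : 0 < Re (g t) ^+ 2 + Im (g t) ^+ 2.
 by rewrite ltr_wpDr ?sqr_ge0// exprn_even_gt0.
have e1 : is_derive t 1 (fun x => Re (g x) ^+ 2 + Im (g x) ^+ 2)
  (2 * (Re (g t) * Re l + Im (g t) * Im l)).
 have -> : (fun x => Re (g x) ^+ 2 + Im (g x) ^+ 2) =
   (Re \o g) * (Re \o g) + (Im \o g) * (Im \o g) by apply/funext => x; rewrite !expr2.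
 by apply: (is_derive_eq (is_deriveD (is_deriveM d1 d1) (is_deriveM d2 d2))); rewrite /GRing.scale /=; ring.
have e2 : is_derive t 1 (fun x => Im (g x) / Re (g x))
  ((Im l * Re (g t) - Im (g t) * Re l) / Re (g t) ^+ 2).
 have v : is_derive t 1 (fun x => (Re (g x))^-1) (- (Re (g t) ^+ 2)^-1 * Re l).
  by have := is_deriveV r0 d1; rewrite /GRing.scale /=.
 have -> : (fun x => Im (g x) / Re (g x)) = (Im \o g) * (fun x => (Re (g x))^-1) by [].
 by apply: is_derive_eq; rewrite /GRing.scale /=; move: r0 => /=; move: (Re (g t)) => r r0; field.
split.
 have e3 := is_derive1_ln q0.
 have -> : Re \o (fun t => clog (g t)) =
  (fun x => 2^-1 *: (@ln R \o (fun x => Re (g x) ^+ 2 + Im (g x) ^+ 2)) x).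
  by apply/funext => x; rewrite /clog /= /GRing.scale /= mulrC.
 apply: is_derive_eq; rewrite /GRing.scale /= ReM ReV ImV.
 move: q0 => /lt0r_neq0; move: (_ + _) => q q0; field.
 by [].
have e3 := is_derive1_atan (Im (g t) / Re (g t)).
have -> : Im \o (fun t => clog (g t)) = atan \o (fun x => Im (g x) / Re (g x)) by [].
apply: is_derive_eq; rewrite /GRing.scale /= ImM ReV ImV.
have q0' := lt0r_neq0 q0.
have : 1 + (Im (g t) / Re (g t)) ^+ 2 = (Re (g t) ^+ 2 + Im (g t) ^+ 2) / Re (g t) ^+ 2.
 by field.
move=> ->; by field; rewrite r0 q0'.
Qed.

Lemma prim_clog S (c a : C) : (forall w, S w -> Re (c * (w - a)) != 0) ->
 prim S (fun w => clog (c * (w - a))) (fun w => (w - a)^-1).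
Proof.
move=> Sc h t l Sh dh.
have r0 := Sc _ Sh.
have c0 : c != 0 by apply: contra_neq r0 => ->; rewrite mul0r.
have h0 : h t - a != 0 by apply: contra_neq r0 => ->; rewrite mulr0.
have d1 : is_cderive (fun t => c * (h t - a)) t (c * l).
 have d2 := is_cderiveD _ _ _ _ _ dh (is_cderive_cst (- a) t).
 apply: is_cderive_ext (is_cderiveM _ _ _ _ _ (is_cderive_cst c t) d2) => [//|].
 by rewrite mul0r add0r addr0.
apply: is_cderive_ext (is_cderive_clog _ _ _ r0 d1) => [//|].
by rewrite invfM mulrACA mulVf// mul1r.
Qed.

#[local] Opaque fcts rcts prim ccts is_cderive.

(** After rotation by [c] the chain avoids the imaginary axis through the pole, where [clog] is a
    primitive. *)
Lemma cint_half_plane S (c a : C) ch : chain_in S ch -> closed_chain ch ->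
 (forall w, S w -> Re (c * (w - a)) != 0) -> cint ch (fun w => (w - a)^-1) = 0.
Proof.
move=> Sch cch Sc; rewrite (cint_prim S _ _ _ Sch _ (prim_clog S c a Sc)); first exact: cch.
apply: fcts_XsubV => w /Sc; apply: contra_neq => ->; by rewrite subrr mulr0.
Qed.

Lemma cint_half_plane_Cexp S (c a : C) ch (Q : {poly C}) : chain_in S ch -> closed_chain ch ->
 (forall w, S w -> Re (c * (w - a)) != 0) -> cint ch (fun w => Cexp Q.[w] / (a - w)) = 0.
Proof.
move=> Sch cch Sc.
have Sa b w : b \in [:: a] -> S w -> w != b.
 rewrite inE => /eqP -> /Sc; apply: contra_neq => ->; by rewrite subrr mulr0.
have := cint_Cexp_invp S ch [:: a] Q (-1) Sch cch Sa.
rewrite (_ : (fun w => _ * invp _ w) = (fun w => Cexp Q.[w] / (a - w))); last first.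
 apply/funext => w; rewrite /invp big_seq1 hornerN hornerC -[a - w]opprB invrN; ring.
apply => b; rewrite inE => /eqP ->; exact: cint_half_plane Sch cch Sc.
Qed.

(* The triangle p, p + L e1, p + L e2; its sides through p are parametrised at
  speeds e1 and e2, so that they are initial segments of rays. *)
Definition chord (p e1 e2 : C) (L : R) : @piece R := lin (p + L%:C * e1) (e2 - e1) 0 L.
Definition tri (p e1 e2 : C) (L : R) : seq (C * @piece R) :=
 [:: (1, lin p e1 0 L); (1, chord p e1 e2 L); (-1, lin p e2 0 L)].

Lemma tri_closed p e1 e2 L : closed_chain (tri p e1 e2 L).
Proof.
move=> F; rewrite /bdry !big_cons big_nil /=.
have -> : p + (0:R)%:C * e1 = p by rewrite rmorph0 mul0r addr0.
have -> : p + (0:R)%:C * e2 = p by rewrite rmorph0 mul0r addr0.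
have -> : p + L%:C * e1 + (0:R)%:C * (e2 - e1) = p + L%:C * e1.
 by rewrite rmorph0 mul0r addr0.
have -> : p + L%:C * e1 + L%:C * (e2 - e1) = p + L%:C * e2 by ring.
by ring.
Qed.

Lemma tri_in S p e1 e2 L : 0 <= L ->
 (forall r, 0 <= r <= L -> S (p + r%:C * e1)) ->
 (forall r, 0 <= r <= L -> S (p + r%:C * e2)) ->
 (forall r, 0 <= r <= L -> S (p + L%:C * e1 + r%:C * (e2 - e1))) ->
 chain_in S (tri p e1 e2 L).
Proof.
move=> L0 S1 S2 S3; split; [exact: wfp_lin|exact: S1|].
split; [exact: wfp_lin|exact: S3|]; split; [exact: wfp_lin|exact: S2|by []].
Qed.

(* In the coordinates of the triangle the point [d] is real, and the three
  sides are seen from it under angles adding up to 2 pi. *)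
Lemma tri_winding (p d x y L : R) : 0 < x * y -> 0 < x * d -> x * d < L * x ^+ 2 -> 0 < L ->
 cint (tri p%:C (x +i* (- y)) (x +i* y) L) (fun w => (w - (p + d)%:C)^-1) = (2 * pi)%:C * 'i%C.
Proof.
move=> xy xd dL L0.
have x0 : x != 0 by apply: contraTneq xy => ->; rewrite mul0r ltxx.
have y0 : y != 0 by apply: contraTneq xy => ->; rewrite mulr0 ltxx.
have d0 : d != 0 by apply: contraTneq xd => ->; rewrite mulr0 ltxx.
have dy : 0 < d * y by have : 0 < (x * y) * (x * d) by [exact: mulr_gt0]; nra.
have xLd : 0 < x * (L * x - d) by nra.
have q0 : 0 < x ^+ 2 + y ^+ 2 by nra.
set q := x ^+ 2 + y ^+ 2 in q0.
have S1 (c e : C) (S := fun w => Re (c * (w - (p + d)%:C)) != 0) l1 l2 a : l1 <= l2 ->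
  (forall r, l1 <= r <= l2 -> 0 < Re (c * (a + r%:C * e - (p + d)%:C))) ->
  pint (lin a e l1 l2) (fun w => (w - (p + d)%:C)^-1) =
  clog (c * (a + l2%:C * e - (p + d)%:C)) - clog (c * (a + l1%:C * e - (p + d)%:C)).
 move=> l12 H.
 have Sch : chain_in S [:: (1, lin a e l1 l2)].
  by split; [exact: wfp_lin|move=> r /H /lt0r_neq0|].
 have := cint_prim S [:: (1, lin a e l1 l2)] _ _ Sch _ (prim_clog S c (p + d)%:C _).
 rewrite /cint /bdry !big_seq1 !mul1r => -> //.
 by apply: fcts_XsubV => w; apply: contra_neq => ->; rewrite subrr mulr0.
rewrite /cint !big_cons big_nil addr0 /= !mul1r mulN1r.
have L0' := ltW L0.
set a := (p + d)%:C.
(* Rotations that turn the sides into vertical segments with positive real part, one for each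
   side. *)
have U1 r : ((- y) +i* x) * (p%:C + r%:C * (x +i* (- y)) - a) = (d * y) +i* (r * q - d * x).
 by rewrite /a /q; complex_ring.
have U2 r : ((- y) +i* (- x)) * (p%:C + r%:C * (x +i* y) - a) =
   (d * y) +i* (d * x - r * q).
 by rewrite /a /q; complex_ring.
have U3 r : x%:C * (p%:C + L%:C * (x +i* (- y)) + r%:C * ((x +i* y) - (x +i* (- y))) - a) =
   (x * (L * x - d)) +i* (x * y * (2 * r - L)).
 by rewrite /a /q; complex_ring.
rewrite (S1 ((- y) +i* x))//; last by move=> r _; rewrite U1.
rewrite (S1 ((- y) +i* (- x)) (x +i* y))//; last by move=> r _; rewrite U2.
rewrite /chord (S1 x%:C)//; last by move=> r _; rewrite U3.
rewrite !U1 !U2 !U3 /clog !ReK !ImK !mul0r !subr0 !sub0r !mulr0 !sub0r.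
(* With A, B, C the three arctangents, the sides through p are each seen from the pole under the
   angle A + B and the third under 2C; A + B + C = pi gives the full turn. *)
have T := atan_sum_pi (x / y) ((L * q - d * x) / (d * y)) (y * L / (L * x - d)).
have T1 : 0 < x / y by rewrite -(pmulr_rgt0 _ (_ : 0 < y ^+ 2)) ?exprn_even_gt0//; have -> : y ^+ 2 * (x / y) = x * y by field.
have Lq : 0 < L * q - d * x by rewrite /q; nra.
have T2 : 0 < (L * q - d * x) / (d * y) by rewrite divr_gt0.
have Lx : L * x - d != 0 by apply: contraTneq xLd => ->; rewrite mulr0 ltxx.
have T3 : 0 < y * L / (L * x - d).
 have -> : y * L / (L * x - d) = (x * y) * L / (x * (L * x - d)) by field; rewrite Lx x0.
 by rewrite divr_gt0// mulr_gt0.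
have {T1 T2 T3} := T T1 T2 T3.
have -> : y * L / (L * x - d) * (x / y * ((L * q - d * x) / (d * y)) - 1) =
  x / y + (L * q - d * x) / (d * y) by rewrite /q; field; rewrite Lx d0 y0.
move=> {T} /(_ erefl) T.
have E1 : (- (d * x)) / (d * y) = - (x / y) by field; rewrite y0 d0.
have E2 : (d * x) / (d * y) = (x / y) by field; rewrite y0 d0.
have E3 : (d * x - L * q) / (d * y) = - ((L * q - d * x) / (d * y)) by field; rewrite y0 d0.
have E4 : (x * y * (2 * L - L)) / (x * (L * x - d)) = y * L / (L * x - d) by field; rewrite Lx x0.
have E5 : (x * y * - L) / (x * (L * x - d)) = - (y * L / (L * x - d)) by field; rewrite Lx x0.
rewrite E1 E2 E3 E4 E5 !atanN -T.
have -> : (d * x - L * q) ^+ 2 = (L * q - d * x) ^+ 2 by ring.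
have -> : (x * y * (2 * L - L)) ^+ 2 = (x * y * L) ^+ 2 by ring.
by apply: complexP; rewrite !ReImE ?mulrN ?sqrrN ?mulr0 ?mulr1; ring.
Qed.

End Winding.

(** * Exchange of closed chains and Newton interpolation *)

Section Newton.
Context {R : realType}.
Local Notation C := R[i].
Implicit Types (f : C -> C) (S : C -> Prop) (ch : seq (C * @piece R)).
#[local] Opaque fcts rcts prim ccts is_cderive.

Definition nchain ch : seq (C * @piece R) := [seq (- cp.1, cp.2) | cp <- ch].
Lemma cint_nchain ch f : cint (nchain ch) f = - cint ch f.
Proof.
rewrite /cint big_map -sumrN; apply: eq_bigr => i _; by rewrite /= mulNr.
Qed.
Lemma nchain_closed ch : closed_chain ch -> closed_chain (nchain ch).
Proof.
move=> cch F; rewrite /bdry big_map -[RHS]oppr0 -[in RHS](cch F) /bdry -sumrN.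
by apply: eq_bigr => i _; rewrite /= mulNr.
Qed.
Lemma nchain_in S ch : chain_in S ch -> chain_in S (nchain ch).
Proof. by elim: ch => //= cp r ih [h1 h2 h3]; split; [exact: h1|exact: h2|exact: ih]. Qed.
Lemma cat_closed (c1 c2 : seq (C * @piece R)) : closed_chain c1 -> closed_chain c2 -> closed_chain (c1 ++ c2).
Proof. by move=> h1 h2 F; have := h1 F; have := h2 F; rewrite /bdry big_cat /= => -> ->; rewrite addr0. Qed.

(** Cauchy's theorem for the difference of the two chains, whose winding number around every pole is
    0. *)
Lemma cint_eq_winding S (c1 c2 : seq (C * @piece R)) (l : seq C) (Q : {poly C}) :
 chain_in S c1 -> chain_in S c2 -> closed_chain c1 -> closed_chain c2 ->
 (forall a w, a \in l -> S w -> w != a) ->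
 (forall a, a \in l -> cint c1 (fun w => (w - a)^-1) = cint c2 (fun w => (w - a)^-1)) ->
 cint c1 (fun w => Cexp Q.[w] * invp l w) = cint c2 (fun w => Cexp Q.[w] * invp l w).
Proof.
move=> S1 S2 h1 h2 Sl W.
have S12 := chain_in_cat S c1 _ S1 (nchain_in _ _ S2).
have h12 := cat_closed _ _ h1 (nchain_closed _ h2).
have := cint_Cexp_invp S _ l Q 1 S12 h12 Sl _.
rewrite (_ : (fun w => Cexp Q.[w] * (1 : {poly C}).[w] * invp l w) = (fun w => Cexp Q.[w] * invp l w)); last first.
 by apply/funext => w; rewrite hornerE mulr1.
rewrite cint_cat cint_nchain => H; apply/eqP; rewrite -subr_eq0; apply/eqP; apply: H.
by move=> a al; rewrite cint_cat cint_nchain W// subrr.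
Qed.

(** A polynomial in Newton form with nodes [l], its coefficients being [kappa] on the suffixes of
    [l]. Two chains with equal values of [kappa] give the same polynomial in z, even if z lies
    inside one of them and outside the other. *)
Fixpoint newton (kappa : seq C -> C) (l : seq C) : {poly C} :=
 if l is a :: l' then kappa l *: (\prod_(b <- l') ('X - b%:P)) + newton kappa l' else 0.

Lemma eq_newton k1 k2 (l : seq C) : (forall l', subseq l' l -> k1 l' = k2 l') ->
 newton k1 l = newton k2 l.
Proof.
elim: l => [//|a l ih] H /=; congr (_ *: _ + _); first by apply: H; exact: subseq_refl.
by apply: ih => l' sl'; apply: H; exact: subseq_trans sl' (subseq_cons _ _).
Qed.

(* Newton interpolation: 1/((w-a)(z-w)) = (1/(w-a) + 1/(z-w))/(z-a). *)
Lemma newton_horner S ch (l : seq C) (Q : {poly C}) z : chain_in S ch ->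
 (forall a w, a \in l -> S w -> w != a) -> (forall w, S w -> w != z) -> z \notin l ->
 cint ch (fun w => Cexp Q.[w] / (z - w)) = 0 ->
 (\prod_(a <- l) (z - a)) * cint ch (fun w => Cexp Q.[w] * invp l w / (z - w)) =
 (newton (fun l => cint ch (fun w => Cexp Q.[w] * invp l w)) l).[z].
Proof.
move=> Sch + Sz + h0.
have cz : fcts S (fun w => (z - w)^-1).
 apply: fctsV; first by move=> w /Sz; rewrite subr_eq0 eq_sym.
 by apply: fctsB; [exact: fcts_cst|exact: fcts_id].
have cQ : fcts S (fun w => Cexp Q.[w]) by apply: fcts_Cexp; exact: fcts_horner.
elim: l => [|a l ih] Sl zl.
 rewrite big_nil mul1r horner0 -[RHS]h0; congr cint; apply/funext => w.
 by rewrite /invp big_nil mulr1.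
have Sl' b w : b \in l -> S w -> w != b by move=> bl; apply: Sl; rewrite inE bl orbT.
move: (zl); rewrite inE negb_or => /andP[za zl'].
have za' : z - a != 0 by rewrite subr_eq0.
have E w : S w -> Cexp Q.[w] * invp (a :: l) w / (z - w) =
  (z - a)^-1 * (Cexp Q.[w] * invp (a :: l) w + Cexp Q.[w] * invp l w / (z - w)).
 move=> Sw; have wa : w - a != 0 by rewrite subr_eq0 (Sl a w)// mem_head.
 have zw : z - w != 0 by rewrite subr_eq0 eq_sym Sz.
 by rewrite /invp big_cons; field; rewrite za' zw wa.
have c1 : fcts S (fun w => Cexp Q.[w] * invp (a :: l) w).
 by apply: fctsM; [exact: cQ|exact: fcts_invp].
have c2 : fcts S (fun w => Cexp Q.[w] * invp l w / (z - w)).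
 by apply: fctsM; [apply: fctsM; [exact: cQ|exact: fcts_invp]|exact: cz].
rewrite (eq_cint _ _ _ _ Sch E) (cintZ S _ _ _ Sch); last exact: fctsD.
rewrite (cintD S _ _ _ Sch c1 c2) [newton _ _]/= hornerD hornerZ -(ih Sl' zl').
rewrite big_cons horner_prod (eq_bigr (fun b => z - b) (fun b _ => hornerXsubC b z)).
by rewrite mulrACA mulfV// mul1r mulrDr; congr (_ + _); exact: mulrC.
Qed.

Section Lambda.
Variables (p x y : R).
Hypotheses (x0 : 0 < x) (y0 : 0 < y).
(** Two counterclockwise triangles with common vertex p, one opening to the right and one to the
    left. For large L every real point other than p is inside one of them, while the vertical line
    through p meets them at p only. *)
Definition lam (L : R) : seq (C * @piece R) :=
 tri p%:C (x +i* (- y)) (x +i* y) L ++ tri p%:C (- (x +i* (- y))) (- (x +i* y)) L.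

Lemma lam_closed L : closed_chain (lam L).
Proof. by apply: cat_closed; exact: tri_closed. Qed.

(** The sign [s] selects the right or the left triangle. The last clause says where the trace is
    real: at the vertex or on the far side. *)
Definition on_lam (s L : R) (w : C) : Prop :=
 [/\ 0 <= s * (Re w - p), `|Im w| * x <= y * (s * (Re w - p)) &
   (Im w == 0) -> (s * (Re w - p) = 0) \/ s * (Re w - p) = L * x].

Lemma tri_on_lam (s L : R) : s ^+ 2 = 1 -> 0 <= L ->
 chain_in (on_lam s L) (tri p%:C ((s * x) +i* (- (s * y))) ((s * x) +i* (s * y)) L).
Proof.
move=> s1 L0; have ns : `|s| = 1.
 by apply/eqP; rewrite -(@eqrXn2 _ 2)// real_normK ?num_real// s1 expr1n.
have n0 : s != 0 by apply: contra_eq_neq ns => ->; rewrite normr0 eq_sym oner_eq0.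
have E r (u : R) : Re (p%:C + r%:C * ((s * x) +i* u)) - p = r * (s * x).
 by rewrite !ReImE; ring.
have F r (u : R) : Im (p%:C + r%:C * ((s * x) +i* u)) = r * u.
 by rewrite !ReImE; ring.
have G r : s * (r * (s * x)) = r * x.
 by transitivity (s ^+ 2 * (r * x)); [ring|rewrite s1 mul1r].
apply: tri_in => // r /andP[r0 rL].
- split; rewrite ?E ?F ?G; first by rewrite mulr_ge0 ?(ltW x0).
  by rewrite normrM normrN normrM ns mul1r (gtr0_norm y0) (ger0_norm r0) mulrAC (mulrC y).
 by rewrite mulf_eq0 oppr_eq0 mulf_eq0 (negPf n0) (gt_eqF y0)/= !orbF => /eqP ->; left; rewrite mul0r.
- split; rewrite ?E ?F ?G; first by rewrite mulr_ge0 ?(ltW x0).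
  by rewrite normrM normrM ns mul1r (gtr0_norm y0) (ger0_norm r0) mulrAC (mulrC y).
 by rewrite mulf_eq0 mulf_eq0 (negPf n0) (gt_eqF y0)/= !orbF => /eqP ->; left; rewrite mul0r.
- have -> : p%:C + L%:C * ((s * x) +i* (- (s * y))) +
   r%:C * (((s * x) +i* (s * y)) - ((s * x) +i* (- (s * y)))) =
   (p + L * (s * x)) +i* ((2 * r - L) * (s * y)).
  by complex_ring.
 rewrite /on_lam; have -> : s * (Re ((p + L * (s * x)) +i* ((2 * r - L) * (s * y))) - p) = L * x.
  by rewrite ReK addrAC subrr add0r G.
 split; [by rewrite mulr_ge0 ?(ltW x0)| |by right].
 rewrite ImK !normrM ns mul1r (gtr0_norm y0) mulrAC (mulrC y) ler_wpM2r ?(ltW y0)//.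
 by rewrite ler_wpM2r ?(ltW x0)// ler_norml; apply/andP; split; lra.
Qed.

Lemma lam_split (L : R) : 0 <= L ->
 chain_in (on_lam 1 L) (tri p%:C (x +i* (- y)) (x +i* y) L) /\
 chain_in (on_lam (-1) L) (tri p%:C (- (x +i* (- y))) (- (x +i* y)) L).
Proof.
move=> L0; split.
 by have := tri_on_lam 1 L (expr1n _ _) L0; rewrite !mul1r.
have := tri_on_lam (-1) L _ L0; rewrite !mulN1r sqrrN expr1n opprK => /(_ erefl).
have -> : - (x +i* (- y)) = (- x) +i* y by apply: complexP; rewrite !ReImE ?opprK.
by have -> : - (x +i* y) = (- x) +i* (- y) by apply: complexP; rewrite !ReImE.
Qed.

Lemma lam_in S L : 0 <= L -> (forall s w, s ^+ 2 = 1 -> on_lam s L w -> S w) ->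
 chain_in S (lam L).
Proof.
move=> L0 H; have [h1 h2] := lam_split L L0; apply: chain_in_cat.
 by apply: chain_in_sub h1 => w; apply: H; rewrite expr1n.
by apply: chain_in_sub h2 => w; apply: H; rewrite sqrrN expr1n.
Qed.

(** The point lies inside exactly one triangle; the other one stays in a half-plane that misses
    it. *)
Lemma lam_winding (a L : R) : a != p -> `|a - p| < L * x ->
 cint (lam L) (fun w => (w - a%:C)^-1) = (2 * pi)%:C * 'i%C.
Proof.
move=> ap aL.
have L0 : 0 < L by rewrite -(pmulr_lgt0 _ x0) (le_lt_trans _ aL).
have [h1 h2] := lam_split L (ltW L0).
have aE : a%:C = (p + (a - p))%:C by rewrite addrC subrK.
move: ap aL; rewrite -subr_eq0 ltr_norml => d0 /andP[dl dr].
rewrite cint_cat; have [d1|d1] := ltP 0 (a - p).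
 rewrite {1}aE tri_winding//; [|exact: mulr_gt0|exact: mulr_gt0|nra].
 rewrite (cint_half_plane _ 1 _ _ h2 (tri_closed _ _ _ _)) ?addr0// => w [q1 _ _].
 by rewrite mul1r !ReImE lt_eqF//; nra.
have d2 : a - p < 0 by rewrite lt_def eq_sym d0.
rewrite (cint_half_plane _ 1 _ _ h1 (tri_closed _ _ _ _)); last first.
 by move=> w [q1 _ _]; rewrite mul1r !ReImE gt_eqF//; nra.
have -> : - (x +i* (- y)) = (- x) +i* (- (- y)) by apply: complexP; rewrite !ReImE.
have -> : - (x +i* y) = (- x) +i* (- y) by apply: complexP; rewrite !ReImE.
have k1 := mulr_gt0 x0 y0; have k2 : 0 < x * (p - a) by rewrite mulr_gt0//; lra.
have k3 : 0 < x * ((a - p) + L * x) by rewrite mulr_gt0//; lra.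
by rewrite add0r aE tri_winding//; nra.
Qed.

Lemma lam_avoid (a s L : R) w : s ^+ 2 = 1 -> a != p -> `|a - p| < L * x -> on_lam s L w -> w != a%:C.
Proof.
move=> s1 ap aL [_ _]; apply: contraPneq => ->; rewrite ReC ImC eqxx => /(_ isT).
have ns : `|s| = 1.
 by apply/eqP; rewrite -(@eqrXn2 _ 2)// real_normK ?num_real// s1 expr1n.
case => h.
 by move: ap; rewrite -subr_eq0 -normr_gt0 -(mul1r `|_|) -ns -normrM h normr0 ltxx.
have : `|s * (a - p)| < L * x by rewrite normrM ns mul1r.
by rewrite h => /(le_lt_trans (ler_norm _)); rewrite ltxx.
Qed.

Lemma lam_line_avoid (eta s L : R) w : s ^+ 2 = 1 -> eta != 0 -> on_lam s L w -> w != p +i* eta.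
Proof.
move=> s1 e0 [_ h _]; apply: contraTneq h => ->; rewrite ReK ImK subrr mulr0 mulr0 -ltNge.
by rewrite mulr_gt0// normr_gt0.
Qed.

Lemma lam_line_Cexp (eta L : R) (Q : {poly C}) : 0 <= L -> eta != 0 ->
 cint (lam L) (fun w => Cexp Q.[w] / ((p +i* eta) - w)) = 0.
Proof.
move=> L0 e0; have [h1 h2] := lam_split L L0; rewrite cint_cat.
(* The separating line passes through the pole and is parallel to the edge of the wedge on the
   pole's side of the real axis, hence the sign of [eta]. *)
have D (s : R) w : on_lam s L w ->
  Re (((s * y) +i* (x * Num.sg eta)) * (w - (p +i* eta))) != 0.
 move=> [q1 q2 _].
 have -> : Re (((s * y) +i* (x * Num.sg eta)) * (w - (p +i* eta))) =
   y * (s * (Re w - p)) - (Im w * Num.sg eta) * x + x * `|eta|.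
  by rewrite [in RHS](normrEsg eta) !ReImE; ring.
 rewrite gt_eqF//.
 have e1 : 0 < `|eta| by rewrite normr_gt0.
 have : `|Im w * Num.sg eta| <= `|Im w| by rewrite normrM normr_sg e0 mulr1.
 rewrite ler_norml => /andP[_ k2].
 have k3 : Im w * Num.sg eta * x <= `|Im w| * x by rewrite ler_wpM2r// ltW.
 have k4 : 0 < x * `|eta| by rewrite mulr_gt0.
 move: (`|Im w|) q2 k3 => m q2 k3; nra.
rewrite (cint_half_plane_Cexp _ _ _ _ Q h1 (tri_closed _ _ _ _) (D 1)).
by rewrite (cint_half_plane_Cexp _ _ _ _ Q h2 (tri_closed _ _ _ _) (D (-1))) addr0.
Qed.

End Lambda.
End Newton.

(** * Singular Gaussian majorants *)

Section Majorant.
Context {R : realType}.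
Local Notation mu := (@lebesgue_measure R).

(** The weight that absorbs half of the Cauchy singularity in one variable; it is integrable at 0,
    where its value is 0 by convention. *)
Definition kap (t : R) : R := `|t| `^ (- 2^-1).

Lemma kap_ge0 t : 0 <= kap t. Proof. exact: powR_ge0. Qed.

Lemma kapE t : kap t = (Num.sqrt `|t|)^-1.
Proof. by rewrite /kap powRN powR12_sqrt. Qed.

Lemma kap_opp t : kap (- t) = kap t. Proof. by rewrite /kap normrN. Qed.

Lemma measurable_kap (D : set (measurableTypeR R)) : measurable_fun D kap.
Proof.
apply: measurable_funTS; apply: (measurableT_comp (measurable_powR _)).
exact: normr_measurable.
Qed.

Lemma kap_cts t : t != 0 -> {for t, continuous kap}.
Proof.
move=> t0; have -> : kap = (fun t => (Num.sqrt `|t|)^-1) by apply/funext => x; exact: kapE.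
apply: (@continuousV _ _ (fun t => Num.sqrt `|t|)).
 by rewrite gt_eqF// sqrtr_gt0 normr_gt0.
by apply: continuous_comp; [exact: norm_continuous|exact: sqrt_continuous].
Qed.

Lemma integral_kap (a : R) : 0 < a -> a <= 1 ->
 (\int[mu]_(x in `[a, 1%R]) (kap x)%:E <= 2%:E)%E.
Proof.
move=> a0; rewrite le_eqVlt => /predU1P[->|a1].
 by rewrite set_itv1 integral_set1 lee_fin.
have cF (x : R) : {for x, continuous (fun x => 2 * Num.sqrt x)}.
 by apply: continuousM; [exact: cst_continuous|exact: sqrt_continuous].
have dF (x : R) : 0 < x -> is_derive x 1 (fun x => 2 * Num.sqrt x) (kap x).
 move=> x0; have := is_derive1_sqrt x0 => h.
 apply: is_derive_eq; rewrite /GRing.scale /= kapE ger0_norm ?(ltW x0)//.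
 by rewrite invfM mulrA divff// mul1r.
rewrite (@continuous_FTC2 _ kap (fun x => 2 * Num.sqrt x))//.
- rewrite lee_fin sqrtr1 mulr1 gerBl mulr_ge0// sqrtr_ge0.
- apply/subspace_continuousP => x /=; rewrite in_itv /= => /andP[ax _].
 by apply: cvg_within_filter; apply: kap_cts; rewrite gt_eqF// (lt_le_trans a0).
- split.
 + move=> x; rewrite in_itv /= => /andP[ax _].
  by have [] := dF x (lt_trans a0 ax).
 + by apply: cvg_at_right_filter; exact: cF.
 + by apply: cvg_at_left_filter; exact: cF.
- move=> x; rewrite in_itv /= => /andP[ax _].
 by rewrite derive1E; have := dF x (lt_trans a0 ax) => h; rewrite derive_val.
Qed.

Lemma integral_kapN (a : R) : 0 < a -> a <= 1 ->
 (\int[mu]_(x in `[(- 1)%R, (- a)%R]) (kap x)%:E <= 2%:E)%E.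
Proof.
move=> a0 a1; rewrite integration_by_substitution_oppr//; last first.
 apply/subspace_continuousP => x /=; rewrite in_itv /= => /andP[_ ax].
 by apply: cvg_within_filter; apply: kap_cts; rewrite lt_eqF// (le_lt_trans ax)// oppr_lt0.
under eq_integral do rewrite /= kap_opp.
exact: integral_kap.
Qed.

(** Exhaustion by the intervals [1/(m+1), 1], on which the primitive 2 sqrt(x) bounds the integral
    by 2, and monotone convergence. *)
Lemma integrable_kap01 : mu.-integrable `](0:R), 1] (EFin \o kap).
Proof.
have mk (D : set (measurableTypeR R)) : measurable_fun D (EFin \o kap) by apply/measurable_EFinP; exact: measurable_kap.
have inv_gt0 m : 0 < (m.+1%:R : R)^-1 by rewrite invr_gt0.
have inv_le1 m : (m.+1%:R : R)^-1 <= 1 by rewrite invf_le1// ler1n.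
apply/integrableP; split => //.
have U : `](0:R), 1]%classic = \bigcup_m `[(m.+1%:R)^-1, 1]%classic.
 apply/seteqP; split => x /=; rewrite ?in_itv /=.
  move=> /andP[x0 x1]; have := archi_boundP (ltW (_ : 0 < x^-1)); rewrite invr_gt0 => /(_ x0).
  set m := Num.Def.archi_bound _ => hm; exists m => //=; rewrite in_itv /= x1 andbT.
  rewrite -[leRHS]invrK lef_pV2 ?posrE ?invr_gt0// (le_trans (ltW hm))// ler_nat//.
 move=> [m _ /=]; rewrite in_itv /= => /andP[h ->]; rewrite andbT.
 exact: lt_le_trans (inv_gt0 m) h.
under eq_integral do rewrite /= ger0_norm ?kap_ge0//.
pose A i : set (measurableTypeR R) := `[(i.+1%:R : R)^-1, 1]%classic.
have h : (\int[mu]_(x in A i) (kap x)%:E @[i --> \oo] --> \int[mu]_(x in \bigcup_i A i) (kap x)%:E)%E.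
 apply: ge0_nondecreasing_set_cvg_integral => //.
 - move=> i j ij; apply/subsetPset => x; rewrite /A /= !in_itv /= => /andP[h ->]; rewrite andbT.
  by apply: le_trans h; rewrite lef_pV2 ?posrE// ler_nat.
 - by move=> i; exact: measurable_itv.
 - by move=> i x _; rewrite lee_fin kap_ge0.
rewrite U; apply: (@le_lt_trans _ _ 2%:E); last exact: ltry.
rewrite -(cvg_lim _ h)//; apply: lime_le; first by apply/cvg_ex; eexists; exact: h.
by apply: nearW => m; exact: integral_kap.
Qed.

Lemma integrable_kap10 : mu.-integrable `[(-1 : R), 0[ (EFin \o kap).
Proof.
have mk (D : set (measurableTypeR R)) : measurable_fun D (EFin \o kap).
 by apply/measurable_EFinP; exact: measurable_kap.
have inv_gt0 m : 0 < (m.+1%:R : R)^-1 by rewrite invr_gt0.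
have inv_le1 m : (m.+1%:R : R)^-1 <= 1 by rewrite invf_le1// ler1n.
apply/integrableP; split => //.
have U : `[(-1 : R), 0[%classic = \bigcup_m `[-1, - (m.+1%:R)^-1]%classic.
 apply/seteqP; split => x /=; rewrite ?in_itv /=.
  move=> /andP[x1 x0]; have x0' : 0 < - x by rewrite oppr_gt0.
  have := archi_boundP (ltW (_ : 0 < (- x)^-1)); rewrite invr_gt0 => /(_ x0').
  set m := Num.Def.archi_bound _ => hm; exists m => //=; rewrite in_itv /= x1 /=.
  rewrite lerNr -[leRHS]invrK lef_pV2 ?posrE ?invr_gt0// (le_trans (ltW hm))// ler_nat//.
 move=> [m _ /=]; rewrite in_itv /= => /andP[-> h] /=.
 by rewrite (le_lt_trans h)// oppr_lt0.
under eq_integral do rewrite /= ger0_norm ?kap_ge0//.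
pose A i : set (measurableTypeR R) := `[-1, - (i.+1%:R : R)^-1]%classic.
have h : (\int[mu]_(x in A i) (kap x)%:E @[i --> \oo] --> \int[mu]_(x in \bigcup_i A i) (kap x)%:E)%E.
 apply: ge0_nondecreasing_set_cvg_integral => //.
 - move=> i j ij; apply/subsetPset => x; rewrite /A /= !in_itv /= => /andP[-> h] /=.
  by apply: le_trans h _; rewrite lerN2 lef_pV2 ?posrE// ler_nat.
 - by move=> i; exact: measurable_itv.
 - by move=> i x _; rewrite lee_fin kap_ge0.
rewrite U; apply: (@le_lt_trans _ _ 2%:E); last exact: ltry.
rewrite -(cvg_lim _ h)//; apply: lime_le; first by apply/cvg_ex; eexists; exact: h.
by apply: nearW => m; exact: integral_kapN.
Qed.

(** The weight is at most 1 outside [-1, 1] and the Gaussian at most 1 inside, so the sum of the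
    weight near 0 and of the Gaussian is a majorant. *)
Lemma integrable_kap_gauss : mu.-integrable setT (EFin \o (fun t => kap t * gauss_fun t)).
Proof.
have i1 : mu.-integrable setT (EFin \o (kap \_ `](0:R), 1])).
 by have /integrable_mkcond := integrable_kap01; rewrite restrict_EFin; apply.
have i2 : mu.-integrable setT (EFin \o (kap \_ `[(-1 : R), 0[)).
 by have /integrable_mkcond := integrable_kap10; rewrite restrict_EFin; apply.
have mT := @measurableT _ (measurableTypeR R).
pose b t := (kap \_ `](0:R), 1]) t + (kap \_ `[(-1 : R), 0[) t + gauss_fun t.
have ib : mu.-integrable setT (EFin \o b).
 by apply: (eq_integrable mT _ _ _ (integrableD mT (integrableD mT i1 i2) (@integrableT_gauss R))).
apply: (le_integrable mT _ _ ib).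
 apply/measurable_EFinP; apply: measurable_funM; first exact: measurable_kap.
 by apply: measurable_funTS; exact: measurable_gauss_fun.
move=> t _; rewrite /= lee_fin /b.
have k0 := kap_ge0; have g0 := @gauss_fun_ge0 R; have g1 := @gauss_fun_le1 R.
have p1 : 0 <= (kap \_ `](0:R), 1]) t by rewrite patchE; case: ifP.
have p2 : 0 <= (kap \_ `[(-1 : R), 0[) t by rewrite patchE; case: ifP.
rewrite !ger0_norm ?addr_ge0 ?mulr_ge0//.
have [t0|t0] := eqVneq t 0.
 have -> : kap t = 0 by rewrite t0 /kap normr0 powR0// oppr_eq0 invr_eq0 pnatr_eq0.
 by rewrite mul0r !addr_ge0.
have [t1|t1] := leP `|t| 1.
 apply: (@le_trans _ _ (kap t)); first by rewrite ler_piMr.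
 rewrite -[leLHS]addr0; apply: lerD => //.
 have [tp|tn] := ltP 0 t.
  rewrite -[leLHS]addr0; apply: lerD => //; rewrite patchE mem_set//= in_itv /= tp/=.
  by rewrite (le_trans (ler_norm _)).
 have tn' : t < 0 by rewrite lt_neqAle t0.
 rewrite -[leLHS]add0r; apply: lerD => //; rewrite patchE mem_set//= in_itv /= tn' andbT.
 by move: t1; rewrite ltr0_norm// lerNl.
rewrite -[leLHS]add0r; apply: lerD; first exact: addr_ge0.
rewrite ler_piMl// kapE invf_le1 ?sqrtr_gt0 ?normr_gt0//.
by rewrite -(@sqrtr1 R) ler_wsqrtr// ltW.
Qed.

End Majorant.

(** * Asymptotic equality of sequences and dominated convergence *)

Section Limits.
Context {R : realType}.
Local Notation C := R[i].
Local Notation mu := (@lebesgue_measure R).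
Local Notation Cint := (Cintegral mu).
Implicit Types (D : set (measurableTypeR R)) (u v w : nat -> C).

(** Asymptotic equality instead of convergence: with parameters varying along bounded sequences,
    both sides depend on n and neither need converge. *)
Definition clo u v : Prop := (fun n => nc (u n - v n)) @ \oo --> (0:R).

Lemma squeeze0 (f g : nat -> R) : (\forall n \near \oo, 0 <= f n <= g n) ->
 g @ \oo --> (0:R) -> f @ \oo --> (0:R).
Proof. by move=> fg g0; exact: (squeeze_cvgr fg (cvg_cst _) g0). Qed.

Lemma clo_le u v (g : nat -> R) : (\forall n \near \oo, nc (u n - v n) <= g n) ->
 g @ \oo --> (0:R) -> clo u v.
Proof.
move=> h g0; apply: squeeze0 g0; near=> n; rewrite nc_ge0 /=; near: n; exact: h.
Unshelve. all: end_near. Qed.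

Lemma eq_clo u v u' v' : (\forall n \near \oo, u n = u' n) -> (\forall n \near \oo, v n = v' n) ->
 clo u v -> clo u' v'.
Proof.
move=> h h' c; apply: clo_le c; near=> n.
by rewrite (near h n)// (near h' n).
Unshelve. all: end_near. Qed.

Lemma clo_refl u : clo u u.
Proof.
apply: (clo_le _ _ (fun=> 0)); last exact: cvg_cst.
by near=> n; rewrite subrr nc0.
Unshelve. all: end_near. Qed.

Lemma clo_sym u v : clo u v -> clo v u.
Proof. by move=> c; apply: clo_le c; near=> n; rewrite ncBC.
Unshelve. all: end_near. Qed.

Lemma cvgD0 (f g : nat -> R) : f @ \oo --> (0:R) -> g @ \oo --> (0:R) ->
 (fun n => f n + g n) @ \oo --> (0:R).
Proof. by move=> f0 g0; rewrite -[0 in X in _ --> X]addr0; exact: cvgD. Qed.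

Lemma cvgM0 (f : nat -> R) c : f @ \oo --> (0:R) -> (fun n => c * f n) @ \oo --> (0:R).
Proof. by move=> f0; rewrite -[0 in X in _ --> X](mulr0 c); apply: cvgM => //; exact: cvg_cst. Qed.

Lemma clo_trans u v w : clo u v -> clo v w -> clo u w.
Proof.
move=> c1 c2; apply: clo_le (cvgD0 _ _ c1 c2); near=> n.
have -> : u n - w n = (u n - v n) + (v n - w n) by rewrite addrA subrK.
exact: ncD.
Unshelve. all: end_near. Qed.

Lemma cloD u v u' v' : clo u v -> clo u' v' ->
 clo (fun n => u n + u' n) (fun n => v n + v' n).
Proof.
move=> c1 c2; apply: clo_le (cvgD0 _ _ c1 c2); near=> n.
by rewrite opprD addrACA ncD.
Unshelve. all: end_near. Qed.

Lemma cloN u v : clo u v -> clo (fun n => - u n) (fun n => - v n).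
Proof. by move=> c; apply: clo_le c; near=> n; rewrite -opprD ncN.
Unshelve. all: end_near. Qed.

Lemma cloB u v u' v' : clo u v -> clo u' v' ->
 clo (fun n => u n - u' n) (fun n => v n - v' n).
Proof. by move=> c1 c2; apply: cloD => //; exact: cloN. Qed.

(** Only the right-hand sides are bounded explicitly; closeness then controls the left-hand ones. *)
Lemma cloM u v u' v' M : (\forall n \near \oo, nc (v n) <= M) ->
 (\forall n \near \oo, nc (v' n) <= M) -> clo u v -> clo u' v' ->
 clo (fun n => u n * u' n) (fun n => v n * v' n).
Proof.
move=> b b' c c'; apply: (clo_le _ _ (fun n => nc (u n - v n) * (nc (u' n - v' n) + M) +
  M * nc (u' n - v' n))).
 near=> n; have -> : u n * u' n - v n * v' n =
  (u n - v n) * ((u' n - v' n) + v' n) + v n * (u' n - v' n) by ring.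
 rewrite (le_trans (ncD _ _))// !ncM lerD// ?ler_wpM2l ?ler_wpM2r ?nc_ge0//.
  by rewrite (le_trans (ncD _ _))// lerD2l; near: n; exact: b'.
 by near: n; exact: b.
apply: cvgD0; last exact: cvgM0.
have : (fun n => nc (u n - v n) * (nc (u' n - v' n) + M)) @ \oo --> (0 * (0 + M) : R).
 by apply: cvgM => //; apply: cvgD => //; exact: cvg_cst.
by rewrite mul0r.
Unshelve. all: end_near. Qed.

Lemma cloZ u v (c : C) : clo u v -> clo (fun n => c * u n) (fun n => c * v n).
Proof.
move=> h; apply: clo_le (cvgM0 _ (nc c) h); near=> n; by rewrite -mulrBr ncM.
Unshelve. all: end_near. Qed.

Lemma clo_cst (a b : C) : clo (fun=> a) (fun=> b) -> a = b.
Proof.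
move=> h; apply/eqP; rewrite -subr_eq0 -nc_eq0; apply/eqP.
have h' : (fun=> nc (a - b)) @ \oo --> nc (a - b) by exact: cvg_cst.
exact: cvg_unique h' h.
Qed.

Lemma clo_real (f g : nat -> R) : (fun n => f n - g n) @ \oo --> (0:R) ->
 clo (fun n => (f n)%:C) (fun n => (g n)%:C).
Proof.
move=> h; apply: (clo_le _ _ (fun n => `|f n - g n|)).
 by near=> n; rewrite -rmorphB ncC.
by rewrite -[0 in X in _ --> X](@normr0 R R); exact: cvg_norm.
Unshelve. all: end_near. Qed.

(** Measurability and domination hold from rank [N] on, so dominated convergence is applied to the
    shifted sequence. *)
Lemma Rint_cvg0 D (f : nat -> R -> R) (b : R -> R) (N : nat) : measurable D ->
 (forall n, (N <= n)%N -> measurable_fun D (f n)) ->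
 mu.-integrable D (EFin \o b) ->
 (forall n t, (N <= n)%N -> D t -> `|f n t| <= b t) ->
 (forall t, D t -> (fun n => f n t) @ \oo --> (0:R)) ->
 (fun n => \int[mu]_(t in D) f n t) @ \oo --> (0:R).
Proof.
move=> mD mf ib fb f0; rewrite -(cvg_shiftn N).
pose F n t := (f (n + N)%N t)%:E.
have h1 n : measurable_fun D (F n).
 by apply/measurable_EFinP; apply: mf; rewrite leq_addl.
have h2 : measurable_fun D (cst 0%E : R -> \bar R) by exact: measurable_cst.
have h3 : {ae mu, forall x, D x -> F ^~ x @ \oo --> (cst 0%E : R -> \bar R) x}.
 apply: aeW => t Dt; apply/fine_cvgP; split; first exact: nearW.
 by have := f0 t Dt; rewrite -(cvg_shiftn N).
have h4 : {ae mu, forall x n, D x -> (`|F n x| <= (EFin \o b) x)%E}.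
 by apply: aeW => t n Dt; rewrite /= lee_fin fb// leq_addl.
have [_ _] := dominated_convergence mD h1 h2 h3 ib h4.
by rewrite integral0 => /fine_cvgP [_].
Qed.

(** The restrictions to [A n] are dominated by the integrand itself and are eventually equal to it
    at each point. *)
Lemma Cint_set_cvg D (A : nat -> set (measurableTypeR R)) (h : R -> C) : measurable D ->
 (forall n, measurable (A n)) -> (forall n, A n `<=` D) ->
 (forall t, D t -> \forall n \near \oo, A n t) ->
 cintegrable D h -> clo (fun n => Cint (A n) h) (fun=> Cint D h).
Proof.
move=> mD mA AD Acov [i1 i2].
have H (f : R -> R) : mu.-integrable D (EFin \o f) ->
  (fun n => \int[mu]_(t in A n) f t - \int[mu]_(t in D) f t) @ \oo --> (0:R).
 move=> fi.
 have ir n : mu.-integrable D (EFin \o (f \_ (A n))).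
  rewrite -restrict_EFin; apply/integrable_restrict; [exact: mA|exact: mD|].
  by apply: (integrableS mD _ _ fi); [exact: measurableI|exact: subIsetl].
 have E n : \int[mu]_(t in A n) f t - \int[mu]_(t in D) f t =
   \int[mu]_(t in D) ((f \_ (A n)) t - f t).
  by rewrite (RintegralB mD (ir n) fi) -Rintegral_mkcondr setIidr.
 have -> : (fun n => \int[mu]_(t in A n) f t - \int[mu]_(t in D) f t) =
   (fun n => \int[mu]_(t in D) ((f \_ (A n)) t - f t)) by apply/funext => n; exact: E.
 apply: (Rint_cvg0 _ (fun n t => (f \_ (A n)) t - f t) (fun t => `|f t|) 0 mD).
 - move=> n _; apply: measurable_funB.
   by have /measurable_int/measurable_EFinP := ir n.
  by have /measurable_int/measurable_EFinP := fi.
 - exact: integrable_norm.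
 - move=> n t _ _; rewrite patchE; case: ifP => _; first by rewrite subrr normr0.
  by rewrite sub0r normrN.
 - move=> t Dt; apply: cvg_near_cst; near=> n; rewrite patchE mem_set ?subrr//.
  by near: n; exact: Acov.
apply: (clo_le _ _ (fun n => `|\int[mu]_(t in A n) Re (h t) - \int[mu]_(t in D) Re (h t)| +
  `|\int[mu]_(t in A n) Im (h t) - \int[mu]_(t in D) Im (h t)|)).
 by near=> n; rewrite (le_trans (nc_le _))// ReB ImB.
have N0 (f : nat -> R) : f @ \oo --> (0:R) -> (fun n => `|f n|) @ \oo --> (0:R).
 by move=> /cvg_norm; rewrite normr0.
by apply: cvgD0; apply: N0; exact: H.
Unshelve. all: end_near. Qed.

Lemma clo_nc0 (F : nat -> C) : clo F (fun=> 0) -> (fun n => nc (F n)) @ \oo --> (0:R).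
Proof. by rewrite /clo; under eq_fun do rewrite subr0. Qed.

Lemma clo_sub0 (F G : nat -> C) : clo F G -> clo (fun n => F n - G n) (fun=> 0).
Proof. by move=> h; apply: (clo_le _ _ (fun n => nc (F n - G n))) h; apply: nearW => n; rewrite subr0. Qed.

Lemma clo_shift k (F G : nat -> C) : clo (fun n => F (n + k)%N) (fun n => G (n + k)%N) -> clo F G.
Proof.
move=> h; pose f n := nc (F n - G n).
have : [sequence f (n + k)%N]_n @ \oo --> (0:R) by exact: h.
by rewrite cvg_shiftn.
Qed.

End Limits.

(** * The finite-n identity *)

Section Empirical.
Context {R : realType}.
Local Notation C := R[i].

(** Real integrals are differences of the integrals of the positive and negative parts; the finite
    sum is computed on each part and recombined. *)
Lemma emp_int n (X : n.-tuple R) (f : R -> R) :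
 measurable_fun [set: measurableTypeR R] f ->
 \int[empirical X]_s f s = n%:R^-1 * \sum_(a <- X) f a.
Proof.
move=> mf; pose ef : measurableTypeR R -> \bar R := EFin \o f.
have mef : measurable_fun setT ef by exact/measurable_EFinP.
have G (g : measurableTypeR R -> \bar R) : (forall x, 0 <= g x)%E -> measurable_fun setT g ->
  (\int[empirical X]_s g s = (n%:R^-1)%:E * \sum_(k < n) g (X`_k))%E.
 move=> g0 mg; rewrite /empirical ge0_integral_mscale// ge0_integral_measure_sum//.
 congr (_ * _)%E; apply: eq_bigr => k _.
 by rewrite integral_dirac// diracT mul1e.
rewrite /Rintegral -/ef.
have -> : (\int[empirical X]_x (f x)%:E = \int[empirical X]_x ef x)%E by [].
rewrite integralE !G//; [|exact: measurable_funeneg|exact: measurable_funepos].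
have E1 k : (ef^\+ (X`_k) = (Num.max (f X`_k) 0)%:E)%E by rewrite unlock /ef /= EFin_max.
have E2 k : (ef^\- (X`_k) = (Num.max (- f X`_k) 0)%:E)%E by rewrite unlock /ef /= EFin_max.
under eq_bigr do rewrite E1.
under [X in (_ - _ * X)%E]eq_bigr do rewrite E2.
rewrite !sumEFin -!EFinM -EFinB /= -mulrBr -sumrB; congr (_ * _).
rewrite [RHS](big_nth 0) size_tuple big_mkord; apply: eq_bigr => k _.
move: (f _) => x; have [h|/ltW h] := leP 0 x.
 have -> : Num.max (- x) 0 = 0 by apply/max_idPr; rewrite oppr_le0.
 exact: subr0.
have -> : Num.max (- x) 0 = - x by apply/max_idPl; rewrite oppr_ge0.
by rewrite sub0r opprK.
Qed.

Lemma Cexp_Clog (u : C) : u != 0 -> Cexp (Clog u) = u.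
Proof.
move=> u0; have n0 := nc_gt0 _ u0; have nn := lt0r_neq0 n0.
rewrite /Cexp /Clog ReK ImK lnK ?posrE//.
have h : -1 <= Re u / nc u <= 1.
 rewrite -ler_norml normrM normfV (gtr0_norm n0) ler_pdivrMr// mul1r; exact: nc_Re.
have cA : cos (Arg u) = Re u / nc u.
 by rewrite /Arg; case: ifP => _; rewrite ?cosN acosK.
have sA : sin (Arg u) = Im u / nc u.
 have s : sin (acos (Re u / nc u)) = `|Im u| / nc u.
  rewrite sin_acos//.
  have n2 : nc u ^+ 2 != 0 by rewrite expf_neq0.
  have D a : (a / nc u) ^+ 2 = a ^+ 2 / nc u ^+ 2 by rewrite exprMn exprVn.
  have -> : 1 - (Re u / nc u) ^+ 2 = (`|Im u| / nc u) ^+ 2.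
   rewrite !D real_normK ?num_real//; apply: (mulIf n2).
   by rewrite mulrBl !divfK// mul1r nc_sq [X in X - _]addrC addrK.
  by rewrite sqrtr_sqr ger0_norm// divr_ge0// ltW.
 rewrite /Arg; case: (leP 0 (Im u)) => hu; first by rewrite s ger0_norm.
 by rewrite sinN s ltr0_norm// mulNr opprK.
by rewrite cA sA; apply: complexP; rewrite /= mulrCA divff ?mulr1.
Qed.

(** Required by [emp_int]. Off the real axis the argument is continuous in s; for real z it is a
    step function. *)
Lemma measurable_Clog (z : C) :
 measurable_fun [set: measurableTypeR R] (fun s => Re (Clog (z - s%:C))) /\
 measurable_fun [set: measurableTypeR R] (fun s => Im (Clog (z - s%:C))).
Proof.
have cz t : ccts (fun s : R => z - s%:C) t.
 by apply: cctsB; [exact: ccts_cst|split; [|exact: cst_continuous]].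
have cn : continuous (fun s : R => nc (z - s%:C)) by move=> t; apply: nc_cts; exact: cz.
split.
 apply: (measurableT_comp (@measurable_ln R)).
 exact: continuous_measurable_fun.
have E s : Im (Clog (z - s%:C)) = if 0 <= Im z then acos ((Re z - s) / nc (z - s%:C))
  else - acos ((Re z - s) / nc (z - s%:C)).
 by rewrite /Clog /Arg ImK ImB ReB !ReImE subr0.
under eq_fun do rewrite E.
suff mA : measurable_fun [set: measurableTypeR R] (fun s => acos ((Re z - s) / nc (z - s%:C))).
 by case: (0 <= Im z) => //; exact: measurable_funN.
have [i0|i0] := eqVneq (Im z) 0.
 (* At s = Re z the quotient is 0 divided by 0, which is 0 by convention, whence the middle
    value. *)
 have F s : acos ((Re z - s) / nc (z - s%:C)) =
   if s < Re z then acos 1 else if s == Re z then acos 0 else acos (-1).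
  have -> : nc (z - s%:C) = `|Re z - s|.
   by rewrite ncE !ReImE i0 subr0 expr0n addr0 sqrtr_sqr.
  case: (ltgtP s (Re z)) => h.
  - by rewrite gtr0_norm ?subr_gt0// divff// gt_eqF// subr_gt0.
  - by rewrite ltr0_norm ?subr_lt0// invrN mulrN divff// lt_eqF// subr_lt0.
  - by rewrite h subrr mul0r.
 under eq_fun do rewrite F.
 apply: measurable_fun_ifT => //; first exact: measurable_fun_ltr.
 by apply: measurable_fun_ifT => //; exact: measurable_fun_eqr.
apply: continuous_measurable_fun => t.
have z0 : z - t%:C != 0.
 by apply: contra_neq i0 => h; rewrite -[LHS]subr0 -[0 in LHS](ImC t) -ImB h.
have n0 := nc_gt0 _ z0.
apply: (@continuous_comp _ _ _ (fun s => (Re z - s) / nc (z - s%:C)) (@acos R)).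
 apply: continuousM; first by apply: continuousB; [exact: cst_continuous|].
 by apply: continuousV; [rewrite gt_eqF|exact: cn].
apply: continuous_acos; rewrite -ltr_norml normrM normfV (gtr0_norm n0) ltr_pdivrMr// mul1r.
have i2 : 0 < Im z ^+ 2 by rewrite exprn_even_gt0.
by rewrite -sqrtr_sqr ncE !ReImE subr0 ltr_sqrt ?ltrDl// ltr_wpDl ?sqr_ge0.
Qed.

(** Since n times the potential is a sum of n logarithms, the branch disappears under the
    exponential and leaves the monic polynomial with roots X_j. *)
Lemma Cexp_log_potential n (X : n.-tuple R) (z : C) : (0 < n)%N ->
 (forall a, a \in X -> z != a%:C) ->
 Cexp (n%:R * log_potential (empirical X) z) = \prod_(a <- X) (z - a%:C).
Proof.
move=> n0 zX; have [m1 m2] := measurable_Clog z.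
have -> : n%:R * log_potential (empirical X) z = \sum_(a <- X) Clog (z - a%:C).
 have nR : (n%:R : R) != 0 by rewrite pnatr_eq0 -lt0n.
 rewrite natC /log_potential /Cintegral !emp_int//; apply: complexP.
  rewrite ReMC ReK mulrA divff// mul1r.
  by elim/big_rec2: _ => [|a x y _ ->]; rewrite ?ReD.
 rewrite ImMC ImK mulrA divff// mul1r.
 by elim/big_rec2: _ => [|a x y _ ->]; rewrite ?ImD.
rewrite Cexp_sum; apply: eq_big_seq => a /zX za.
by rewrite Cexp_Clog// subr_eq0.
Qed.

End Empirical.

#[local] Opaque fcts rcts prim ccts is_cderive cintegrable clo.

(** * Rays and lines as limits of segments *)

Section Rays.
Context {R : realType}.
Local Notation C := R[i].
Local Notation mu := (@lebesgue_measure R).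
Local Notation Cint := (Cintegral mu).
Definition pos_half : set (measurableTypeR R) := [set r : R | 0 <= r].
(** The direction [e] may have any modulus, so that rescaling a contour stays within this family. *)
Definition rayC (a e : C) (f : C -> C) : C := Cint pos_half (fun r => f (a + r%:C * e) * e).
Definition lineC (a e : C) (f : C -> C) : C := Cint setT (fun r => f (a + r%:C * e) * e).

Lemma pos_halfE : pos_half = `[0, +oo[%classic.
Proof. by rewrite set_itvcy. Qed.
Lemma measurable_pos_half : measurable pos_half.
Proof. by rewrite pos_halfE; exact: measurable_itv. Qed.

Lemma ray_limit a e f : cintegrable pos_half (fun r => f (a + r%:C * e) * e) ->
 clo (fun m => pint (lin a e 0 m%:R) f) (fun=> rayC a e f).
Proof.
move=> ih; pose A (m : nat) : set (measurableTypeR R) := `[0, m%:R]%classic.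
refine (Cint_set_cvg pos_half A _ measurable_pos_half _ _ _ ih).
- by move=> n; exact: measurable_itv.
- by move=> n t; rewrite /A /= in_itv /= /pos_half /= => /andP[].
- move=> t; rewrite /pos_half /= => t0; near=> n; rewrite /A /= in_itv /= t0 /=.
 near: n; exact: nbhs_infty_ger.
Unshelve. all: end_near. Qed.

Lemma line_limit a e (c : R) f : 0 < c -> cintegrable setT (fun r => f (a + r%:C * e) * e) ->
 clo (fun m => pint (lin a e (- (c * m%:R)) (c * m%:R)) f) (fun=> lineC a e f).
Proof.
move=> c0 ih; pose A (m : nat) : set (measurableTypeR R) := `[- (c * m%:R), c * m%:R]%classic.
refine (Cint_set_cvg setT A _ measurableT _ _ _ ih).
- by move=> n; exact: measurable_itv.
- by move=> n t _.
- move=> t _; near=> n; rewrite /A /= in_itv /= -ler_norml -ler_pdivrMl//.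
 near: n; exact: nbhs_infty_ger.
Unshelve. all: end_near. Qed.

Lemma pint_lin_bound a e l1 l2 f (B : R) : l1 <= l2 ->
 (forall t, l1 <= t <= l2 -> ccts (fun r => f (a + r%:C * e)) t) ->
 (forall t, l1 <= t <= l2 -> nc (f (a + t%:C * e)) <= B) ->
 nc (pint (lin a e l1 l2) f) <= 2 * (B * nc e * (l2 - l1)).
Proof.
move=> l12 cf fB; rewrite /pint /=.
have ic : cintegrable `[l1, l2] (fun t => f (a + t%:C * e) * e).
 by apply: ccts_cintegrable => t /cf ct; apply: cctsM => //; exact: ccts_cst.
have iB : mu.-integrable `[l1, l2] (EFin \o (fun=> B * nc e)).
 apply: continuous_compact_integrable; first exact: segment_compact.
 by move=> x; exact: cst_continuous.
have hB t : `[l1, l2]%classic t -> nc (f (a + t%:C * e) * e) <= B * nc e.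
 by rewrite /= in_itv /= => /fB h; rewrite ncM ler_wpM2r ?nc_ge0.
have := nc_Cint_le `[l1, l2] _ _ (measurable_itv _) ic iB hB.
rewrite Rintegral_cst//= lebesgue_measure_itv/= lte_fin; case: ltP => //= l21.
by rewrite mulr0 mulr0 => h; rewrite (le_trans h)// (le_anti (introT andP (conj l12 l21))) subrr !mulr0.
Qed.

Definition cauchy_fun (t : R) : R := (1 + t ^+ 2)^-1.

Lemma integrable_cauchy_fun : mu.-integrable setT (EFin \o cauchy_fun).
Proof.
have cc : continuous cauchy_fun by have := @continuous_oneDsqrV R.
have mc : measurable_fun [set: measurableTypeR R] (EFin \o cauchy_fun).
 by apply/measurable_EFinP; exact: continuous_measurable_fun.
have g0 t : 0 <= cauchy_fun t by rewrite /cauchy_fun invr_ge0; nra.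
apply/integrableP; split => //.
under eq_integral do rewrite /= ger0_norm//.
rewrite (@ge0_symfun_integralT _ cauchy_fun)//; last first.
 by move=> x; rewrite /cauchy_fun /= sqrrN.
have := @integral0y_oneDsqr R; rewrite set_itvcy /= => ->.
by rewrite -EFinM ltry.
Qed.

(** Completing the square: half of the quadratic decay absorbs the linear term. *)
Lemma expR_le_cauchy (c b K t : R) : 0 < c -> 0 <= b ->
 K - c * t ^+ 2 + b * `|t| <= K + b ^+ 2 / c - c / 2 * t ^+ 2.
Proof.
move=> c0 b0; have t2 : t ^+ 2 = `|t| ^+ 2 by rewrite real_normK ?num_real.
rewrite t2; move: `|t| => x.
have : 0 <= (b - c * x) ^+ 2 / c by rewrite divr_ge0 ?sqr_ge0// ltW.
have -> : (b - c * x) ^+ 2 / c = b ^+ 2 / c - 2 * b * x + c * x ^+ 2.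
 by field; rewrite gt_eqF.
have : 0 <= b ^+ 2 / c by rewrite divr_ge0 ?sqr_ge0// ltW.
lra.
Qed.

Lemma gauss_le_cauchy (c t : R) : 0 < c -> c <= 1 -> expR (- (c * t ^+ 2)) <= c^-1 * cauchy_fun t.
Proof.
move=> c0 c1; rewrite expRN /cauchy_fun -invfM lef_pV2 ?posrE ?expR_gt0//; last by nra.
apply: le_trans (expR_ge1Dx _); nra.
Qed.

(** Continuity bounds the function on [-N, N] and the Gaussian bounds it beyond; both bounds are
    merged into one multiple of 1/(1 + t^2). *)
Lemma integrable_of_tail (D : set (measurableTypeR R)) (h : R -> C) (N K c : R) : measurable D ->
 0 < c -> c <= 1 -> 0 <= N -> 0 <= K ->
 (forall t, ccts h t) -> (forall t, D t -> N <= `|t| -> nc (h t) <= K * expR (- (c * t ^+ 2))) ->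
 cintegrable D h.
Proof.
move=> mD c0 c1 N0 K0 ch hb.
have mh : cmeas setT h by apply: ccts_cmeas => //.
have [B hB] : exists B, forall t, `[- N, N]%classic t -> nc (h t) <= B.
 have NN : - N <= N by lra.
 have cn : {within `[- N, N], continuous (fun t => nc (h t))}.
  by apply: continuous_subspaceT => t; apply: nc_cts.
 by have [x _ hx] := EVT_max NN cn; exists (nc (h x)) => t /=; exact: hx.
pose M := `|B| * (1 + N ^+ 2) + K / c.
apply: (le_cintegrable _ _ (fun t => M * cauchy_fun t) mD).
- by case: mh => m1 m2; split; [exact: measurable_funTS m1|exact: measurable_funTS m2].
- by apply: (integrableS measurableT mD (@subsetT _ _)); exact: (integrableZl _ M integrable_cauchy_fun).
move=> t Dt; have g0 : 0 < cauchy_fun t by rewrite invr_gt0; nra.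
rewrite mulrDl; have [tN|tN] := leP N `|t|.
 rewrite ler_wpDl//; first by rewrite !mulr_ge0// ?ltW//; nra.
 rewrite (le_trans (hb t Dt tN))// -mulrA ler_wpM2l//.
 exact: gauss_le_cauchy.
rewrite ler_wpDr//; first by rewrite mulr_ge0 ?divr_ge0// ltW.
have tt : `[- N, N]%classic t by rewrite /= in_itv /= -ler_norml ltW.
rewrite (le_trans (hB t tt))// (le_trans (ler_norm _))// -mulrA ler_peMr//.
rewrite /cauchy_fun -[leLHS](divff (lt0r_neq0 (_ : 0 < 1 + t ^+ 2))) ?ler_wpM2r ?invr_ge0//; try nra.
by rewrite lerD2l -(real_normK (num_real t)) lerXn2r ?nnegrE// ltW.
Qed.

(** At parameter 0 the vertical line crosses the real axis, where it may hit a pole or the vertex of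
    the rays; the identities of integrands hold off that null point only. *)
Lemma Cint_eq_off0 (D : set (measurableTypeR R)) (h k : R -> C) : measurable D -> D 0 ->
 (forall t, D t -> t != 0 -> h t = k t) -> cmeas D k -> Cint D h = Cint D k.
Proof.
move=> mD D0 hk [m1 m2].
have mD0 : measurable (D `\ 0) by exact: measurableD.
have ms : D `\ 0 `<=` D by move=> t [].
have H (f g : R -> R) : (forall t, D t -> t != 0 -> f t = g t) -> measurable_fun D g ->
  \int[mu]_(t in D) f t = \int[mu]_(t in D) g t.
 move=> fg mg; have mg' : measurable_fun (D `\ 0) g by exact: measurable_funS mg.
 have mf' : measurable_fun (D `\ 0) f.
  by apply: eq_measurable_fun mg' => t; rewrite inE => -[Dt /eqP t0]; rewrite fg.
 rewrite /Rintegral -[in LHS](@integral_setD1 _ _ 0)//; last exact/measurable_EFinP.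
 rewrite -[in RHS](@integral_setD1 _ _ 0)//; last exact/measurable_EFinP.
 congr fine; apply: eq_integral => t; rewrite inE => -[Dt /eqP t0]; by rewrite fg.
by apply: complexP; rewrite /Cintegral /=; apply: H => // t Dt t0; rewrite hk.
Qed.

(** An exponential growth bound is enough, as every polynomial below is multiplied by a Gaussian. *)
Lemma nc_horner_le (q : {poly C}) : exists K m : R, [/\ 0 <= K, 0 <= m &
 forall z, nc q.[z] <= K * expR (m * nc z)].
Proof.
elim/poly_ind: q => [|q c [K [m [K0 m0 h]]]].
 by exists 0, 0; split => // z; rewrite horner0 nc0 mul0r.
exists (K + nc c), (m + 1); split; rewrite ?addr_ge0 ?nc_ge0// => z.
rewrite !hornerE (le_trans (ncD _ _))// ncM mulrDl; apply: lerD.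
 rewrite mulrDl mul1r expRD mulrA ler_pM ?nc_ge0//.
 by rewrite (le_trans _ (expR_ge1Dx _))// lerDr.
rewrite ler_peMr ?nc_ge0// -expR0 ler_expR mulr_ge0 ?nc_ge0// addr_ge0//.
Qed.

End Rays.

(** * Moving and rescaling the vertical line *)

Section FiniteIdentity.
Context {R : realType}.
Local Notation C := R[i].
Lemma gauss_seq0 (A c : R) : 0 < c -> 0 <= A ->
 (fun m : nat => A * (m%:R * expR (- (c * m%:R ^+ 2)))) @ \oo --> (0:R).
Proof.
move=> c0 A0; apply: (squeeze0 _ (fun m => (A * (2 / c)) * m.+1%:R^-1)); last first.
 by apply: cvgM0; exact: cvg_harmonic.
near=> m; have m1 : 1 <= m%:R :> R by rewrite ler1n; near: m; exact: nbhs_infty_gt.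
have m0 : 0 < m%:R :> R by rewrite (lt_le_trans ltr01).
rewrite !mulr_ge0 ?expR_ge0//= -[leRHS]mulrA ler_wpM2l// expRN.
have h : c * m%:R ^+ 2 <= expR (c * m%:R ^+ 2) by rewrite (le_trans _ (expR_ge1Dx _))// lerDr.
have q0 : 0 < c * m%:R ^+ 2 by rewrite mulr_gt0// exprn_gt0.
apply: (@le_trans _ _ (m%:R / (c * m%:R ^+ 2))).
 by rewrite ler_wpM2l ?(ltW m0)// lef_pV2 ?posrE ?expR_gt0.
have -> : m%:R / (c * m%:R ^+ 2) = (1 / c) * m%:R^-1 by field; rewrite !gt_eqF.
rewrite -[leRHS]mulrA mul1r [leRHS](_ : _ = c^-1 * (2 / m.+1%:R)); last by ring.
rewrite ler_wpM2l ?invr_ge0 ?(ltW c0)// ler_pdivlMr ?ltr0n// mulrC ler_pdivrMr//.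
by rewrite -natr1; lra.
Unshelve. all: end_near. Qed.

Lemma integrable_of_gauss_tail (D : set (measurableTypeR R)) (h : R -> C) (N K c : R) :
 measurable D -> 0 < c -> 0 <= N -> 0 <= K -> (forall t, ccts h t) ->
 (forall t, D t -> N <= `|t| -> nc (h t) <= K * expR (- (c * t ^+ 2))) -> cintegrable D h.
Proof.
move=> mD c0 N0 K0 ch hb; have m0 : 0 < Num.min c 1 by rewrite lt_min c0 ltr01.
have m1 : Num.min c 1 <= 1 by rewrite ge_min lexx orbT.
apply: (integrable_of_tail D h N K (Num.min c 1)) => // t Dt Nt.
rewrite (le_trans (hb t Dt Nt))// ler_wpM2l// ler_expR lerN2 ler_wpM2r ?sqr_ge0//.
by rewrite ge_min lexx.
Qed.

Definition gq (c x : R) : {poly C} := c%:C *: ('X - x%:C%:P) ^+ 2.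
Lemma gqE c x z : (gq c x).[z] = c%:C * (z - x%:C) ^+ 2.
Proof. by rewrite /gq hornerZ horner_exp hornerXsubC. Qed.
Lemma Re_gq c x z : Re (gq c x).[z] = c * ((Re z - x) ^+ 2 - Im z ^+ 2).
Proof. by rewrite gqE !(expr2, ReImE); ring. Qed.

Section LineShift.
Variables (c y : R) (N : {poly C}).
Hypothesis c0 : 0 < c.
Let F z := Cexp (gq c y).[z] * N.[z].

(** In a vertical strip the real part of c (z - y)^2 is at most a constant minus c (Im z)^2; half of
    this decay pays for the polynomial. *)
Lemma strip_decay (M e : R) : 0 < e -> exists K c' : R, [/\ 0 <= K, 0 < c' &
 forall z, `|Re z| <= M -> forall r, `|Im z| = e * `|r| -> nc (F z) <= K * expR (- (c' * r ^+ 2))].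
Proof.
move=> e0; have [K [m [K0 m0 hN]]] := nc_horner_le N.
exists (K * expR (c * (M + `|y|) ^+ 2 + m * M + (m * e) ^+ 2 / (c * e ^+ 2))), (c * e ^+ 2 / 2); split.
- by rewrite mulr_ge0 ?expR_ge0.
- by rewrite divr_gt0// mulr_gt0// exprn_gt0.
move=> z zM r zr; rewrite /F ncM nc_Cexp Re_gq mulrC.
rewrite (le_trans (ler_wpM2r (expR_ge0 _) (hN z)))// -!mulrA ler_wpM2l// -!expRD ler_expR.
have i2 : Im z ^+ 2 = e ^+ 2 * r ^+ 2.
 by rewrite -(real_normK (num_real (Im z))) zr exprMn real_normK ?num_real.
have r2 : (Re z - y) ^+ 2 <= (M + `|y|) ^+ 2.
 rewrite -(real_normK (num_real (Re z - y))) lerXn2r ?nnegrE//.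
  by rewrite addr_ge0// (le_trans _ zM).
 by rewrite (le_trans (ler_normB _ _))// lerD2r.
have nz : nc z <= M + e * `|r| by rewrite (le_trans (nc_le _))// zr lerD2r.
have h := expR_le_cauchy (c * e ^+ 2) (m * e) (c * (M + `|y|) ^+ 2 + m * M) r.
rewrite i2 mulrBr; apply: (@le_trans _ _ (c * (M + `|y|) ^+ 2 + m * M - c * e ^+ 2 * r ^+ 2 + m * e * `|r|)).
 have k1 : c * (Re z - y) ^+ 2 <= c * (M + `|y|) ^+ 2 by rewrite ler_wpM2l// ltW.
 have k2 : m * nc z <= m * (M + e * `|r|) by rewrite ler_wpM2l.
 by move: k1 k2; lra.
have h1 : 0 < c * e ^+ 2 by rewrite mulr_gt0// exprn_gt0.
apply: le_trans (h h1 (mulr_ge0 m0 (ltW e0))) _.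
by lra.
Qed.

Lemma F_cts (a e : C) t : ccts (fun r => F (a + r%:C * e)) t.
Proof.
have cl : ccts (fun r : R => a + r%:C * e) t by exact: is_cderive_cts (is_cderive_lin a e t).
by apply: cctsM; [apply: ccts_Cexp|]; apply: ccts_horner.
Qed.

Lemma line_integrable (a e : R) : 0 < e ->
 cintegrable setT (fun r => F (a%:C + r%:C * (0 +i* e)) * (0 +i* e)).
Proof.
move=> e0; have [K [c' [K0 c'0 h]]] := strip_decay `|a| e e0.
apply: (integrable_of_gauss_tail setT _ 0 (K * e) c') => //; first by rewrite mulr_ge0// ltW.
 by move=> t; apply: cctsM; [exact: F_cts|exact: ccts_cst].
move=> t _ _; rewrite ncM mulrAC ler_pM ?nc_ge0//.
 by apply: h; rewrite !ReImE ?mulr0 ?mul0r ?subr0 ?addr0 ?add0r ?mulr0 ?addr0//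
  ?normrM ?(gtr0_norm e0) 1?mulrC//.
by rewrite ncE /= expr0n add0r sqrtr_sqr gtr0_norm.
Qed.

(** Cauchy's theorem on rectangles of height growing with m. The two vertical sides run at speeds 1
    and [e], so their parameter intervals are chosen to end at the same heights. *)
Lemma line_shift (a b e : R) : 0 < e ->
 lineC a%:C (0 +i* 1) F = lineC b%:C (0 +i* e) F.
Proof.
move=> e0.
have i1 := line_integrable a 1 ltr01; have i2 := line_integrable b e e0.
have l1 := line_limit _ _ e F e0 i1; have l2 := line_limit _ _ 1 F ltr01 i2.
have hor (a1 b1 s : R) : `|s| = 1 -> clo (fun m => pint (lin (a1 +i* (s * (e * m%:R))) ((b1 - a1)%:C) 0 1) F) (fun=> 0).
 move=> s1; have [K [c' [K0 c'0 h]]] := strip_decay (`|a1| + `|b1|) e e0.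
 apply: (clo_le _ _ (fun m => (2 * (K * nc ((b1 - a1)%:C : C))) * (m%:R * expR (- (c' * m%:R ^+ 2))))); last first.
  by apply: gauss_seq0 => //; rewrite !mulr_ge0 ?nc_ge0.
 near=> m; have m1 : 1 <= m%:R :> R by rewrite ler1n; near: m; exact: nbhs_infty_gt.
 rewrite subr0; have := pint_lin_bound (a1 +i* (s * (e * m%:R))) (b1 - a1)%:C 0 1 F (K * expR (- (c' * m%:R ^+ 2))) ler01.
 move=> /(_ (fun t _ => F_cts _ _ t)) H; apply: (le_trans (H _)) => [t /andP[t0 t1]|].
  apply: h; rewrite !ReImE ?mulr0 ?mul0r ?subr0 ?addr0 /=.
   have -> : a1 + t * (b1 - a1) = (1 - t) * a1 + t * b1 by ring.
   rewrite (le_trans (ler_normD _ _))// !normrM lerD// ler_piMl//; rewrite ger0_norm//; lra.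
  by rewrite normrM s1 mul1r normrM (gtr0_norm e0).
 rewrite subr0 mulr1 -[leRHS]mulrA ler_wpM2l// [leLHS]mulrAC ler_wpM2l ?mulr_ge0 ?nc_ge0//.
 by rewrite ler_peMl// expR_ge0.
have top := hor b a 1 (normr1 _); have bot := hor a b (-1) _.
rewrite normrN1 in bot; have {}bot := bot erefl.
pose ch m : seq (C * @piece R) := [:: (1, lin b%:C (0 +i* e) (- (1 * m%:R)) (1 * m%:R));
 (1, lin (b +i* (1 * (e * m%:R))) (a - b)%:C 0 1);
 (-1, lin a%:C (0 +i* 1) (- (e * m%:R)) (e * m%:R));
 (1, lin (a +i* (-1 * (e * m%:R))) (b - a)%:C 0 1)].
have ch0 m : cint (ch m) F = 0.
 have m0 : 0 <= m%:R :> R by [].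
 have Sch : chain_in (fun=> True) (ch m).
  split; [apply: wfp_lin; lra|by []|]; split; [exact: wfp_lin|by []|].
  split; [apply: wfp_lin; have := mulr_ge0 (ltW e0) m0; lra|by []|]; split; [exact: wfp_lin|by []|by []].
 have cch : closed_chain (ch m).
  move=> G; rewrite /bdry !big_cons big_nil /=.
  have E1 : b%:C + (1 * m%:R)%:C * (0 +i* e) = b +i* (1 * (e * m%:R)).
   by complex_ring.
  have E2 : b%:C + (- (1 * m%:R))%:C * (0 +i* e) = b +i* (-1 * (e * m%:R)).
   by complex_ring.
  have E3 : a%:C + (e * m%:R)%:C * (0 +i* 1) = a +i* (1 * (e * m%:R)).
   by complex_ring.
  have E4 : a%:C + (- (e * m%:R))%:C * (0 +i* 1) = a +i* (-1 * (e * m%:R)).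
   by complex_ring.
  have E5 (u v s : R) : u +i* s + (1 : R)%:C * (v - u)%:C = v +i* s.
   by complex_ring.
  have E6 (u v s : R) : u +i* s + (0:R)%:C * (v - u)%:C = u +i* s.
   by complex_ring.
  rewrite E1 E2 E3 E4 !E5 !E6; ring.
 have := cint_Cexp_invp (fun=> True) (ch m) [::] (gq c y) N Sch cch.
 rewrite (_ : (fun w => _ * invp [::] w) = F); last first.
  by apply/funext => w; rewrite /invp big_nil mulr1.
 by apply.
apply: clo_cst; apply: clo_sym.
have l3 := cloD _ _ _ _ (cloD _ _ _ _ l2 top) (cloD _ _ _ _ (cloN _ _ l1) bot).
have l4 : clo (fun=> 0) (fun=> lineC b%:C (0 +i* e) F + 0 + (- lineC a%:C (0 +i* 1) F + 0)).
 apply: eq_clo l3; apply: nearW => m //.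
 by rewrite -(ch0 m) /cint !big_cons big_nil /=; ring.
have l5 := cloD _ _ _ _ l4 (clo_refl (fun=> lineC a%:C (0 +i* 1) F)).
apply: clo_sym; apply: eq_clo l5; apply: nearW => m; ring.
Unshelve. all: end_near. Qed.

End LineShift.
End FiniteIdentity.

(** * From growing triangles to four rays *)

Section RayRepresentation.
Context {R : realType}.
Local Notation C := R[i].
(** What remains of the two triangles of [lam] when the far sides go to infinity; the orientation is
    inherited from them. *)
Definition rays4 (p ax ay : R) (f : C -> C) : C :=
 rayC p%:C (ax +i* (- ay)) f - rayC p%:C (ax +i* ay) f
 + (rayC p%:C (- (ax +i* (- ay))) f - rayC p%:C (- (ax +i* ay)) f).

Section Decay.
Variables (X : seq R) (p ax ay c x eta : R).
Hypotheses (ay0 : 0 < ay) (ayx : ay < ax) (c0 : 0 < c) (eta0 : eta != 0) (pX : p \notin X).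
Let Xc := [seq a%:C | a <- X].
Let f w := Cexp (gq (- c) x).[w] * invp Xc w / ((p +i* eta) - w).
Let ax0 : 0 < ax. Proof. exact: lt_trans ayx. Qed.

Lemma points_bound : exists2 U : R, 1 <= U & forall a, a \in X -> `|a - p| + 1 <= U.
Proof.
have [U U1 H] : exists2 U : R, 1 <= U & all (fun a => `|a - p| + 1 <= U) X.
 elim: X => [|a l [U U1 H]]; first by exists 1.
 exists (U + (`|a - p| + 1)); first by rewrite ler_wpDr// addr_ge0.
 rewrite /= ler_wpDl ?(le_trans ler01)//=; apply/allP => b /(allP H) h.
 by rewrite ler_wpDr// addr_ge0.
by exists U => // a /(allP H).
Qed.

(** Since [ay < ax], the square of w - p has positive real part in the double sector, so the
    Gaussian factor decays there. Beyond [U] all poles are at distance at least 1 and the rational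
    factor is at most 1. *)
Lemma rays_decay : exists U K c' : R, [/\ 1 <= U, 0 <= K, 0 < c',
 (forall a, a \in X -> `|a - p| + 1 <= U) &
 forall w s u, s ^+ 2 = 1 -> Re w - p = s * u -> U <= u -> `|Im w| * ax <= ay * u ->
  nc (f w) <= K * expR (- (c' * u ^+ 2))].
Proof.
have [U U1 HU] := points_bound.
pose k := 1 - (ay / ax) ^+ 2.
have k0 : 0 < k.
 by rewrite /k subr_gt0 expr_lt1// ?ltr_pdivrMr ?mul1r// divr_ge0// ltW.
pose b := 2 * c * `|p - x|.
exists U, (expR (b ^+ 2 / (c * k))), (c * k / 2).
split; [exact: U1|exact: expR_ge0|by rewrite divr_gt0// mulr_gt0|exact: HU|].
move=> w s u s1 wu Uu iw.
have u1 : 1 <= u by rewrite (le_trans U1).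
have u0 : 0 < u by rewrite (lt_le_trans ltr01).
have ns : `|s| = 1.
 by apply/eqP; rewrite -(@eqrXn2 _ 2)// real_normK ?num_real// s1 expr1n.
have nw : `|Re w - p| = u by rewrite wu normrM ns mul1r gtr0_norm.
have den : 1 <= nc ((p +i* eta) - w).
 by rewrite (le_trans _ (nc_Re _))// ReB ReK distrC nw.
have inv : nc (invp Xc w) <= 1.
 have wa a : a \in X -> 1 <= nc (w - a%:C).
  move=> aX; rewrite (le_trans _ (nc_Re _))// ReB ReC.
  have := HU a aX; have := ler_distD p (Re w) a; rewrite nw [`|p - a|]distrC.
  have := lerB_dist (Re w - p) (a - p); rewrite nw opprB addrA subrK.
  lra.
 rewrite /invp /Xc big_map; elim: X wa => [|a l ih] wa; first by rewrite big_nil nc1.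
 rewrite big_cons ncM ncV mulr_ile1 ?invr_ge0 ?nc_ge0//.
  by rewrite invf_le1 ?wa ?mem_head// (lt_le_trans ltr01)// wa ?mem_head.
 by apply: ih => d dl; apply: wa; rewrite inE dl orbT.
rewrite /f ncM ncM ncV nc_Cexp Re_gq.
have e0 := expR_ge0 (- c * ((Re w - x) ^+ 2 - Im w ^+ 2)).
have h1 : (nc ((p +i* eta) - w))^-1 <= 1 by rewrite invf_le1// (lt_le_trans ltr01).
rewrite (@le_trans _ _ (expR (- c * ((Re w - x) ^+ 2 - Im w ^+ 2))))//.
 rewrite -[leRHS]mulr1 ler_pM ?invr_ge0 ?nc_ge0 ?mulr_ge0 ?nc_ge0//.
 by rewrite ler_piMr.
rewrite -expRD ler_expR.
have im2 : Im w ^+ 2 <= (ay / ax) ^+ 2 * u ^+ 2.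
 rewrite -exprMn -(real_normK (num_real (Im w))) lerXn2r ?nnegrE//.
  by rewrite mulr_ge0 ?divr_ge0 ?ltW.
 by rewrite mulrAC ler_pdivlMr.
have re2 : u ^+ 2 - 2 * `|p - x| * u <= (Re w - x) ^+ 2.
 have -> : Re w - x = s * u + (p - x) by rewrite -wu; ring.
 have -> : (s * u + (p - x)) ^+ 2 = s ^+ 2 * u ^+ 2 + 2 * (s * (p - x)) * u + (p - x) ^+ 2 by ring.
 rewrite s1 mul1r.
 have := ler_norm (- (s * (p - x))); rewrite normrN normrM ns mul1r => h.
 have h2 : - (s * (p - x)) * u <= `|p - x| * u by rewrite ler_wpM2r// ltW.
 have := sqr_ge0 (p - x); lra.
have h := expR_le_cauchy (c * k) b 0 u (mulr_gt0 c0 k0) _.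
have b0 : 0 <= b by rewrite !mulr_ge0// ltW.
have {}h := h b0; rewrite (gtr0_norm u0) !add0r in h.
apply: le_trans h.
have h3 : c * (Re w - x) ^+ 2 >= c * (u ^+ 2 - 2 * `|p - x| * u) by rewrite ler_wpM2l// ltW.
have h4 : c * Im w ^+ 2 <= c * ((ay / ax) ^+ 2 * u ^+ 2) by rewrite ler_wpM2l// ltW.
by move: h3 h4; rewrite /k /b; lra.
Qed.

Lemma f_cts (e : C) t : e != 0 -> Re e != 0 -> Im e != 0 ->
 ccts (fun r => f (p%:C + r%:C * e)) t.
Proof.
move=> e0 re0 ie0.
have cl : ccts (fun r : R => p%:C + r%:C * e) t by exact: is_cderive_cts (is_cderive_lin p%:C e t).
have cv u : p%:C + t%:C * e != u -> ccts (fun r : R => (p%:C + r%:C * e - u)^-1) t.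
 move=> h; apply: cctsV; first by rewrite subr_eq0.
 by apply: cctsB => //; exact: ccts_cst.
apply: cctsM; last first.
 apply: cctsV; last by apply: cctsB => //; exact: ccts_cst.
 rewrite subr_eq0; apply/eqP => h.
 have := congr1 (@complex.Re R) h; have := congr1 (@complex.Im R) h; rewrite !ReImE add0r => h1 /eqP.
 rewrite addrC -subr_eq subrr eq_sym mulf_eq0 (negPf re0) orbF => /eqP t0.
 by move: h1; rewrite t0 mul0r; apply/eqP.
apply: cctsM; first by apply: ccts_Cexp; exact: ccts_horner.
have H l : p \notin l -> ccts (fun r : R => invp [seq a%:C | a <- l] (p%:C + r%:C * e)) t.
 elim: l => [|a l ih] pl.
  have -> : (fun r : R => invp [seq a%:C | a <- [::]] (p%:C + r%:C * e)) = (fun=> 1).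
   by apply/funext => r; rewrite /invp big_nil.
  exact: ccts_cst.
 move: pl; rewrite inE negb_or => /andP[pa /ih pl].
 have -> : (fun r : R => invp [seq a%:C | a <- a :: l] (p%:C + r%:C * e)) =
   (fun r : R => (p%:C + r%:C * e - a%:C)^-1 * invp [seq a%:C | a <- l] (p%:C + r%:C * e)).
  by apply/funext => r; rewrite /invp big_cons.
 apply: cctsM; last exact: pl.
apply: cv; apply/eqP => h.
 have := congr1 (@complex.Re R) h; have := congr1 (@complex.Im R) h; rewrite !ReImE add0r.
 move=> /eqP; rewrite mulf_eq0 (negPf ie0) orbF => /eqP t0; rewrite t0 mul0r addr0.
 exact/eqP.
exact: H.
Qed.

Lemma ray_integrable (s s' : R) : s ^+ 2 = 1 -> s' ^+ 2 = 1 ->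
 cintegrable pos_half (fun r => f (p%:C + r%:C * ((s * ax) +i* (s' * ay))) * ((s * ax) +i* (s' * ay))).
Proof.
move=> s1 s1'.
have ns (v : R) : v ^+ 2 = 1 -> v != 0 by move=> h; apply/eqP => v0; move: h => /eqP; rewrite v0 expr0n eq_sym oner_eq0.
have nn (v : R) : v ^+ 2 = 1 -> `|v| = 1.
 by move=> h; apply/eqP; rewrite -(@eqrXn2 _ 2)// real_normK ?num_real// h expr1n.
set e := (s * ax) +i* (s' * ay).
have sx := ns s s1; have sy := ns s' s1'.
have axn := lt0r_neq0 ax0; have ayn := lt0r_neq0 ay0.
have re0 : Re e != 0 by rewrite /e ReK mulf_neq0.
have ie0 : Im e != 0 by rewrite /e ImK mulf_neq0.
have e0 : e != 0 by apply: contra_neq re0 => ->.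
have [U [K [c' [U1 K0 c'0 _ h]]]] := rays_decay.
have U0 : 0 <= U by rewrite (le_trans ler01).
apply: (integrable_of_gauss_tail pos_half _ (U / ax) (K * nc e) (c' * ax ^+ 2)).
- exact: measurable_pos_half.
- by rewrite mulr_gt0// exprn_gt0.
- by rewrite divr_ge0// ltW.
- by rewrite mulr_ge0 ?nc_ge0.
- by move=> t; apply: cctsM; [exact: f_cts|exact: ccts_cst].
move=> t t0; rewrite /pos_half /= in t0; rewrite ger0_norm// => Ut.
rewrite ncM mulrAC ler_wpM2r ?nc_ge0// -mulrA -exprMn.
apply: (h _ s) => //.
- by rewrite !ReImE; ring.
- by rewrite mulrC -ler_pdivrMr.
- rewrite !ReImE add0r mul0r addr0 !normrM (nn s')// mul1r (gtr0_norm ay0) ger0_norm//.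
 by rewrite le_eqVlt; apply/orP; left; apply/eqP; ring.
Qed.

(** The far side has length of order m and lies in the sector of decay at distance of order m from
    p. *)
Lemma chord_small (s : R) : s ^+ 2 = 1 ->
 clo (fun m => pint (chord p%:C ((s * ax) +i* (- (s * ay))) ((s * ax) +i* (s * ay)) m%:R) f) (fun=> 0).
Proof.
move=> s1.
have ns : s != 0 by apply/eqP => v0; move: s1 => /eqP; rewrite v0 expr0n eq_sym oner_eq0.
have nn : `|s| = 1 by apply/eqP; rewrite -(@eqrXn2 _ 2)// real_normK ?num_real// s1 expr1n.
have [U [K [c' [U1 K0 c'0 HU h]]]] := rays_decay.
set e1 := (_ +i* _); set e2 := (_ +i* _).
have E m r : p%:C + m%:C * e1 + r%:C * (e2 - e1) = (p + s * (m * ax)) +i* (s * ay * (2 * r - m)).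
 by complex_ring.
apply: (clo_le _ _ (fun m => (2 * (K * nc (e2 - e1))) * (m%:R * expR (- (c' * ax ^+ 2 * m%:R ^+ 2))))); last first.
 by apply: gauss_seq0; [rewrite mulr_gt0// exprn_gt0|rewrite !mulr_ge0 ?nc_ge0].
near=> m; have mU : U / ax <= m%:R by near: m; exact: nbhs_infty_ger.
have mU' : U <= m%:R * ax by rewrite -ler_pdivrMr.
have m0 : 0 <= m%:R :> R by [].
rewrite subr0 /chord.
have := pint_lin_bound (p%:C + m%:R%:C * e1) (e2 - e1) 0 m%:R f (K * expR (- (c' * (m%:R * ax) ^+ 2))) m0.
move=> H; apply: le_trans (H _ _) _ => [t tm|t /andP[t0 tm]|].
- have cl : ccts (fun r : R => p%:C + m%:R%:C * e1 + r%:C * (e2 - e1)) t.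
  exact: is_cderive_cts (is_cderive_lin _ (e2 - e1) t).
 have nz u : `|Re u - p| + 1 <= U -> p%:C + m%:R%:C * e1 + t%:C * (e2 - e1) != u.
  move=> hu; apply/eqP => w; move: hu; rewrite -w E ReK addrAC subrr add0r.
  by rewrite normrM nn mul1r ger0_norm ?mulr_ge0 ?(ltW ax0)//; move: mU'; lra.
 apply: cctsM; last first.
  apply: cctsV; last by apply: cctsB => //; exact: ccts_cst.
  by rewrite subr_eq0 eq_sym nz// ReK subrr normr0 add0r.
 apply: cctsM; first by apply: ccts_Cexp; exact: ccts_horner.
 have H' l : {subset l <= X} -> ccts (fun r : R => invp [seq a%:C | a <- l] (p%:C + m%:R%:C * e1 + r%:C * (e2 - e1))) t.
  elim: l => [|a l ih] pl.
   have -> : (fun r : R => invp [seq a%:C | a <- [::]] (p%:C + m%:R%:C * e1 + r%:C * (e2 - e1))) = (fun=> 1).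
    by apply/funext => r; rewrite /invp big_nil.
   exact: ccts_cst.
  have -> : (fun r : R => invp [seq a%:C | a <- a :: l] (p%:C + m%:R%:C * e1 + r%:C * (e2 - e1))) =
    (fun r : R => (p%:C + m%:R%:C * e1 + r%:C * (e2 - e1) - a%:C)^-1 *
     invp [seq a%:C | a <- l] (p%:C + m%:R%:C * e1 + r%:C * (e2 - e1))).
   by apply/funext => r; rewrite /invp big_cons.
  apply: cctsM; last by apply: ih => b bl; apply: pl; rewrite inE bl orbT.
  apply: cctsV; last by apply: cctsB => //; exact: ccts_cst.
  by rewrite subr_eq0 nz// ReC; apply: HU; apply: pl; rewrite mem_head.
 exact: H'.
- apply: (h _ s) => //; rewrite E ?ReK ?ImK; first by ring.
 have -> : `|s * ay * (2 * t - m%:R)| * ax = ay * ax * `|2 * t - m%:R|.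
  by rewrite !normrM nn mul1r (gtr0_norm ay0); ring.
 have -> : ay * (m%:R * ax) = ay * ax * m%:R by ring.
 rewrite ler_wpM2l ?mulr_ge0 ?(ltW ay0) ?(ltW ax0)// ler_norml; apply/andP; split; lra.
- by rewrite subr0 exprMn; have -> : c' * (m%:R ^+ 2 * ax ^+ 2) = c' * ax ^+ 2 * m%:R ^+ 2; [ring|rewrite le_eqVlt; apply/orP; left; apply/eqP; ring].
Unshelve. all: end_near. Qed.

Lemma lam_limit : clo (fun m => cint (lam p ax ay m%:R) f) (fun=> rays4 p ax ay f).
Proof.
have sN : (-1 : R) ^+ 2 = 1 by rewrite sqrrN expr1n.
have sP : (1 : R) ^+ 2 = 1 by rewrite expr1n.
have l1 := ray_limit _ _ _ (ray_integrable 1 (-1) sP sN).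
have l2 := ray_limit _ _ _ (ray_integrable 1 1 sP sP).
have l3 := ray_limit _ _ _ (ray_integrable (-1) 1 sN sP).
have l4 := ray_limit _ _ _ (ray_integrable (-1) (-1) sN sN).
have k1 := chord_small 1 sP; have k2 := chord_small (-1) sN.
rewrite !mul1r !mulN1r ?opprK in l1 l2 l3 l4 k1 k2.
have E1 : - (ax +i* (- ay)) = (- ax) +i* ay by apply: complexP; rewrite !ReImE ?opprK.
have E2 : - (ax +i* ay) = (- ax) +i* (- ay) by apply: complexP; rewrite !ReImE.
rewrite /rays4 E1 E2.
have H := cloD _ _ _ _ (cloD _ _ _ _ (cloD _ _ _ _ l1 (cloN _ _ l2)) k1)
 (cloD _ _ _ _ (cloD _ _ _ _ l3 (cloN _ _ l4)) k2).
apply: eq_clo H; apply: nearW => m; last by ring.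
by rewrite /lam /tri E1 E2 /cint !big_cons big_nil /=; ring.
Qed.

End Decay.
End RayRepresentation.

(** * The double integral over the vertical line and the four rays *)

Section FiniteIdentity.
Context {R : realType}.
Local Notation C := R[i].
Local Notation mu := (@lebesgue_measure R).
Local Notation Cint := (Cintegral mu).
Lemma vline_integralE (x0 : R) (f : C -> C) : vline_integral x0 f = lineC x0%:C (0 +i* 1) f.
Proof.
rewrite /vline_integral /contour_integral /lineC; apply: eq_Cint => r _.
have E t : Defs.vline x0 t = x0%:C + t%:C * (0 +i* 1).
 by apply: complexP; rewrite /Defs.vline !ReImE; ring.
have -> : Defs.vline x0 = (fun t => x0%:C + t%:C * (0 +i* 1)) by apply/funext => t; exact: E.
by rewrite (is_cderive_path_deriveE _ _ _ (is_cderive_lin _ _ _)).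
Qed.

Section Identity.
Variables (n : nat) (X : n.-tuple R) (x0 : R) (gamma : R -> C) (s t x y p ax ay eps : R).
Hypotheses (n0 : (0 < n)%N) (adm : admissible X x0 gamma) (s0 : 0 < s) (t0 : 0 < t)
 (pX : p \notin (X : seq R)) (ay0 : 0 < ay) (ayx : ay < ax) (eps0 : 0 < eps).
Let Xc := [seq a%:C | a <- (X : seq R)] : seq C.
Let Qz := gq (n%:R / (2 * t)) y.
Let Qw := gq (- (n%:R / (2 * s))) x.
Let h z w := Cexp ((n%:R / (2 * t))%:C * ((z - y%:C) ^+ 2 + (2 * t)%:C * log_potential (empirical X) z)
     - (n%:R / (2 * s))%:C * ((w - x%:C) ^+ 2 + (2 * s)%:C * log_potential (empirical X) w)) / (z - w).

Lemma BM_integrandE z w : (forall a, a \in X -> z != a%:C) -> (forall a, a \in X -> w != a%:C) ->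
 h z w = Cexp Qz.[z] * \prod_(a <- Xc) (z - a) * (Cexp Qw.[w] * invp Xc w / (z - w)).
Proof.
move=> zX wX; have nR : n%:R != 0 :> R by rewrite pnatr_eq0 -lt0n.
have sn := lt0r_neq0 s0; have tn := lt0r_neq0 t0.
rewrite /h; set gz := log_potential _ z; set gw := log_potential _ w.
have -> : (n%:R / (2 * t))%:C * ((z - y%:C) ^+ 2 + (2 * t)%:C * gz)
     - (n%:R / (2 * s))%:C * ((w - x%:C) ^+ 2 + (2 * s)%:C * gw) =
  Qz.[z] + n%:R * gz + (Qw.[w] - n%:R * gw).
 have E (r : R) : r != 0 -> (n%:R / (2 * r))%:C * (2 * r)%:C = n%:R :> C.
  by move=> r0; rewrite -rmorphM -[RHS](rmorph_nat (real_complex R)); congr (_%:C); field.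
 by rewrite /Qz /Qw !gqE rmorphN mulNr !mulrDr !mulrA !E// opprD; ring.
rewrite !CexpD CexpN !Cexp_log_potential// /Xc /invp !big_map -prodfV; ring.
Qed.

(** One polynomial [N] describes the inner integral on the original line and, after replacement of
    the curve by the rays, on the line through p. The coefficients are integrals of exp(Qw) over
    products of w - X_j, equal for curve and triangles because all winding numbers are 1. *)
Lemma curve_integral_newton : exists2 N : {poly C},
 (forall r, r != 0 -> curve_integral gamma (h (x0 +i* r)) = Cexp Qz.[x0 +i* r] * N.[x0 +i* r])
 & forall eta, eta != 0 -> N.[p +i* eta] = \prod_(a <- Xc) ((p +i* eta) - a) *
   rays4 p ax ay (fun w => Cexp Qw.[w] * invp Xc w / ((p +i* eta) - w)).
Proof.
case: adm => clg gx gX gw; have [ch [chS chc chE]] := closed_curve_chain gamma clg.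
have ax0 : 0 < ax by exact: lt_trans ayx.
pose S w := (forall a, a \in Xc -> w != a).
have SX w : S w <-> forall a, a \in X -> w != a%:C.
 split => H a aX; first by apply: H; exact: map_f.
 by case/mapP: aX => b /H ? ->.
have gS : forall t, 0 <= t <= 1 -> S (gamma t) by move=> u u01; apply/SX => a aX; exact: gX.
have chSS := chS _ gS.
have Sl (l : seq C) : {subset l <= Xc} -> forall a w, a \in l -> S w -> w != a.
 by move=> lX a w al; apply; exact: lX.
have chw a : a \in Xc -> cint ch (fun w => (w - a)^-1) = (2 * pi)%:C * 'i%C.
 move=> aX; have [b bX ab] := mapP aX.
 have fa : fcts S (fun w => (w - a)^-1).
  apply: fctsV; first by move=> w /(_ a aX); rewrite subr_eq0.
  by apply: fctsB; [exact: fcts_id|exact: fcts_cst].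
 rewrite -(chE _ _ chSS fa).
 have := gw b bX; rewrite /winding_number -ab => /(congr1 (fun u => (2 * pi)%:C * 'i%C * u)).
 rewrite mulrA mulr1 divff ?mul1r//.
 apply/eqP => /(congr1 (@complex.Im R)); rewrite !ReImE /= => /eqP.
 by rewrite mulr1 mul0r addr0 mulf_eq0 (gt_eqF (pi_gt0 _)) pnatr_eq0.
exists (newton (fun l => cint ch (fun w => Cexp Qw.[w] * invp l w)) Xc).
- move=> r r0; set z := x0 +i* r.
 have zS : S z by apply/SX => a _; apply/eqP => /(congr1 (@complex.Im R)); rewrite ImK ImC; exact/eqP.
 (* The curve avoids the line Re = x0, so no point of the line is encircled in the way of the
    kernel: each w is strictly on one side of it. *)
 pose S' w := S w /\ Re w != x0.
 have gS' : forall t, 0 <= t <= 1 -> S' (gamma t) by move=> u u01; split; [exact: gS|exact: gx].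
 have chS' := chS _ gS'.
 have S'z w : S' w -> w != z by move=> [_ +]; apply: contra_neq => ->.
 have cz : fcts S' (fun w => (z - w)^-1).
  apply: fctsV; first by move=> w /S'z; rewrite subr_eq0 eq_sym.
  by apply: fctsB; [exact: fcts_cst|exact: fcts_id].
 have f1 : fcts S' (fun w => Cexp Qw.[w] * invp Xc w / (z - w)).
  apply: fctsM cz; apply: fctsM; first by apply: fcts_Cexp; exact: fcts_horner.
  by apply: fcts_invp => a w aX [+ _]; apply.
 have f2 : fcts S' (fun w => Cexp Qz.[z] * \prod_(a <- Xc) (z - a) * (Cexp Qw.[w] * invp Xc w / (z - w))).
  by apply: fctsM f1; exact: fcts_cst.
 transitivity (curve_integral gamma
   (fun w => Cexp Qz.[z] * \prod_(a <- Xc) (z - a) * (Cexp Qw.[w] * invp Xc w / (z - w)))).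
  rewrite /curve_integral /contour_integral; apply: eq_Cint => u u01.
  by rewrite BM_integrandE//; apply/SX => //; exact: gS.
 rewrite (chE _ _ chS' f2) (cintZ _ _ _ _ chS' f1) -mulrA; congr (_ * _).
 apply: (newton_horner S') => //.
 + by move=> a w aX [+ _]; apply.
 + by apply/negP => /zS; rewrite eqxx.
 + apply: (cint_half_plane_Cexp S' 1) => // w [_ wx]; rewrite mul1r ReB ReK subr_eq0//.
- move=> eta e0; set z := p +i* eta.
 have zS : S z by apply/SX => a _; apply/eqP => /(congr1 (@complex.Im R)); rewrite ImK ImC; exact/eqP.
 have [U U1 HU] := points_bound (X : seq R) p.
 have c0 : 0 < n%:R / (2 * s) by rewrite divr_gt0 ?ltr0n ?mulr_gt0.
 have L := lam_limit X p ax ay _ x eta ay0 ayx c0 e0 pX.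
 apply/esym/clo_cst.
 have L' := cloZ _ _ (\prod_(a <- Xc) (z - a)) L.
 refine (eq_clo _ _ _ _ _ _ (clo_sym _ _ L')); first by apply: nearW.
 (* For such m all X_j lie inside the triangles, and the value no longer depends on m. *)
 near=> m; have mU : U / ax < m%:R by near: m; exact: nbhs_infty_gtr.
 have {}mU : U < m%:R * ax by rewrite -ltr_pdivrMr.
 have m0 : 0 <= m%:R :> R by [].
 have aL a : a \in X -> `|a - p| < m%:R * ax.
  by move=> aX; apply: le_lt_trans mU; rewrite (le_trans _ (HU a aX))// lerDl.
 have ap a : a \in X -> a != p by move=> aX; apply: contraNneq pX => <-.
 have lS : forall s w, s ^+ 2 = 1 -> on_lam p ax ay s m%:R w -> S w.
  move=> s' w s1 ow; apply/SX => a aX.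
  exact: (lam_avoid p ax ay a s' m%:R w s1 (ap a aX) (aL a aX) ow).
 have lin1 := lam_in p ax ay ax0 ay0 S m%:R m0 lS.
 have lin2 := lam_in p ax ay ax0 ay0 (fun w => S w /\ w != z) m%:R m0
  (fun s' w s1 ow => conj (lS s' w s1 ow) (lam_line_avoid p ax ay ax0 eta s' m%:R w s1 e0 ow)).
 rewrite (newton_horner (fun w => S w /\ w != z) _ Xc Qw z lin2).
 + congr (_.[_]); apply: eq_newton => l' sl.
  have sub : {subset l' <= Xc} by exact: mem_subseq.
  apply: (cint_eq_winding S) => //.
  * exact: lam_closed.
  * exact: Sl.
  * move=> a /sub aX; rewrite (chw a aX); have [b bX ->] := mapP aX.
   by rewrite (lam_winding p ax ay ax0 ay0 b m%:R (ap b bX) (aL b bX)).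
 + by move=> a w aX [+ _]; apply.
 + by move=> w [].
 + by apply/negP => /zS; rewrite eqxx.
 + by exact: lam_line_Cexp.
Unshelve. all: end_near. Qed.

(** Both lines carry the entire function exp(Qz) N(z), so only this function is shifted; the poles
    and the curve have no part in the move. *)
Lemma finite_identity : vline_integral x0 (fun z => curve_integral gamma (h z)) =
 Cint setT (fun r => Cexp Qz.[p +i* (eps * r)] * (\prod_(a <- Xc) ((p +i* (eps * r)) - a) *
   rays4 p ax ay (fun w => Cexp Qw.[w] * invp Xc w / ((p +i* (eps * r)) - w))) * (0 +i* eps)).
Proof.
have [N N1 N2] := curve_integral_newton.
have c0 : 0 < n%:R / (2 * t) by rewrite divr_gt0 ?ltr0n ?mulr_gt0.
have E (a e r : R) : a%:C + r%:C * (0 +i* e) = a +i* (e * r).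
 by complex_ring.
have i1 := line_integrable _ y N c0 x0 1 ltr01.
have i2 := line_integrable _ y N c0 p eps eps0.
rewrite vline_integralE.
transitivity (lineC x0%:C (0 +i* 1) (fun z => Cexp Qz.[z] * N.[z])).
 rewrite /lineC; apply: Cint_eq_off0 => //; last first.
  exact: cintegrable_cmeas i1.
 by move=> r _ r0; rewrite !E mul1r N1.
rewrite (line_shift _ y N c0 x0 p eps eps0) /lineC.
apply/esym; apply: Cint_eq_off0 => //; last exact: cintegrable_cmeas i2.
by move=> r _ r0; rewrite !E N2// mulf_neq0// gt_eqF.
Qed.
End Identity.
End FiniteIdentity.

(** * Iterated integrals with a Cauchy kernel *)

Section IteratedIntegrals.
Context {R : realType}.
Local Notation C := R[i].
Local Notation mR := (measurableTypeR R).
Local Notation mu := (@lebesgue_measure R).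
Local Notation Cint := (Cintegral mu).

Section Real.
Variables (k : mR * mR -> R) (al be : R -> R).
Hypotheses (mk : measurable_fun setT k) (ia : mu.-integrable setT (EFin \o al))
 (ib : mu.-integrable setT (EFin \o be)) (kab : forall t r, `|k (t, r)| <= al t * be r).

Lemma scaled_integrable (c : R) (b : R -> R) : mu.-integrable setT (EFin \o b) ->
 mu.-integrable setT (EFin \o (fun r => c * b r)).
Proof. by move=> h; apply: eq_integrable (integrableZl measurableT c h) => // r _; rewrite /= EFinM. Qed.

Lemma section_measurable t : measurable_fun setT (fun r : mR => k (t, r)).
Proof. exact: (measurableT_comp mk (pair1_measurable t)). Qed.

Lemma section_integrable t : mu.-integrable setT (EFin \o (fun r => k (t, r))).
Proof.
apply: (le_integrable measurableT _ _ (scaled_integrable (al t) be ib)) => //=.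
- by apply/measurable_EFinP; exact: section_measurable.
- by move=> r _; rewrite lee_fin (le_trans (kab t r))// ler_norm.
Qed.

(** Tonelli's theorem with the product majorant [al t * be r]. All double integrals below have such
    a majorant, which is the purpose of splitting the Cauchy kernel. *)
Lemma product_integrable : (mu \x mu)%E.-integrable setT (EFin \o k).
Proof.
have mk' : measurable_fun setT (EFin \o k) by exact/measurable_EFinP.
apply/integrable12ltyP => //.
have i2 : mu.-integrable setT (EFin \o (fun t => (\int[mu]_r be r) * al t)).
 exact: scaled_integrable.
have h t : (\int[mu]_r `|(EFin \o k) (t, r)| <= ((\int[mu]_r be r) * al t)%:E)%E.
 have i1 := scaled_integrable (al t) be ib.
 rewrite mulrC -(RintegralZl (al t) measurableT ib) /Rintegral fineK; last exact: integrable_fin_num.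
 apply: ge0_le_integral => //=.
 - by apply/measurable_EFinP; apply: measurableT_comp => //; exact: section_measurable.
 - exact: measurable_int i1.
 - by move=> r _; rewrite lee_fin.
have h0 t : (0 <= \int[mu]_r `|(EFin \o k) (t, r)|)%E by exact: integral_ge0.
apply: (@le_lt_trans _ _ (\int[mu]_t ((\int[mu]_r be r) * al t)%:E)%E); last first.
 by have := integrable_fin_num measurableT i2; rewrite fin_numElt => /andP[].
apply: ge0_le_integral => //.
- apply: (measurable_fun_fubini_tonelli_F (m2 := mu) (abse \o (EFin \o k))) => [|u].
  exact: measurableT_comp.
 exact: abse_ge0.
- exact: measurable_int i2.
Qed.

Lemma iterated_integrable : mu.-integrable setT (EFin \o (fun t => \int[mu]_r k (t, r))).
Proof.
have := integrable_fubini_F product_integrable.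
apply: eq_integrable => // t _; rewrite /fubini_F /= /Rintegral fineK//.
exact: integrable_fin_num (section_integrable t).
Qed.

End Real.

Lemma swap_measurable (k : mR * mR -> R) : measurable_fun setT k ->
 measurable_fun setT (fun u : mR * mR => k (u.2, u.1)).
Proof.
by move=> mk; apply: (measurableT_comp mk); apply/measurable_fun_pairP; split;
 [exact: measurable_snd|exact: measurable_fst].
Qed.

Lemma real_fubini (k : mR * mR -> R) (al be : R -> R) : measurable_fun setT k ->
 mu.-integrable setT (EFin \o al) -> mu.-integrable setT (EFin \o be) ->
 (forall t r, `|k (t, r)| <= al t * be r) ->
 \int[mu]_t \int[mu]_r k (t, r) = \int[mu]_r \int[mu]_t k (t, r).
Proof.
move=> mk ia ib kab.
have kab' t r : `|k (r, t)| <= be t * al r by rewrite mulrC.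
have H := Fubini (product_integrable k al be mk ia ib kab).
rewrite /Rintegral; congr fine.
transitivity (\int[mu]_t \int[mu]_r (EFin \o k) (t, r))%E.
 apply: eq_integral => t _; rewrite fineK//.
 exact: (integrable_fin_num measurableT (section_integrable k al be mk ib kab t)).
rewrite H; apply: eq_integral => r _; rewrite fineK//.
apply: (integrable_fin_num measurableT).
exact: (section_integrable (fun u => k (u.2, u.1)) be al (swap_measurable k mk) ia (fun t r => kab' t r) r).
Qed.

Definition cmeas2 (k : R -> R -> C) : Prop :=
 measurable_fun setT (fun u : mR * mR => Re (k u.1 u.2)) /\
 measurable_fun setT (fun u : mR * mR => Im (k u.1 u.2)).

Lemma cmeas2_1 (a : R -> C) : cmeas setT a -> cmeas2 (fun t _ => a t).
Proof.
move=> [m1 m2]; split.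
 exact: (measurableT_comp m1 (@measurable_fst _ _ mR mR)).
exact: (measurableT_comp m2 (@measurable_fst _ _ mR mR)).
Qed.

Lemma cmeas2_swap k : cmeas2 k -> cmeas2 (fun t r => k r t).
Proof. by move=> [m1 m2]; split; [exact: swap_measurable m1|exact: swap_measurable m2]. Qed.

Lemma cmeas2_2 (a : R -> C) : cmeas setT a -> cmeas2 (fun _ t => a t).
Proof. by move=> h; exact: cmeas2_swap (cmeas2_1 a h). Qed.

Lemma cmeas2M k l : cmeas2 k -> cmeas2 l -> cmeas2 (fun t r => k t r * l t r).
Proof.
move=> [m1 m2] [m3 m4]; split.
 under eq_fun do rewrite ReM.
 by apply: measurable_funB; exact: measurable_funM.
under eq_fun do rewrite ImM.
by apply: measurable_funD; exact: measurable_funM.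
Qed.

Lemma cmeas2B k l : cmeas2 k -> cmeas2 l -> cmeas2 (fun t r => k t r - l t r).
Proof.
move=> [m1 m2] [m3 m4]; split.
 under eq_fun do rewrite ReB.
 exact: measurable_funB.
under eq_fun do rewrite ImB.
exact: measurable_funB.
Qed.

Lemma cmeas2V k : cmeas2 k -> cmeas2 (fun t r => (k t r)^-1).
Proof.
move=> [m1 m2].
have mi : measurable_fun setT (fun u : mR * mR => (Re (k u.1 u.2) ^+ 2 + Im (k u.1 u.2) ^+ 2)^-1).
 under eq_fun do rewrite -powR_inv1 ?addr_ge0 ?sqr_ge0//.
 apply: (measurableT_comp (measurable_powR (-1))).
 by apply: measurable_funD; apply: measurable_funX.
split.
 under eq_fun do rewrite ReV.
 exact: measurable_funM.
under eq_fun do rewrite ImV.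
by apply: measurableT_comp => //; exact: measurable_funM.
Qed.

Section Iterated.
Variables (k : R -> R -> C) (al be : R -> R).
Hypotheses (mk : cmeas2 k) (ia : mu.-integrable setT (EFin \o al))
 (ib : mu.-integrable setT (EFin \o be)) (kab : forall t r, nc (k t r) <= al t * be r).
Let kR t r : `|Re (k t r)| <= al t * be r. Proof. exact: le_trans (nc_Re _) (kab t r). Qed.
Let kI t r : `|Im (k t r)| <= al t * be r. Proof. exact: le_trans (nc_Im _) (kab t r). Qed.

Lemma inner_cintegrable t : cintegrable setT (k t).
Proof.
split.
 exact: (section_integrable (fun u => Re (k u.1 u.2)) al be mk.1 ib kR t).
exact: (section_integrable (fun u => Im (k u.1 u.2)) al be mk.2 ib kI t).
Qed.

Lemma iterated_cintegrable : cintegrable setT (fun t => Cint setT (k t)).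
Proof.
split.
 exact: (iterated_integrable (fun u => Re (k u.1 u.2)) al be mk.1 ia ib kR).
exact: (iterated_integrable (fun u => Im (k u.1 u.2)) al be mk.2 ia ib kI).
Qed.

Lemma iterated_bound : nc (Cint setT (fun t => Cint setT (k t))) <=
 4 * (\int[mu]_t al t * \int[mu]_r be r).
Proof.
have i1 := scaled_integrable (2 * \int[mu]_r be r) al ia.
have -> : 4 * (\int[mu]_t al t * \int[mu]_r be r) = 2 * \int[mu]_t ((2 * \int[mu]_r be r) * al t).
 by rewrite (RintegralZl _ measurableT ia); ring.
apply: (nc_Cint_le _ _ _ measurableT iterated_cintegrable i1) => t _.
rewrite -mulrA [X in 2 * X]mulrC -(RintegralZl _ measurableT ib).
by apply: (nc_Cint_le _ _ _ measurableT (inner_cintegrable t) (scaled_integrable (al t) be ib)).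
Qed.

Lemma Cint_fubini : Cint setT (fun t => Cint setT (k t)) = Cint setT (fun r => Cint setT (k^~ r)).
Proof.
apply: complexP.
 exact: (real_fubini (fun u => Re (k u.1 u.2)) al be mk.1 ia ib kR).
exact: (real_fubini (fun u => Im (k u.1 u.2)) al be mk.2 ia ib kI).
Qed.

End Iterated.
End IteratedIntegrals.

(** * Domination on the contours and the limit of the double integral *)

Section Domination.
Context {R : realType}.
Local Notation C := R[i].
(** The derivative has the sign of x, so 0 is a minimum; the mean value theorem is used on each
    side. *)
Lemma ge0_of_derive (f df : R -> R) : (forall x : R, is_derive x 1 f (df x)) ->
 (forall x, 0 <= df x * x) -> f 0 = 0 -> forall x, 0 <= f x.
Proof.
move=> fd dfx f0 x; have cf (A : set R) : {within A, continuous f}.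
 apply: continuous_subspaceT => y; apply: differentiable_continuous; apply/derivable1_diffP.
 by have [] := fd y.
have [x0|x0|->] := ltgtP x 0; last by rewrite f0.
- have [c] := MVT x0 (fun y _ => fd y) (cf _).
 rewrite in_itv /= => /andP[xc c0]; rewrite f0 !sub0r => /eqP.
 rewrite mulrN eqr_opp => /eqP ->; have := dfx c; move: (df c) => d dc; nra.
- have [c] := MVT x0 (fun y _ => fd y) (cf _).
 rewrite in_itv /= => /andP[c0 cx]; rewrite f0 !subr0 => ->.
 have := dfx c; rewrite pmulr_lge0// => h; exact: mulr_ge0 (ltW x0).
Qed.

Lemma is_derive_ln (g : R -> R) (y l : R) : 0 < g y -> is_derive y 1 g l ->
 is_derive y 1 (fun x => ln (g x)) ((g y)^-1 * l).
Proof.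
move=> g0 dg; have := @is_derive1_comp _ (@ln R) g y _ _ (is_derive1_ln g0) dg.
by rewrite /GRing.scale /= mulrC.
Qed.

Lemma is_derive_inv (g : R -> R) (y l : R) : g y != 0 -> is_derive y 1 g l ->
 is_derive y 1 (fun x => (g x)^-1) (- (g y ^+ 2)^-1 * l).
Proof.
move=> g0 dg; have := @is_deriveV _ g y l 1 g0 dg.
by [].
Qed.

(** The difference of the two sides has derivative x^5/(1 + x^2)^2. The left-hand side is the
    logarithm of |1 + ix|^2. *)
Lemma ln1sqr_le (x : R) : ln (1 + x ^+ 2) <= x ^+ 2 - x ^+ 4 / (2 * (1 + x ^+ 2)).
Proof.
pose f (x : R) := x ^+ 2 - x ^+ 4 * (2 * (1 + x ^+ 2))^-1 - ln (1 + x ^+ 2).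
pose df (x : R) := x ^+ 5 / (1 + x ^+ 2) ^+ 2.
have q (y : R) : 0 < 1 + y ^+ 2 by rewrite ltr_wpDr ?sqr_ge0.
suff : 0 <= f x by rewrite /f; lra.
apply: (ge0_of_derive f df) => [y|y|].
- have q1 : is_derive y 1 (fun x : R => 1 + x ^+ 2) (2 * y).
  by apply: is_derive_eq; rewrite /GRing.scale /=; ring.
 have q2 : is_derive y 1 (fun x : R => 2 * (1 + x ^+ 2)) (2 * (2 * y)).
  by apply: is_derive_eq; rewrite /GRing.scale /=; ring.
 have d1 : is_derive y 1 (fun x : R => ln (1 + x ^+ 2)) (2 * y * (1 + y ^+ 2)^-1).
  by rewrite mulrC; exact: (is_derive_ln (fun x : R => 1 + x ^+ 2)).
 have q0 : 2 * (1 + y ^+ 2) != 0 :> R by rewrite mulf_neq0// gt_eqF.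
 have d2 := is_derive_inv (fun x : R => 2 * (1 + x ^+ 2)) y _ q0 q2.
 rewrite /f; apply: is_derive_eq.
 rewrite /GRing.scale /= /df; field; exact: lt0r_neq0 (q y).
- rewrite /df mulrAC divr_ge0 ?sqr_ge0// -exprSr.
 by rewrite (exprM y 2 3) exprn_ge0 ?sqr_ge0.
- by rewrite /f !expr0n /= mul0r addr0 ln1 !subr0.
Qed.

(** With k = 2 cos(pi/6) up to sign, the logarithm is that of |1 + x exp(i theta)|^2 on one of the
    rays, and k^2 = 3 is what cancels the cubic term. The derivative has the sign of x because 1 +
    kx + x^2 is at most 2(1 + x^2). *)
Lemma ln_quadratic_ge (k x : R) : k ^+ 2 = 3 ->
 x ^+ 4 / (8 * (1 + x ^+ 2)) <= ln (1 + k * x + x ^+ 2) - k * x + x ^+ 2 / 2.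
Proof.
move=> k3.
pose Q (x : R) := 1 + k * x + x ^+ 2.
pose f (x : R) := ln (Q x) - k * x + x ^+ 2 / 2 - x ^+ 4 * (8 * (1 + x ^+ 2))^-1.
pose df (x : R) := x ^+ 3 / Q x - x ^+ 3 * (2 + x ^+ 2) / (4 * (1 + x ^+ 2) ^+ 2).
have q (y : R) : 0 < 1 + y ^+ 2 by rewrite ltr_wpDr ?sqr_ge0.
have Q0 (y : R) : 0 < Q y.
 by rewrite /Q; have := sqr_ge0 (y + k / 2); rewrite sqrrD !expr2 in k3 *; nra.
suff : 0 <= f x by rewrite /f /Q; lra.
apply: (ge0_of_derive f df) => [y|y|].
- have q1 : is_derive y 1 (fun x : R => 8 * (1 + x ^+ 2)) (8 * (2 * y)).
  by apply: is_derive_eq; rewrite /GRing.scale /=; ring.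
 have q2 : is_derive y 1 Q (k + 2 * y).
  by rewrite /Q; apply: is_derive_eq; rewrite /GRing.scale /=; ring.
 have q0 : 8 * (1 + y ^+ 2) != 0 :> R by rewrite mulf_neq0// gt_eqF.
 have d2 := is_derive_inv (fun x : R => 8 * (1 + x ^+ 2)) y _ q0 q1.
 have d3 : is_derive y 1 (fun x => ln (Q x)) ((Q y)^-1 * (k + 2 * y)) by exact: is_derive_ln.
 rewrite /f; apply: is_derive_eq.
 rewrite /GRing.scale /= /df; have := lt0r_neq0 (Q0 y); rewrite /Q => Qn.
 have -> : y ^+ 3 / (1 + k * y + y ^+ 2) = (k + 2 * y) / (1 + k * y + y ^+ 2) - k + y.
  by apply: (mulIf Qn); rewrite !mulrDl !divfK// mulNr; ring: k3.
 field; rewrite ?Qn (lt0r_neq0 (q y)) //.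
- have -> : df y * y = y ^+ 4 * ((Q y)^-1 - (2 + y ^+ 2) / (4 * (1 + y ^+ 2) ^+ 2)).
  by rewrite /df; ring.
 apply: mulr_ge0; first by rewrite (exprM y 2 2) sqr_ge0.
 rewrite subr_ge0 ler_pdivrMr ?mulr_gt0 ?exprn_gt0// mulrC ler_pdivlMr//.
 have h : Q y <= 2 * (1 + y ^+ 2).
  by rewrite /Q; have := sqr_ge0 (k - 2 * y); rewrite sqrrB !expr2 in k3 *; nra.
 apply: le_trans (ler_wpM2l _ h) _; first by rewrite addr_ge0 ?sqr_ge0.
 have := sqr_ge0 y; move: (y ^+ 2) => z z0; rewrite expr2; nra.
- by rewrite /f /Q !expr0n /= mulr0 !mul0r !addr0 ln1 !subr0.
Qed.

(** The factor 1 + u divided by the exponential of its logarithm expanded to fourth order. *)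
Definition f5 (u : C) : C := (1 + u) * Cexp (- u + u ^+ 2 / 2 - u ^+ 3 / 3 + u ^+ 4 / 4).

(** The derivative of [f5] at v is v^4 times the exponential factor, all lower terms cancelling,
    which yields order 5. For |u| at most 1 the exponent is bounded by 4. *)
Lemma nc_f5_sub1 (u : C) : nc u <= 1 -> nc (f5 u - 1) <= 2 * (nc u ^+ 5 * expR 4).
Proof.
move=> u1; pose q (v : C) : C := - v + v ^+ 2 / 2 - v ^+ 3 / 3 + v ^+ 4 / 4.
pose h' (t : R) : C := (t%:C * u) ^+ 4 * Cexp (q (t%:C * u)) * u.
have := nc_increment (fun t => f5 (t%:C * u)) h' (nc u ^+ 5 * expR 4).
have -> : f5 ((0:R)%:C * u) = 1 by rewrite rmorph0 /f5 !mul0r addr0 !expr0n /= !mul0r oppr0 !addr0 mul1r Cexp0.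
rewrite rmorph1 mul1r; apply => t t01.
- have dl : is_cderive (fun t : R => t%:C * u) t u := is_cderive_line u t.
 have d k n := is_cderiveM _ _ _ _ _ (is_cderive_cst k t) (is_cderiveX _ _ _ n dl).
 have d1 := is_cderiveM _ _ _ _ _ (is_cderive_cst (-1) t) dl.
 have dq := is_cderiveD _ _ _ _ _ (is_cderiveD _ _ _ _ _ (is_cderiveD _ _ _ _ _ d1 (d 2^-1 1)) (d (- 3^-1) 2)) (d 4^-1 3).
 have df := is_cderiveM _ _ _ _ _ (is_cderiveD _ _ _ _ _ (is_cderive_cst 1 t) dl) (is_cderive_Cexp _ _ _ dq).
 apply: is_cderive_ext df => [r|].
  by rewrite /f5; congr (_ * Cexp _); ring.
 have -> : -1 * (t%:C * u) + 2^-1 * (t%:C * u) ^+ 2 + - 3^-1 * (t%:C * u) ^+ 3 +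
   4^-1 * (t%:C * u) ^+ 4 = q (t%:C * u) by rewrite /q; ring.
 by rewrite /h'; field.
- have cl : ccts (fun t : R => t%:C * u) t := is_cderive_cts _ _ _ (is_cderive_line u t).
 apply: cctsM; last exact: ccts_cst.
 apply: cctsM; first exact: cctsX.
 apply: ccts_Cexp; rewrite /q.
 have d k n := cctsM _ _ _ (cctsX _ _ n cl) (ccts_cst k t).
 exact: cctsD (cctsB _ _ _ (cctsD _ _ _ (cctsN _ _ cl) (d 2^-1 2)) (d 3^-1 3)) (d 4^-1 4).
- have [t0 t1] := andP t01; have n0 := nc_ge0 u.
 have nt : nc (t%:C * u) <= nc u by rewrite ncM ncC ger0_norm// ler_piMl.
 have nv m : nc ((t%:C * u) ^+ m) <= 1.
  by rewrite ncX exprn_ile1 ?nc_ge0// (le_trans nt).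
 rewrite /h' 2!ncM nc_Cexp mulrAC; apply: ler_pM; rewrite ?mulr_ge0 ?nc_ge0 ?expR_ge0//.
  by rewrite ncX [leRHS]exprSr ler_wpM2r// lerXn2r ?nnegrE ?nc_ge0.
 rewrite ler_expR (le_trans (ler_norm _))// (le_trans (nc_Re _))// /q.
 have h m (k : nat) : (0 < k)%N -> nc ((t%:C * u) ^+ m / k%:R) <= 1.
  move=> k0; rewrite ncM ncV nc_nat mulr_ile1 ?nc_ge0 ?invr_ge0//.
  by rewrite invf_le1 ?ltr0n// ler1n.
 rewrite (le_trans (ncD _ _))// (le_trans (lerD (ncB _ _) (lexx _)))//.
 rewrite (le_trans (lerD (lerD (ncD _ _) (lexx _)) (lexx _)))// ncN.
 have := nv 1; rewrite expr1; have := h 2 2 erefl; have := h 3 3 erefl; have := h 4 4 erefl; lra.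
Qed.

(** One pole factor with the first two terms of its logarithm removed; the removed terms are
    collected in the coefficients [g] and [b] of [Afun]. *)
Definition efac (e : R) (u : C) : C := (1 + e%:C * u) * Cexp (- (e%:C * u) + (e%:C * u) ^+ 2 / 2).
Definition Afun (g b : R) (l : seq R) (u : C) : C :=
 Cexp (- (g%:C * u) + b%:C * u ^+ 2) * \prod_(e <- l) efac e u.
Definition Bfun (g b a3 a4 : R) (u : C) : C :=
 Cexp (- (g%:C * u) + b%:C * u ^+ 2 + a3%:C * u ^+ 3 - a4%:C * u ^+ 4).
Definition psum3 (l : seq R) : R := (\sum_(e <- l) e ^+ 3) / 3.
Definition psum4 (l : seq R) : R := (\sum_(e <- l) e ^+ 4) / 4.

Lemma psum4_ge0 l : 0 <= psum4 l.
Proof. by rewrite divr_ge0// sumr_ge0// => e _; rewrite (exprM e 2 2) sqr_ge0. Qed.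

(** The third and fourth terms of the logarithms add up to power sums of the poles, and what is left
    of each factor is 1 + O(e^5). *)
Lemma AfunE g b l u : Afun g b l u = Bfun g b (psum3 l) (psum4 l) u * \prod_(e <- l) f5 (e%:C * u).
Proof.
elim: l => [|e l ih].
 by rewrite /Afun /Bfun /psum3 /psum4 !big_nil !mul0r !addr0 subr0.
have -> : Afun g b (e :: l) u = Afun g b l u * efac e u by rewrite /Afun big_cons; ring.
have -> : Bfun g b (psum3 (e :: l)) (psum4 (e :: l)) u =
  Bfun g b (psum3 l) (psum4 l) u * Cexp ((e%:C * u) ^+ 3 / 3 - (e%:C * u) ^+ 4 / 4).
 rewrite /Bfun -CexpD; congr Cexp; rewrite /psum3 /psum4 !big_cons !mulrDl.
 have CD (x y : R) : (x + y)%:C = x%:C + y%:C by rewrite rmorphD.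
 rewrite !CD.
 have -> : (e ^+ 3 / 3)%:C = e%:C ^+ 3 / 3 by rewrite rmorphM rmorphXn fmorphV rmorph_nat.
 have -> : (e ^+ 4 / 4)%:C = e%:C ^+ 4 / 4 by rewrite rmorphM rmorphXn fmorphV rmorph_nat.
 by ring.
have -> : efac e u = Cexp ((e%:C * u) ^+ 3 / 3 - (e%:C * u) ^+ 4 / 4) * f5 (e%:C * u).
 by rewrite /efac /f5 mulrCA -CexpD; congr (_ * Cexp _); ring.
by rewrite ih big_cons; ring.
Qed.

Lemma nc_le_sqr (z : C) (b : R) : 0 <= b -> nc z ^+ 2 <= b ^+ 2 -> nc z <= b.
Proof. by move=> b0; rewrite ler_pXn2r// nnegrE nc_ge0. Qed.

Lemma nc_efac_im (e eta : R) :
 nc (efac e (0 +i* eta)) <= expR (- ((e * eta) ^+ 4 / (4 * (1 + (e * eta) ^+ 2)))).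
Proof.
rewrite /efac; have -> : e%:C * (0 +i* eta) = 0 +i* (e * eta) by complex_ring.
move: (e * eta) => x; apply: nc_le_sqr; first exact: expR_ge0.
have q : 0 < 1 + x ^+ 2 by rewrite ltr_wpDr ?sqr_ge0.
have -> : - (0 +i* x) + (0 +i* x) ^+ 2 / 2 = (- (x ^+ 2 / 2)) +i* (- x).
 by apply: complexP; rewrite ?expr2 -[2]/(2%:R) natC -fmorphV !ReImE; field.
rewrite ncM exprMn nc_sq nc_Cexp !ReImE -!expRM_natl.
have -> : (1 + 0) ^+ 2 + (0 + x) ^+ 2 = expR (ln (1 + x ^+ 2)).
 by rewrite lnK ?posrE//; ring.
rewrite -expRD ler_expR; have := ln1sqr_le x.
have -> : 2%:R * - (x ^+ 4 / (4 * (1 + x ^+ 2))) = - (x ^+ 4 / (2 * (1 + x ^+ 2))) by field; rewrite lt0r_neq0.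
lra.
Qed.

(** The inverse is bounded because the w-integrand has the poles in its denominator. The square c^2
    = 3/4 makes both c = sqrt(3)/2 and its negative admissible, for either sign of e. *)
Lemma nc_efac_ray (e r c d : R) : c ^+ 2 = 3 / 4 -> d ^+ 2 = 1 / 4 ->
 nc (efac e (r%:C * (c +i* d)))^-1 <= expR (- ((e * r) ^+ 4 / (16 * (1 + (e * r) ^+ 2)))).
Proof.
move=> c2 d2; rewrite /efac mulrA -rmorphM.
move: (e * r) => x; have q : 0 < 1 + x ^+ 2 by rewrite ltr_wpDr ?sqr_ge0.
rewrite ncV invf_ple ?posrE ?expR_gt0//; last first.
 rewrite nc_gt0// mulf_neq0 ?Cexp_neq0//; apply/eqP => h.
 have := congr1 (@complex.Im R) h; have := congr1 (@complex.Re R) h; rewrite !ReImE => h1 h2.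
 have : x * d = 0 by lra.
 move/eqP; rewrite mulf_eq0 => /orP[|] /eqP E; first by move: h1; rewrite E; lra.
 by move: d2; rewrite E expr0n /=; lra.
rewrite -expRN opprK -(@ler_pXn2r _ 2)// ?nnegrE ?expR_ge0 ?nc_ge0//.
have -> : - (x%:C * (c +i* d)) + (x%:C * (c +i* d)) ^+ 2 / 2 = (- (x * c) + x ^+ 2 / 4) +i* (- (x * d) + x ^+ 2 * (c * d)).
 apply: complexP; rewrite ?expr2 -[2]/(2%:R) natC -fmorphV !ReImE; last by field.
 rewrite !expr2 in c2 d2 *.
 have -> : x * x / 4 = x * x * (c * c - d * d) / 2 by rewrite c2 d2; field.
 by field.
rewrite ncM exprMn nc_sq nc_Cexp !ReImE -!expRM_natl.
have k3 : (2 * c) ^+ 2 = 3 by rewrite exprMn c2; field.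
have Q0 : 0 < 1 + 2 * c * x + x ^+ 2.
 have := sqr_ge0 (x + c); rewrite sqrrD c2; lra.
have -> : (1 + (x * c - 0 * d)) ^+ 2 + (0 + (x * d + 0 * c)) ^+ 2 = expR (ln (1 + 2 * c * x + x ^+ 2)).
 rewrite lnK ?posrE//.
 have -> : x ^+ 2 = x ^+ 2 * (c ^+ 2 + d ^+ 2) by rewrite c2 d2; field.
 by ring.
rewrite -expRD ler_expR; have := ln_quadratic_ge (2 * c) x k3.
have -> : 2%:R * (x ^+ 4 / (16 * (1 + x ^+ 2))) = x ^+ 4 / (8 * (1 + x ^+ 2)) by field; rewrite lt0r_neq0.
lra.
Qed.

Section Factors.
Variables (l : seq R) (del : R).
Hypothesis ldel : forall e, e \in l -> `|e| <= del.

(** Replacing each denominator by the one of the largest pole lets the exponents add up to the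
    fourth power sum. *)
Lemma prod_decay (f : R -> C) (r K : R) : 0 < K -> (forall e, e \in l ->
  nc (f e) <= expR (- ((e * r) ^+ 4 / (K * (1 + (e * r) ^+ 2))))) ->
 nc (\prod_(e <- l) f e) <= expR (- (4 / K * psum4 l * r ^+ 4 / (1 + (del * r) ^+ 2))).
Proof.
move=> K0 h; rewrite nc_prod.
have -> : - (4 / K * psum4 l * r ^+ 4 / (1 + (del * r) ^+ 2)) =
  \sum_(e <- l) - ((e * r) ^+ 4 / (K * (1 + (del * r) ^+ 2))).
 rewrite sumrN /psum4; congr (- _); rewrite -mulr_suml.
 have -> : \sum_(e <- l) (e * r) ^+ 4 = (\sum_(e <- l) e ^+ 4) * r ^+ 4.
  by rewrite mulr_suml; apply: eq_bigr => e _; rewrite exprMn.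
 by field; rewrite !lt0r_neq0// ltr_wpDr ?sqr_ge0.
rewrite expR_sum !big_seq; apply: ler_prod => e el; rewrite nc_ge0/= (le_trans (h e el))//.
have q (y : R) : 0 < 1 + y ^+ 2 by rewrite ltr_wpDr ?sqr_ge0.
rewrite ler_expR lerN2 ler_wpM2l//; first by rewrite (exprM _ 2 2) sqr_ge0.
rewrite lef_pV2 ?posrE ?mulr_gt0// ler_wpM2l ?(ltW K0)// lerD2l !exprMn ler_wpM2r ?sqr_ge0//.
by rewrite -[e ^+ 2]real_normK ?num_real// lerXn2r ?nnegrE// ?ldel// (le_trans (normr_ge0 e))// ldel.
Qed.

Lemma nc_Afun_im g b eta :
 nc (Afun g b l (0 +i* eta)) <= expR (- (b * eta ^+ 2 + psum4 l * eta ^+ 4 / (1 + (del * eta) ^+ 2))).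
Proof.
rewrite /Afun ncM nc_Cexp [in leRHS]opprD [in leRHS]expRD; apply: ler_pM; rewrite ?expR_ge0 ?nc_ge0//.
 by rewrite ler_expR expr2 !ReImE; lra.
have := prod_decay (fun e => efac e (0 +i* eta)) eta 4 _ (fun e _ => nc_efac_im e eta).
by rewrite divff ?mul1r//; exact.
Qed.

Lemma nc_Afun_ray g b r c d : c ^+ 2 = 3 / 4 -> d ^+ 2 = 1 / 4 -> 0 <= r ->
 nc (Afun g b l (r%:C * (c +i* d)))^-1 <=
 expR (`|g| * r - (b * r ^+ 2 / 2 + psum4 l * r ^+ 4 / (4 * (1 + (del * r) ^+ 2)))).
Proof.
move=> c2 d2 r0; rewrite /Afun invfM ncM [in leRHS]opprD [in leRHS]addrA [in leRHS]expRD; apply: ler_pM; rewrite ?expR_ge0 ?nc_ge0//.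
 rewrite -CexpN nc_Cexp ler_expR.
 have -> : Re (- (- (g%:C * (r%:C * (c +i* d))) + b%:C * (r%:C * (c +i* d)) ^+ 2)) =
  g * (r * c) - b * r ^+ 2 * (c ^+ 2 - d ^+ 2) by rewrite !expr2 !ReImE; ring.
 have -> : b * r ^+ 2 * (c ^+ 2 - d ^+ 2) = b * r ^+ 2 / 2 by rewrite c2 d2; field.
 rewrite lerD2r (le_trans (ler_norm _))// normrM ler_wpM2l// normrM ger0_norm// ler_piMr//.
 by rewrite -(@ler_pXn2r _ 2)// ?nnegrE// real_normK ?num_real// c2 expr1n; lra.
rewrite -prodfV.
have := prod_decay (fun e => (efac e (r%:C * (c +i* d)))^-1) r 16 _ (fun e _ => nc_efac_ray e r c d c2 d2).
move=> H; apply: le_trans (H _) _ => //; rewrite ler_expR le_eqVlt; apply/orP; left; apply/eqP; field.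
by rewrite lt0r_neq0// ltr_wpDr ?sqr_ge0.
Qed.

End Factors.

Lemma nc_prod_sub1 (I : eqType) (r : seq I) (f : I -> C) :
 nc (\prod_(i <- r) f i - 1) <= expR (\sum_(i <- r) nc (f i - 1)) - 1.
Proof.
elim: r => [|i r ih]; first by rewrite !big_nil subrr nc0 expR0 subrr.
rewrite !big_cons expRD; set p := \prod_(_ <- _) _ in ih *; set s := \sum_(_ <- _) _ in ih *.
have -> : f i * p - 1 = f i * (p - 1) + (f i - 1) by ring.
rewrite (le_trans (ncD _ _))// ncM.
have h1 : nc (f i) <= 1 + nc (f i - 1) by rewrite -{1}[f i](subrK 1) addrC (le_trans (ncD _ _))// nc1.
have h2 := expR_ge1Dx (nc (f i - 1)).
have p0 := nc_ge0 (p - 1); have f0 := nc_ge0 (f i - 1).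
apply: (@le_trans _ _ (expR (nc (f i - 1)) * (expR s - 1) + (expR (nc (f i - 1)) - 1))); last by lra.
apply: lerD; last by lra.
apply: ler_pM => //; first exact: nc_ge0.
exact: le_trans h2.
Qed.

(** The fifth powers sum to at most [del] times the sum of fourth powers, so the remainder vanishes
    as long as [psum4] stays bounded and [del] tends to 0. *)
Lemma nc_prod_f5 l del u : (forall e, e \in l -> `|e| <= del) -> del * nc u <= 1 ->
 nc (\prod_(e <- l) f5 (e%:C * u) - 1) <= expR (8 * expR 4 * nc u ^+ 5 * (del * psum4 l)) - 1.
Proof.
move=> ld u1; rewrite (le_trans (nc_prod_sub1 _ _ _))// lerB// ler_expR.
have -> : 8 * expR 4 * nc u ^+ 5 * (del * psum4 l) = \sum_(e <- l) 2 * (del * e ^+ 4 * nc u ^+ 5 * expR 4).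
 rewrite (eq_bigr (fun e => (2 * del * nc u ^+ 5 * expR 4) * e ^+ 4)); last by move=> e _; ring.
 by rewrite /psum4 -mulr_sumr; field.
rewrite !big_seq; apply: ler_sum => e el.
have n0 := nc_ge0 u; have eu : nc (e%:C * u) = `|e| * nc u by rewrite ncM ncC.
have := nc_f5_sub1 (e%:C * u); rewrite eu => h.
apply: le_trans (h _) _; first by rewrite (le_trans _ u1)// ler_wpM2r// ld.
rewrite ler_wpM2l// ler_wpM2r ?expR_ge0// exprMn ler_wpM2r ?exprn_ge0//.
rewrite exprS (exprM `|e| 2 2) real_normK ?num_real// -exprM ler_wpM2r ?ld//.
by rewrite (exprM e 2 2) sqr_ge0.
Qed.

End Domination.

(** * Double integrals with a kernel dominated by a product of weights *)

Section WeightedKernels.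
Context {R : realType}.
Local Notation C := R[i].
Local Notation mR := (measurableTypeR R).
Local Notation mu := (@lebesgue_measure R).
Local Notation Cint := (Cintegral mu).
Lemma cmeasM (D : set mR) (g h : R -> C) : cmeas D g -> cmeas D h -> cmeas D (fun t => g t * h t).
Proof.
move=> [m1 m2] [m3 m4]; split.
 have -> : Re \o (fun t => g t * h t) = (fun t => Re (g t) * Re (h t) - Im (g t) * Im (h t)).
  by apply/funext => t; rewrite /= ReM.
 by apply: measurable_funB; exact: measurable_funM.
have -> : Im \o (fun t => g t * h t) = (fun t => Re (g t) * Im (h t) + Im (g t) * Re (h t)).
 by apply/funext => t; rewrite /= ImM.
by apply: measurable_funD; exact: measurable_funM.
Qed.

Lemma cmeasB (D : set mR) (g h : R -> C) : cmeas D g -> cmeas D h -> cmeas D (fun t => g t - h t).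
Proof.
move=> [m1 m2] [m3 m4]; split.
 have -> : Re \o (fun t => g t - h t) = (fun t => Re (g t) - Re (h t)).
  by apply/funext => t; rewrite /= ReB.
 exact: measurable_funB.
have -> : Im \o (fun t => g t - h t) = (fun t => Im (g t) - Im (h t)).
 by apply/funext => t; rewrite /= ImB.
exact: measurable_funB.
Qed.

Lemma measurable_nc (D : set mR) (g : R -> C) : cmeas D g -> measurable_fun D (fun t => nc (g t)).
Proof.
move=> [m1 m2].
have -> : (fun t => nc (g t)) = (fun t => (Re (g t) ^+ 2 + Im (g t) ^+ 2) `^ (2^-1)).
 by apply/funext => t; rewrite powR12_sqrt ?ncE// addr_ge0 ?sqr_ge0.
apply: (measurableT_comp (measurable_powR (2^-1))).
by apply: measurable_funD; apply: measurable_funX.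
Qed.

(** The bound is required on the contour [A] only: off it, the functions on the right-hand rays need
    not decay. *)
Definition gdom (A : R -> bool) (K : R) (a : R -> C) : Prop :=
 cmeas setT a /\ (0 <= K /\ forall t, A t -> nc (a t) <= K * gauss_fun t).

Definition weight (w : R -> R) : Prop :=
 [/\ measurable_fun setT (w : mR -> R), forall t, 0 <= w t &
  mu.-integrable setT (EFin \o (fun t => w t * gauss_fun t))].

Lemma weight_kap : weight kap.
Proof. split; [exact: measurable_kap|exact: kap_ge0|exact: integrable_kap_gauss]. Qed.

(** Indicators enter as complex factors, so that lines and rays are all integrals over the whole
    real line and share one Fubini theorem. *)
Definition bC (b : bool) : C := (b%:R : R)%:C.
Lemma bC_nc b : nc (bC b) = b%:R. Proof. by rewrite /bC ncC normr_nat. Qed.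

Definition wint (A : R -> bool) (w : R -> R) (a : R -> C) : R := \int[mu]_t ((A t)%:R * w t * nc (a t)).

Lemma wint_pt A w a K t : weight w -> gdom A K a ->
 0 <= (A t)%:R * w t * nc (a t) <= K * (w t * gauss_fun t).
Proof.
move=> [_ w0 _] [_ [K0 ha]]; rewrite !mulr_ge0 ?nc_ge0//=.
case: (A t) (ha t) => h; last by rewrite !mul0r !mulr_ge0// gauss_fun_ge0.
by rewrite mul1r mulrCA ler_wpM2l// h.
Qed.

Lemma wint_integrable A w a K : weight w -> cmeas setT (fun t => bC (A t)) -> gdom A K a ->
 mu.-integrable setT (EFin \o (fun t => (A t)%:R * w t * nc (a t))).
Proof.
move=> hw [mA _] ha; have [mw w0 iw] := hw; have [ma _] := ha.
apply: (le_integrable measurableT _ _ (scaled_integrable K _ iw)) => //=.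
 apply/measurable_EFinP; apply: measurable_funM; last exact: measurable_nc.
 by apply: measurable_funM => //; exact: mA.
move=> t _; rewrite lee_fin; have /andP[h1 h2] := wint_pt A w a K t hw ha.
by rewrite ger0_norm// (le_trans h2)// ler_norm.
Qed.

Section Kernel.
Variables (A B : R -> bool) (Z W : R -> C) (wa wb : R -> R).
Hypotheses (mA : cmeas setT (fun t => bC (A t))) (mB : cmeas setT (fun t => bC (B t)))
 (mZ : cmeas setT Z) (mW : cmeas setT W) (hwa : weight wa) (hwb : weight wb).
Hypothesis kern : forall t r, A t -> B r -> nc (Z t - W r)^-1 <= wa t * wb r.

Definition wk (a b : R -> C) (t r : R) : C := bC (A t) * a t * (bC (B r) * b r) / (Z t - W r).
Definition WI (a b : R -> C) : C := Cint setT (fun t => Cint setT (wk a b t)).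

Lemma wk_meas a b : cmeas setT a -> cmeas setT b -> cmeas2 (wk a b).
Proof.
move=> ma mb; rewrite /wk; apply: cmeas2M; last first.
 by apply: cmeas2V; apply: cmeas2B; [exact: cmeas2_1|exact: cmeas2_2].
apply: cmeas2M; first by apply: (cmeas2_1 (fun t => bC (A t) * a t)); exact: cmeasM.
by apply: (cmeas2_2 (fun t => bC (B t) * b t)); exact: cmeasM.
Qed.

Lemma wk_bound a b t r : nc (wk a b t r) <= ((A t)%:R * wa t * nc (a t)) * ((B r)%:R * wb r * nc (b r)).
Proof.
rewrite /wk !ncM !bC_nc.
have [At|_] := boolP (A t); last by rewrite !mul0r.
have [Br|_] := boolP (B r); last by rewrite !(mul0r, mulr0).
rewrite !mul1r [leRHS](_ : _ = nc (a t) * nc (b r) * (wa t * wb r)); last by ring.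
by rewrite ler_wpM2l ?mulr_ge0 ?nc_ge0 ?kern.
Qed.

Lemma WI_integrable a b K K' : gdom A K a -> gdom B K' b ->
 cintegrable setT (fun t => Cint setT (wk a b t)) /\ forall t, cintegrable setT (wk a b t).
Proof.
move=> ha hb.
have ia := wint_integrable A wa a K hwa mA ha; have ib := wint_integrable B wb b K' hwb mB hb.
have m := wk_meas a b ha.1 hb.1.
by split; [exact: iterated_cintegrable m ia ib (wk_bound a b)|exact: inner_cintegrable m ib (wk_bound a b)].
Qed.

Lemma WI_bound a b K K' : gdom A K a -> gdom B K' b -> nc (WI a b) <= 4 * (wint A wa a * wint B wb b).
Proof.
move=> ha hb.
have ia := wint_integrable A wa a K hwa mA ha; have ib := wint_integrable B wb b K' hwb mB hb.
exact: iterated_bound (wk_meas a b ha.1 hb.1) ia ib (wk_bound a b).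
Qed.

Lemma WI_fubini a b K K' : gdom A K a -> gdom B K' b ->
 WI a b = Cint setT (fun r => Cint setT (fun t => wk a b t r)).
Proof.
move=> ha hb.
have ia := wint_integrable A wa a K hwa mA ha; have ib := wint_integrable B wb b K' hwb mB hb.
exact: Cint_fubini (wk_meas a b ha.1 hb.1) ia ib (wk_bound a b).
Qed.

Lemma gdomB D a a' K K' : gdom D K a -> gdom D K' a' -> gdom D (K + K') (fun t => a t - a' t).
Proof.
move=> [m1 [k1 h1]] [m2 [k2 h2]]; split; [exact: cmeasB|split; first exact: addr_ge0].
by move=> t Dt; rewrite (le_trans (ncB _ _))// mulrDl lerD ?h1 ?h2.
Qed.

Lemma WI_diff a a' b b' K K' : gdom A K a -> gdom A K a' -> gdom B K' b -> gdom B K' b' ->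
 WI a b - WI a' b' = WI (fun t => a t - a' t) b + WI a' (fun t => b t - b' t).
Proof.
move=> ha ha' hb hb'; have ha'' := gdomB _ _ _ _ _ ha ha'; have hb'' := gdomB _ _ _ _ _ hb hb'.
have [i1 j1] := WI_integrable _ _ _ _ ha hb; have [i2 j2] := WI_integrable _ _ _ _ ha' hb'.
have [i3 j3] := WI_integrable _ _ _ _ ha'' hb; have [i4 j4] := WI_integrable _ _ _ _ ha' hb''.
rewrite /WI -(CintB _ _ _ measurableT i1 i2) -(CintD _ _ _ measurableT i3 i4); apply: eq_Cint => t _.
rewrite -CintB// -CintD//; apply: eq_Cint => r _.
by rewrite /wk; ring.
Qed.

Lemma wint_le D w a K : weight w -> cmeas setT (fun t => bC (D t)) -> gdom D K a ->
 0 <= wint D w a <= K * \int[mu]_t (w t * gauss_fun t).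
Proof.
move=> hw mD ha; have [_ w0 iw] := hw; rewrite /wint -RintegralZl//; apply/andP; split.
 by apply: Rintegral_ge0 => t _; rewrite !mulr_ge0 ?nc_ge0.
apply: le_Rintegral => //; first exact: wint_integrable hw mD ha.
 exact: scaled_integrable.
by move=> t _; have /andP[] := wint_pt D w a K t hw ha.
Qed.

Lemma wint_cvg0 D w (a : nat -> R -> C) K (N : nat) : weight w -> cmeas setT (fun t => bC (D t)) ->
 (forall n, (N <= n)%N -> gdom D K (a n)) ->
 (forall t, D t -> clo (fun n => a n t) (fun=> 0)) -> (fun n => wint D w (a n)) @ \oo --> (0:R).
Proof.
move=> hw mD ha a0; have [mw w0 iw] := hw.
apply: (Rint_cvg0 setT _ (fun t => K * (w t * gauss_fun t)) N) => //.
- by move=> n Nn; have /measurable_int/measurable_EFinP := wint_integrable D w (a n) K hw mD (ha n Nn).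
- exact: scaled_integrable.
- move=> n t Nn _; have /andP[h1 h2] := wint_pt D w (a n) K t hw (ha n Nn).
 by rewrite ger0_norm.
- move=> t _; case Dt : (D t); last by under eq_fun do rewrite mulr0n !mul0r; exact: cvg_cst.
 rewrite mulr1n; apply: cvgM0; exact: clo_nc0 (a0 t Dt).
Qed.

(** By bilinearity the difference splits into two terms, each with one differing factor. The product
    majorant reduces both to weighted integrals in one variable, to which dominated convergence
    applies. *)
Lemma WI_clo (a a' b b' : nat -> R -> C) K (N : nat) :
 (forall n, (N <= n)%N -> [/\ gdom A K (a n), gdom A K (a' n), gdom B K (b n) & gdom B K (b' n)]) ->
 (forall t, A t -> clo (fun n => a n t) (fun n => a' n t)) ->
 (forall t, B t -> clo (fun n => b n t) (fun n => b' n t)) ->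
 clo (fun n => WI (a n) (b n)) (fun n => WI (a' n) (b' n)).
Proof.
move=> H ca cb.
pose Ma := K * \int[mu]_t (wa t * gauss_fun t); pose Mb := K * \int[mu]_t (wb t * gauss_fun t).
have and4_1 (P1 P2 P3 P4 : Prop) : [/\ P1, P2, P3 & P4] -> P1 by case.
have and4_2 (P1 P2 P3 P4 : Prop) : [/\ P1, P2, P3 & P4] -> P2 by case.
have and4_3 (P1 P2 P3 P4 : Prop) : [/\ P1, P2, P3 & P4] -> P3 by case.
have and4_4 (P1 P2 P3 P4 : Prop) : [/\ P1, P2, P3 & P4] -> P4 by case.
have l1 := wint_cvg0 A wa (fun n t => a n t - a' n t) (K + K) N hwa mA
 (fun n Nn => gdomB _ _ _ _ _ (and4_1 _ _ _ _ (H n Nn)) (and4_2 _ _ _ _ (H n Nn)))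
 (fun t At => clo_sub0 _ _ (ca t At)).
have l2 := wint_cvg0 B wb (fun n t => b n t - b' n t) (K + K) N hwb mB
 (fun n Nn => gdomB _ _ _ _ _ (and4_3 _ _ _ _ (H n Nn)) (and4_4 _ _ _ _ (H n Nn)))
 (fun t Bt => clo_sub0 _ _ (cb t Bt)).
apply: (clo_le _ _ (fun n => 4 * Mb * wint A wa (fun t => a n t - a' n t) + 4 * Ma * wint B wb (fun t => b n t - b' n t))); last first.
 by apply: cvgD0; exact: cvgM0.
near=> n; have Nn : (N <= n)%N by near: n; exact: nbhs_infty_ge.
have [h1 h2 h3 h4] := H n Nn.
rewrite (WI_diff _ _ _ _ _ _ h1 h2 h3 h4); apply: le_trans (ncD _ _) _; apply: lerD.
 apply: le_trans (WI_bound _ _ _ _ (gdomB _ _ _ _ _ h1 h2) h3) _.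
 have /andP[p1 p2] := wint_le B wb _ _ hwb mB h3.
 have /andP[p3 _] := wint_le A wa _ _ hwa mA (gdomB _ _ _ _ _ h1 h2).
 rewrite -[leRHS]mulrA [X in _ <= 4 * X]mulrC; apply: ler_wpM2l => //; exact: ler_wpM2l.
apply: le_trans (WI_bound _ _ _ _ h2 (gdomB _ _ _ _ _ h3 h4)) _.
have /andP[p1 p2] := wint_le A wa _ _ hwa mA h2.
have /andP[p3 _] := wint_le B wb _ _ hwb mB (gdomB _ _ _ _ _ h3 h4).
rewrite -[leRHS]mulrA; apply: ler_wpM2l => //; exact: ler_wpM2r.
Unshelve. all: end_near. Qed.

End Kernel.
End WeightedKernels.

(** * The imaginary axis against the four rays at angle pi/6 *)

Section FourRays.
Context {R : realType}.
Local Notation C := R[i].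
Local Notation mR := (measurableTypeR R).
Local Notation mu := (@lebesgue_measure R).
Local Notation Cint := (Cintegral mu).
(** The common point of the contours is removed from both of them, since the bound on the kernel by
    weights holds off it only. *)
Definition off0 (t : R) : bool := t != 0.
Definition posb (t : R) : bool := 0 < t.

Lemma cmeas_bC (A : R -> bool) : measurable ([set t | A t] : set mR) -> cmeas setT (fun t => bC (A t)).
Proof.
move=> mA; split; last exact: measurable_cst.
have E t : (\1_([set t | A t] : set mR) t : R) = (A t)%:R.
 by rewrite indicE (_ : (t \in _) = A t)//; apply/idP/idP; rewrite inE.
have m : measurable_fun setT (\1_([set t | A t] : set mR) : mR -> R) by exact: measurable_indic.
by apply: eq_measurable_fun m => t _; rewrite E.
Qed.

Lemma cmeas_off0 : cmeas setT (fun t => bC (off0 t)).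
Proof.
apply: cmeas_bC; have -> : [set t | off0 t] = ~` [set (0:R)].
 by apply/seteqP; split => t /eqP.
by apply: measurableC; exact: measurable_set1.
Qed.

Lemma cmeas_posb : cmeas setT (fun t => bC (posb t)).
Proof.
apply: cmeas_bC; have -> : [set t | posb t] = `]0, +oo[%classic by rewrite set_itvoy.
exact: measurable_itv.
Qed.

Lemma cmeas_lin (a e : C) : cmeas setT (fun t => a + t%:C * e).
Proof.
apply: ccts_cmeas => // t _; exact: is_cderive_cts (is_cderive_lin a e t).
Qed.

Lemma cmeasV (g : R -> C) : cmeas setT g -> cmeas setT (fun t => (g t)^-1).
Proof.
move=> [m1 m2].
have mi : measurable_fun setT (fun u : mR => (Re (g u) ^+ 2 + Im (g u) ^+ 2)^-1).
 under eq_fun do rewrite -powR_inv1 ?addr_ge0 ?sqr_ge0//.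
 apply: (measurableT_comp (measurable_powR (-1))).
 by apply: measurable_funD; apply: measurable_funX.
split.
 have -> : Re \o (fun t => (g t)^-1) = (fun t => Re (g t) * (Re (g t) ^+ 2 + Im (g t) ^+ 2)^-1).
  by apply/funext => t; rewrite /= ReV.
 exact: measurable_funM.
have -> : Im \o (fun t => (g t)^-1) = (fun t => - (Im (g t) * (Re (g t) ^+ 2 + Im (g t) ^+ 2)^-1)).
 by apply/funext => t; rewrite /= ImV.
by apply: measurableT_comp => //; exact: measurable_funM.
Qed.

Lemma kern_kap (z : C) (eta r : R) : eta != 0 -> r != 0 -> `|eta| * `|r| <= nc z ^+ 2 ->
 nc z^-1 <= kap eta * kap r.
Proof.
move=> e0 r0 h; rewrite !kapE -invfM -sqrtrM// ncV.
have p : 0 < `|eta| * `|r| by rewrite mulr_gt0 ?normr_gt0.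
have s0 : 0 < Num.sqrt (`|eta| * `|r|) by rewrite sqrtr_gt0.
have n0 : 0 < nc z.
 rewrite lt_def nc_ge0 andbT; apply: contraTneq p => z0.
 by rewrite -leNgt (le_trans h)// z0 expr0n.
by rewrite lef_pV2 ?posrE// -(@ler_pXn2r _ 2)// ?nnegrE ?(ltW n0) ?(ltW s0)// sqr_sqrtr ?(ltW p).
Qed.

(** The angle between a ray and the imaginary axis is at least pi/3, so the squared distance is at
    least r^2 + eta^2 - |eta| r, which is at least |eta| r. *)
Lemma kern_ray (eta r c d : R) : c ^+ 2 = 3 / 4 -> d ^+ 2 = 1 / 4 -> off0 eta -> posb r ->
 nc (0 +i* eta - r%:C * (c +i* d))^-1 <= kap eta * kap r.
Proof.
move=> c2 d2 e0 r0; apply: kern_kap => //; first exact: lt0r_neq0.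
rewrite nc_sq !ReImE (gtr0_norm r0).
have -> : (0 - (r * c - 0 * d)) ^+ 2 + (eta - (r * d + 0 * c)) ^+ 2 =
  r ^+ 2 * (c ^+ 2 + d ^+ 2) + eta ^+ 2 - 2 * (eta * d) * r by ring.
have -> : c ^+ 2 + d ^+ 2 = 1 by rewrite c2 d2; lra.
have h : 2 * (eta * d) <= `|eta|.
 rewrite (le_trans (ler_norm _))// !normrM (ger0_norm (ler0n _ 2)).
 have -> : `|d| = 1 / 2.
  by apply/eqP; rewrite -(@eqrXn2 _ 2)// ?divr_ge0// real_normK ?num_real// d2; apply/eqP; field.
 by rewrite mulrCA mulrA; lra.
have h2 : 2 * (eta * d) * r <= `|eta| * r by rewrite ler_wpM2r// ltW.
have := sqr_ge0 (`|eta| - r); rewrite sqrrB real_normK ?num_real//; lra.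
Qed.

Definition sq3 : R := Num.sqrt 3.
Lemma sq3_sq : (sq3 / 2) ^+ 2 = 3 / 4 :> R.
Proof. by rewrite expr_div_n sqr_sqrtr//; congr (_ / _); rewrite -natrX. Qed.
Lemma half_sq : (1 / 2 : R) ^+ 2 = 1 / 4. Proof. by field. Qed.
Lemma sq3_gt : 1 / 2 < sq3 / 2.
Proof.
rewrite ltr_pM2r ?invr_gt0//; rewrite -[ltLHS](@sqrtr1 R) ltr_sqrt//; lra.
Qed.

Definition imag (t : R) : C := 0 +i* t.

Definition unit6 (e : C) : Prop := Re e ^+ 2 = 3 / 4 /\ Im e ^+ 2 = 1 / 4.
Lemma unit6_rays : [/\ unit6 ((sq3 / 2) +i* (- (1 / 2))), unit6 ((sq3 / 2) +i* (1 / 2)),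
 unit6 (- ((sq3 / 2) +i* (- (1 / 2)))) & unit6 (- ((sq3 / 2) +i* (1 / 2)))].
Proof.
by split; split; rewrite ?(ReN, ImN, ReK, ImK) ?sqrrN ?sq3_sq ?half_sq.
Qed.

Lemma kern6 (e : C) : unit6 e -> forall t r, off0 t -> posb r ->
 nc (imag t - r%:C * e)^-1 <= kap t * kap r.
Proof. by move=> [h1 h2] t r t0 r0; case: e h1 h2 => c d /= h1 h2; exact: kern_ray. Qed.

Lemma cmeas_imag : cmeas setT imag.
Proof.
have -> : imag = fun t => 0 + t%:C * (0 +i* 1); last exact: cmeas_lin.
by apply/funext => t; apply: complexP; rewrite /imag !ReImE; ring.
Qed.

Lemma cmeas_rmul (e : C) : cmeas setT (fun r => r%:C * e).
Proof.
have -> : (fun r : R => r%:C * e) = fun t => 0 + t%:C * e by apply/funext => t; rewrite add0r.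
exact: cmeas_lin.
Qed.

Definition WI6 (e : C) (a b : R -> C) : C := WI off0 posb imag (fun r => r%:C * e) a b.

Definition wk6 (e : C) := wk off0 posb imag (fun r => r%:C * e).

Lemma WI6_integrable e a b K K' : unit6 e -> gdom off0 K a -> gdom posb K' b ->
 cintegrable setT (fun t => Cint setT (wk6 e a b t)) /\ forall t, cintegrable setT (wk6 e a b t).
Proof.
move=> ue; exact: (WI_integrable _ _ _ _ kap kap cmeas_off0 cmeas_posb cmeas_imag (cmeas_rmul e) weight_kap weight_kap (kern6 e ue)).
Qed.

Lemma WI6_clo e (a a' b b' : nat -> R -> C) K (N : nat) : unit6 e ->
 (forall n, (N <= n)%N -> [/\ gdom off0 K (a n), gdom off0 K (a' n), gdom posb K (b n) & gdom posb K (b' n)]) ->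
 (forall t, off0 t -> clo (fun n => a n t) (fun n => a' n t)) ->
 (forall t, posb t -> clo (fun n => b n t) (fun n => b' n t)) ->
 clo (fun n => WI6 e (a n) (b n)) (fun n => WI6 e (a' n) (b' n)).
Proof.
move=> ue; exact: (WI_clo _ _ _ _ kap kap cmeas_off0 cmeas_posb cmeas_imag (cmeas_rmul e) weight_kap weight_kap (kern6 e ue)).
Qed.

Lemma pos_halfE_posb (h : R -> C) : cmeas setT h ->
 Cint pos_half h = Cint setT (fun r => bC (posb r) * h r).
Proof.
move=> mh; have mpos := measurable_pos_half.
have E (f : R -> R) : measurable_fun setT (f : mR -> R) ->
  \int[mu]_(r in pos_half) f r = \int[mu]_r ((posb r)%:R * f r).
 move=> mf; rewrite Rintegral_mkcond.
 have h1 : Cint setT (fun r => ((f \_ pos_half) r)%:C) = Cint setT (fun r => ((posb r)%:R * f r)%:C).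
  apply: Cint_eq_off0 => // [r _ r0|].
   congr (_%:C); rewrite /patch /posb lt_def r0 /=.
   have -> : (r \in pos_half) = (0 <= r) by apply/idP/idP; rewrite inE.
   by case: (0 <= r); rewrite ?mul1r ?mul0r.
  split; last exact: measurable_cst.
  have -> : Re \o (fun r => ((posb r)%:R * f r)%:C) = (fun r => (posb r)%:R * f r) by [].
  by apply: measurable_funM => //; exact: cmeas_posb.1.
 exact: (congr1 (@complex.Re R) h1).
apply: complexP; rewrite /Cintegral /=.
 rewrite E; last exact: mh.1.
 by apply: eq_Rintegral => r _; rewrite ReMC.
rewrite E; last exact: mh.2.
by apply: eq_Rintegral => r _; rewrite ImMC.
Qed.

Lemma ray_wk6 e a (g : C -> C) K K' eta : unit6 e -> gdom off0 K a -> gdom posb K' (fun r => g (r%:C * e)) ->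
 off0 eta -> a eta * rayC 0 e (fun w => g w / (imag eta - w)) = e * Cint setT (wk6 e a (fun r => g (r%:C * e)) eta).
Proof.
move=> ue ha hb e0; have [_ i1] := WI6_integrable e a _ K K' ue ha hb.
have mk : cmeas setT (fun r => g (r%:C * e) / (imag eta - r%:C * e)).
 apply: cmeasM; first exact: hb.1.
 have mm : cmeas setT (fun r : R => imag eta - r%:C * e).
  by apply: cmeasB; [split; exact: measurable_cst|exact: cmeas_rmul].
 exact: cmeasV.
rewrite /rayC.
have -> : (fun r => g (0 + r%:C * e) / (imag eta - (0 + r%:C * e)) * e) =
     (fun r => (g (r%:C * e) / (imag eta - r%:C * e)) * e).
 by apply/funext => r; rewrite add0r.
rewrite pos_halfE_posb; last by apply: cmeasM => //; split; exact: measurable_cst.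
have i2 := i1 eta.
have a1 : bC (off0 eta) = 1 :> C by rewrite e0.
have [az|az] := eqVneq (a eta) 0.
 rewrite az mul0r (_ : wk6 _ _ _ _ = fun=> 0) ?Cint0 ?mulr0//.
 by apply/funext => r; rewrite /wk6 /wk az !(mulr0, mul0r).
have E r : bC (posb r) * (g (r%:C * e) / (imag eta - r%:C * e) * e) =
  (e / a eta) * wk6 e a (fun r => g (r%:C * e)) eta r.
 by rewrite /wk6 /wk a1; set d := (_ - _)^-1; field.
rewrite (eq_Cint _ _ _ (fun r _ => E r)) CintZ//.
by rewrite !mulrA; congr (_ * _); field.
Qed.

(** The common form to which the prelimit kernel and both limit kernels are brought before they are
    compared. *)
Definition L4 (f g : C -> C) : C := Cint setT (fun eta => f (imag eta) *
 rays4 0 (sq3 / 2) (1 / 2) (fun w => g w / (imag eta - w)) * imag 1).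

Definition gdom4 (K : R) (f g : C -> C) : Prop :=
 gdom off0 K (fun t => f (imag t)) /\ forall e, unit6 e -> gdom posb K (fun r => g (r%:C * e)).

(** The integrand is prescribed off t = 0 only, because every identity for the inner integral fails
    to make sense where the rays meet the line. *)
Lemma L4E_off0 f g K (h : R -> C) : gdom4 K f g -> (forall t, t != 0 -> h t = f (imag t) *
  rays4 0 (sq3 / 2) (1 / 2) (fun w => g w / (imag t - w)) * imag 1) ->
 let e1 := (sq3 / 2) +i* (- (1 / 2)) in let e2 := (sq3 / 2) +i* (1 / 2) in
 let w e := e * WI6 e (fun t => f (imag t)) (fun r => g (r%:C * e)) in
 Cint setT h = imag 1 * (w e1 - w e2 + (w (- e1) - w (- e2))).
Proof.
move=> [ha hb] hh e1 e2 w; have [u1 u2 u3 u4] := unit6_rays.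
have I e (ue : unit6 e) := WI6_integrable e _ _ K K ue ha (hb e ue).
have [i1 _] := I _ u1; have [i2 _] := I _ u2; have [i3 _] := I _ u3; have [i4 _] := I _ u4.
pose G e t := e * Cint setT (wk6 e (fun t => f (imag t)) (fun r => g (r%:C * e)) t).
have j1 : cintegrable setT (G e1) := cintegrableZ _ _ e1 measurableT i1.
have j2 : cintegrable setT (G e2) := cintegrableZ _ _ e2 measurableT i2.
have j3 : cintegrable setT (G (- e1)) := cintegrableZ _ _ (- e1) measurableT i3.
have j4 : cintegrable setT (G (- e2)) := cintegrableZ _ _ (- e2) measurableT i4.
have b1 := cintegrableB _ _ _ measurableT j1 j2; have b2 := cintegrableB _ _ _ measurableT j3 j4.
have j := cintegrableD _ _ _ measurableT b1 b2.
have jj := cintegrableZ _ _ (imag 1) measurableT j.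
transitivity (Cint setT (fun t => imag 1 * (G e1 t - G e2 t + (G (- e1) t - G (- e2) t)))).
 apply: Cint_eq_off0 => //; last exact: cintegrable_cmeas jj.
 move=> t _ t0; rewrite hh// /rays4 rmorph0 /G -!(ray_wk6 _ (fun t => f (imag t)) g K K)//; try exact: hb.
 ring.
rewrite (CintZ _ _ _ measurableT j) (CintD _ _ _ measurableT b1 b2).
rewrite (CintB _ _ _ measurableT j1 j2) (CintB _ _ _ measurableT j3 j4) /G.
by rewrite (CintZ _ _ _ measurableT i1) (CintZ _ _ _ measurableT i2) (CintZ _ _ _ measurableT i3) (CintZ _ _ _ measurableT i4).
Qed.

Lemma L4E f g K : gdom4 K f g ->
 let e1 := (sq3 / 2) +i* (- (1 / 2)) in let e2 := (sq3 / 2) +i* (1 / 2) in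
 let w e := e * WI6 e (fun t => f (imag t)) (fun r => g (r%:C * e)) in
 L4 f g = imag 1 * (w e1 - w e2 + (w (- e1) - w (- e2))).
Proof. by move=> h; rewrite /L4; exact: (L4E_off0 f g K _ h). Qed.

Lemma L4_off0 f g K (h : R -> C) : gdom4 K f g -> (forall t, t != 0 -> h t = f (imag t) *
  rays4 0 (sq3 / 2) (1 / 2) (fun w => g w / (imag t - w)) * imag 1) -> Cint setT h = L4 f g.
Proof. by move=> h1 h2; rewrite (L4E _ _ _ h1) (L4E_off0 _ _ _ _ h1 h2). Qed.

Lemma L4_clo (f f' g g' : nat -> C -> C) K N :
 (forall n, (N <= n)%N -> gdom4 K (f n) (g n) /\ gdom4 K (f' n) (g' n)) ->
 (forall t, clo (fun n => f n (imag t)) (fun n => f' n (imag t))) ->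
 (forall w, clo (fun n => g n w) (fun n => g' n w)) ->
 clo (fun n => L4 (f n) (g n)) (fun n => L4 (f' n) (g' n)).
Proof.
move=> H cf cg; have [u1 u2 u3 u4] := unit6_rays.
have W e : unit6 e -> clo (fun n => e * WI6 e (fun t => f n (imag t)) (fun r => g n (r%:C * e)))
  (fun n => e * WI6 e (fun t => f' n (imag t)) (fun r => g' n (r%:C * e))).
 move=> ue; apply: cloZ; apply: (WI6_clo e _ _ _ _ K N ue) => [n Nn|t _|r _].
 - have [[h1 h2] [h3 h4]] := H n Nn; split; [exact: h1|exact: h3|exact: h2|exact: h4].
 - exact: cf.
 - exact: cg.
have c := cloZ _ _ (imag 1) (cloD _ _ _ _ (cloB _ _ _ _ (W _ u1) (W _ u2)) (cloB _ _ _ _ (W _ u3) (W _ u4))).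
by apply: eq_clo c; near=> n; have Nn : (N <= n)%N by [near: n; exact: nbhs_infty_ge];
  have [h1 h2] := H n Nn; rewrite (L4E _ _ K).
Unshelve. all: end_near. Qed.

End FourRays.

(** * Uniform domination and the limit of the integrands *)

Section Core.
Context {R : realType}.
Local Notation C := R[i].

(** The weaker of the exponents available on the two contours beats r^2 up to the constant [K]. With
    [del = 0] this is the condition for the limit function. *)
Definition qdom (M K b psi del : R) : Prop := forall r : R,
 r ^+ 2 - K <= b * r ^+ 2 / 2 + psi * r ^+ 4 / (4 * (1 + (del * r) ^+ 2)) - M * `|r|.

Lemma quartic_term_ge0 (psi del r : R) : 0 <= psi -> 0 <= psi * r ^+ 4 / (4 * (1 + (del * r) ^+ 2)).
Proof.
move=> p0; have r4 : 0 <= r ^+ 4 by rewrite (exprM r 2 2) sqr_ge0.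
apply: divr_ge0; first exact: mulr_ge0.
by apply: mulr_ge0 => //; apply: addr_ge0 => //; exact: sqr_ge0.
Qed.

(** Edge regime: the quadratic coefficient suffices, the quartic one contributing only its sign. *)
Lemma qdom_quadratic M b psi del : 4 <= b -> 0 <= psi -> qdom M (M ^+ 2) b psi del.
Proof.
move=> b4 p0 r.
have := quartic_term_ge0 psi del r p0; move: (_ / (4 * _)) => Y h1.
have h2 : 4 * r ^+ 2 <= b * r ^+ 2 by rewrite ler_wpM2r ?sqr_ge0.
have := sqr_ge0 (2 * `|r| - M); have := sqr_ge0 M.
rewrite sqrrB exprMn real_normK ?num_real// -natrX; lra.
Qed.

(** Merging regime: the quadratic coefficient may be negative. For small [del] the damped quartic
    still exceeds any prescribed multiple of r^2 up to a constant, although it grows only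
    quadratically. *)
Lemma qdom_quartic M a : 0 <= M -> 0 < a -> exists K d0 : R, [/\ 0 < d0 &
 forall b psi del, - M <= b -> a / 2 <= psi -> 0 <= del -> del <= d0 -> qdom M K b psi del].
Proof.
(* In [P], 1 is the decay to be kept, M/2 pays for a negative [b] and M for the linear term. Then m
   makes a m/8 equal to [P], and c comes from the square of r^2 - m. *)
move=> M0 a0; pose P := 1 + 3 * M / 2; pose m := 8 * P / a; pose c := m ^+ 2 / 2.
have P0 : 0 < P by rewrite /P; lra.
have m0 : 0 < m by rewrite /m divr_gt0// mulr_gt0.
exists (c * a / 8 + M), (Num.sqrt (2 * m)^-1); split; first by rewrite sqrtr_gt0 invr_gt0 mulr_gt0.
move=> b psi del bM pa d0 dd r.
have d2 : m * del ^+ 2 <= 1 / 2.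
 have : del ^+ 2 <= (2 * m)^-1.
  have <- : Num.sqrt (2 * m)^-1 ^+ 2 = (2 * m)^-1 by rewrite sqr_sqrtr// invr_ge0 mulr_ge0// ltW.
  by rewrite lerXn2r ?nnegrE ?sqrtr_ge0.
 move=> /(ler_wpM2l (ltW m0)) h; apply: le_trans h _.
 by rewrite le_eqVlt; apply/orP; left; apply/eqP; field; rewrite gt_eqF.
have q : 0 < 1 + (del * r) ^+ 2 by rewrite ltr_wpDr ?sqr_ge0.
have r4 : 0 <= r ^+ 4 by rewrite (exprM r 2 2) sqr_ge0.
have h1 : a / 8 * (r ^+ 4 / (1 + (del * r) ^+ 2)) <= psi * r ^+ 4 / (4 * (1 + (del * r) ^+ 2)).
 have -> : psi * r ^+ 4 / (4 * (1 + (del * r) ^+ 2)) = psi / 4 * (r ^+ 4 / (1 + (del * r) ^+ 2)).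
  by field; rewrite lt0r_neq0.
 by rewrite ler_wpM2r ?divr_ge0 ?(ltW q)//; lra.
have h2 : m * r ^+ 2 - c <= r ^+ 4 / (1 + (del * r) ^+ 2).
 rewrite ler_pdivlMr// exprMn.
 have -> : (m * r ^+ 2 - c) * (1 + del ^+ 2 * r ^+ 2) = m * r ^+ 2 + (m * del ^+ 2) * r ^+ 4 - c - c * del ^+ 2 * r ^+ 2 by ring.
 have k1 : m * del ^+ 2 * r ^+ 4 <= 1 / 2 * r ^+ 4 by exact: ler_wpM2r.
 have c0 : 0 <= c by rewrite /c divr_ge0 ?sqr_ge0.
 have k2 : 0 <= c * del ^+ 2 * r ^+ 2 by apply: mulr_ge0; [apply: mulr_ge0 => //; exact: sqr_ge0|exact: sqr_ge0].
 have cE : 2 * c = m ^+ 2 by rewrite /c; field.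
 have := sqr_ge0 (r ^+ 2 - m); rewrite sqrrB -exprM /=; lra.
have h3 : a / 8 * (m * r ^+ 2 - c) <= a / 8 * (r ^+ 4 / (1 + (del * r) ^+ 2)).
 by rewrite ler_wpM2l//; lra.
have h4 : a / 8 * (m * r ^+ 2 - c) = P * r ^+ 2 - c * a / 8 by rewrite /m; field; rewrite gt_eqF.
have h5 : - M * r ^+ 2 <= b * r ^+ 2 by rewrite ler_wpM2r ?sqr_ge0.
have h6 : M * `|r| <= M * (r ^+ 2 + 1).
 by rewrite ler_wpM2l//; have := sqr_ge0 (`|r| - 1); rewrite sqrrB real_normK ?num_real//; have := sqr_ge0 r; lra.
move: h4; rewrite /P; lra.
Qed.

Lemma gaussE (r : R) : gauss_fun r = expR (- r ^+ 2). Proof. by []. Qed.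

Section Bounds.
Variables (l : seq R) (del M K g b : R).
Hypotheses (ldel : forall e, e \in l -> `|e| <= del) (gM : `|g| <= M)
 (hq : qdom M K b (psum4 l) del).

Lemma K_ge0 : 0 <= K.
Proof. by have := hq 0; rewrite normr0 !expr0n /= !(mulr0, mul0r) addr0; lra. Qed.

Let M0 : 0 <= M. Proof. exact: le_trans gM. Qed.

Lemma Afun_im_gauss t : nc (Afun g b l (imag t)) <= expR (2 * K) * gauss_fun t.
Proof.
rewrite gaussE -expRD (le_trans (nc_Afun_im l del ldel g b t))// ler_expR.
have := hq t; have := mulr_ge0 M0 (normr_ge0 t); have := sqr_ge0 t.
have -> : psum4 l * t ^+ 4 / (1 + (del * t) ^+ 2) = 4 * (psum4 l * t ^+ 4 / (4 * (1 + (del * t) ^+ 2))).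
 by field; rewrite lt0r_neq0// ltr_wpDr ?sqr_ge0.
have : 0 <= psum4 l * t ^+ 4 / (4 * (1 + (del * t) ^+ 2)).
 exact/quartic_term_ge0/psum4_ge0.
lra.
Qed.

Lemma Afun_ray_gauss e r : unit6 e -> 0 <= r -> nc (Afun g b l (r%:C * e))^-1 <= expR (2 * K) * gauss_fun r.
Proof.
case: e => c d [c2 d2] r0; rewrite [complex.Re _]/= [complex.Im _]/= in c2 d2; rewrite gaussE -expRD.
rewrite (le_trans (nc_Afun_ray l del ldel g b r c d c2 d2 r0))// ler_expR.
have := hq r; rewrite (ger0_norm r0).
have : `|g| * r <= M * r by rewrite ler_wpM2r.
have := K_ge0; lra.
Qed.
End Bounds.

Section BoundsB.
Variables (a3 a4 M K g b : R).
Hypotheses (gM : `|g| <= M) (hq : qdom M K b a4 0) (a40 : 0 <= a4).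
Let M0 : 0 <= M. Proof. exact: le_trans gM. Qed.
Let K0 : 0 <= K.
Proof. by have := hq 0; rewrite normr0 !expr0n /= !(mulr0, mul0r) addr0; lra. Qed.

Lemma qdom0 r : r ^+ 2 - K <= b * r ^+ 2 / 2 + a4 * r ^+ 4 / 4 - M * `|r|.
Proof. by have := hq r; rewrite mul0r expr0n /= addr0 mulr1. Qed.

Lemma Bfun_im_gauss t : nc (Bfun g b a3 a4 (imag t)) <= expR (2 * K) * gauss_fun t.
Proof.
rewrite gaussE -expRD nc_Cexp ler_expR.
have -> : Re (- (g%:C * imag t) + b%:C * imag t ^+ 2 + a3%:C * imag t ^+ 3 - a4%:C * imag t ^+ 4) =
  - (b * t ^+ 2 + a4 * t ^+ 4) by rewrite /imag !exprS expr0 !ReImE; ring.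
have := qdom0 t; have := mulr_ge0 M0 (normr_ge0 t); have := sqr_ge0 t.
have : 0 <= a4 * t ^+ 4 by rewrite mulr_ge0// (exprM t 2 2) sqr_ge0.
lra.
Qed.

Lemma Bfun_ray_gauss e r : unit6 e -> 0 <= r -> nc (Bfun g b a3 a4 (r%:C * e))^-1 <= expR (2 * K) * gauss_fun r.
Proof.
case: e => c d [c2 d2] r0; rewrite [complex.Re _]/= [complex.Im _]/= in c2 d2; rewrite gaussE -expRD /Bfun.
rewrite -CexpN nc_Cexp ler_expR.
have -> : Re (- (- (g%:C * (r%:C * (c +i* d))) + b%:C * (r%:C * (c +i* d)) ^+ 2 + a3%:C * (r%:C * (c +i* d)) ^+ 3
  - a4%:C * (r%:C * (c +i* d)) ^+ 4)) = g * (r * c) - b * r ^+ 2 * (c ^+ 2 - d ^+ 2)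
  - a3 * r ^+ 3 * (c * (c ^+ 2 - 3 * d ^+ 2)) + a4 * r ^+ 4 * ((c ^+ 2 - d ^+ 2) ^+ 2 - 4 * c ^+ 2 * d ^+ 2).
 by rewrite !exprS !expr0 !ReImE; ring.
(* The real part of the cube of a direction at angle pi/6 vanishes, so [a3] leaves no trace in the
   modulus. *)
have -> : c ^+ 2 - 3 * d ^+ 2 = 0 by rewrite c2 d2; field.
rewrite c2 d2.
have : g * (r * c) <= M * r.
 rewrite (le_trans (ler_norm _))// normrM ler_pM// normrM ger0_norm// ler_piMr//.
 by rewrite -(@ler_pXn2r _ 2)// ?nnegrE// real_normK ?num_real// c2 expr1n; lra.
have := qdom0 r; rewrite (ger0_norm r0).
have : 0 <= a4 * r ^+ 4 by rewrite mulr_ge0// (exprM r 2 2) sqr_ge0.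
have := sqr_ge0 r; have k0 := K0; move: (r ^+ 3) => r3; rewrite mulr0 mulr0 subr0; lra.
Qed.
End BoundsB.

Lemma ccts_lin (e : C) t : ccts (fun r => r%:C * e) t.
Proof. exact: is_cderive_cts (is_cderive_line e t). Qed.

Lemma ccts_Bfun g b a3 a4 (e : C) t : ccts (fun r => Bfun g b a3 a4 (r%:C * e)) t.
Proof.
have cl := ccts_lin e t; have m k n := cctsM _ _ _ (ccts_cst k t) (cctsX _ _ n cl).
have m1 k := cctsM _ _ _ (ccts_cst k t) cl.
apply: ccts_Cexp.
exact: cctsB (cctsD _ _ _ (cctsD _ _ _ (cctsN _ _ (m1 g%:C)) (m b%:C 2)) (m a3%:C 3)) (m a4%:C 4).
Qed.

Lemma ccts_Afun g b l (e : C) t : ccts (fun r => Afun g b l (r%:C * e)) t.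
Proof.
have cl := ccts_lin e t; have m k n := cctsM _ _ _ (ccts_cst k t) (cctsX _ _ n cl).
have m1 k := cctsM _ _ _ (ccts_cst k t) cl.
apply: cctsM; first by apply: ccts_Cexp; exact: cctsD (cctsN _ _ (m1 g%:C)) (m b%:C 2).
elim: l => [|a l ih].
 have -> : (fun r : R => \prod_(e0 <- [::]) efac e0 (r%:C * e)) = (fun=> 1) by apply/funext => r; rewrite big_nil.
 exact: ccts_cst.
have -> : (fun r : R => \prod_(e0 <- a :: l) efac e0 (r%:C * e)) =
  (fun r => efac a (r%:C * e) * \prod_(e0 <- l) efac e0 (r%:C * e)) by apply/funext => r; rewrite big_cons.
apply: cctsM ih; apply: cctsM; first by apply: cctsD; [exact: ccts_cst|exact: m1].
apply: ccts_Cexp; apply: cctsD; first by apply: cctsN; exact: m1.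
by apply: cctsM; [exact: cctsX (m1 a%:C)|exact: ccts_cst].
Qed.

Lemma imagE t : imag t = t%:C * (0 +i* 1) :> C.
Proof. by rewrite /imag; complex_ring. Qed.

Lemma ccts_cmeasT (h : R -> C) : (forall t, ccts h t) -> cmeas setT h.
Proof. by move=> ch; apply: ccts_cmeas => // t _; exact: ch. Qed.

Lemma cmeas_imagf (f : C -> C) : cmeas setT (fun t => f (t%:C * (0 +i* 1))) -> cmeas setT (fun t => f (imag t)).
Proof. by have -> : (fun t => f (imag t)) = (fun t => f (t%:C * (0 +i* 1))) by apply/funext => t; rewrite imagE. Qed.

Lemma Afun_gdom4 l del M K gt bt gs bs : (forall e, e \in l -> `|e| <= del) -> `|gt| <= M -> `|gs| <= M ->
 qdom M K bt (psum4 l) del -> qdom M K bs (psum4 l) del ->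
 gdom4 (expR (2 * K)) (Afun gt bt l) (fun w => (Afun gs bs l w)^-1).
Proof.
move=> ld gM gM' q1 q2; split.
 split; first by apply: cmeas_imagf; apply: ccts_cmeasT => t; exact: ccts_Afun.
 by split => [|t _]; [exact: expR_ge0|exact: (Afun_im_gauss l del M K gt bt ld gM q1)].
move=> e ue; split; first by apply: cmeasV; apply: ccts_cmeasT => t; exact: ccts_Afun.
by split => [|t t0]; [exact: expR_ge0|exact: (Afun_ray_gauss l del M K gs bs ld gM' q2 e t ue (ltW t0))].
Qed.

Lemma Bfun_gdom4 a3 a4 M K gt bt gs bs : 0 <= a4 -> `|gt| <= M -> `|gs| <= M ->
 qdom M K bt a4 0 -> qdom M K bs a4 0 ->
 gdom4 (expR (2 * K)) (Bfun gt bt a3 a4) (fun w => (Bfun gs bs a3 a4 w)^-1).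
Proof.
move=> a40 gM gM' q1 q2; split.
 split; first by apply: cmeas_imagf; apply: ccts_cmeasT => t; exact: ccts_Bfun.
 by split => [|t _]; [exact: expR_ge0|exact: (Bfun_im_gauss a3 a4 M K gt bt gM q1 a40)].
move=> e ue; split; first by apply: cmeasV; apply: ccts_cmeasT => t; exact: ccts_Bfun.
by split => [|t t0]; [exact: expR_ge0|exact: (Bfun_ray_gauss a3 a4 M K gs bs gM' q2 a40 e t ue (ltW t0))].
Qed.

Lemma cloV1 (H : nat -> C) : clo H (fun=> 1) -> clo (fun n => (H n)^-1) (fun=> 1).
Proof.
move=> h; apply: (clo_le _ _ (fun n => 2 * nc (H n - 1))); last exact: cvgM0 (clo_nc0 _ (clo_sub0 _ _ h)).
have h2 := clo_nc0 _ (clo_sub0 _ _ h).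
have h3 : \forall n \near \oo, nc (H n - 1) < 1 / 2 by apply: (cvgr_lt 0) => //; lra.
near=> n; have sm : nc (H n - 1) < 1 / 2 by near: n; exact: h3.
have Hn : 1 / 2 <= nc (H n).
 have := ncB (H n) (H n - 1); have -> : H n - (H n - 1) = 1 by ring.
 rewrite nc1; lra.
have H0 : H n != 0 by apply: contraTneq Hn => ->; rewrite nc0 -ltNge; lra.
have -> : (H n)^-1 - 1 = (H n)^-1 * (1 - H n) by rewrite mulrBr mulr1 mulVf.
rewrite ncM ncV ncBC; apply: ler_wpM2r; first exact: nc_ge0.
by rewrite -[leRHS]invrK lef_pV2 ?posrE ?invr_gt0//; lra.
Unshelve. all: end_near. Qed.

Lemma ncCX (a : R) (u : C) k : nc (a%:C * u ^+ k) = `|a| * nc u ^+ k.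
Proof. by rewrite ncM ncC ncX. Qed.

Lemma nc_Bfun_le (g b a3 a4 M : R) (u : C) : `|g| <= M -> `|b| <= M ->
 nc (Bfun g b a3 a4 u) <= expR (M * nc u + M * nc u ^+ 2 + `|a3| * nc u ^+ 3 + `|a4| * nc u ^+ 4) /\
 nc (Bfun g b a3 a4 u)^-1 <= expR (M * nc u + M * nc u ^+ 2 + `|a3| * nc u ^+ 3 + `|a4| * nc u ^+ 4).
Proof.
move=> gM bM; rewrite /Bfun -CexpN; set q := _ - _.
have h : nc q <= M * nc u + M * nc u ^+ 2 + `|a3| * nc u ^+ 3 + `|a4| * nc u ^+ 4.
 rewrite /q (le_trans (ncB _ _))// (le_trans (lerD (ncD _ _) (lexx _)))//.
 rewrite (le_trans (lerD (lerD (ncD _ _) (lexx _)) (lexx _)))// ncN !ncCX ncM ncC.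
 rewrite lerD2r lerD2r; apply: lerD; apply: ler_wpM2r => //; [exact: nc_ge0|exact: exprn_ge0 (nc_ge0 u)].
have hq z : nc z <= nc q -> nc (Cexp z) <= expR (M * nc u + M * nc u ^+ 2 + `|a3| * nc u ^+ 3 + `|a4| * nc u ^+ 4).
 by move=> zq; rewrite nc_Cexp ler_expR (le_trans (ler_norm _))// (le_trans (nc_Re _))// (le_trans zq)//.
by split; apply: hq; rewrite ?ncN.
Qed.

Lemma clo_Cexp1 (v : nat -> C) (w : nat -> R) : (forall n, nc (v n) <= w n) -> w @ \oo --> (0:R) ->
 clo (fun n => Cexp (v n)) (fun=> 1).
Proof.
move=> vw w0; apply: (clo_le _ _ (fun n => 2 * expR 1 * w n)); last exact: cvgM0.
have h3 : \forall n \near \oo, w n < 1 by apply: (cvgr_lt 0).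
near=> n; have w1 : w n < 1 by near: n; exact: h3.
apply: le_trans (nc_Cexp_sub1 _) _; rewrite -mulrA; apply: ler_wpM2l => //.
rewrite mulrC; apply: ler_pM; rewrite ?expR_ge0 ?nc_ge0 ?vw// ler_expR.
exact: le_trans (vw n) (ltW w1).
Unshelve. all: end_near. Qed.

Section Sequences.
Variables (l : nat -> seq R) (del : nat -> R) (a3 a4 M : R).
Hypotheses (ldel : forall n e, e \in l n -> `|e| <= del n) (del0 : del @ \oo --> (0:R))
 (l3 : (fun n => psum3 (l n) - a3) @ \oo --> (0:R)) (l4 : (fun n => psum4 (l n) - a4) @ \oo --> (0:R)).

(** The quotient of [Afun] by [Bfun] does not involve [g] and [b], which is why these may vary with
    n within bounds. *)
Lemma Hfun_clo u : clo (fun n => Cexp ((psum3 (l n) - a3)%:C * u ^+ 3 - (psum4 (l n) - a4)%:C * u ^+ 4) *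
  \prod_(e <- l n) f5 (e%:C * u)) (fun=> 1).
Proof.
have c1 : clo (fun n => Cexp ((psum3 (l n) - a3)%:C * u ^+ 3 - (psum4 (l n) - a4)%:C * u ^+ 4)) (fun=> 1).
 pose v n : C := (psum3 (l n) - a3)%:C * u ^+ 3 - (psum4 (l n) - a4)%:C * u ^+ 4.
 pose w n := nc u ^+ 3 * `|psum3 (l n) - a3| + nc u ^+ 4 * `|psum4 (l n) - a4|.
 have w0 : w @ \oo --> (0:R).
  by apply: cvgD0; apply: cvgM0; [move/cvg_norm: l3|move/cvg_norm: l4]; rewrite normr0.
 have vw n : nc (v n) <= w n by rewrite /v /w (le_trans (ncB _ _))// !ncCX !(mulrC (nc u ^+ _)).
 exact: (clo_Cexp1 v w vw w0).
have c2 : clo (fun n => \prod_(e <- l n) f5 (e%:C * u)) (fun=> 1).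
 pose w n := 8 * expR 4 * nc u ^+ 5 * (del n * psum4 (l n)).
 have w0 : w @ \oo --> (0:R).
  apply: cvgM0; rewrite -(mul0r a4); apply: cvgM => //.
  have -> : (fun n => psum4 (l n)) = (fun n => (psum4 (l n) - a4) + a4) by apply/funext => n; rewrite subrK.
  by rewrite -[a4 in X in _ --> X]add0r; apply: cvgD => //; exact: cvg_cst.
 have w1 : (fun n => expR (w n) - 1) @ \oo --> (0:R).
  have w2 : (fun n => expR (w n)) @ \oo --> expR (0:R).
   by apply: continuous_cvg => //; exact: continuous_expR.
  rewrite expR0 in w2; rewrite -(subrr (1 : R)); apply: cvgB; [exact: w2|exact: cvg_cst].
 have d0 : (fun n => nc u * del n) @ \oo --> (0:R) by exact: cvgM0.
 apply: (clo_le _ _ (fun n => expR (w n) - 1)) => //.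
 have h3 : \forall n \near \oo, nc u * del n < 1 by apply: (cvgr_lt 0).
 near=> n; apply: nc_prod_f5; first exact: ldel.
 by rewrite mulrC ltW//; near: n; exact: h3.
have := cloM _ _ _ _ 1 _ _ c1 c2; rewrite mulr1; apply.
 by apply: nearW => n; rewrite nc1.
by apply: nearW => n; rewrite nc1.
Unshelve. all: end_near. Qed.

Variables (g b : nat -> R).
Hypotheses (gM : forall n, `|g n| <= M) (bM : forall n, `|b n| <= M).

Lemma Afun_BfunE n u : Afun (g n) (b n) (l n) u = Bfun (g n) (b n) a3 a4 u *
 (Cexp ((psum3 (l n) - a3)%:C * u ^+ 3 - (psum4 (l n) - a4)%:C * u ^+ 4) * \prod_(e <- l n) f5 (e%:C * u)).
Proof.
rewrite AfunE mulrA; congr (_ * _); rewrite /Bfun -CexpD !rmorphB; congr Cexp; ring.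
Qed.

Lemma Afun_clo u : clo (fun n => Afun (g n) (b n) (l n) u) (fun n => Bfun (g n) (b n) a3 a4 u).
Proof.
have := cloM _ _ _ _ (Num.max 1 (expR (M * nc u + M * nc u ^+ 2 + `|a3| * nc u ^+ 3 + `|a4| * nc u ^+ 4)))
 _ _ (clo_refl (fun n => Bfun (g n) (b n) a3 a4 u)) (Hfun_clo u).
move=> h; apply: eq_clo (h _ _); apply: nearW => n.
- by rewrite -Afun_BfunE.
- by rewrite mulr1.
- by rewrite le_max (nc_Bfun_le _ _ _ _ _ _ (gM n) (bM n)).1 orbT.
- by rewrite nc1 le_max lexx.
Qed.

Lemma AfunV_clo u : clo (fun n => (Afun (g n) (b n) (l n) u)^-1) (fun n => (Bfun (g n) (b n) a3 a4 u)^-1).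
Proof.
have := cloM _ _ _ _ (Num.max 1 (expR (M * nc u + M * nc u ^+ 2 + `|a3| * nc u ^+ 3 + `|a4| * nc u ^+ 4)))
 _ _ (clo_refl (fun n => (Bfun (g n) (b n) a3 a4 u)^-1)) (cloV1 _ (Hfun_clo u)).
move=> h; apply: eq_clo (h _ _); apply: nearW => n.
- by rewrite -invfM -Afun_BfunE.
- by rewrite mulr1.
- by rewrite le_max (nc_Bfun_le _ _ _ _ _ _ (gM n) (bM n)).2 orbT.
- by rewrite nc1 le_max lexx.
Qed.

End Sequences.

(** The alternative hypothesis separates the regimes: a quadratic coefficient at least 4 at the
    edge, a positive quartic limit at a merging point. Domination by [gdom4] also holds eventually
    for each n, as [BM_main] requires it. *)
Lemma core_asymptotics (l : nat -> seq R) (del gt bt gs bs : nat -> R) (a3 a4 M : R) :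
 (forall n e, e \in l n -> `|e| <= del n) -> (forall n, 0 <= del n) -> del @ \oo --> (0:R) ->
 (fun n => psum3 (l n) - a3) @ \oo --> (0:R) -> (fun n => psum4 (l n) - a4) @ \oo --> (0:R) ->
 (forall n, [/\ `|gt n| <= M, `|gs n| <= M, `|bt n| <= M & `|bs n| <= M]) -> 0 <= a4 ->
 (forall n, 4 <= bt n /\ 4 <= bs n) \/ 0 < a4 ->
 (\forall n \near \oo, exists K, gdom4 K (Afun (gt n) (bt n) (l n)) (fun w => (Afun (gs n) (bs n) (l n) w)^-1)) /\
 clo (fun n => L4 (Afun (gt n) (bt n) (l n)) (fun w => (Afun (gs n) (bs n) (l n) w)^-1))
   (fun n => L4 (Bfun (gt n) (bt n) a3 a4) (fun w => (Bfun (gs n) (bs n) a3 a4 w)^-1)).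
Proof.
move=> ld dge0 del0 l3 l4 bd a40 alt.
have M0 : 0 <= M by have [h _ _ _] := bd 0; exact: le_trans h.
have [K [N HQ]] : exists K N, forall n, (N <= n)%N -> [/\ qdom M K (bt n) (psum4 (l n)) (del n),
  qdom M K (bs n) (psum4 (l n)) (del n), qdom M K (bt n) a4 0 & qdom M K (bs n) a4 0].
 case: alt => [b4|a4p].
  exists (M ^+ 2), 0 => n _; have [h1 h2] := b4 n.
  by split; apply: qdom_quadratic => //; exact: psum4_ge0.
 have [K [d1 [d1p HK]]] := qdom_quartic M a4 M0 a4p.
 have a2 : 0 < a4 / 2 by lra.
 have h1 : \forall n \near \oo, `|psum4 (l n) - a4| < a4 / 2 by exact: cvgr0_norm_lt.
 have h2 : \forall n \near \oo, `|del n| < d1 by exact: cvgr0_norm_lt.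
 have [N _ HN] : \forall n \near \oo, `|psum4 (l n) - a4| < a4 / 2 /\ `|del n| < d1.
  by near=> n; split; near: n; [exact: h1|exact: h2].
 exists K, N => n Nn; have [k1 k2] := HN n Nn; have [_ _ m3 m4] := bd n.
 have b1 : - M <= bt n by move: m3; rewrite ler_norml => /andP[].
 have b2 : - M <= bs n by move: m4; rewrite ler_norml => /andP[].
 have p1 : a4 / 2 <= psum4 (l n) by move: k1; rewrite ltr_norml => /andP[k1 _]; lra.
 have p2 : a4 / 2 <= a4 by lra.
 have dd : del n <= d1 by rewrite (le_trans (ler_norm _))// ltW.
 split; [exact: HK b1 p1 (dge0 n) dd|exact: HK b2 p1 (dge0 n) dd|exact: HK b1 p2 (lexx _) (ltW d1p)|exact: HK b2 p2 (lexx _) (ltW d1p)].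
split.
 near=> n; have Nn : (N <= n)%N by near: n; exact: nbhs_infty_ge.
 exists (expR (2 * K)); have [q1 q2 q3 q4] := HQ n Nn; have [m1 m2 m3 m4] := bd n.
 exact: (Afun_gdom4 (l n) (del n) M K _ _ _ _ (ld n) m1 m2 q1 q2).
apply: (L4_clo _ _ _ _ (expR (2 * K)) N) => [n Nn|t|w].
- have [q1 q2 q3 q4] := HQ n Nn; have [m1 m2 m3 m4] := bd n; split.
  exact: (Afun_gdom4 (l n) (del n) M K _ _ _ _ (ld n) m1 m2 q1 q2).
 exact: (Bfun_gdom4 a3 a4 M K _ _ _ _ a40 m1 m2 q3 q4).
- refine (Afun_clo l del a3 a4 M ld del0 l3 l4 gt bt _ _ (imag t)).
  by move=> n; have [] := bd n.
 by move=> n; have [] := bd n.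
- refine (AfunV_clo l del a3 a4 M ld del0 l3 l4 gs bs _ _ w).
  by move=> n; have [] := bd n.
 by move=> n; have [] := bd n.
Unshelve. all: end_near. Qed.

End Core.

(** * The rescaled double integral of the kernel *)

Section MainTerm.
Context {R : realType}.
Local Notation C := R[i].
Local Notation mR := (measurableTypeR R).
Lemma RCD (x y : R) : (x + y)%:C = x%:C + y%:C. Proof. exact: rmorphD. Qed.
Lemma RCN (x : R) : (- x)%:C = - x%:C. Proof. exact: rmorphN. Qed.
Lemma RCM (x y : R) : (x * y)%:C = x%:C * y%:C. Proof. exact: rmorphM. Qed.
Lemma RCX (x : R) k : (x ^+ k)%:C = x%:C ^+ k. Proof. exact: rmorphXn. Qed.
Lemma RCV (x : R) : (x^-1)%:C = (x%:C)^-1. Proof. exact: fmorphV. Qed.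
Lemma RCnat k : (k%:R : R)%:C = k%:R. Proof. exact: rmorph_nat. Qed.
Lemma RC_sum (I : Type) (r : seq I) (F : I -> R) : (\sum_(i <- r) F i)%:C = \sum_(i <- r) (F i)%:C.
Proof. exact: rmorph_sum. Qed.
Lemma RC_prod (I : Type) (r : seq I) (F : I -> R) : (\prod_(i <- r) F i)%:C = \prod_(i <- r) (F i)%:C.
Proof. exact: rmorph_prod. Qed.

Lemma cmeasZ (D : set mR) (c : C) h : cmeas D h -> cmeas D (fun t => c * h t).
Proof. by move=> mh; apply: cmeasM => //; split; exact: measurable_cst. Qed.

Lemma gdomZ A K K' (c : C) a : nc c * K <= K' -> gdom A K a -> gdom A K' (fun t => c * a t).
Proof.
move=> cK [ma [K0 ha]]; split; first exact: cmeasZ.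
split; first by rewrite (le_trans _ cK)// mulr_ge0// nc_ge0.
move=> t At; rewrite ncM (le_trans (ler_wpM2l (nc_ge0 c) (ha t At)))// mulrA.
by rewrite ler_wpM2r// gauss_fun_ge0.
Qed.

Lemma gdom4Z K f g (c c' : C) : gdom4 K f g ->
 gdom4 ((nc c + nc c') * K) (fun z => c * f z) (fun w => c' * g w).
Proof.
move=> [ha hb]; have K0 : 0 <= K by have [_ []] := ha.
split; first by apply: (gdomZ _ K) => //; rewrite ler_wpM2r// lerDl nc_ge0.
by move=> e ue; apply: (gdomZ _ K); [rewrite ler_wpM2r// lerDr nc_ge0|exact: hb].
Qed.

Lemma L4Z K f g (c c' : C) : gdom4 K f g ->
 L4 (fun z => c * f z) (fun w => c' * g w) = c * c' * L4 f g.
Proof.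
move=> h; have [ha hb] := h; have [u1 u2 u3 u4] := unit6_rays (R := R).
have h' := gdom4Z _ _ _ c c' h.
have E1 := L4E _ _ _ h; have E2 := L4E _ _ _ h'; cbv zeta in E1, E2; rewrite {}E1 {}E2.
have W e : unit6 e -> WI6 e (fun t => c * f (imag t)) (fun r => c' * g (r%:C * e)) =
  c * c' * WI6 e (fun t => f (imag t)) (fun r => g (r%:C * e)).
 move=> ue; have [i1 i2] := WI6_integrable e _ _ K K ue ha (hb e ue).
 rewrite /WI6 /WI -CintZ//; apply: eq_Cint => t _; rewrite -CintZ//; last exact: i2.
 by apply: eq_Cint => r _; rewrite /wk; ring.
rewrite (W _ u1) (W _ u2) (W _ u3) (W _ u4).
move: (WI6 _ _ _) (WI6 _ _ _) (WI6 _ _ _) (WI6 _ _ _) => w1 w2 w3 w4; ring.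
Qed.

Section Rescaling.
Variables (X : seq R) (p eps : R).
Hypotheses (pX : p \notin X) (eps0 : 0 < eps).
Let Xc := [seq a%:C | a <- X] : seq C.
(** In the variable xi with z = p + eps xi, the factor z - a becomes (p - a)(1 + e xi). *)
Definition scaled_poles : seq R := [seq eps / (p - a) | a <- X].
(** Minus the coefficient of xi in c (z - y)^2 plus the sum of the logarithms of the 1 + e xi;
    [quad_coef] is the coefficient of xi^2. *)
Definition lin_coef (c y : R) : R := - (c * 2 * eps * (p - y) + \sum_(e <- scaled_poles) e).
Definition quad_coef (c : R) : R := c * eps ^+ 2 - (\sum_(e <- scaled_poles) e ^+ 2) / 2.

Let pa a : a \in X -> p - a != 0.
Proof. by move=> aX; rewrite subr_eq0; apply: contraNneq pX => ->. Qed.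

Lemma prod_poles (xi : C) : \prod_(a <- Xc) (p%:C + eps%:C * xi - a) =
 (\prod_(a <- X) (p - a))%:C * \prod_(e <- scaled_poles) (1 + e%:C * xi).
Proof.
rewrite /Xc /scaled_poles !big_map RC_prod -big_split /=.
apply: eq_big_seq => a /pa aX.
have aX' : p%:C - a%:C != 0 :> C by rewrite -RCN -RCD; apply: contra_neq aX => /(congr1 (@complex.Re R)).
by rewrite RCM RCV RCD RCN; field.
Qed.

Lemma gq_Afun c y xi : Cexp (gq c y).[p%:C + eps%:C * xi] * \prod_(a <- Xc) (p%:C + eps%:C * xi - a) =
 (expR (c * (p - y) ^+ 2) * \prod_(a <- X) (p - a))%:C *
 Afun (lin_coef c y) (quad_coef c) scaled_poles xi.
Proof.
rewrite prod_poles RCM -CexpC -!mulrA; rewrite /Afun /efac big_split /= -Cexp_sum.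
set P := (\prod_(a <- X) _)%:C; set Q := \prod_(e <- scaled_poles) _.
have -> : \sum_(i <- scaled_poles) (- (i%:C * xi) + (i%:C * xi) ^+ 2 / 2) =
  - ((\sum_(e <- scaled_poles) e)%:C * xi) + (\sum_(e <- scaled_poles) e ^+ 2)%:C * xi ^+ 2 / 2.
 rewrite !RC_sum !mulr_suml -sumrN -big_split /=; apply: eq_bigr => e _.
 by rewrite RCX; ring.
rewrite gqE /lin_coef /quad_coef.
set s1 := \sum_(e <- _) e; set s2 := \sum_(e <- _) _.
have -> : c%:C * (p%:C + eps%:C * xi - y%:C) ^+ 2 = (c * (p - y) ^+ 2)%:C +
  ((- ((- (c * 2 * eps * (p - y) + s1))%:C * xi) + (c * eps ^+ 2 - s2 / 2)%:C * xi ^+ 2) +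
  (- (s1%:C * xi) + s2%:C * xi ^+ 2 / 2)).
 by rewrite !(RCD, RCN, RCM, RCX) RCV !RCnat; field.
by rewrite !CexpD; ring.
Qed.

Lemma gq_AfunV c x w : Cexp (gq (- c) x).[p%:C + eps%:C * w] * invp Xc (p%:C + eps%:C * w) =
 ((expR (c * (p - x) ^+ 2) * \prod_(a <- X) (p - a))^-1)%:C *
 (Afun (lin_coef c x) (quad_coef c) scaled_poles w)^-1.
Proof.
have := gq_Afun c x w => /(congr1 (fun z => z^-1)); rewrite RCV [in X in X = _]invfM [in X in _ = X]invfM => <-.
rewrite -CexpN /invp prodfV; congr (Cexp _ * _).
by rewrite !gqE RCN mulNr.
Qed.

Lemma rays4_scale (ax ay : R) (G : C -> C) :
 rays4 p (eps * ax) (eps * ay) G = rays4 0 ax ay (fun w => eps%:C * G (p%:C + eps%:C * w)).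
Proof.
have E (u v : R) : rayC p%:C ((eps * u) +i* (eps * v)) G = rayC 0 (u +i* v) (fun w => eps%:C * G (p%:C + eps%:C * w)).
 rewrite /rayC; apply: eq_Cint => r _.
 have -> : (eps * u) +i* (eps * v) = eps%:C * (u +i* v) by complex_ring.
 by rewrite add0r (mulrCA eps%:C r%:C); set g := G _; ring.
have N (u v : R) : - (u +i* v) = (- u) +i* (- v) by apply: complexP; rewrite !ReImE.
rewrite /rays4 (N (eps * ax) (- (eps * ay))) (N (eps * ax) (eps * ay)) (N ax (- ay)) (N ax ay).
by rewrite -!mulrN !E.
Qed.

End Rescaling.

(** The constants in front of [Afun] for z and for w contain the product of the p - a, once directly
    and once inverted, so only the two Gaussian constants survive. *)
Lemma BM_main (n : nat) (X : n.-tuple R) (x0 : R) (gamma : R -> C) (s t x y p eps K : R) :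
 (0 < n)%N -> admissible X x0 gamma -> 0 < s -> 0 < t -> p \notin (X : seq R) -> 0 < eps ->
 let l := scaled_poles X p eps in
 let A c v := Afun (lin_coef X p eps c v) (quad_coef X p eps c) l in
 let ct := n%:R / (2 * t) in let cs := n%:R / (2 * s) in
 gdom4 K (A ct y) (fun w => (A cs x w)^-1) ->
 vline_integral x0 (fun z => curve_integral gamma (fun w =>
  Cexp ((n%:R / (2 * t))%:C * ((z - y%:C) ^+ 2 + (2 * t)%:C * log_potential (empirical X) z)
     - (n%:R / (2 * s))%:C * ((w - x%:C) ^+ 2 + (2 * s)%:C * log_potential (empirical X) w))
  / (z - w))) = (eps * expR (ct * (p - y) ^+ 2 - cs * (p - x) ^+ 2))%:C * L4 (A ct y) (fun w => (A cs x w)^-1).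
Proof.
move=> n0 adm s0 t0 pX e0 l A ct cs hK.
have s3 := sq3_gt (R := R).
have k1 : 0 < eps * (1 / 2) by rewrite mulr_gt0.
have k2 : eps * (1 / 2) < eps * (sq3 / 2) by rewrite ltr_pM2l.
rewrite (finite_identity n X x0 gamma s t x y p _ _ eps n0 adm s0 t0 pX k1 k2 e0).
pose cz := expR (ct * (p - y) ^+ 2) * \prod_(a <- (X : seq R)) (p - a).
pose cw := (expR (cs * (p - x) ^+ 2) * \prod_(a <- (X : seq R)) (p - a))^-1.
have P0 : \prod_(a <- (X : seq R)) (p - a) != 0.
 rewrite prodf_seq_neq0; apply/allP => a aX /=; rewrite subr_eq0.
 by apply: contraNneq pX => ->.
have -> : (eps * expR (ct * (p - y) ^+ 2 - cs * (p - x) ^+ 2))%:C = (eps * cz)%:C * cw%:C :> C.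
 rewrite -RCM; congr (_%:C); rewrite /cz /cw expRD expRN; field.
 by rewrite P0 gt_eqF// expR_gt0.
have hK' := gdom4Z _ _ _ (eps * cz)%:C cw%:C hK.
rewrite -(L4Z _ _ _ _ _ hK); apply: (L4_off0 _ _ _ _ hK') => r r0; rewrite rays4_scale.
have -> : p +i* (eps * r) = p%:C + eps%:C * imag r by rewrite /imag; complex_ring.
 rewrite mulrA (gq_Afun _ _ _ pX).
 have -> : (fun w => eps%:C * (Cexp (gq (- (n%:R / (2 * s))) x).[p%:C + eps%:C * w] *
   invp [seq a%:C | a <- (X : seq R)] (p%:C + eps%:C * w) / (p%:C + eps%:C * imag r - (p%:C + eps%:C * w)))) =
  (fun w => (cw%:C * (A cs x w)^-1) / (imag r - w)).
  apply/funext => w; rewrite (gq_AfunV _ _ _ pX).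
  have -> : p%:C + eps%:C * imag r - (p%:C + eps%:C * w) = eps%:C * (imag r - w) by ring.
  have en : eps%:C != 0 :> C by rewrite -nc_eq0 ncC normr_eq0 gt_eqF.
  have cancel (a d : C) : eps%:C * (a / (eps%:C * d)) = a / d.
   by rewrite invfM; move: (d^-1) => d'; field.
  by rewrite cancel.
 have -> : 0 +i* eps = eps%:C * imag 1 by rewrite /imag; complex_ring.
 by rewrite /cz /A RCM; ring.
Qed.

End MainTerm.

(** * The limit kernels as double integrals over common contours *)

Section HalfPlane.
Context {R : realType}.
Local Notation C := R[i].
Local Notation mu := (@lebesgue_measure R).
Variables (Q : {poly C}) (a kp : C).
Let F (w : C) : C := Cexp Q.[w] / (a - w).

(** A half-plane with normal [kp] at positive distance from the pole [a]; rays and segments stay in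
    it as soon as their ends or directions do. *)
Definition hpl (dl : R) (w : C) : Prop := Re (kp * (w - a)) <= - dl.
(** Gaussian decay along the ray from c in direction d, with the standard Gaussian in the parameter
    of the ray. *)
Definition gray (K : R) (c d : C) : Prop :=
 forall r, 0 <= r -> nc (Cexp Q.[c + r%:C * d]) <= K * gauss_fun r.

Lemma hpl_ray dl c d r : hpl dl c -> Re (kp * d) <= 0 -> 0 <= r -> hpl dl (c + r%:C * d).
Proof.
rewrite /hpl => h1 h2 r0.
have -> : Re (kp * (c + r%:C * d - a)) = Re (kp * (c - a)) + r * Re (kp * d) by rewrite !ReImE; ring.
by have := mulr_ge0_le0 r0 h2; lra.
Qed.

Lemma hpl_seg dl A B t : hpl dl A -> hpl dl B -> 0 <= t <= 1 -> hpl dl (A + t%:C * (B - A)).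
Proof.
rewrite /hpl => h1 h2 /andP[t0 t1].
have -> : Re (kp * (A + t%:C * (B - A) - a)) = (1 - t) * Re (kp * (A - a)) + t * Re (kp * (B - a)).
 by rewrite !ReImE; ring.
have k1 : (1 - t) * Re (kp * (A - a)) <= (1 - t) * - dl by rewrite ler_wpM2l//; lra.
have k2 : t * Re (kp * (B - a)) <= t * - dl by rewrite ler_wpM2l.
lra.
Qed.

Lemma hpl_inv dl w : 0 < dl -> hpl dl w -> nc (a - w)^-1 <= nc kp / dl.
Proof.
move=> d0 h; rewrite ncV ncBC.
have h1 : dl <= nc kp * nc (w - a).
 rewrite -ncM (le_trans _ (nc_Re _))//; have := ler_norm (- Re (kp * (w - a))); rewrite normrN.
 by move: h; rewrite /hpl; lra.
have kp0 : nc kp != 0.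
 by apply: contraTneq h1 => ->; rewrite mul0r -ltNge.
have n0 : 0 < nc (w - a).
 by rewrite lt_def nc_ge0 andbT; apply: contraTneq h1 => ->; rewrite mulr0 -ltNge.
by rewrite ler_pdivlMr// ler_pdivrMl// mulrC.
Qed.

Lemma hpl_neq dl w : 0 < dl -> hpl dl w -> Re (kp * (w - a)) != 0.
Proof. by rewrite /hpl => d0 h; rewrite lt_eqF//; lra. Qed.

Lemma F_cmeas (g : R -> C) : (forall t, ccts g t) -> cmeas setT (fun t => F (g t)).
Proof.
move=> cg; apply: cmeasM; first by apply: ccts_cmeasT => t; apply: ccts_Cexp; exact: ccts_horner.
apply: cmeasV; apply: cmeasB; first by split; exact: measurable_cst.
exact: ccts_cmeasT.
Qed.

Lemma F_gauss dl w K g : 0 < dl -> hpl dl w -> nc (Cexp Q.[w]) <= K * g -> nc (F w) <= nc kp / dl * K * g.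
Proof.
move=> d0 hw h; rewrite /F ncM mulrC -[leRHS]mulrA.
by apply: ler_pM; rewrite ?nc_ge0//; exact: hpl_inv.
Qed.

Lemma ray_integrable_hpl K dl c d : 0 < dl -> 0 <= K -> hpl dl c -> Re (kp * d) <= 0 -> gray K c d ->
 cintegrable pos_half (fun r => F (c + r%:C * d) * d).
Proof.
move=> d0 K0 hc hd hg.
have ig : mu.-integrable pos_half (EFin \o (fun t => (nc kp / dl * K * nc d) * gauss_fun t)).
 apply: (integrableS measurableT) => //; first exact: measurable_pos_half.
 exact: scaled_integrable (@integrableT_gauss R).
apply: (le_cintegrable _ _ _ measurable_pos_half _ ig).
 have m : cmeas setT (fun r => F (c + r%:C * d) * d).
  apply: cmeasM; last by split; exact: measurable_cst.
  by apply: F_cmeas => t; exact: is_cderive_cts (is_cderive_lin c d t).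
 by case: m => m1 m2; split; [apply: measurable_funS m1|apply: measurable_funS m2].
move=> r r0; have hr := hpl_ray dl c d r hc hd r0.
rewrite ncM [leRHS]mulrAC; apply: ler_wpM2r; first exact: nc_ge0.
exact: (F_gauss _ _ _ _ d0 hr (hg r r0)).
Qed.

(** The closing segments grow linearly in m and the integrand decays like a Gaussian in m, the pole
    staying at a fixed distance. *)
Lemma chord_small_hpl (A B : nat -> C) (K L c dl : R) (N : nat) : 0 < dl -> 0 < c -> 0 <= K -> 0 <= L ->
 (forall m, (N <= m)%N -> [/\ hpl dl (A m), hpl dl (B m), nc (B m - A m) <= L * m%:R &
   forall t, 0 <= t <= 1 -> nc (Cexp Q.[A m + t%:C * (B m - A m)]) <= K * expR (- (c * m%:R ^+ 2))]) ->
 clo (fun m => pint (lin (A m) (B m - A m) 0 1) F) (fun=> 0).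
Proof.
move=> d0 c0 K0 L0 H; have cst0 : 0 <= 2 * (nc kp / dl * K).
 by rewrite mulr_ge0// mulr_ge0// divr_ge0 ?nc_ge0// ltW.
apply: (clo_le _ _ (fun m => (2 * (nc kp / dl * K) * L) * (m%:R * expR (- (c * m%:R ^+ 2))))); last first.
 by apply: gauss_seq0 => //; exact: mulr_ge0 cst0 L0.
near=> m; have Nm : (N <= m)%N by near: m; exact: nbhs_infty_ge.
have [hA hB hL hE] := H m Nm; rewrite subr0.
have := pint_lin_bound (A m) (B m - A m) 0 1 F (nc kp / dl * (K * expR (- (c * m%:R ^+ 2)))) ler01.
move=> bd; apply: le_trans (bd _ _) _ => [t tm|t t01|].
- have cl : ccts (fun r : R => A m + r%:C * (B m - A m)) t by exact: is_cderive_cts (is_cderive_lin _ _ t).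
 apply: cctsM; first by apply: ccts_Cexp; exact: ccts_horner.
 apply: cctsV; last by apply: cctsB => //; exact: ccts_cst.
 rewrite subr_eq0; apply/eqP => E; have := hpl_seg dl _ _ t hA hB tm.
 by rewrite /hpl -E subrr mulr0 /=; lra.
- rewrite mulrA; apply: (F_gauss _ _ _ _ d0 (hpl_seg _ _ _ _ hA hB t01)); exact: hE.
- rewrite subr0 mulr1 [leLHS](_ : _ = 2 * (nc kp / dl * K) * expR (- (c * m%:R ^+ 2)) * nc (B m - A m)); last by ring.
 rewrite [leRHS](_ : _ = 2 * (nc kp / dl * K) * expR (- (c * m%:R ^+ 2)) * (L * m%:R)); last by ring.
 by rewrite ler_wpM2l// mulr_ge0 ?expR_ge0.
Unshelve. all: end_near. Qed.

Section WedgeShift.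
Variables (c1 c2 d1 d1' d2 d2' : C) (K dl : R).
Hypotheses (dl0 : 0 < dl) (K0 : 0 <= K) (h1 : hpl dl c1) (h2 : hpl dl c2)
 (k1 : Re (kp * d1) <= 0) (k1' : Re (kp * d1') <= 0) (k2 : Re (kp * d2) <= 0) (k2' : Re (kp * d2') <= 0)
 (g1 : gray K c1 d1) (g1' : gray K c1 d1') (g2 : gray K c2 d2) (g2' : gray K c2 d2').
Hypotheses
 (ch : clo (fun m => pint (lin (c1 + m%:R%:C * d1) ((c2 + m%:R%:C * d2) - (c1 + m%:R%:C * d1)) 0 1) F) (fun=> 0))
 (ch' : clo (fun m => pint (lin (c1 + m%:R%:C * d1') ((c2 + m%:R%:C * d2') - (c1 + m%:R%:C * d1')) 0 1) F) (fun=> 0)).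

(** Four truncated rays and two chords form a closed chain on one side of the pole, and the chords
    vanish in the limit. Both vertex and directions may change. *)
Lemma wedge_shift : rayC c1 d1 F - rayC c1 d1' F = rayC c2 d2 F - rayC c2 d2' F.
Proof.
have r1 := ray_limit _ _ _ (ray_integrable_hpl K dl c1 d1 dl0 K0 h1 k1 g1).
have r1' := ray_limit _ _ _ (ray_integrable_hpl K dl c1 d1' dl0 K0 h1 k1' g1').
have r2 := ray_limit _ _ _ (ray_integrable_hpl K dl c2 d2 dl0 K0 h2 k2 g2).
have r2' := ray_limit _ _ _ (ray_integrable_hpl K dl c2 d2' dl0 K0 h2 k2' g2').
pose chn (m : nat) : seq (C * @piece R) := [:: (1, lin c1 d1 0 m%:R); (-1, lin c1 d1' 0 m%:R);
 (1, lin (c1 + m%:R%:C * d1) ((c2 + m%:R%:C * d2) - (c1 + m%:R%:C * d1)) 0 1);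
 (-1, lin c2 d2 0 m%:R); (1, lin c2 d2' 0 m%:R);
 (-1, lin (c1 + m%:R%:C * d1') ((c2 + m%:R%:C * d2') - (c1 + m%:R%:C * d1')) 0 1)].
have ch0 m : cint (chn m) F = 0.
 have m0 : 0 <= m%:R :> R by [].
 have P c d : hpl dl c -> Re (kp * d) <= 0 -> ptrace (hpl dl) (lin c d 0 m%:R).
  by move=> hc hd t /andP[t0 _]; exact: hpl_ray.
 have P' A B : hpl dl A -> hpl dl B -> ptrace (hpl dl) (lin A (B - A) 0 1).
  by move=> hA hB t t01; exact: hpl_seg.
 have e c d : hpl dl c -> Re (kp * d) <= 0 -> hpl dl (c + m%:R%:C * d) by move=> hc hd; exact: hpl_ray.
 have Sch : chain_in (hpl dl) (chn m).
  split; [exact: wfp_lin|exact: P|]; split; [exact: wfp_lin|exact: P|].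
  split; [exact: wfp_lin|apply: P'; exact: e|]; split; [exact: wfp_lin|exact: P|].
  split; [exact: wfp_lin|exact: P|]; split; [exact: wfp_lin|apply: P'; exact: e|exact: I].
 have cch : closed_chain (chn m).
  move=> G; rewrite /bdry !big_cons big_nil /=.
  have E0 (u v : C) : u + (0:R)%:C * v = u by rewrite rmorph0 mul0r addr0.
  have E1 (u v : C) : u + (1 : R)%:C * (v - u) = v by rewrite rmorph1 mul1r addrC subrK.
  rewrite !E1 !E0; ring.
 exact: (cint_half_plane_Cexp _ kp a _ Q Sch cch (fun w h => hpl_neq dl w dl0 h)).
apply/eqP; rewrite -subr_eq0; apply/eqP/esym; apply: clo_cst.
have l := cloD _ _ _ _ (cloB _ _ _ _ (cloB _ _ _ _ r1 r1') (cloB _ _ _ _ r2 r2')) (cloB _ _ _ _ ch ch').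
refine (eq_clo _ _ _ _ _ _ l); last by apply: nearW => m; rewrite subr0 addr0.
by apply: nearW => m; rewrite -(ch0 m) /cint !big_cons big_nil /=; ring.
Qed.
End WedgeShift.

(** A line is cut into two rays with the same starting point, which puts line contours into the form
    required by [wedge_shift]. *)
Lemma line_rays K dl c e : 0 < dl -> 0 <= K -> hpl dl c -> Re (kp * e) = 0 -> gray K c e -> gray K c (- e) ->
 cintegrable setT (fun r => F (c + r%:C * e) * e) /\ lineC c e F = rayC c e F - rayC c (- e) F.
Proof.
move=> dl0 K0 hc he g1 g2.
have he' : Re (kp * - e) = 0 by rewrite mulrN ReN he oppr0.
have le1 : Re (kp * e) <= 0 by rewrite he.
have le2 : Re (kp * - e) <= 0 by rewrite he'.
have i1 := ray_integrable_hpl K dl c e dl0 K0 hc le1 g1.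
have i2 := ray_integrable_hpl K dl c (- e) dl0 K0 hc le2 g2.
have r1 := ray_limit _ _ _ i1; have r2 := ray_limit _ _ _ i2.
have hl t : hpl dl (c + t%:C * e).
 rewrite /hpl; have -> : Re (kp * (c + t%:C * e - a)) = Re (kp * (c - a)) + t * Re (kp * e) by rewrite !ReImE; ring.
 by rewrite he mulr0 addr0.
have ii : cintegrable setT (fun r => F (c + r%:C * e) * e).
 have ig : mu.-integrable setT (EFin \o (fun t => (nc kp / dl * K * nc e) * gauss_fun t)).
  exact: scaled_integrable (@integrableT_gauss R).
 apply: (le_cintegrable _ _ _ measurableT _ ig).
  apply: cmeasM; last by split; exact: measurable_cst.
  by apply: F_cmeas => t; exact: is_cderive_cts (is_cderive_lin c e t).
 move=> r _; rewrite ncM [leRHS]mulrAC; apply: ler_wpM2r; first exact: nc_ge0.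
 apply: (F_gauss _ _ _ _ dl0 (hl r)).
 have [r0|r0] := leP 0 r; first exact: g1.
 have := g2 (- r); rewrite oppr_ge0 => /(_ (ltW r0)).
 by rewrite RCN mulrNN /gauss_fun sqrrN.
split; first exact: ii.
have l1 := line_limit _ _ 1 _ ltr01 ii.
pose chn (m : nat) : seq (C * @piece R) := [:: (1, lin c e (- (1 * m%:R)) (1 * m%:R)); (-1, lin c e 0 m%:R);
 (1, lin c (- e) 0 m%:R)].
have ch0 m : cint (chn m) F = 0.
 have m0 : 0 <= m%:R :> R by [].
 have Sch : chain_in (hpl dl) (chn m).
  split; [apply: wfp_lin; lra|by move=> t _; exact: hl|]; split; [exact: wfp_lin|by move=> t _; exact: hl|].
  split; [exact: wfp_lin| |exact: I].
  by move=> t _; have -> : pgm (lin c (- e) 0 m%:R) t = c + (- t)%:C * e; [rewrite /= RCN mulrN mulNr|exact: hl].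
 have cch : closed_chain (chn m).
  move=> G; rewrite /bdry !big_cons big_nil /=.
  have E0 (v : C) : c + (0:R)%:C * v = c by rewrite rmorph0 mul0r addr0.
  by rewrite !E0 mul1r RCN mulrN mulNr; ring.
 exact: (cint_half_plane_Cexp _ kp a _ Q Sch cch (fun w h => hpl_neq dl w dl0 h)).
have l := cloB _ _ _ _ r1 r2.
have l1' : clo (fun m => pint (lin c e 0 m%:R) F - pint (lin c (- e) 0 m%:R) F) (fun=> lineC c e F).
 refine (eq_clo _ _ _ _ _ _ l1); last exact: nearW.
 apply: nearW => m; have := ch0 m; rewrite /cint !big_cons big_nil /= => E.
 by apply/eqP; rewrite -subr_eq0 -E; apply/eqP; ring.
exact: clo_cst (clo_trans _ _ _ (clo_sym _ _ l1') l).
Qed.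

End HalfPlane.

(** * The transition kernel on the rays at angle pi/6 *)

Section Transition.
Context {R : realType}.
Local Notation C := R[i].
Lemma ray_integralE (th : R) (f : C -> C) : ray_integral th f = rayC 0 (cos th +i* sin th) f.
Proof.
rewrite /ray_integral /contour_integral /rayC; apply: eq_Cint => r _.
have E t : ((t * cos th) +i* (t * sin th) : C) = 0 + t%:C * (cos th +i* sin th).
 by complex_ring.
have -> : (fun r => (r * cos th) +i* (r * sin th)) = (fun t : R => 0 + t%:C * (cos th +i* sin th)) by apply/funext => t; exact: E.
by rewrite (is_cderive_path_deriveE _ _ _ (is_cderive_lin _ _ _)) E.
Qed.

Definition qp (k1 k2 k3 k4 : R) : {poly C} :=
 k1%:C *: 'X + k2%:C *: 'X^2 + k3%:C *: 'X^3 + k4%:C *: 'X^4.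
Lemma qpE k1 k2 k3 k4 w : (qp k1 k2 k3 k4).[w] = k1%:C * w + k2%:C * w ^+ 2 + k3%:C * w ^+ 3 + k4%:C * w ^+ 4.
Proof. by rewrite /qp !hornerD !hornerZ hornerX !hornerXn. Qed.

Lemma BfunV_qp g b a3 a4 w : (Bfun g b a3 a4 w)^-1 = Cexp (qp g (- b) (- a3) a4).[w].
Proof. by rewrite /Bfun -CexpN qpE !RCN; congr Cexp; ring. Qed.
Lemma Bfun_qp g b a3 a4 w : Bfun g b a3 a4 w = Cexp (qp (- g) b a3 (- a4)).[w].
Proof. by rewrite /Bfun qpE !RCN; congr Cexp; ring. Qed.

Lemma quartic_bound (c1 c2 c3 : R) : 0 <= c1 -> 0 <= c2 -> 0 <= c3 -> exists K : R, forall r, 0 <= r ->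
 c1 * r + c2 * r ^+ 2 + c3 * r ^+ 3 - r ^+ 4 / 8 <= K - 4 * r ^+ 2.
Proof.
move=> c10 c20 c30; pose M := 4 * c3 ^+ 2 + c2 + 4 + c1; exists (4 * M ^+ 2 + c1) => r r0.
have h1 : c3 * r ^+ 3 <= r ^+ 4 / 16 + 4 * c3 ^+ 2 * r ^+ 2.
 have := sqr_ge0 (r ^+ 2 / 4 - 2 * c3 * r).
 have -> : (r ^+ 2 / 4 - 2 * c3 * r) ^+ 2 = r ^+ 4 / 16 + 4 * c3 ^+ 2 * r ^+ 2 - c3 * r ^+ 3 by field.
 lra.
have h2 : c1 * r <= c1 * r ^+ 2 + c1.
 have : c1 * r <= c1 * (r ^+ 2 + 1).
  by apply: ler_wpM2l => //; have := sqr_ge0 (r - 1); rewrite sqrrB; have := sqr_ge0 r; lra.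
 lra.
have h3 : M * r ^+ 2 <= r ^+ 4 / 16 + 4 * M ^+ 2.
 have := sqr_ge0 (r ^+ 2 / 4 - 2 * M).
 have -> : (r ^+ 2 / 4 - 2 * M) ^+ 2 = r ^+ 4 / 16 + 4 * M ^+ 2 - M * r ^+ 2 by field.
 lra.
by move: h3; rewrite {1}/M; lra.
Qed.

(** Between the angles pi/6 and pi/3, in each quadrant, the argument of w^4 stays within pi/3 of
    pi. *)
Lemma sector_quartic (w : C) : Re w ^+ 2 <= 3 * Im w ^+ 2 -> Im w ^+ 2 <= 3 * Re w ^+ 2 ->
 Re (w ^+ 4) <= - (nc w ^+ 4 / 2).
Proof.
move=> h1 h2; have -> : nc w ^+ 4 = (Re w ^+ 2 + Im w ^+ 2) ^+ 2 by rewrite (exprM _ 2 2) nc_sq.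
have -> : Re (w ^+ 4) = (Re w ^+ 2) ^+ 2 - 6 * Re w ^+ 2 * Im w ^+ 2 + (Im w ^+ 2) ^+ 2.
 by rewrite !exprS expr0 !ReImE; ring.
have := sqr_ge0 (Re w); have := sqr_ge0 (Im w); move: (Re w ^+ 2) (Im w ^+ 2) h1 h2 => x y h1 h2 y0 x0.
have : 0 <= (3 * x - y) * (3 * y - x) by rewrite mulr_ge0//; lra.
by rewrite !expr2; lra.
Qed.

Lemma qp_sector k1 k2 k3 : exists2 K : R, 0 <= K & forall w,
 Re w ^+ 2 <= 3 * Im w ^+ 2 -> Im w ^+ 2 <= 3 * Re w ^+ 2 ->
 nc (Cexp (qp k1 k2 k3 4^-1).[w]) <= K * expR (- (4 * nc w ^+ 2)).
Proof.
have [K HK] := quartic_bound `|k1| `|k2| `|k3| (normr_ge0 _) (normr_ge0 _) (normr_ge0 _).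
exists (expR K) => [|w h1 h2]; first exact: expR_ge0.
rewrite -expRD nc_Cexp ler_expR; apply: le_trans (HK (nc w) (nc_ge0 w)).
rewrite qpE.
have T (k : R) (j : nat) : Re (k%:C * w ^+ j) <= `|k| * nc w ^+ j.
 by rewrite (le_trans (ler_norm _))// (le_trans (nc_Re _))// ncCX.
have h4 := sector_quartic w h1 h2; have T1 := T k1 1; rewrite !expr1 in T1.
have T2 := T k2 2; have T3 := T k3 3.
rewrite !ReD; have -> : Re ((4^-1)%:C * w ^+ 4) = 4^-1 * Re (w ^+ 4) by rewrite ReMC.
lra.
Qed.

Section Rotation.
Variables (k1 k2 k3 t s s' h : R).
Hypotheses (t0 : t != 0) (s1 : s ^+ 2 = 1) (s1' : s' ^+ 2 = 1) (h0 : 0 < h) (h2 : h ^+ 2 = 1 / 2).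
Let e := (s * (sq3 / 2)) +i* (s' * (1 / 2)) : C.
Let e' := (s * h) +i* (s' * h) : C.
Let G (w : C) : C := Cexp (qp k1 k2 k3 4^-1).[w] / (imag t - w).

Let ns : `|s| = 1. Proof. by apply/eqP; rewrite -(@eqrXn2 _ 2)// real_normK ?num_real// s1 expr1n. Qed.
Let ns' : `|s'| = 1. Proof. by apply/eqP; rewrite -(@eqrXn2 _ 2)// real_normK ?num_real// s1' expr1n. Qed.
(** A normal separating the pole on the imaginary axis from the closed sector swept by the rotation,
    whatever the signs. *)
Let kp : C := (- s) +i* (- Num.sg t).
Let kd (x y : R) : 0 <= y -> y <= x -> Re (kp * ((s * x) +i* (s' * y))) <= 0.
Proof.
move=> y0 xy; rewrite !ReImE.
have -> : - s * (s * x) - - Num.sg t * (s' * y) = - (s ^+ 2) * x + (Num.sg t * s') * y by ring.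
have : Num.sg t * s' <= 1 by rewrite (le_trans (ler_norm _))// normrM ns' mulr1 normr_sg t0.
by rewrite s1 => /(ler_wpM2r y0); lra.
Qed.

Let hle : h <= sq3 / 2.
Proof.
rewrite -(@ler_pXn2r _ 2)// ?nnegrE ?(ltW h0) ?divr_ge0 ?sqrtr_ge0// h2 sq3_sq; lra.
Qed.
Let hge : 1 / 2 <= h.
Proof. by rewrite -(@ler_pXn2r _ 2)// ?nnegrE ?(ltW h0)// h2; lra. Qed.

Let hp0 : hpl (imag t) kp `|t| 0.
Proof.
rewrite /hpl sub0r mulrN ReN lerN2 ReM /kp /imag !ReK !ImK.
by rewrite mulr0 sub0r mulNr opprK -normrEsg.
Qed.

(** The rotation from angle pi/6 to pi/4 sweeps a sector of quartic decay that contains no pole: the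
    pole is on the imaginary axis. *)
Lemma rotate_ray : cintegrable pos_half (fun r => G (0 + r%:C * e') * e') /\ rayC 0 e' G = rayC 0 e G.
Proof.
have [K K0 HK] := qp_sector k1 k2 k3.
have dl0 : 0 < `|t| by rewrite normr_gt0.
have ns2 : s ^+ 2 = 1 /\ s' ^+ 2 = 1 by [].
have gr (x y : R) : x ^+ 2 <= 3 * y ^+ 2 -> y ^+ 2 <= 3 * x ^+ 2 -> x ^+ 2 + y ^+ 2 = 1 ->
  gray (qp k1 k2 k3 4^-1) K 0 ((s * x) +i* (s' * y)).
 move=> xy yx xy1 r r0; rewrite add0r.
 have E1 : Re (r%:C * ((s * x) +i* (s' * y))) ^+ 2 = r ^+ 2 * x ^+ 2.
  rewrite !ReImE; have -> : (r * (s * x) - 0 * (s' * y)) ^+ 2 = s ^+ 2 * (r ^+ 2 * x ^+ 2) by ring.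
  by rewrite s1 mul1r.
 have E2 : Im (r%:C * ((s * x) +i* (s' * y))) ^+ 2 = r ^+ 2 * y ^+ 2.
  rewrite !ReImE; have -> : (r * (s' * y) + 0 * (s * x)) ^+ 2 = s' ^+ 2 * (r ^+ 2 * y ^+ 2) by ring.
  by rewrite s1' mul1r.
 have r2 := sqr_ge0 r.
 apply: le_trans (HK _ _ _) _; [by rewrite E1 E2 [leRHS]mulrCA; apply: ler_wpM2l|by rewrite E1 E2 [leRHS]mulrCA; apply: ler_wpM2l|].
 apply: ler_wpM2l => //; rewrite /gauss_fun ler_expR nc_sq E1 E2 -mulrDr xy1 mulr1.
 by have := sqr_ge0 r; lra.
have g1 : gray (qp k1 k2 k3 4^-1) K 0 e.
 by apply: gr; rewrite ?sq3_sq ?half_sq; lra.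
have g2 : gray (qp k1 k2 k3 4^-1) K 0 e'.
 by apply: gr; rewrite h2; lra.
have kpe : Re (kp * e) <= 0 by apply: kd => //; apply: ltW; exact: sq3_gt.
have kpe' : Re (kp * e') <= 0 by apply: kd => //; exact: ltW.
have E (m r : R) : 0 + m%:C * e + r%:C * ((0 + m%:C * e') - (0 + m%:C * e)) =
  (s * (m * ((1 - r) * (sq3 / 2) + r * h))) +i* (s' * (m * ((1 - r) * (1 / 2) + r * h))).
 by complex_ring.
have c1 : clo (fun m => pint (lin (0 + m%:R%:C * e) ((0 + m%:R%:C * e') - (0 + m%:R%:C * e)) 0 1) G) (fun=> 0).
 apply: (chord_small_hpl _ _ kp (fun m => 0 + m%:R%:C * e) (fun m => 0 + m%:R%:C * e') K (nc (e' - e)) 1 `|t| 0) => //.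
  exact: nc_ge0.
 move=> m _; have m0 : 0 <= m%:R :> R by [].
 split; [exact: hpl_ray|exact: hpl_ray| |].
  by rewrite !add0r -mulrBr ncM ncC ger0_norm// mulrC.
 move=> r /andP[r0 r1]; rewrite E.
 set x := (1 - r) * (sq3 / 2) + r * h; set y := (1 - r) * (1 / 2) + r * h.
 have p1 : 0 <= r * (h - 1 / 2) by rewrite mulr_ge0// subr_ge0.
 have p2 : 0 <= (1 - r) * (sq3 / 2 - 1 / 2).
  by rewrite mulr_ge0 ?subr_ge0//; exact: ltW (sq3_gt (R := R)).
 have q1 : 1 / 2 <= y by rewrite /y; lra.
 have q2 : y <= x by rewrite /x /y; lra.
 have q3 : x ^+ 2 <= 3 * y ^+ 2.
  have : x <= sq3 * y.
   have s3 : 1 <= (sq3 : R) by have := sq3_gt (R := R); lra.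
   by rewrite /x /y; have : r * h <= sq3 * (r * h); [rewrite ler_peMl// mulr_ge0// ltW|lra].
  move=> xy; have -> : 3 * y ^+ 2 = (sq3 * y) ^+ 2 by rewrite exprMn /sq3 sqr_sqrtr.
  by rewrite lerXn2r ?nnegrE//; lra.
 have q4 : y ^+ 2 <= 3 * x ^+ 2.
  have : y ^+ 2 <= x ^+ 2 by rewrite lerXn2r ?nnegrE//; lra.
  have := sqr_ge0 x; lra.
 have E1 : (s * (m%:R * x)) ^+ 2 = m%:R ^+ 2 * x ^+ 2 by rewrite !exprMn s1 mul1r.
 have E2 : (s' * (m%:R * y)) ^+ 2 = m%:R ^+ 2 * y ^+ 2 by rewrite !exprMn s1' mul1r.
 have r2 := sqr_ge0 (m%:R : R).
 apply: le_trans (HK _ _ _) _; [by rewrite ReK ImK E1 E2 [leRHS]mulrCA; apply: ler_wpM2l|by rewrite ReK ImK E1 E2 [leRHS]mulrCA; apply: ler_wpM2l|].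
 apply: ler_wpM2l => //; rewrite ler_expR nc_sq ReK ImK E1 E2 -mulrDr lerN2 mul1r.
 have k : 1 / 2 <= x ^+ 2 + y ^+ 2.
  by have : (1 / 2) ^+ 2 <= y ^+ 2; [rewrite lerXn2r ?nnegrE//; lra|rewrite half_sq; have : y ^+ 2 <= x ^+ 2; [rewrite lerXn2r ?nnegrE//; lra|lra]].
 have : m%:R ^+ 2 * (1 / 2) <= m%:R ^+ 2 * (x ^+ 2 + y ^+ 2) by apply: ler_wpM2l => //; exact: sqr_ge0.
 have := sqr_ge0 (m%:R : R); lra.
(* A single ray is rotated, so the second ray of both wedges is the same and its chord is
   degenerate. *)
have c2 : clo (fun m => pint (lin (0 + m%:R%:C * e') ((0 + m%:R%:C * e') - (0 + m%:R%:C * e')) 0 1) G) (fun=> 0).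
 apply: eq_clo (clo_refl (fun=> 0)); apply: nearW => m //.
 by rewrite subrr /pint /= (eq_Cint _ _ (fun=> 0)) ?Cint0// => r _; rewrite mulr0.
have := wedge_shift _ _ kp 0 0 e e' e' e' K `|t| dl0 K0 hp0 hp0 kpe kpe' kpe' kpe' g1 g2 g2 g2 c1 c2.
rewrite subrr => /eqP; rewrite subr_eq0 => /eqP <-; split => //.
exact: (ray_integrable_hpl _ _ kp K `|t| 0 e' dl0 K0 hp0 kpe' g2).
Qed.

Lemma rotate_rayZ (c : C) (ee ee' : C) : ee = e -> ee' = e' ->
 rayC 0 ee' (fun w => c * G w) = c * rayC 0 ee G.
Proof.
move=> -> ->; have [i1 <-] := rotate_ray.
rewrite /rayC -(CintZ _ _ _ measurable_pos_half i1); apply: eq_Cint => r _; rewrite /=; ring.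
Qed.

End Rotation.
Lemma quarter_pi : [/\ 0 < cos (pi / 4 : R), cos (pi / 4 : R) ^+ 2 = 1 / 2 & sin (pi / 4 : R) = cos (pi / 4)].
Proof.
have p0 := pi_gt0 R.
have E : sin (pi / 4 : R) = cos (pi / 4).
 by rewrite -cosBpihalf -cosN; congr cos; field.
split => //; first by apply: cos_gt0_pihalf; apply/andP; split; lra.
by have := cos2Dsin2 (pi / 4 : R); rewrite E; lra.
Qed.

(** Domination comes from the quartic coefficient 1/4, the quadratic ones -t/2 having any sign. The
    orientation of the four rays matches that of the two triangles. *)
Lemma transition_L4 (a t1 t2 u v : R) :
 vline_integral 0 (fun zeta => pearcey_Gamma_integral (fun omega =>
  Cexp (- (zeta ^+ 4 / 4) + a%:C * zeta ^+ 3 / 3 - t2%:C * zeta ^+ 2 / 2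
     - v%:C * zeta
     + omega ^+ 4 / 4 - a%:C * omega ^+ 3 / 3 + t1%:C * omega ^+ 2 / 2
     + u%:C * omega)
  / (zeta - omega))) =
 L4 (Bfun v (- (t2 / 2)) (a / 3) 4^-1) (fun w => (Bfun u (- (t1 / 2)) (a / 3) 4^-1 w)^-1).
Proof.
pose M := `|u| + `|v| + `|t1| + `|t2|.
have M0 : 0 <= M by rewrite !addr_ge0.
have a4 : 0 < 4^-1 :> R by [].
have [K [d0 [d0p HK]]] := qdom_quartic M 4^-1 M0 a4.
have bnd (x y : R) : `|x| <= M -> - M <= - (x / 2).
 by rewrite ler_norml => /andP[]; have := M0; lra.
have n1 := normr_ge0 u; have n2 := normr_ge0 v; have n3 := normr_ge0 t1; have n4 := normr_ge0 t2.
have hK : gdom4 (expR (2 * K)) (Bfun v (- (t2 / 2)) (a / 3) 4^-1) (fun w => (Bfun u (- (t1 / 2)) (a / 3) 4^-1 w)^-1).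
 apply: (Bfun_gdom4 _ _ M K) => //; rewrite /M; try lra.
  by apply: HK; [apply: bnd; rewrite // /M; lra|lra|lra|exact: ltW].
 by apply: HK; [apply: bnd; rewrite // /M; lra|lra|lra|exact: ltW].
rewrite vline_integralE; apply: (L4_off0 _ _ _ _ hK) => t t0.
have -> : (0:R)%:C + t%:C * (0 +i* 1) = imag t :> C by rewrite imagE rmorph0 add0r.
congr (_ * _); rewrite /pearcey_Gamma_integral !ray_integralE.
set G := fun w : C => Cexp (qp u (t1 / 2) (- (a / 3)) 4^-1).[w] / (imag t - w).
have -> : (fun omega : C => Cexp (- (imag t ^+ 4 / 4) + a%:C * imag t ^+ 3 / 3 - t2%:C * imag t ^+ 2 / 2
   - v%:C * imag t + omega ^+ 4 / 4 - a%:C * omega ^+ 3 / 3 + t1%:C * omega ^+ 2 / 2 + u%:C * omega)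
   / (imag t - omega)) = (fun w => Bfun v (- (t2 / 2)) (a / 3) 4^-1 (imag t) * G w).
 apply/funext => w; rewrite /G mulrA; congr (_ / _); rewrite Bfun_qp -CexpD !qpE; congr Cexp.
 by rewrite !(RCN, RCM) !RCV !RCnat; field.
have -> : (fun w => (Bfun u (- (t1 / 2)) (a / 3) 4^-1 w)^-1 / (imag t - w)) = G.
 by apply/funext => w; rewrite BfunV_qp opprK.
have [h0 h2 hs] := quarter_pi; set h := cos (pi / 4) in h0 h2 hs.
have sP : (1 : R) ^+ 2 = 1 by rewrite expr1n.
have sN : (-1 : R) ^+ 2 = 1 by rewrite sqrrN expr1n.
have rot s s' (s1 : s ^+ 2 = 1) (s1' : s' ^+ 2 = 1) := rotate_rayZ u (t1 / 2) (- (a / 3)) t s s' h t0 s1 s1' h0 h2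
 (Bfun v (- (t2 / 2)) (a / 3) 4^-1 (imag t)).
have p3 : 3 * pi / 4 = pi / 4 + pi / 2 :> R by field.
have c3 : cos (3 * pi / 4 : R) = - h by rewrite p3 cosDpihalf hs.
have s3 : sin (3 * pi / 4 : R) = h by rewrite p3 sinDpihalf.
rewrite !cosN !sinN c3 s3 hs -/h /rays4 !rmorph0.
rewrite (rot 1 (-1) sP sN ((sq3 / 2) +i* (- (1 / 2))) (h +i* (- h))); [|by rewrite !mul1r mulN1r|by rewrite mul1r mulN1r].
rewrite (rot (-1) 1 sN sP (- ((sq3 / 2) +i* (- (1 / 2)))) ((- h) +i* h)); [| |by rewrite mul1r mulN1r]; last first.
 by apply: complexP; rewrite !ReImE ?opprK; ring.
rewrite (rot 1 1 sP sP ((sq3 / 2) +i* (1 / 2)) (h +i* h)); [|by rewrite !mul1r|by rewrite !mul1r].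
rewrite (rot (-1) (-1) sN sN (- ((sq3 / 2) +i* (1 / 2))) ((- h) +i* (- h))); [| |by rewrite !mulN1r]; last first.
 by complex_ring.
by ring.
Qed.

End Transition.

(** * Cubic decay along the contours of the Airy kernel *)

Section AiryContours.
Context {R : realType}.
Local Notation C := R[i].
(** Twice the angle is pi minus the angle, so the cosine c solves 2 c^2 - 1 = - c. *)
Lemma third_pi : cos (pi / 3 : R) = 1 / 2 /\ sin (pi / 3 : R) = sq3 / 2.
Proof.
have p0 := pi_gt0 R.
have E : pi / 3 + pi / 3 = pi - pi / 3 :> R by field.
have c0 : 0 < cos (pi / 3 : R) by apply: cos_gt0_pihalf; apply/andP; split; lra.
have s0 : 0 < sin (pi / 3 : R) by apply: sin_gt0_pi; apply/andP; split; lra.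
have cs := cos2Dsin2 (pi / 3 : R).
have := cosD (pi / 3 : R) (pi / 3); rewrite E cosB cospi sinpi.
move: (cos _) (sin _) c0 s0 cs => c s c0 s0 cs h.
have c2 : (2 * c - 1) * (c + 1) = 0 by rewrite !expr2 in cs; nra.
have cE : c = 1 / 2.
 by move/eqP: c2; rewrite mulf_eq0 => /orP[/eqP|/eqP]; lra.
split => //; apply/eqP; rewrite -(@eqrXn2 _ 2)//; [|exact: ltW|by rewrite divr_ge0 ?sqrtr_ge0].
by rewrite sq3_sq; apply/eqP; move: cs; rewrite cE half_sq; lra.
Qed.

Lemma sq3_bounds : [/\ 0 < (sq3 : R), (sq3 : R) ^+ 2 = 3, 17/10 <= (sq3 : R) & (sq3 : R) <= 7/4].
Proof.
have s0 : 0 < (sq3 : R) by rewrite sqrtr_gt0.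
have s2 : (sq3 : R) ^+ 2 = 3 by rewrite sqr_sqrtr.
by split => //; rewrite -(@ler_pXn2r _ 2)// ?nnegrE ?(ltW s0)// s2; lra.
Qed.

Section CubicBounds.
Variables (M c k1 k2 k3 : R).
Hypotheses (hc : 72 * M + 12 <= c) (b1 : `|k1| <= M) (b2 : `|k2| <= M).
Let M0 : 0 <= M. Proof. exact: le_trans b1. Qed.

(** The constant terms left in [cub_ray] once (c + r)^2 is bounded by 2 c^2 + 2 r^2 and r by r^2 +
    1. *)
Definition cubK : R := 2 * c ^+ 3 + 2 * M * c ^+ 2 + M * c + M.

Let low (w : C) : Re (qp k1 k2 k3 0).[w] <= M * nc w + M * nc w ^+ 2 + k3 * Re (w ^+ 3).
Proof.
rewrite qpE rmorph0 mul0r addr0 !ReD.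
have T (k : R) (j : nat) : `|k| <= M -> Re (k%:C * w ^+ j) <= M * nc w ^+ j.
 move=> kM; rewrite (le_trans (ler_norm _))// (le_trans (nc_Re _))// ncCX ler_wpM2r//.
 by rewrite exprn_ge0// nc_ge0.
have T1 := T k1 1 b1; rewrite !expr1 in T1; have T2 := T k2 2 b2.
by have -> : Re (k3%:C * w ^+ 3) = k3 * Re (w ^+ 3); [rewrite ReMC|lra].
Qed.

Lemma cub_ray (w : C) r : 0 <= r -> nc w <= c + r -> k3 * Re (w ^+ 3) <= 2 * c ^+ 3 - c * r ^+ 2 / 4 ->
 nc (Cexp (qp k1 k2 k3 0).[w]) <= expR cubK * gauss_fun r.
Proof.
move=> r0 wr h; rewrite gaussE -expRD nc_Cexp ler_expR (le_trans (low w))//.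
have m0 := M0; have hc' := hc; have c0 : 0 <= c by lra.
have n0 := nc_ge0 w.
have h1 : M * nc w <= M * (c + r) by apply: ler_wpM2l.
have h2 : M * nc w ^+ 2 <= M * (c + r) ^+ 2.
 by apply: ler_wpM2l => //; rewrite lerXn2r ?nnegrE// addr_ge0.
have h3 : M * (c + r) ^+ 2 <= M * (2 * c ^+ 2 + 2 * r ^+ 2).
 by apply: ler_wpM2l => //; have := sqr_ge0 (c - r); rewrite sqrrB sqrrD; lra.
have h4 : M * r <= M * (r ^+ 2 + 1).
 by apply: ler_wpM2l => //; have := sqr_ge0 (r - 1); rewrite sqrrB; have := sqr_ge0 r; lra.
have h5 : (12 * M + 4) * r ^+ 2 <= c * r ^+ 2 by apply: ler_wpM2r; [exact: sqr_ge0|lra].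
by rewrite /cubK; lra.
Qed.

(** Origin of the threshold on [c]: linear and quadratic terms cost at most 6 M m^2, so c m^2/12 has
    to exceed (6 M + 1) m^2. *)
Lemma cub_chord (w : C) m : 1 <= m -> nc w <= 2 * m -> k3 * Re (w ^+ 3) <= - (c * m ^+ 2 / 12) ->
 nc (Cexp (qp k1 k2 k3 0).[w]) <= 1 * expR (- (1 * m ^+ 2)).
Proof.
move=> m1 wr h; rewrite mul1r nc_Cexp ler_expR (le_trans (low w))//.
have m0 := M0; have hc' := hc; have n0 := nc_ge0 w.
have h1 : M * nc w <= M * (2 * m ^+ 2).
 apply: ler_wpM2l => //; rewrite (le_trans wr)// ler_wpM2l// expr2 ler_peMl//; lra.
have h2 : M * nc w ^+ 2 <= M * (2 * m) ^+ 2.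
 by apply: ler_wpM2l => //; rewrite lerXn2r ?nnegrE//; lra.
have h5 : (72 * M + 12) * m ^+ 2 <= c * m ^+ 2 by apply: ler_wpM2r => //; exact: sqr_ge0.
by move: h2; rewrite exprMn; lra.
Qed.
End CubicBounds.

Lemma nc_unit (x y : R) : x ^+ 2 + y ^+ 2 = 1 -> nc (x +i* y) = 1.
Proof. by move=> h; rewrite ncE ReK ImK h sqrtr1. Qed.

Lemma nc_le_xy (x y b : R) : 0 <= x + b -> x <= b -> 0 <= y + b -> y <= b -> nc (x +i* y) <= 2 * b.
Proof.
move=> h1 h2 h3 h4; rewrite (le_trans (nc_le _))// ReK ImK.
have : `|x| <= b by rewrite ler_norml; apply/andP; split; lra.
have : `|y| <= b by rewrite ler_norml; apply/andP; split; lra.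
lra.
Qed.

Section Contours.
Variables (M c : R).
Hypotheses (M0 : 0 <= M) (hc : 72 * M + 12 <= c).
Let c0 : 0 < c. Proof. have := M0; have := hc; lra. Qed.
Let c12 : 12 <= c. Proof. have := M0; have := hc; lra. Qed.
Let q3 := sq3_bounds.

Let third (x y : R) : x ^+ 2 = 1 / 4 -> y ^+ 2 = 3 / 4 -> Re ((x +i* y) ^+ 3) = x * (1 / 4 - 9 / 4).
Proof.
move=> hx hy; have -> : Re ((x +i* y) ^+ 3) = x * (x ^+ 2 - 3 * y ^+ 2) by rewrite !exprS expr0 !ReImE; ring.
by rewrite hx hy; congr (_ * _); lra.
Qed.

Let cubic_ineq r : 0 <= r -> - (r ^+ 3 / 3) <= 2 * c ^+ 3 - c * r ^+ 2 / 4.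
Proof.
move=> r0; have : 0 <= (r - 2 * c) ^+ 2 * (r + c) by rewrite mulr_ge0 ?sqr_ge0// addr_ge0// ltW.
have -> : (r - 2 * c) ^+ 2 * (r + c) = r ^+ 3 - 3 * c * r ^+ 2 + 4 * c ^+ 3 by ring.
have : 0 <= c * r ^+ 2 by rewrite mulr_ge0 ?sqr_ge0// ltW.
have : 0 <= c ^+ 3 by rewrite exprn_ge0// ltW.
lra.
Qed.

Section Poly.
Variables (k1 k2 : R).
Hypotheses (b1 : `|k1| <= M) (b2 : `|k2| <= M).
Let p := qp k1 k2 (1 / 3) 0.
Let q := qp k1 k2 (- (1 / 3)) 0.
Let K := expR (cubK M c).

(** At the angles pi/3 and 2 pi/3 the cube is real and has the right sign, so the decay is cubic;
    [cubic_ineq] weakens it to the quadratic decay common to all contours. *)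
Lemma gray_center (x y k3 : R) (k3E : k3 = 1/3 \/ k3 = - (1/3)) : x ^+ 2 = 1 / 4 -> y ^+ 2 = 3 / 4 -> 0 <= k3 * x ->
 gray (qp k1 k2 k3 0) K 0 (x +i* y).
Proof.
move=> hx hy kx r r0; rewrite add0r; apply: (cub_ray M c) => //.
 by rewrite ncM ncC ger0_norm// nc_unit ?mulr1 ?lerDr ?(ltW c0)// hx hy; lra.
rewrite exprMn -RCX ReMC third//.
have x12 : k3 * x = 1 / 6.
  apply/eqP; rewrite -(@eqrXn2 _ 2)//; apply/eqP.
  by rewrite exprMn hx; case: k3E => ->; rewrite ?sqrrN; field.
have := cubic_ineq r r0.
have -> : k3 * (r ^+ 3 * (x * (1 / 4 - 9 / 4))) = (k3 * x) * r ^+ 3 * (- 2) by field.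
by rewrite x12; lra.
Qed.

(** At angle pi/6 the pure cube contributes nothing; the decay comes from the mixed term 3 c (r
    e)^2, whose real part is positive. *)
Lemma gray_q_side (x y : R) : x ^+ 2 = 3 / 4 -> y ^+ 2 = 1 / 4 -> gray q K c%:C (x +i* y).
Proof.
move=> hx hy r r0; apply: (cub_ray M c) => //.
 by rewrite (le_trans (ncD _ _))// ncM !ncC !ger0_norm ?(ltW c0)// nc_unit ?mulr1// hx hy; lra.
have -> : Re ((c%:C + r%:C * (x +i* y)) ^+ 3) = c ^+ 3 + 3 * c ^+ 2 * r * x + 3 * c * r ^+ 2 * (x ^+ 2 - y ^+ 2) +
  r ^+ 3 * x * (x ^+ 2 - 3 * y ^+ 2) by rewrite !exprS expr0 !ReImE; ring.
rewrite hx hy (_ : 3 / 4 - 3 * (1 / 4) = 0 :> R); last by field.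
rewrite mulr0 addr0.
have xb : - x <= 1.
 have := sqr_ge0 (x + 1); rewrite sqrrD hx; lra.
have h1 : - x * (c ^+ 2 * r) <= 1 * (c ^+ 2 * r) by apply: ler_wpM2r => //; rewrite mulr_ge0 ?sqr_ge0.
have : 0 <= c * (r / 2 - c) ^+ 2 by rewrite mulr_ge0 ?sqr_ge0// ltW.
have -> : c * (r / 2 - c) ^+ 2 = c * r ^+ 2 / 4 - c ^+ 2 * r + c ^+ 3 by field.
have : 0 <= c ^+ 3 by rewrite exprn_ge0// ltW.
lra.
Qed.

Lemma gray_p_line (y : R) : y ^+ 2 = 1 -> gray p K c%:C (0 +i* y).
Proof.
move=> hy r r0; apply: (cub_ray M c) => //.
 by rewrite (le_trans (ncD _ _))// ncM !ncC !ger0_norm ?(ltW c0)// nc_unit ?mulr1// hy expr0n add0r.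
have -> : Re ((c%:C + r%:C * (0 +i* y)) ^+ 3) = c ^+ 3 - 3 * c * r ^+ 2 * y ^+ 2 by rewrite !exprS expr0 !ReImE; ring.
rewrite hy; have : 0 <= c ^+ 3 by rewrite exprn_ge0// ltW.
have : 0 <= c * r ^+ 2 by rewrite mulr_ge0 ?sqr_ge0// ltW.
lra.
Qed.

(* s is the sign of the imaginary part. *)
Lemma chord_q_right m r : 8 * c <= m -> 0 <= r <= 1 ->
 nc (Cexp q.[(c%:C + m%:C * ((sq3 / 2) +i* (- (1 / 2)))) + r%:C * ((c%:C + m%:C * ((sq3 / 2) +i* (1 / 2))) - (c%:C + m%:C * ((sq3 / 2) +i* (- (1 / 2)))))])
 <= 1 * expR (- (1 * m ^+ 2)).
Proof.
move=> cm /andP[r0 r1]; have [s0 s2 sl su] := q3; have c12' := c12; have m0 : 0 < m by lra.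
have -> : (c%:C + m%:C * ((sq3 / 2) +i* (- (1 / 2)))) + r%:C * ((c%:C + m%:C * ((sq3 / 2) +i* (1 / 2))) - (c%:C + m%:C * ((sq3 / 2) +i* (- (1 / 2)))))
  = (c + m * (sq3 / 2)) +i* (m * (r - 1 / 2)) by apply: complexP; rewrite !ReImE; field.
apply: (cub_chord M c) => //; first by lra.
 have h1 : m * sq3 <= m * (7 / 4) by rewrite ler_wpM2l// ltW.
 have h2 : 0 <= m * sq3 by rewrite mulr_ge0// ltW.
 have h3 : 0 <= m * r by rewrite mulr_ge0// ltW.
 have h4 : m * r <= m * 1 by rewrite ler_wpM2l// ltW.
 apply: nc_le_xy; lra.
set y := r - 1 / 2; have y2 : y ^+ 2 <= 1 / 4.
 by rewrite /y; have : 0 <= r * (1 - r); [rewrite mulr_ge0// subr_ge0|lra].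
have -> : Re (((c + m * (sq3 / 2)) +i* (m * y)) ^+ 3) = c ^+ 3 + 3 * c ^+ 2 * m * (sq3 / 2) + 3 * c * m ^+ 2 * ((sq3 / 2) ^+ 2 - y ^+ 2) +
  m ^+ 3 * (sq3 / 2) * ((sq3 / 2) ^+ 2 - 3 * y ^+ 2) by rewrite !exprS expr0 !ReImE; ring.
rewrite sq3_sq.
have p1 : 0 <= c ^+ 3 by rewrite exprn_ge0// ltW.
have p2 : 0 <= 3 * c ^+ 2 * m * (sq3 / 2) by rewrite !mulr_ge0 ?sqr_ge0// ?divr_ge0 ltW.
have p3 : 0 <= c * m ^+ 2 * (1 / 4 - y ^+ 2).
 by apply: mulr_ge0; [apply: mulr_ge0; [exact: ltW|exact: sqr_ge0]|rewrite subr_ge0].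
have p4 : 0 <= m ^+ 3 * (sq3 / 2) * (3 / 4 - 3 * y ^+ 2).
 apply: mulr_ge0; last lra.
 by apply: mulr_ge0; [rewrite exprn_ge0// ltW|rewrite divr_ge0// ltW].
have p5 : 0 <= c * m ^+ 2 by rewrite !mulr_ge0 ?sqr_ge0// ltW.
lra.
Qed.

Lemma chord_q_left s m r : s ^+ 2 = 1 -> 4 * c <= m -> 0 <= r <= 1 ->
 nc (Cexp q.[(c%:C + m%:C * ((- (sq3 / 2)) +i* (s * (1 / 2)))) + r%:C * ((0 + m%:C * ((- (1 / 2)) +i* (s * (sq3 / 2)))) -
   (c%:C + m%:C * ((- (sq3 / 2)) +i* (s * (1 / 2)))))]) <= 1 * expR (- (1 * m ^+ 2)).
Proof.
move=> ss cm /andP[r0 r1]; have [s0 s2 sl su] := q3; have c12' := c12; have m0 : 0 < m by lra.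
pose X := m * ((1 - r) * (sq3 / 2) + r / 2) - (1 - r) * c.
pose Y := m * ((1 - r) * (1 / 2) + r * (sq3 / 2)).
have -> : (c%:C + m%:C * ((- (sq3 / 2)) +i* (s * (1 / 2)))) + r%:C * ((0 + m%:C * ((- (1 / 2)) +i* (s * (sq3 / 2)))) -
   (c%:C + m%:C * ((- (sq3 / 2)) +i* (s * (1 / 2))))) = (- X) +i* (s * Y).
 by rewrite /X /Y; apply: complexP; rewrite !ReImE; field.
apply: (cub_chord M c) => //; first by lra.
 have h1 : m * ((1 - r) * sq3) <= m * ((1 - r) * (7 / 4)).
  by apply: ler_wpM2l; [exact: ltW|apply: ler_wpM2l => //; lra].
 have h2 : m * (r * sq3) <= m * (r * (7 / 4)).
  by apply: ler_wpM2l; [exact: ltW|apply: ler_wpM2l => //; lra].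
 have h3 : 0 <= m * ((1 - r) * sq3).
  by apply: mulr_ge0; [exact: ltW|apply: mulr_ge0; lra].
 have h4 : 0 <= m * (r * sq3).
  by apply: mulr_ge0; [exact: ltW|apply: mulr_ge0; lra].
 have h5 : 0 <= (1 - r) * c by apply: mulr_ge0; lra.
 have h6 : (1 - r) * c <= 1 * c by apply: ler_wpM2r; lra.
 have h7 : 0 <= m * r by apply: mulr_ge0; lra.
 have h8 : m * r <= m * 1 by apply: ler_wpM2l; lra.
 have X1 : 0 <= X + m by rewrite /X; lra.
 have X2 : X <= m by rewrite /X; lra.
 have X3 : - X <= m by rewrite /X; lra.
 have Y1 : 0 <= Y + m by rewrite /Y; lra.
 have Y2 : Y <= m by rewrite /Y; lra.
 have Y3 : - Y <= m by rewrite /Y; lra.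
 move/eqP: ss; rewrite sqrf_eq1 => /orP[] /eqP ->; apply: nc_le_xy; lra.
have -> : Re (((- X) +i* (s * Y)) ^+ 3) = - X ^+ 3 + 3 * X * s ^+ 2 * Y ^+ 2 by rewrite !exprS expr0 !ReImE; ring.
rewrite ss mulr1.
(* The real part of a cube factors along the three lines where it vanishes; along the chord each
   factor is bounded below, by m/4, c and m. *)
have E : - X ^+ 3 + 3 * X * Y ^+ 2 = X * (sq3 * Y - X) * (X + sq3 * Y).
 by rewrite -s2; ring.
have f1 : sq3 * Y - X = m * r + (1 - r) * c.
 have -> : sq3 * Y - X = m * r * (sq3 ^+ 2 - 1) / 2 + (1 - r) * c by rewrite /X /Y; field.
 by rewrite s2; field.
have g1 : c <= sq3 * Y - X.
 by rewrite f1; have : 0 <= r * (m - c); [rewrite mulr_ge0//; lra|lra].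
have rc : 0 <= r * c by rewrite mulr_ge0// ltW.
have g2 : m / 4 <= X.
 have : 0 <= m * ((1 - r) * (sq3 / 2 - 1 / 2)).
  by apply: mulr_ge0; [exact: ltW|apply: mulr_ge0; lra].
 by rewrite /X; lra.
have g3 : m <= X + sq3 * Y.
 have h1 : sq3 * (m / 2) <= sq3 * Y.
  apply: ler_wpM2l; first exact: ltW.
  have : 0 <= m * (r * (sq3 / 2 - 1 / 2)).
   by apply: mulr_ge0; [exact: ltW|apply: mulr_ge0; lra].
  by rewrite /Y; lra.
 have h2 : 17 / 10 * (m / 2) <= sq3 * (m / 2) by apply: ler_wpM2r => //; lra.
 lra.
have big : (m / 4) * c * m <= X * (sq3 * Y - X) * (X + sq3 * Y).
 apply: ler_pM => //; [by rewrite mulr_ge0 ?divr_ge0 ?ltW|exact: ltW|apply: ler_pM => //].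
  by rewrite divr_ge0// ltW.
 exact: ltW.
rewrite E; rewrite expr2; lra.
Qed.

Lemma chord_p s m r : s ^+ 2 = 1 -> 2 * c <= m -> 0 <= r <= 1 ->
 nc (Cexp p.[(c%:C + m%:C * (0 +i* s)) + r%:C * ((0 + m%:C * ((1 / 2) +i* (s * (sq3 / 2)))) - (c%:C + m%:C * (0 +i* s)))])
  <= 1 * expR (- (1 * m ^+ 2)).
Proof.
move=> ss cm /andP[r0 r1]; have [s0 s2 sl su] := q3; have c12' := c12; have m0 : 0 < m by lra.
pose X := (1 - r) * c + r * (m / 2).
pose Y := m * ((1 - r) + r * (sq3 / 2)).
have -> : (c%:C + m%:C * (0 +i* s)) + r%:C * ((0 + m%:C * ((1 / 2) +i* (s * (sq3 / 2)))) - (c%:C + m%:C * (0 +i* s))) = X +i* (s * Y).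
 by rewrite /X /Y; apply: complexP; rewrite !ReImE; field.
apply: (cub_chord M c) => //; first by lra.
 have h2 : m * (r * sq3) <= m * (r * (7 / 4)).
  by apply: ler_wpM2l; [exact: ltW|apply: ler_wpM2l => //; lra].
 have h4 : 0 <= m * (r * sq3).
  by apply: mulr_ge0; [exact: ltW|apply: mulr_ge0; lra].
 have h5 : 0 <= (1 - r) * c by apply: mulr_ge0; lra.
 have h6 : (1 - r) * c <= 1 * c by apply: ler_wpM2r; lra.
 have h7 : 0 <= m * r by apply: mulr_ge0; lra.
 have h8 : m * r <= m * 1 by apply: ler_wpM2l; lra.
 have X1 : 0 <= X + m by rewrite /X; lra.
 have X2 : X <= m by rewrite /X; lra.
 have Y1 : 0 <= Y + m by rewrite /Y; lra.
 have Y2 : Y <= m by rewrite /Y; lra.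
 have Y3 : - Y <= m by rewrite /Y; lra.
 move/eqP: ss; rewrite sqrf_eq1 => /orP[] /eqP ->; apply: nc_le_xy; lra.
have -> : Re ((X +i* (s * Y)) ^+ 3) = X ^+ 3 - 3 * X * s ^+ 2 * Y ^+ 2 by rewrite !exprS expr0 !ReImE; ring.
rewrite ss mulr1.
(* Same factorisation, the lower bounds of the three factors now being c, m/2 and m. *)
have E : X ^+ 3 - 3 * X * Y ^+ 2 = - (X * (sq3 * Y - X) * (X + sq3 * Y)).
 by rewrite -s2; ring.
have rc : 0 <= (1 - r) * c by rewrite mulr_ge0 ?subr_ge0// ltW.
have g1 : c <= X.
 have : 0 <= r * (m / 2 - c) by apply: mulr_ge0; lra.
 by rewrite /X; lra.
have f1 : sq3 * Y = m * ((1 - r) * sq3 + r * (sq3 ^+ 2 / 2)) by rewrite /Y; field.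
have f2 : m * (1 - r) <= m * ((1 - r) * sq3) by rewrite ler_wpM2l ?(ltW m0)// ler_peMr ?subr_ge0//; lra.
have f3 : m * r * (3 / 2) + m * (1 - r) <= sq3 * Y.
 by rewrite f1 s2; lra.
have mr : 0 <= m * r by rewrite mulr_ge0// ltW.
have rc' : (1 - r) * c <= c by rewrite ler_piMl ?(ltW c0)//; lra.
have g2 : m / 2 <= sq3 * Y - X by rewrite /X; lra.
have g3 : m <= X + sq3 * Y by lra.
have big : c * (m / 2) * m <= X * (sq3 * Y - X) * (X + sq3 * Y).
 apply: ler_pM => //; [by rewrite mulr_ge0 ?divr_ge0 ?ltW|exact: ltW|apply: ler_pM => //].
  exact: ltW.
 by rewrite divr_ge0// ltW.
have p5 : 0 <= c * m ^+ 2 by rewrite !mulr_ge0 ?sqr_ge0// ltW.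
by rewrite E; move: big p5; rewrite expr2; lra.
Qed.

End Poly.
End Contours.
End AiryContours.

(** * The Airy kernel on the shifted contours *)

Section RayKernels.
Context {R : realType}.
Local Notation C := R[i].
Local Notation mu := (@lebesgue_measure R).
Local Notation Cint := (Cintegral mu).
(** If the outer factor vanishes at t both sides are 0; otherwise it is divided out, so that
    integrability of the weighted kernel gives that of the ray integrand. *)
Lemma ray_wk (A : R -> bool) (Z : R -> C) (w0 d : C) (a : R -> C) (g : C -> C) (t : R) :
 A t -> cmeas setT (fun r => g (w0 + r%:C * d)) ->
 cintegrable setT (wk A posb Z (fun r => w0 + r%:C * d) a (fun r => g (w0 + r%:C * d) * d) t) ->
 a t * rayC w0 d (fun w => g w / (Z t - w)) =
 Cint setT (wk A posb Z (fun r => w0 + r%:C * d) a (fun r => g (w0 + r%:C * d) * d) t).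
Proof.
move=> At mg ii.
have a1 : bC (A t) = 1 :> C by rewrite At.
have mk : cmeas setT (fun r => g (w0 + r%:C * d) / (Z t - (w0 + r%:C * d)) * d).
 apply: cmeasM; last by split; exact: measurable_cst.
 apply: cmeasM; first exact: mg.
 apply: cmeasV; apply: cmeasB; [by split; exact: measurable_cst|exact: cmeas_lin].
have [az|az] := eqVneq (a t) 0.
 rewrite az mul0r (_ : wk _ _ _ _ _ _ _ = fun=> 0) ?Cint0//.
 by apply/funext => r; rewrite /wk az !(mulr0, mul0r).
rewrite /rayC (pos_halfE_posb _ mk).
have E r : bC (posb r) * (g (w0 + r%:C * d) / (Z t - (w0 + r%:C * d)) * d) =
  (a t)^-1 * wk A posb Z (fun r => w0 + r%:C * d) a (fun r => g (w0 + r%:C * d) * d) t r.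
 by rewrite /wk a1; set dd := (_ - _)^-1; field.
by rewrite (eq_Cint _ _ _ (fun r _ => E r)) CintZ// mulrA mulfV// mul1r.
Qed.

Lemma wk_swap (A B : R -> bool) (Z W : R -> C) (a b : R -> C) t r :
 wk A B Z W a b t r = - wk B A W Z b a r t.
Proof. by rewrite /wk -[W r - Z t]opprB invrN; ring. Qed.

Lemma pos_half_eq (h k : R -> C) : (forall t, 0 < t -> h t = k t) -> (forall t, t <= 0 -> k t = 0) ->
 cmeas setT k -> Cint pos_half h = Cint setT k.
Proof.
move=> hk k0 [m1 m2]; have mp := measurable_pos_half (R := R).
transitivity (Cint pos_half k).
 apply: Cint_eq_off0 => //; first exact: (lexx (0:R)).
  by move=> t tp t0; apply: hk; rewrite lt_def t0.
 by split; [exact: measurable_funS m1|exact: measurable_funS m2].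
rewrite pos_halfE_posb//; apply: eq_Cint => t _.
by case: (ltP 0 t) => t0; [rewrite /posb t0 /bC mul1r|rewrite k0// mulr0].
Qed.

(** For contours at a distance at least 1 from each other the Cauchy kernel needs no singular
    weight. *)
Lemma weight1 : weight (fun=> 1 : R).
Proof.
split; [exact: measurable_cst|by []|].
by apply: eq_integrable (@integrableT_gauss R) => // t _; rewrite /= mul1r.
Qed.

Lemma cmeas_predT : cmeas setT (fun t : R => bC true).
Proof. by split; exact: measurable_cst. Qed.

Section Airy.
Variables (M c t1 t2 u v : R).
Hypotheses (M0 : 0 <= M) (hc : 72 * M + 12 <= c) (bu : `|u| <= M) (bv : `|v| <= M)
 (b1 : `|t1| <= M) (b2 : `|t2| <= M).
Let p := qp (- v) (- t2) (1 / 3) 0.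
Let q := qp u t1 (- (1 / 3)) 0.
Let P (z : C) : C := Cexp p.[z].
Let Gq (w : C) : C := Cexp q.[w].
Let K := expR (cubK M c).
Let c12 : 12 <= c. Proof. have := M0; have := hc; lra. Qed.
Let c0 : 0 < c. Proof. exact: lt_le_trans c12. Qed.
Let K0 : 0 <= K. Proof. exact: expR_ge0. Qed.
Let bv' : `|- v| <= M. Proof. by rewrite normrN. Qed.
Let b2' : `|- t2| <= M. Proof. by rewrite normrN. Qed.

Let dl3 (s : R) : C := (- (1 / 2)) +i* (s * (sq3 / 2)).
Let el3 (s : R) : C := (1 / 2) +i* (s * (sq3 / 2)).
Let a5 (s : R) : C := (- (sq3 / 2)) +i* (s * (1 / 2)).
Let a6 (s : R) : C := (sq3 / 2) +i* (s * (1 / 2)).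

Let N8 : exists N : nat, forall m, (N <= m)%N -> 8 * c <= m%:R.
Proof. by have [N _ HN] := nbhs_infty_ger (8 * c); exists N => m /HN. Qed.

Let sP : (1 : R) ^+ 2 = 1. Proof. by rewrite expr1n. Qed.
Let sN : (-1 : R) ^+ 2 = 1. Proof. by rewrite sqrrN expr1n. Qed.
Let half2 (s : R) : s ^+ 2 = 1 -> (s * (1 / 2)) ^+ 2 = 1 / 4.
Proof. by move=> ss; rewrite exprMn ss half_sq; ring. Qed.
Let sq32 (s : R) : s ^+ 2 = 1 -> (s * (sq3 / 2)) ^+ 2 = 3 / 4.
Proof. by move=> ss; rewrite exprMn ss sq3_sq mul1r. Qed.

Let len (c1 c2 d1 d2 : C) (m : nat) : nc (c2 - c1) <= c -> nc d1 <= 1 -> nc d2 <= 1 -> 8 * c <= m%:R ->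
 nc ((c2 + m%:R%:C * d2) - (c1 + m%:R%:C * d1)) <= 3 * m%:R.
Proof.
move=> h1 h2 h3 hm; have m0 : 0 <= m%:R :> R by [].
have -> : (c2 + m%:R%:C * d2) - (c1 + m%:R%:C * d1) = (c2 - c1) + (m%:R%:C * d2 - m%:R%:C * d1) by ring.
rewrite (le_trans (ncD _ _))// (le_trans (lerD h1 (ncB _ _)))// !ncM !ncC ger0_norm//.
have k1 : m%:R * nc d1 <= m%:R * 1 by apply: ler_wpM2l.
have k2 : m%:R * nc d2 <= m%:R * 1 by apply: ler_wpM2l.
by have := c0; lra.
Qed.

Let nc_dl3 s : s ^+ 2 = 1 -> nc (dl3 s) <= 1.
Proof. by move=> ss; rewrite nc_unit// sqrrN half_sq sq32//; lra. Qed.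
Let nc_el3 s : s ^+ 2 = 1 -> nc (el3 s) <= 1.
Proof. by move=> ss; rewrite nc_unit// half_sq sq32//; lra. Qed.
Let nc_a5 s : s ^+ 2 = 1 -> nc (a5 s) <= 1.
Proof. by move=> ss; rewrite nc_unit// sqrrN sq3_sq half2//; lra. Qed.
Let nc_a6 s : s ^+ 2 = 1 -> nc (a6 s) <= 1.
Proof. by move=> ss; rewrite nc_unit// sq3_sq half2//; lra. Qed.

Section Inner.
Variable t : R.
Hypothesis t0 : t != 0.
Let a : C := c%:C + imag t.
Let F (w : C) : C := Gq w / (a - w).
Let sg1 : `|Num.sg t| = 1. Proof. by rewrite normr_sg t0. Qed.
Let dl0 : 0 < `|t| / 2. Proof. by rewrite divr_gt0// normr_gt0. Qed.

Let kpE (al x y : R) : Re ((al +i* (- (Num.sg t / 2))) * (x +i* y)) = al * x + Num.sg t * y / 2.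
Proof. by rewrite ReM !ReK !ImK; field. Qed.

Let sgy (s y : R) : s ^+ 2 = 1 -> 0 <= y -> Num.sg t * (s * y) <= y.
Proof.
move=> ss y0; rewrite (le_trans (ler_norm _))// !normrM sg1 mul1r (ger0_norm y0).
by move/eqP: ss; rewrite sqrf_eq1 => /orP[] /eqP ->; rewrite ?normrN normr1 mul1r.
Qed.

Let hpc (al : R) : hpl a (al +i* (- (Num.sg t / 2))) (`|t| / 2) c%:C.
Proof.
rewrite /hpl; have -> : c%:C - a = 0 +i* (- t) by rewrite /a /imag; complex_ring.
by rewrite kpE mulr0 add0r mulrN -normrEsg mulNr.
Qed.

Let hp0 : hpl a (1 +i* (- (Num.sg t / 2))) (`|t| / 2) 0.
Proof.
rewrite /hpl; have -> : 0 - a = (- c) +i* (- t) by rewrite /a /imag; complex_ring.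
by rewrite kpE (mulrN (Num.sg t)) -normrEsg; have := c0; lra.
Qed.

(** The shifted cubic integrand decays in the whole sector between the two right-hand rays and the
    pole is outside it, so these rays cancel. They may therefore be added to the two rays of the
    Airy contour. *)
Lemma right_wedge : rayC c%:C (a6 (-1)) F = rayC c%:C (a6 1) F.
Proof.
have [N HN] := N8; have [s0 s2 sl su] := sq3_bounds (R := R).
pose kp : C := (-1) +i* (- (Num.sg t / 2)).
have kd s : s ^+ 2 = 1 -> Re (kp * a6 s) <= 0.
 move=> ss; rewrite kpE; have := sgy s (1 / 2) ss; rewrite divr_ge0// => /(_ isT); lra.
have g s : s ^+ 2 = 1 -> gray q K c%:C (a6 s).
 by move=> ss; apply: gray_q_side => //; rewrite ?sq3_sq ?half2.
have c1 : clo (fun m => pint (lin (c%:C + m%:R%:C * a6 (-1)) ((c%:C + m%:R%:C * a6 1) - (c%:C + m%:R%:C * a6 (-1))) 0 1) F) (fun=> 0).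
 apply: (chord_small_hpl q a kp (fun m => c%:C + m%:R%:C * a6 (-1)) (fun m => c%:C + m%:R%:C * a6 1) 1 3 1 (`|t| / 2) N) => //.
 move=> m Nm; have m0 : 0 <= m%:R :> R by []; have hm := HN m Nm.
 split; [exact: (hpl_ray a kp _ _ _ _ (hpc (-1)) (kd _ sN) m0)|exact: (hpl_ray a kp _ _ _ _ (hpc (-1)) (kd _ sP) m0)| |].
  by apply: len => //; [rewrite subrr nc0 ltW|exact: nc_a6|exact: nc_a6].
 move=> r r01; have -> : a6 (-1) = (sq3 / 2) +i* (- (1 / 2)) by rewrite /a6 mulN1r.
 have -> : a6 1 = (sq3 / 2) +i* (1 / 2) by apply: complexP => //; rewrite /a6 !ImK; ring.
 exact: (chord_q_right M c M0 hc u t1 bu b1 _ _ hm r01).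
have c2 : clo (fun m => pint (lin (c%:C + m%:R%:C * a6 1) ((c%:C + m%:R%:C * a6 1) - (c%:C + m%:R%:C * a6 1)) 0 1) F) (fun=> 0).
 apply: eq_clo (clo_refl (fun=> 0)); apply: nearW => m //.
 by rewrite subrr /pint /= (eq_Cint _ _ (fun=> 0)) ?Cint0// => r _; rewrite mulr0.
have := wedge_shift q a kp _ _ _ _ _ _ K _ dl0 K0 (hpc (-1)) (hpc (-1)) (kd _ sN) (kd _ sP) (kd _ sP) (kd _ sP)
  (g _ sN) (g _ sP) (g _ sP) (g _ sP) c1 c2.
by rewrite subrr => /eqP; rewrite subr_eq0 => /eqP.
Qed.

(** For fixed z on c + iR the left wedge keeps the pole on its right while its vertex moves from c
    to 0 and its angle from 5 pi/6 to 2 pi/3. *)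
Lemma left_wedge : rayC c%:C (a5 1) F - rayC c%:C (a5 (-1)) F = rayC 0 (dl3 1) F - rayC 0 (dl3 (-1)) F.
Proof.
have [N HN] := N8; have [s0 s2 sl su] := sq3_bounds (R := R).
pose kp : C := 1 +i* (- (Num.sg t / 2)).
have kd5 s : s ^+ 2 = 1 -> Re (kp * a5 s) <= 0.
 move=> ss; rewrite kpE; have := sgy s (1 / 2) ss; rewrite divr_ge0// => /(_ isT); lra.
have kd3 s : s ^+ 2 = 1 -> Re (kp * dl3 s) <= 0.
 move=> ss; rewrite kpE; have := sgy s (sq3 / 2) ss; rewrite divr_ge0 ?(ltW s0)// => /(_ isT); lra.
have g5 s : s ^+ 2 = 1 -> gray q K c%:C (a5 s).
 by move=> ss; apply: gray_q_side => //; rewrite ?sqrrN ?sq3_sq ?half2.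
have g3 s : s ^+ 2 = 1 -> gray q K 0 (dl3 s).
 move=> ss; have hx : (- (1 / 2) : R) ^+ 2 = 1 / 4 by rewrite sqrrN half_sq.
 have hk : 0 <= - (1 / 3) * - (1 / 2) :> R by lra.
 exact: (gray_center M c M0 hc _ _ bu b1 _ _ _ (or_intror erefl) hx (sq32 _ ss) hk).
have ch s : s ^+ 2 = 1 -> clo (fun m => pint (lin (c%:C + m%:R%:C * a5 s) ((0 + m%:R%:C * dl3 s) - (c%:C + m%:R%:C * a5 s)) 0 1) F) (fun=> 0).
 move=> ss.
 apply: (chord_small_hpl q a kp (fun m => c%:C + m%:R%:C * a5 s) (fun m => 0 + m%:R%:C * dl3 s) 1 3 1 (`|t| / 2) N) => //.
 move=> m Nm; have m0 : 0 <= m%:R :> R by []; have hm := HN m Nm.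
 split; [exact: (hpl_ray a kp _ _ _ _ (hpc 1) (kd5 _ ss) m0)|exact: (hpl_ray a kp _ _ _ _ hp0 (kd3 _ ss) m0)| |].
  by apply: len => //; [rewrite sub0r ncN ncC ger0_norm// ltW|exact: nc_a5|exact: nc_dl3].
 by move=> r r01; apply: (chord_q_left M c M0 hc u t1 bu b1 _ _ _ ss _ r01); have := c0; lra.
exact: (wedge_shift q a kp _ _ _ _ _ _ K _ dl0 K0 (hpc 1) hp0 (kd5 _ sP) (kd5 _ sN) (kd3 _ sP) (kd3 _ sN)
  (g5 _ sP) (g5 _ sN) (g3 _ sP) (g3 _ sN) (ch _ sP) (ch _ sN)).
Qed.

End Inner.

Section Outer.
Variables (r s : R).
Hypotheses (r0 : 0 < r) (ss : s ^+ 2 = 1).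
Let a : C := 0 + r%:C * dl3 s.
Let F (z : C) : C := P z / (a - z).

(** For fixed w on the left wedge the pole stays on the left, and the line c + iR folds onto the
    Airy contour with vertex 0. *)
Lemma line_to_rays : cintegrable setT (fun t => F (c%:C + t%:C * (0 +i* 1)) * (0 +i* 1)) /\
 lineC c%:C (0 +i* 1) F = rayC 0 (el3 1) F - rayC 0 (el3 (-1)) F.
Proof.
have [N HN] := N8; have [s0 s2 sl su] := sq3_bounds (R := R).
pose kp : C := (-1) +i* 0.
have kE (z : C) : Re (kp * z) = - Re z by rewrite ReM ReK ImK; ring.
have Ra : Re a = - (r / 2) by rewrite /a /dl3 !ReImE; field.
have r0' := r0; have dl0 : 0 < r / 2 by lra.
have hpx (z : C) : 0 <= Re z -> hpl a kp (r / 2) z.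
 by move=> z0; rewrite /hpl kE ReB Ra; lra.
have hc' : hpl a kp (r / 2) c%:C by apply: hpx; rewrite ReC ltW.
have h0 : hpl a kp (r / 2) 0 by apply: hpx.
have N1 : - (0 +i* 1 : C) = 0 +i* (-1) by apply: complexP; rewrite !ReImE ?oppr0.
have ki (y : R) : Re (kp * (0 +i* y)) = 0 by rewrite kE ReK oppr0.
have gp1 : gray p K c%:C (0 +i* 1) by apply: gray_p_line.
have gp2 : gray p K c%:C (0 +i* (-1)) by apply: gray_p_line.
have gp3 : gray p K c%:C (- (0 +i* 1)) by rewrite N1.
have [ii ->] := line_rays p a kp K (r / 2) c%:C (0 +i* 1) dl0 K0 hc' (ki 1) gp1 gp3.
split; first exact: ii.
have kd1 y : Re (kp * (0 +i* y)) <= 0 by rewrite ki.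
have kd3 y : Re (kp * el3 y) <= 0 by rewrite kE ReK; lra.
have g3 y : y ^+ 2 = 1 -> gray p K 0 (el3 y).
 move=> ys; have hk : 0 <= (1 / 3) * (1 / 2) :> R by lra.
 exact: (gray_center M c M0 hc _ _ bv' b2' _ _ _ (or_introl erefl) half_sq (sq32 _ ys) hk).
have ch y : y ^+ 2 = 1 -> clo (fun m => pint (lin (c%:C + m%:R%:C * (0 +i* y)) ((0 + m%:R%:C * el3 y) - (c%:C + m%:R%:C * (0 +i* y))) 0 1) F) (fun=> 0).
 move=> ys.
 apply: (chord_small_hpl p a kp (fun m => c%:C + m%:R%:C * (0 +i* y)) (fun m => 0 + m%:R%:C * el3 y) 1 3 1 (r / 2) N) => //.
 move=> m Nm; have m0 : 0 <= m%:R :> R by []; have hm := HN m Nm.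
 split; [exact: (hpl_ray a kp _ _ _ _ hc' (kd1 _) m0)|exact: (hpl_ray a kp _ _ _ _ h0 (kd3 _) m0)| |].
  apply: len => //; [by rewrite sub0r ncN ncC ger0_norm// ltW| |exact: nc_el3].
  by rewrite nc_unit// ys expr0n add0r.
 by move=> x x01; apply: (chord_p M c M0 hc _ _ bv' b2' _ _ _ ys _ x01); have := c0; lra.
rewrite N1.
exact: (wedge_shift p a kp _ _ _ _ _ _ K _ dl0 K0 hc' h0 (kd1 _) (kd1 _) (kd3 _) (kd3 _)
  gp1 gp2 (g3 _ sP) (g3 _ sN) (ch _ sP) (ch _ sN)).
Qed.
End Outer.

Let Zl (t : R) : C := c%:C + imag t.
Let Wd (s r : R) : C := 0 + r%:C * dl3 s.
Let Ze (s t : R) : C := 0 + t%:C * el3 s.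
Let al (t : R) : C := P (Zl t) * (0 +i* 1).
Let bl (s r : R) : C := Gq (Wd s r) * dl3 s.
Let ar (s t : R) : C := P (Ze s t) * el3 s.
Let allb : R -> bool := fun=> true.

Let cCexp (Q : {poly C}) (w d : C) : cmeas setT (fun r : R => Cexp Q.[w + r%:C * d]).
Proof.
apply: ccts_cmeasT => t; apply: ccts_Cexp; apply: ccts_horner.
exact: is_cderive_cts (is_cderive_lin w d t).
Qed.
Let cCexpZ (Q : {poly C}) (w d e : C) : cmeas setT (fun r : R => Cexp Q.[w + r%:C * d] * e).
Proof. by apply: cmeasM; [exact: cCexp|split; exact: measurable_cst]. Qed.

Let ZlE t : Zl t = c%:C + t%:C * (0 +i* 1).
Proof. by rewrite /Zl imagE. Qed.

Let nci (z d : C) g : nc z <= g -> nc d <= 1 -> nc (z * d) <= g.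
Proof. by move=> h1 h2; rewrite ncM (le_trans _ h1)// ler_piMr ?nc_ge0. Qed.

Let G1 : gdom allb K al.
Proof.
split.
 have -> : al = fun t => Cexp p.[c%:C + t%:C * (0 +i* 1)] * (0 +i* 1) by apply/funext => t; rewrite /al /P ZlE.
 exact: cCexpZ.
split => // t _; apply: nci; last by rewrite nc_unit// expr0n expr1n add0r.
rewrite /P ZlE; have [t0|t0] := leP 0 t.
 exact: (gray_p_line M c M0 hc _ _ bv' b2' 1 sP t t0).
have t0' : 0 <= - t by rewrite oppr_ge0 ltW.
have := gray_p_line M c M0 hc _ _ bv' b2' (-1) sN (- t) t0'.
have -> : (- t)%:C * (0 +i* (-1)) = t%:C * (0 +i* 1) :> C by complex_ring.
by rewrite /gauss_fun sqrrN.
Qed.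

Let G2 s : s ^+ 2 = 1 -> gdom posb K (bl s).
Proof.
move=> ss; split; first exact: cCexpZ.
split => // t t0; apply: nci; last exact: nc_dl3.
have hx : (- (1 / 2) : R) ^+ 2 = 1 / 4 by rewrite sqrrN half_sq.
have hk : 0 <= - (1 / 3) * - (1 / 2) :> R by lra.
exact: (gray_center M c M0 hc _ _ bu b1 _ _ _ (or_intror erefl) hx (sq32 _ ss) hk t (ltW t0)).
Qed.

Let G3 s : s ^+ 2 = 1 -> gdom posb K (ar s).
Proof.
move=> ss; split; first exact: cCexpZ.
split => // t t0; apply: nci; last exact: nc_el3.
have hk : 0 <= (1 / 3) * (1 / 2) :> R by lra.
exact: (gray_center M c M0 hc _ _ bv' b2' _ _ _ (or_introl erefl) half_sq (sq32 _ ss) hk t (ltW t0)).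
Qed.

Let kern1 s t r : allb t -> posb r -> nc (Zl t - Wd s r)^-1 <= 1 * 1.
Proof.
move=> _ r0; rewrite mulr1 ncV.
have h : 1 <= nc (Zl t - Wd s r).
 rewrite (le_trans _ (nc_Re _))// (le_trans _ (ler_norm _))// /Zl /Wd /dl3 /imag !ReImE.
 have := c12; rewrite /posb in r0; lra.
by rewrite invf_le1// (lt_le_trans ltr01).
Qed.

Let kern2 s' s : s' ^+ 2 = 1 -> s ^+ 2 = 1 -> forall t r, posb t -> posb r ->
 nc (Ze s' t - Wd s r)^-1 <= kap t * kap r.
Proof.
move=> ss' ss t r t0 r0; apply: kern_kap; rewrite ?gt_eqF// !gtr0_norm// nc_sq /Ze /Wd /el3 /dl3 !ReImE.
have -> : (0 + (t * (1 / 2) - 0 * (s' * (sq3 / 2))) - (0 + (r * - (1 / 2) - 0 * (s * (sq3 / 2))))) ^+ 2 +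
 (0 + (t * (s' * (sq3 / 2)) + 0 * (1 / 2)) - (0 + (r * (s * (sq3 / 2)) + 0 * - (1 / 2)))) ^+ 2 =
 (t ^+ 2 + r ^+ 2 + 2 * (t * r)) * (1 / 4) + (s' ^+ 2 * t ^+ 2 + s ^+ 2 * r ^+ 2 - 2 * (s' * s) * (t * r)) * (sq3 / 2) ^+ 2 by field.
rewrite ss ss' sq3_sq !mul1r.
have tr : 0 <= t * r by rewrite mulr_ge0 ?ltW.
have h : (s' * s) * (t * r) <= t * r.
 rewrite ler_piMl// (le_trans (ler_norm _))// normrM.
 have n x : x ^+ 2 = 1 -> `|x| = 1 :> R.
  by move=> x1; apply/eqP; rewrite -(@eqrXn2 _ 2)// real_normK ?num_real// x1 expr1n.
 by rewrite !n// mulr1.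
have := sqr_ge0 (t - r); rewrite sqrrB; lra.
Qed.

Let mZl : cmeas setT Zl.
Proof. by have -> : Zl = fun t => c%:C + t%:C * (0 +i* 1) by [apply/funext => t; exact: ZlE]; exact: cmeas_lin. Qed.

Let W1 s := WI allb posb Zl (Wd s) al (bl s).
Let W2 s' s := WI posb posb (Ze s') (Wd s) (ar s') (bl s).
Let mW s : cmeas setT (Wd s). Proof. exact: cmeas_lin. Qed.
Let mE s : cmeas setT (Ze s). Proof. exact: cmeas_lin. Qed.
Let mp := cmeas_posb (R := R).

Let I1 s (ss : s ^+ 2 = 1) := WI_integrable _ _ _ _ _ _ cmeas_predT mp mZl (mW s) weight1 weight1 (kern1 s) _ _ _ _ G1 (G2 s ss).
Let I2 s' s (ss' : s' ^+ 2 = 1) (ss : s ^+ 2 = 1) :=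
 WI_integrable _ _ _ _ _ _ mp mp (mE s') (mW s) weight_kap weight_kap (kern2 s' s ss' ss) _ _ _ _ (G3 s' ss') (G2 s ss).

Let kern2' s' s : s' ^+ 2 = 1 -> s ^+ 2 = 1 -> forall r t, posb r -> posb t ->
 nc (Wd s r - Ze s' t)^-1 <= kap r * kap t.
Proof. by move=> ss' ss r t r0 t0; rewrite ncV ncBC -ncV mulrC; exact: kern2. Qed.
Let I3 s' s (ss' : s' ^+ 2 = 1) (ss : s ^+ 2 = 1) :=
 WI_integrable _ _ _ _ _ _ mp mp (mW s) (mE s') weight_kap weight_kap (kern2' s' s ss' ss) _ _ _ _ (G2 s ss) (G3 s' ss').

(** The z-contour is moved for fixed w, so the order of integration is exchanged before and after.
    Near vertex 0 the contours touch and the singular weights are needed; on the line they are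
    not. *)
Lemma W1E s : s ^+ 2 = 1 -> W1 s = W2 1 s - W2 (-1) s.
Proof.
move=> ss.
have F1 := WI_fubini _ _ _ _ _ _ cmeas_predT mp mZl (mW s) weight1 weight1 (kern1 s) _ _ _ _ G1 (G2 s ss).
have F2 s' (ss' : s' ^+ 2 = 1) := WI_fubini _ _ _ _ _ _ mp mp (mE s') (mW s) weight_kap weight_kap (kern2 s' s ss' ss) _ _ _ _ (G3 s' ss') (G2 s ss).
have [j1 j1'] := I3 1 s sP ss; have [j2 j2'] := I3 (-1) s sN ss.
have sw s' r : s' ^+ 2 = 1 -> Cint setT (fun t => wk posb posb (Ze s') (Wd s) (ar s') (bl s) t r) =
  - Cint setT (wk posb posb (Wd s) (Ze s') (bl s) (ar s') r).
 move=> ss'; have [_ k'] := I3 s' s ss' ss; rewrite -(CintN _ _ measurableT (k' r)).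
 by apply: eq_Cint => t _; exact: wk_swap.
rewrite /W1 /W2 F1 (F2 _ sP) (F2 _ sN).
rewrite (eq_Cint _ _ _ (fun r _ => sw 1 r sP)) (eq_Cint _ _ _ (fun r _ => sw (-1) r sN)).
rewrite (CintN _ _ measurableT j1) (CintN _ _ measurableT j2) opprK addrC -(CintB _ _ _ measurableT j2 j1).
apply: eq_Cint => r _; have [r0|r0] := boolP (posb r); last first.
 have z (A : R -> bool) (Z' : R -> C) a' t : wk A posb Z' (Wd s) a' (bl s) t r = 0 by rewrite /wk (negbTE r0) /bC !(mul0r, mulr0).
 have z' s' t : wk posb posb (Wd s) (Ze s') (bl s) (ar s') r t = 0 by rewrite wk_swap z oppr0.
 rewrite (eq_Cint _ _ (fun=> 0)); last by move=> t _; exact: z.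
 rewrite (eq_Cint _ (wk _ _ _ (Ze (-1)) _ _ _) (fun=> 0)); last by move=> t _; exact: z'.
 rewrite (eq_Cint _ (wk _ _ _ (Ze 1) _ _ _) (fun=> 0)); last by move=> t _; exact: z'.
 by rewrite !Cint0 subrr.
have [ii E] := line_to_rays r s r0.
have R1 := ray_wk posb (Wd s) 0 (el3 1) (bl s) P r r0 (cCexp _ _ _) (j1' r).
have R2 := ray_wk posb (Wd s) 0 (el3 (-1)) (bl s) P r r0 (cCexp _ _ _) (j2' r).
transitivity (- bl s r * lineC c%:C (0 +i* 1) (fun z => P z / (Wd s r - z))); last first.
 by rewrite E -R1 -R2; ring.
rewrite /lineC -(CintZ _ _ _ measurableT ii); apply: eq_Cint => t _.
rewrite wk_swap /wk r0 /bC /al ZlE; set iv := (_ - _)^-1; rewrite rmorph1; ring.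
Qed.

Let H (zeta : C) : C := airy_Gamma_integral (fun omega => Cexp (zeta ^+ 3 / 3 - zeta * v%:C - t2%:C * zeta ^+ 2
     - omega ^+ 3 / 3 + omega * u%:C + t1%:C * omega ^+ 2) / (zeta - omega)).

Let HE zeta : H zeta = rayC 0 (dl3 1) (fun w => P zeta * Gq w / (zeta - w)) - rayC 0 (dl3 (-1)) (fun w => P zeta * Gq w / (zeta - w)).
Proof.
have [c3 s3] := third_pi (R := R).
have E2 : 2 * pi / 3 = pi - pi / 3 :> R by field.
have C2 : cos (2 * pi / 3 : R) = - (1 / 2) by rewrite E2 cosB cospi sinpi c3; ring.
have S2 : sin (2 * pi / 3 : R) = sq3 / 2 by rewrite E2 sinB cospi sinpi s3; ring.
rewrite /H /airy_Gamma_integral !ray_integralE cosN sinN C2 S2 /dl3 (mul1r (sq3 / 2)) (mulN1r (sq3 / 2)).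
have -> : (fun omega : C => Cexp (zeta ^+ 3 / 3 - zeta * v%:C - t2%:C * zeta ^+ 2
     - omega ^+ 3 / 3 + omega * u%:C + t1%:C * omega ^+ 2) / (zeta - omega)) = (fun w => P zeta * Gq w / (zeta - w)).
 apply/funext => w; congr (_ / _); rewrite /P /Gq -CexpD /p /q !qpE; congr Cexp.
 by rewrite !(RCN, RCM) !RCV !RCnat rmorph0 rmorph1; field.
by [].
Qed.

Let ray_H s' : s' ^+ 2 = 1 -> rayC 0 (el3 s') H = W2 s' 1 - W2 s' (-1).
Proof.
move=> ss'; have [i1 i1'] := I2 s' 1 ss' sP; have [i2 i2'] := I2 s' (-1) ss' sN.
rewrite /W2 /WI -(CintB _ _ _ measurableT i1 i2) /rayC; apply: pos_half_eq.
- move=> t t0; have tp : posb t by [].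
 have Rw s (ss : s ^+ 2 = 1) : el3 s' * rayC 0 (dl3 s) (fun w => P (Ze s' t) * Gq w / (Ze s' t - w)) =
   Cint setT (wk posb posb (Ze s') (Wd s) (ar s') (bl s) t).
  have [_ k'] := I2 s' s ss' ss.
  have X : wk posb posb (Ze s') (Wd s) (ar s') (bl s) t =
    wk posb posb (Ze s') (fun r => 0 + r%:C * dl3 s) (fun=> el3 s') (fun r => P (Ze s' t) * Gq (0 + r%:C * dl3 s) * dl3 s) t.
   by apply/funext => r; rewrite /wk /ar /bl; congr (_ / _); ring.
  rewrite X; apply: (ray_wk posb (Ze s') 0 (dl3 s) (fun=> el3 s') (fun w => P (Ze s' t) * Gq w) t tp).
   apply: cmeasM; [by split; exact: measurable_cst|exact: cCexp].
  by rewrite -X; exact: k'.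
 by rewrite HE mulrC mulrBr (Rw 1 sP) (Rw (-1) sN).
- move=> t t0; have tp : posb t = false by apply/negbTE; rewrite /posb -leNgt.
 have z s : Cint setT (wk posb posb (Ze s') (Wd s) (ar s') (bl s) t) = 0.
  rewrite (eq_Cint _ _ (fun=> 0)) ?Cint0// => r _; by rewrite /wk tp /bC !(mul0r).
 by rewrite !z subrr.
- exact: cintegrable_cmeas (cintegrableB _ _ _ measurableT i1 i2).
Qed.

Lemma airy_W1 : airy_Sigma_integral H = W1 1 - W1 (-1).
Proof.
have [c3 s3] := third_pi (R := R).
rewrite /airy_Sigma_integral !ray_integralE cosN sinN c3 s3 (W1E _ sP) (W1E _ sN).
have -> : (1 / 2) +i* (sq3 / 2) = el3 1 by rewrite /el3 (mul1r (sq3 / 2)).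
have -> : (1 / 2) +i* (- (sq3 / 2)) = el3 (-1) by rewrite /el3 (mulN1r (sq3 / 2)).
rewrite (ray_H _ sP) (ray_H _ sN).
move: (W2 1 1) (W2 1 (-1)) (W2 (-1) 1) (W2 (-1) (-1)) => x1 x2 x3 x4; ring.
Qed.

(** Expansion of z^3/3 - y z^2 - x z around c: [Esh] is the constant term, [gsh] minus the linear
    coefficient, and the quadratic coefficient is c - y. *)
Let gsh (x y : R) : R := x + 2 * c * y - c ^+ 2.
Let Esh (x y : R) : R := c ^+ 3 / 3 - y * c ^+ 2 - x * c.

Let P_shift z : P (c%:C + z) = (expR (Esh v t2))%:C * Bfun (gsh v t2) (c - t2) (1 / 3) 0 z.
Proof.
rewrite -CexpC Bfun_qp -CexpD /P /p !qpE /Esh /gsh; congr Cexp.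
by rewrite oppr0 !(RCD, RCN, RCM, RCX) !RCV !RCnat rmorph0 rmorph1; field.
Qed.

Let Gq_shift w : Gq (c%:C + w) = (expR (- Esh u t1))%:C * (Bfun (gsh u t1) (c - t1) (1 / 3) 0 w)^-1.
Proof.
rewrite -CexpC BfunV_qp -CexpD /Gq /q !qpE /Esh /gsh; congr Cexp.
by rewrite !(RCD, RCN, RCM, RCX) !RCV !RCnat rmorph0 rmorph1; field.
Qed.

(** The Airy exponent has no quartic term and cannot be dominated on the four rays at 0. Around c
    its quadratic coefficient c - tau is at least 4, which is the case covered by
    [qdom_quadratic]. *)
Lemma airy_L4 : airy_Sigma_integral H = (expR (Esh v t2 - Esh u t1))%:C *
 L4 (Bfun (gsh v t2) (c - t2) (1 / 3) 0) (fun w => (Bfun (gsh u t1) (c - t1) (1 / 3) 0 w)^-1).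
Proof.
have [i1 i1'] := I1 1 sP; have [i2 i2'] := I1 (-1) sN.
rewrite airy_W1 /W1 /WI -(CintB _ _ _ measurableT i1 i2).
pose M' := M + 2 * c * M + c ^+ 2.
have cM : 0 <= c * M by rewrite mulr_ge0// ltW.
have M0' : 0 <= M' by rewrite /M' !addr_ge0 ?sqr_ge0//; lra.
have gb x y : `|x| <= M -> `|y| <= M -> `|gsh x y| <= M'.
 move=> xM yM; rewrite /gsh /M' (le_trans (ler_normB _ _))// [`|c ^+ 2|]ger0_norm ?sqr_ge0// lerD2r.
 rewrite (le_trans (ler_normD _ _))// lerD// normrM ger0_norm; last by rewrite mulr_ge0// ltW.
 by apply: ler_wpM2l => //; rewrite mulr_ge0// ltW.
have b4 x : `|x| <= M -> 4 <= c - x.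
 by rewrite ler_norml => /andP[_ h]; have := hc; have := M0; lra.
have hK : gdom4 (expR (2 * M' ^+ 2)) (Bfun (gsh v t2) (c - t2) (1 / 3) 0) (fun w => (Bfun (gsh u t1) (c - t1) (1 / 3) 0 w)^-1).
 apply: (Bfun_gdom4 _ _ M') => //; [exact: gb|exact: gb| |].
  by apply: qdom_quadratic => //; exact: b4.
 by apply: qdom_quadratic => //; exact: b4.
have hK' := gdom4Z _ _ _ (expR (Esh v t2))%:C (expR (- Esh u t1))%:C hK.
rewrite expRD RCM -(L4Z _ _ _ _ _ hK); apply: (L4_off0 _ _ _ _ hK') => t t0.
rewrite -(ray_wk allb Zl 0 (dl3 1) al Gq t isT (cCexp _ _ _) (i1' t)).
rewrite -(ray_wk allb Zl 0 (dl3 (-1)) al Gq t isT (cCexp _ _ _) (i2' t)).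
rewrite -mulrBr -(left_wedge t t0) /al P_shift.
have sh e : rayC c%:C e (fun w => Gq w / (c%:C + imag t - w)) =
  rayC 0 e (fun w => (expR (- Esh u t1))%:C * (Bfun (gsh u t1) (c - t1) (1 / 3) 0 w)^-1 / (imag t - w)).
 rewrite /rayC; apply: eq_Cint => r _; rewrite add0r -Gq_shift; congr (_ / _ * _); ring.
have rw : rayC c%:C (a6 (-1)) (fun w => Gq w / (c%:C + imag t - w)) - rayC c%:C (a6 1) (fun w => Gq w / (c%:C + imag t - w)) = 0.
 by rewrite (right_wedge t t0) subrr.
(* The vanishing pair of right-hand rays is inserted to complete the four rays. *)
rewrite -[X in _ * X]add0r -{}rw !sh /rays4.
have A1 : a6 (-1) = (sq3 / 2) +i* (- (1 / 2)) by rewrite /a6 mulN1r.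
have A2 : a6 1 = (sq3 / 2) +i* (1 / 2) by apply: complexP => //; rewrite /a6 !ImK; ring.
have A3 : a5 1 = - ((sq3 / 2) +i* (- (1 / 2))) by apply: complexP; rewrite /a5 !ReImE ?ReK ?ImK //; ring.
have A4 : a5 (-1) = - ((sq3 / 2) +i* (1 / 2)) by apply: complexP; rewrite /a5 !ReImE ?ReK ?ImK //; ring.
rewrite A1 A2 A3 A4 /imag; ring.
Qed.

End Airy.
End RayKernels.

(** * Limit theorem under asymptotic conditions on the moments *)

Section PerturbedLimit.
Context {R : realType}.
Local Notation C := R[i].
Local Notation mu := (@lebesgue_measure R).
Lemma WI6_bounded K : exists B : R, forall e a b, unit6 e -> gdom off0 K a -> gdom posb K b -> nc (WI6 e a b) <= B.
Proof.
pose I := \int[mu]_t (kap t * gauss_fun t) : R.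
exists (4 * (K * I * (K * I))) => e a b ue ha hb.
apply: le_trans (WI_bound _ _ _ _ _ _ (cmeas_off0 (R:=R)) (cmeas_posb (R:=R)) (cmeas_imag (R:=R)) (cmeas_rmul e) weight_kap weight_kap (kern6 e ue) a b K K ha hb) _.
have /andP[p1 p2] := wint_le off0 kap a K weight_kap (cmeas_off0 (R:=R)) ha.
have /andP[p3 p4] := wint_le posb kap b K weight_kap (cmeas_posb (R:=R)) hb.
by rewrite ler_wpM2l//; apply: ler_pM.
Qed.

(** Uniform boundedness of the integrals allows their multiplication by prefactors that are only
    asymptotically equal. *)
Lemma L4_bounded K : exists B : R, forall f g, gdom4 K f g -> nc (L4 f g) <= B.
Proof.
have [B hB] := WI6_bounded K; have [u1 u2 u3 u4] := unit6_rays (R := R).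
set e1 := _ +i* _ in u1 u3; set e2 := _ +i* _ in u2 u4.
exists (nc (imag 1 : C) * (nc e1 * B + nc e2 * B + (nc (- e1) * B + nc (- e2) * B))) => f g h.
have [ha hb] := h; rewrite (L4E _ _ _ h) ncM; apply: ler_wpM2l; first exact: nc_ge0.
have W e : unit6 e -> nc (e * WI6 e (fun t => f (imag t)) (fun r => g (r%:C * e))) <= nc e * B.
 move=> ue; rewrite ncM; apply: ler_wpM2l; first exact: nc_ge0.
 exact: (hB e _ _ ue ha (hb e ue)).
by apply: le_trans (ncD _ _) (lerD (le_trans (ncB _ _) (lerD _ _)) (le_trans (ncB _ _) (lerD _ _))); exact: W.
Qed.

Lemma Bfun_clo (g b g' b' : nat -> R) (a3 a4 M : R) u :
 (fun n => g n - g' n) @ \oo --> (0:R) -> (fun n => b n - b' n) @ \oo --> (0:R) ->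
 (forall n, `|g' n| <= M) -> (forall n, `|b' n| <= M) ->
 clo (fun n => Bfun (g n) (b n) a3 a4 u) (fun n => Bfun (g' n) (b' n) a3 a4 u) /\
 clo (fun n => (Bfun (g n) (b n) a3 a4 u)^-1) (fun n => (Bfun (g' n) (b' n) a3 a4 u)^-1).
Proof.
move=> g0 b0 gM bM.
pose v n : C := - ((g n - g' n)%:C * u) + (b n - b' n)%:C * u ^+ 2.
have E n : Bfun (g n) (b n) a3 a4 u = Bfun (g' n) (b' n) a3 a4 u * Cexp (v n).
 by rewrite /Bfun -CexpD /v !RCD !RCN; congr Cexp; ring.
pose w n := nc u * `|g n - g' n| + nc u ^+ 2 * `|b n - b' n|.
have w0 : w @ \oo --> (0:R).
 by apply: cvgD0; apply: cvgM0; [move/cvg_norm: g0|move/cvg_norm: b0]; rewrite normr0.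
have vw n : nc (v n) <= w n.
 by rewrite /v /w (le_trans (ncD _ _))// ncN ncM ncC ncCX mulrC lerD2l mulrC.
have c1 := clo_Cexp1 v w vw w0.
pose BD := Num.max 1 (expR (M * nc u + M * nc u ^+ 2 + `|a3| * nc u ^+ 3 + `|a4| * nc u ^+ 4)).
split.
 have := cloM _ _ _ _ BD _ _ (clo_refl (fun n => Bfun (g' n) (b' n) a3 a4 u)) c1.
 move=> h; apply: eq_clo (h _ _); apply: nearW => n.
 - by rewrite -E.
 - by rewrite mulr1.
 - by rewrite le_max (nc_Bfun_le _ _ _ _ _ _ (gM n) (bM n)).1 orbT.
 - by rewrite nc1 le_max lexx.
have := cloM _ _ _ _ BD _ _ (clo_refl (fun n => (Bfun (g' n) (b' n) a3 a4 u)^-1)) (cloV1 _ c1).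
move=> h; apply: eq_clo (h _ _); apply: nearW => n.
- by rewrite -invfM -E.
- by rewrite mulr1.
- by rewrite le_max (nc_Bfun_le _ _ _ _ _ _ (gM n) (bM n)).2 orbT.
- by rewrite nc1 le_max lexx.
Qed.

Lemma qdom_common a4 M : 0 <= M -> 0 <= a4 -> exists K, forall b : R, - M <= b -> 4 <= b \/ 0 < a4 -> qdom M K b a4 0.
Proof.
move=> M0; rewrite le_eqVlt => /predU1P[<-|a0].
 by exists (M ^+ 2) => b _ [b4|]; [exact: qdom_quadratic|rewrite ltxx].
have [K [d1 [d1p HK]]] := qdom_quartic M a4 M0 a0.
by exists K => b bM _; apply: HK => //; [lra|exact: ltW].
Qed.

(** In the application the coefficients of [Afun] are known only up to o(1); they are replaced
    inside [Bfun] after the passage to the limit form. *)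
Lemma perturbed_asymptotics (l : nat -> seq R) (del gt bt gs bs gt' bt' gs' bs' c c' : nat -> R) (a3 a4 M : R) N :
 (forall n, (N <= n)%N -> forall e, e \in l n -> `|e| <= del n) -> (forall n, 0 <= del n) -> del @ \oo --> (0:R) ->
 (fun n => psum3 (l n) - a3) @ \oo --> (0:R) -> (fun n => psum4 (l n) - a4) @ \oo --> (0:R) ->
 (fun n => gt n - gt' n) @ \oo --> (0:R) -> (fun n => bt n - bt' n) @ \oo --> (0:R) ->
 (fun n => gs n - gs' n) @ \oo --> (0:R) -> (fun n => bs n - bs' n) @ \oo --> (0:R) ->
 (fun n => c n - c' n) @ \oo --> (0:R) ->
 (forall n, [/\ `|gt' n| <= M, `|gs' n| <= M, `|bt' n| <= M & `|bs' n| <= M]) -> (forall n, `|c' n| <= M) -> 0 <= a4 ->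
 (forall n, 5 <= bt' n /\ 5 <= bs' n) \/ 0 < a4 ->
 (\forall n \near \oo, exists K, gdom4 K (Afun (gt n) (bt n) (l n)) (fun w => (Afun (gs n) (bs n) (l n) w)^-1)) /\
 clo (fun n => (c n)%:C * L4 (Afun (gt n) (bt n) (l n)) (fun w => (Afun (gs n) (bs n) (l n) w)^-1))
   (fun n => (c' n)%:C * L4 (Bfun (gt' n) (bt' n) a3 a4) (fun w => (Bfun (gs' n) (bs' n) a3 a4 w)^-1)).
Proof.
move=> ld dge0 del0 l3 l4 cgt cbt cgs cbs cc bd cM a40 alt.
have M0 : 0 <= M := le_trans (normr_ge0 _) (cM 0).
have [k [Nk Hk]] : exists k, (N <= k)%N /\ forall n, (k <= n)%N -> [/\ `|gt n - gt' n| < 1, `|gs n - gs' n| < 1, `|bt n - bt' n| < 1 & `|bs n - bs' n| < 1].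
 have h1 : \forall n \near \oo, `|gt n - gt' n| < 1 by exact: cvgr0_norm_lt.
 have h2 : \forall n \near \oo, `|gs n - gs' n| < 1 by exact: cvgr0_norm_lt.
 have h3 : \forall n \near \oo, `|bt n - bt' n| < 1 by exact: cvgr0_norm_lt.
 have h4 : \forall n \near \oo, `|bs n - bs' n| < 1 by exact: cvgr0_norm_lt.
 have [k _ Hk] : \forall n \near \oo, [/\ `|gt n - gt' n| < 1, `|gs n - gs' n| < 1, `|bt n - bt' n| < 1 & `|bs n - bs' n| < 1].
  by near=> n; split; near: n; [exact: h1|exact: h2|exact: h3|exact: h4].
 exists (maxn N k); split; first exact: leq_maxl.
 by move=> n kn; apply: Hk; apply: leq_trans kn; exact: leq_maxr.
have sh (f : nat -> R) : f @ \oo --> (0:R) -> (fun n => f (n + k)%N) @ \oo --> (0:R).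
 by move=> h; have := h; rewrite -(cvg_shiftn k).
have kn n : (k <= n + k)%N by rewrite leq_addl.
have bd' n : [/\ `|gt (n + k)%N| <= M + 1, `|gs (n + k)%N| <= M + 1, `|bt (n + k)%N| <= M + 1 & `|bs (n + k)%N| <= M + 1].
 have [h1 h2 h3 h4] := Hk _ (kn n); have [m1 m2 m3 m4] := bd (n + k)%N.
 have T (x y : R) : `|x - y| < 1 -> `|y| <= M -> `|x| <= M + 1.
  by move=> /ltW xy yM; rewrite -[x](subrK y) addrC (le_trans (ler_normD _ _))// lerD.
 by split; [exact: T h1 m1|exact: T h2 m2|exact: T h3 m3|exact: T h4 m4].
(* The bound 5 on the limiting coefficients leaves 4 for the perturbed ones, the perturbation being
   below 1. *)
have alt1 : (forall n, 4 <= bt (n + k)%N /\ 4 <= bs (n + k)%N) \/ 0 < a4.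
 case: alt => [b5|]; [left => n|by right].
 have [_ _ + +] := Hk _ (kn n); have [] := b5 (n + k)%N; rewrite !ltr_norml => q1 q2 /andP[q3 _] /andP[q4 _].
 by split; lra.
have [g1 c1] := core_asymptotics (fun n => l (n + k)%N) (fun n => del (n + k)%N) (fun n => gt (n + k)%N) (fun n => bt (n + k)%N)
 (fun n => gs (n + k)%N) (fun n => bs (n + k)%N) a3 a4 (M + 1) (fun n => ld _ (leq_trans Nk (kn n))) (fun n => dge0 _)
 (sh _ del0) (sh _ l3) (sh _ l4) bd' a40 alt1.
split.
 case: g1 => m _ hm; exists (m + k)%N => //= n mn.
 have kn' : (k <= n)%N by rewrite (leq_trans _ mn)// leq_addl.
 have := hm (n - k)%N; rewrite /= subnK//; apply.
 by rewrite leq_subRL// addnC.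
have [K hK] := qdom_common a4 (M + 1) (addr_ge0 M0 ler01) a40.
have c2 : clo (fun n => L4 (Bfun (gt (n + k)%N) (bt (n + k)%N) a3 a4) (fun w => (Bfun (gs (n + k)%N) (bs (n + k)%N) a3 a4 w)^-1))
  (fun n => L4 (Bfun (gt' (n + k)%N) (bt' (n + k)%N) a3 a4) (fun w => (Bfun (gs' (n + k)%N) (bs' (n + k)%N) a3 a4 w)^-1)) /\
  forall n, gdom4 (expR (2 * K)) (Bfun (gt' (n + k)%N) (bt' (n + k)%N) a3 a4) (fun w => (Bfun (gs' (n + k)%N) (bs' (n + k)%N) a3 a4 w)^-1).
 have lo (b : R) : `|b| <= M + 1 -> - (M + 1) <= b by rewrite ler_norml => /andP[].
 have up (b : R) : `|b| <= M -> `|b| <= M + 1 by move=> h; rewrite (le_trans h)// lerDl.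
 have dB n : gdom4 (expR (2 * K)) (Bfun (gt (n + k)%N) (bt (n + k)%N) a3 a4) (fun w => (Bfun (gs (n + k)%N) (bs (n + k)%N) a3 a4 w)^-1).
  have [m1 m2 m3 m4] := bd' n; apply: (Bfun_gdom4 a3 a4 (M + 1) K) => //; apply: hK; try exact: lo.
   by case: alt1 => [/(_ n)[h _]|]; [left|right].
  by case: alt1 => [/(_ n)[_ h]|]; [left|right].
 have dB' n : gdom4 (expR (2 * K)) (Bfun (gt' (n + k)%N) (bt' (n + k)%N) a3 a4) (fun w => (Bfun (gs' (n + k)%N) (bs' (n + k)%N) a3 a4 w)^-1).
  have [m1 m2 m3 m4] := bd (n + k)%N; apply: (Bfun_gdom4 a3 a4 (M + 1) K) => //; try exact: up.
   apply: hK; first exact: lo (up _ m3).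
   by case: alt => [/(_ (n + k)%N)[h _]|]; [left; lra|right].
  apply: hK; first exact: lo (up _ m4).
  by case: alt => [/(_ (n + k)%N)[_ h]|]; [left; lra|right].
 split; last exact: dB'.
 apply: (L4_clo _ _ _ _ (expR (2 * K)) 0) => [n _|t|w]; first exact: (conj (dB n) (dB' n)).
  apply: (Bfun_clo _ _ _ _ a3 a4 M (imag t) (sh _ cgt) (sh _ cbt) _ _).1 => n; by have [] := bd (n + k)%N.
 by apply: (Bfun_clo _ _ _ _ a3 a4 M w (sh _ cgs) (sh _ cbs) _ _).2 => n; have [] := bd (n + k)%N.
case: c2 => c2 dB'; have [B hB] := L4_bounded (expR (2 * K)).
apply: (clo_shift k); apply: (cloM _ _ _ _ (Num.max M B)).
- by apply: nearW => n; rewrite ncC le_max cM.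
- by apply: nearW => n; rewrite le_max hB ?orbT//; exact: dB'.
- exact: clo_real (sh _ cc).
- exact: clo_trans c1 c2.
Unshelve. all: end_near. Qed.

(** * Asymptotic equality of bounded real sequences *)

Implicit Types f g : nat -> R.

Definition rlo f g : Prop := (fun n => f n - g n) @ \oo --> (0:R).

Definition bseq f : Prop := exists M, forall n, `|f n| <= M.

Lemma bseq_cst (c : R) : bseq (fun=> c). Proof. by exists `|c| => n. Qed.

Lemma bseqD f g : bseq f -> bseq g -> bseq (fun n => f n + g n).
Proof. by move=> [A hA] [B hB]; exists (A + B) => n; rewrite (le_trans (ler_normD _ _))// lerD. Qed.

Lemma bseqN f : bseq f -> bseq (fun n => - f n).
Proof. by move=> [A hA]; exists A => n; rewrite normrN. Qed.

Lemma bseqM f g : bseq f -> bseq g -> bseq (fun n => f n * g n).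
Proof. by move=> [A hA] [B hB]; exists (A * B) => n; rewrite normrM ler_pM. Qed.

Lemma rlo_refl f : rlo f f.
Proof. by rewrite /rlo; under eq_fun do rewrite subrr; exact: cvg_cst. Qed.

Lemma rlo_cvg f (c : R) : f @ \oo --> c -> rlo f (fun=> c).
Proof. by move=> h; rewrite /rlo -(subrr c); apply: cvgB => //; exact: cvg_cst. Qed.

Lemma cvg_rlo f (c : R) : rlo f (fun=> c) -> f @ \oo --> c.
Proof.
move=> h; have -> : f = (fun n => (f n - c) + c) by apply/funext => n; rewrite subrK.
by rewrite -[X in _ --> X]add0r; apply: cvgD => //; exact: cvg_cst.
Qed.

Lemma rlo_eq f g f' : (\forall n \near \oo, f n = f' n) -> rlo f g -> rlo f' g.
Proof.
move=> e; rewrite /rlo => h; apply: cvg_trans h; apply: near_eq_cvg.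
by near=> n; rewrite (near e n).
Unshelve. all: end_near. Qed.

Lemma cvg_ext f g (c : R) : (forall n, f n = g n) -> f @ \oo --> c -> g @ \oo --> c.
Proof. by move=> /funext ->. Qed.

Lemma rloD f g f' g' : rlo f g -> rlo f' g' -> rlo (fun n => f n + f' n) (fun n => g n + g' n).
Proof.
by move=> h h'; apply: (cvg_ext _ _ _ _ (cvgD0 _ _ h h')) => n; ring.
Qed.

Lemma rloN f g : rlo f g -> rlo (fun n => - f n) (fun n => - g n).
Proof.
by move=> h; apply: (cvg_ext _ _ _ _ (cvgM0 _ (-1) h)) => n; ring.
Qed.

Lemma rloM f g f' g' : bseq g -> bseq g' -> rlo f g -> rlo f' g' ->
 rlo (fun n => f n * f' n) (fun n => g n * g' n).
Proof.
move=> [A hA] [B hB] h h'.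
have bdd (a c : nat -> R) K : (forall n, `|a n| <= K) -> c @ \oo --> (0:R) -> (fun n => c n * a n) @ \oo --> (0:R).
 move=> aK c0; apply/cvgr0Pnorm_lt => e e0.
 have K0 : 0 <= K := le_trans (normr_ge0 _) (aK 0).
 have d0 : 0 < e / (K + 1) by rewrite divr_gt0// ltr_wpDl.
 have hc : \forall n \near \oo, `|c n| < e / (K + 1) by exact: cvgr0_norm_lt.
 near=> n; rewrite normrM; have hn : `|c n| < e / (K + 1) by near: n; exact: hc.
 apply: (@le_lt_trans _ _ (`|c n| * K)); first by rewrite ler_wpM2l.
 apply: (@le_lt_trans _ _ (`|c n| * (K + 1))); first by rewrite ler_wpM2l// lerDl.
 by rewrite -ltr_pdivlMr// ltr_wpDl.
have c1 : (fun n => (f n - g n) * (f' n - g' n)) @ \oo --> (0:R).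
 by rewrite -[X in _ --> X](mulr0 0); exact: cvgM.
have c2 := cvgD0 _ _ c1 (cvgD0 _ _ (bdd _ _ _ hB h) (bdd _ _ _ hA h')).
by apply: (cvg_ext _ _ _ _ c2) => n; ring.
Unshelve. all: end_near. Qed.

Lemma rlo_exp f g : bseq g -> rlo f g -> rlo (fun n => expR (f n)) (fun n => expR (g n)).
Proof.
move=> [M hM] h.
have h1 : rlo (fun n => expR (f n - g n)) (fun=> 1).
 apply: rlo_cvg; rewrite -expR0; apply: continuous_cvg => //; exact: continuous_expR.
have b : bseq (fun n => expR (g n)).
 by exists (expR M) => n; rewrite ger0_norm ?expR_ge0// ler_expR (le_trans (ler_norm _)).
apply: (cvg_ext _ _ _ _ (rloM _ _ _ _ b (bseq_cst 1) (rlo_refl _) h1)) => n.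
by rewrite -expRD mulr1 (addrC (g n)) subrK.
Qed.

Definition pmom (X : seq R) (p : R) (k : nat) : R := (size X)%:R^-1 * \sum_(a <- X) ((p - a) ^+ k)^-1.

Lemma sum_scaled (X : seq R) p e k : (0 < size X)%N -> \sum_(x <- scaled_poles X p e) x ^+ k = (size X)%:R * e ^+ k * pmom X p k.
Proof.
move=> n0; rewrite /scaled_poles big_map /pmom mulrAC mulrA mulfV ?pnatr_eq0 -?lt0n// mul1r mulrC.
rewrite mulr_sumr; apply: eq_bigr => a _; by rewrite expr_div_n.
Qed.

(** The gauge factor is exactly what completes the square, shifting p - y by t G and p - x by s
    G. *)
Lemma gauge_exponent (n s t x y p G : R) : s != 0 -> t != 0 ->
 n / (2 * t) * (p - y) ^+ 2 - n / (2 * s) * (p - x) ^+ 2 + ((- n * G * y + n * G ^+ 2 * t / 2) - (- n * G * x + n * G ^+ 2 * s / 2)) =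
 n / (2 * t) * (p - y + t * G) ^+ 2 - n / (2 * s) * (p - x + s * G) ^+ 2.
Proof. by move=> s0 t0; field; rewrite s0 t0. Qed.

(** By symmetry |a| is the smaller modulus. A difference of moduli above 1 is trivial, and otherwise
    exp(-a^2) absorbs the factor 2|a| + 1. *)
Lemma exp_sqr_lip (a c : R) : `|expR (- a ^+ 2) - expR (- c ^+ 2)| <= 2 * `|a - c|.
Proof.
wlog ac : a c / `|a| <= `|c|.
 by move=> H; have [/H//|/ltW/H] := leP `|a| `|c|; rewrite distrC (distrC c).
have d1 : `|c| - `|a| <= `|a - c| by rewrite distrC; exact: lerB_dist.
have sq : a ^+ 2 <= c ^+ 2 by rewrite -(real_normK (num_real a)) -(real_normK (num_real c)) lerXn2r ?nnegrE.
have e1 : expR (- c ^+ 2) <= expR (- a ^+ 2) by rewrite ler_expR lerN2.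
rewrite ger0_norm ?subr_ge0//; have := normr_ge0 a; have cc0 := normr_ge0 c.
have e0 : 0 <= expR (- c ^+ 2) := expR_ge0 _.
have e2 : expR (- a ^+ 2) <= 1 by rewrite -expR0 ler_expR oppr_le0 sqr_ge0.
move=> a0; have [d|d] := leP (`|c| - `|a|) 1; last by lra.
have k1 : expR (- a ^+ 2) - expR (- c ^+ 2) <= expR (- a ^+ 2) * (`|c| ^+ 2 - `|a| ^+ 2).
 have -> : expR (- c ^+ 2) = expR (- a ^+ 2) * expR (- (c ^+ 2 - a ^+ 2)) by rewrite -expRD; congr expR; ring.
 rewrite -[X in X - _]mulr1 -mulrBr ler_wpM2l ?expR_ge0// !real_normK ?num_real//.
 by have := expR_ge1Dx (- (c ^+ 2 - a ^+ 2)); lra.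
apply: (le_trans k1); rewrite expRN ler_pdivrMl ?expR_gt0//.
have k2 : `|c| ^+ 2 - `|a| ^+ 2 <= (2 * `|a| + 1) * (`|c| - `|a|).
 by rewrite (_ : _ - _ = (`|c| + `|a|) * (`|c| - `|a|)); [rewrite ler_wpM2r//; lra|ring].
have k3 : 2 * `|a| + 1 <= expR (a ^+ 2) * 2.
 have := expR_ge1Dx (a ^+ 2); have := sqr_ge0 (`|a| - 1 / 2); rewrite sqrrB real_normK ?num_real//; lra.
apply: (le_trans k2); rewrite mulrA; apply: ler_pM => //; lra.
Qed.

(** The Gaussian density is singular as dt tends to 0, so convergence uniform in the times is not
    automatic. The two centres differ by a multiple of dt, and this factor compensates both the
    narrow width and the prefactor. *)
Lemma gauss_lip (k dt w w' be : R) : 0 < k -> 0 < dt -> w - w' = dt * be ->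
 `|expR (- (w ^+ 2 / (2 * k * dt))) / Num.sqrt (2 * pi * k * dt) - expR (- (w' ^+ 2 / (2 * k * dt))) / Num.sqrt (2 * pi * k * dt)|
  <= `|be| / k.
Proof.
move=> k0 d0 wE; pose q := Num.sqrt (2 * k * dt).
have q2 : q ^+ 2 = 2 * k * dt by rewrite sqr_sqrtr// !mulr_ge0// ltW.
have q0 : 0 < q by rewrite sqrtr_gt0 !mulr_gt0.
have E x : x ^+ 2 / (2 * k * dt) = (x / q) ^+ 2 by rewrite expr_div_n q2.
have piq : q <= Num.sqrt (2 * pi * k * dt).
 rewrite /q ler_sqrt; last by rewrite !mulr_ge0 ?pi_ge0// ltW.
 rewrite !ler_pM2r// ler_peMr//; have := pi_ge2 R; lra.
rewrite !E -mulrBl normrM [X in _ * X]ger0_norm ?invr_ge0 ?sqrtr_ge0//.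
apply: (@le_trans _ _ (2 * `|w / q - w' / q| / q)).
 by apply: ler_pM; rewrite ?invr_ge0 ?sqrtr_ge0 ?normr_ge0 ?exp_sqr_lip ?lef_pV2 ?posrE ?(lt_le_trans q0).
rewrite -mulrBl wE !normrM (gtr0_norm d0) (@gtr0_norm _ q^-1) ?invr_gt0//.
rewrite (_ : 2 * (dt * `|be| / q) / q = `|be| * (2 * dt) / q ^+ 2); last by field; rewrite lt0r_neq0.
have -> : `|be| * (2 * dt) / q ^+ 2 = `|be| / k.
 rewrite q2; move: `|be| => B; have kk := lt0r_neq0 k0; have dd := lt0r_neq0 d0; by field; rewrite ?kk ?dd.
exact: lexx.
Qed.

Section Data.
Variables (X : forall n, n.-tuple R) (x0 xg p sg tau1 tau2 u v : nat -> R) (gamma : nat -> R -> C)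
 (xs T G0 k eta rho b0 a3 a4 b om D M : R).
(** The edge and merging regimes differ only in the data: [sg] is the spatial scale, [k] is 2 or 1,
    [eta] is the offset of the base point in units of eps, [rho] the defect of the first-order
    condition, [b0] that of the second, [b] the drift caused by a gauge slope different from [G0],
    and [om] the offset between base point and gauge. *)
Let eps n := T * sg n / n%:R.
Let dl n := n%:R / sg n ^+ 2.
Let G n := stieltjes (empirical (X n)) (xg n).
Let tn n (tau : R) := T + k * tau * dl n.
Let h n := p n - xs.
Hypotheses (T0 : 0 < T) (k0 : 0 < k) (a40 : 0 <= a4) (D0 : 0 < D).
Hypotheses (adm : forall n, (0 < n)%N -> admissible (X n) (x0 n) (gamma n))
 (sg0 : forall n, (0 < n)%N -> 0 < sg n)
 (eps_cvg : eps @ \oo --> (0:R))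
 (dl_cvg : dl @ \oo --> (0:R))
 (gap : \forall n \near \oo, forall a, a \in X n -> D <= `|p n - a|)
 (rho_cvg : (fun n => T * sg n * (h n / T + pmom (X n) (p n) 1 - G0)) @ \oo --> rho)
 (eta_cvg : (fun n => h n * n%:R / (T * sg n)) @ \oo --> eta)
 (b0_cvg : (fun n => T ^+ 2 * sg n ^+ 2 / (2 * n%:R) * (T^-1 - pmom (X n) (p n) 2)) @ \oo --> b0)
 (a3_cvg : (fun n => n%:R * eps n ^+ 3 * pmom (X n) (p n) 3 / 3) @ \oo --> a3)
 (a4_cvg : (fun n => n%:R * eps n ^+ 4 * pmom (X n) (p n) 4 / 4) @ \oo --> a4)
 (b_cvg : (fun n => k * n%:R * (G0 - G n) / sg n) @ \oo --> b)
 (om_cvg : (fun n => n%:R * (h n + T * (G n - G0)) / (T * sg n)) @ \oo --> om).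
Hypotheses (B1 : bseq tau1) (B2 : bseq tau2) (B3 : bseq u) (B4 : bseq v).
Hypothesis alt : (forall n, 5 <= b0 - k * tau1 n / 2 /\ 5 <= b0 - k * tau2 n / 2) \/ 0 < a4.

Let n_pos : \forall n \near \oo, (0 < n)%N. Proof. exact: nbhs_infty_gt. Qed.

Lemma time_cvg (tau : nat -> R) : bseq tau -> (fun n => tn n (tau n)) @ \oo --> T.
Proof.
move=> B; apply: cvg_rlo.
have h1 := rloM _ _ _ _ (bseqM _ _ (bseq_cst k) B) (bseq_cst 0) (rlo_refl _) (rlo_cvg _ _ dl_cvg).
apply: (cvg_ext _ _ _ _ (rloD _ _ _ _ (rlo_refl (fun=> T)) h1)) => n.
by rewrite /tn; ring.
Qed.

Lemma time_pos (tau : nat -> R) : bseq tau -> \forall n \near \oo, 0 < tn n (tau n).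
Proof. by move=> B; exact: (cvgr_gt _ (time_cvg _ B) _ T0). Qed.

Lemma ratio_cvg (tau : nat -> R) : bseq tau -> (fun n => T / tn n (tau n)) @ \oo --> (1 : R).
Proof.
move=> B; rewrite -(mulfV (lt0r_neq0 T0)); apply: cvgM; first exact: cvg_cst.
by apply: cvgV; [rewrite lt0r_neq0|exact: time_cvg].
Qed.

Lemma lin_rlo (tau y : nat -> R) : bseq tau -> bseq y ->
 rlo (fun n => lin_coef (X n) (p n) (eps n) (n%:R / (2 * tn n (tau n))) (xs + tn n (tau n) * G0 + y n / sg n))
  (fun n => y n + k * tau n * eta - rho).
Proof.
move=> Bt By.
have h1 := rloM _ _ _ _ (bseqM _ _ (bseq_cst k) Bt) (bseq_cst eta) (rlo_refl _) (rlo_cvg _ _ eta_cvg).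
have h2 := rloD _ _ _ _ (rlo_refl y) h1.
have h3 := rloM _ _ _ _ (bseqD _ _ By (bseqM _ _ (bseqM _ _ (bseq_cst k) Bt) (bseq_cst eta))) (bseq_cst 1) h2 (rlo_cvg _ _ (ratio_cvg _ Bt)).
have h4 := rloD _ _ _ _ h3 (rloN _ _ (rlo_cvg _ _ rho_cvg)).
rewrite /rlo; apply: cvg_trans h4; apply: near_eq_cvg; near=> n.
have n0 : (0 < n)%N by near: n; exact: n_pos.
have nn : n%:R != 0 :> R by rewrite pnatr_eq0 -lt0n.
have s0 := lt0r_neq0 (sg0 n n0).
have t0 : 0 < tn n (tau n) by near: n; exact: time_pos.
have tt := lt0r_neq0 t0; have TT := lt0r_neq0 T0.
have -> : lin_coef (X n) (p n) (eps n) (n%:R / (2 * tn n (tau n))) (xs + tn n (tau n) * G0 + y n / sg n) =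
 - (n%:R / (2 * tn n (tau n)) * 2 * eps n * (p n - (xs + tn n (tau n) * G0 + y n / sg n)) + n%:R * eps n * pmom (X n) (p n) 1).
 by have := sum_scaled (X n) (p n) (eps n) 1; rewrite size_tuple n0 expr1 => /(_ isT) <-; rewrite /lin_coef.
rewrite mulr1 /eps /h.
(* Solved for tau, this makes the claim a rational identity in the time itself. *)
have E : tn n (tau n) * sg n ^+ 2 = T * sg n ^+ 2 + k * tau n * n%:R by rewrite /tn /dl; field.
move: (pmom _ _ _) (tn n (tau n)) tt t0 E => m1 t tt _ E.
have -> : k * tau n = (t - T) * sg n ^+ 2 / n%:R by apply: (mulIf nn); rewrite divfK// mulrBl E; ring.
by field; rewrite nn s0 tt TT.
Unshelve. all: end_near. Qed.

Lemma quad_rlo (tau : nat -> R) : bseq tau ->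
 rlo (fun n => quad_coef (X n) (p n) (eps n) (n%:R / (2 * tn n (tau n)))) (fun n => b0 - k * tau n / 2).
Proof.
move=> Bt.
have h1 := rloM _ _ _ _ (bseqM _ _ (bseq_cst (k / 2)) Bt) (bseq_cst 1) (rlo_refl _) (rlo_cvg _ _ (ratio_cvg _ Bt)).
have h2 := rloD _ _ _ _ (rlo_cvg _ _ b0_cvg) (rloN _ _ h1).
rewrite /rlo; apply: cvg_trans h2; apply: near_eq_cvg; near=> n.
have n0 : (0 < n)%N by near: n; exact: n_pos.
have nn : n%:R != 0 :> R by rewrite pnatr_eq0 -lt0n.
have s0 := lt0r_neq0 (sg0 n n0).
have t0 : 0 < tn n (tau n) by near: n; exact: time_pos.
have tt := lt0r_neq0 t0; have TT := lt0r_neq0 T0.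
rewrite /quad_coef sum_scaled size_tuple// /eps.
have E : tn n (tau n) * sg n ^+ 2 = T * sg n ^+ 2 + k * tau n * n%:R by rewrite /tn /dl; field.
move: (pmom _ _ _) (tn n (tau n)) tt t0 E => m1 t tt _ E.
have -> : tau n = (t - T) * sg n ^+ 2 / n%:R / k.
 by apply: (mulIf (lt0r_neq0 k0)); rewrite divfK ?lt0r_neq0//; apply: (mulIf nn); rewrite divfK// mulrBl E; ring.
by field; rewrite ?nn ?s0 ?tt ?TT ?(lt0r_neq0 k0).
Unshelve. all: end_near. Qed.

Let gf n s x := gauge_fun (X n) (xg n) s x.
Let t n := tn n (tau2 n).
Let s n := tn n (tau1 n).
Let y n := xs + t n * G0 + v n / sg n.
Let x n := xs + s n * G0 + u n / sg n.
Local Notation pex n := (om ^+ 2 * (k * (tau1 n - tau2 n) / 2) - om * (tau2 n * b + v n - (tau1 n * b + u n))).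

(** After [gauge_exponent] the exponent is [L1 - L2 + L3]: a term quadratic in the offset [omn], a
    mixed term, and a term with the vanishing factor n/sg^2. *)
Lemma prefactor_rlo : rlo
 (fun n => n%:R * eps n / (sg n * Num.sqrt (s n * t n)) *
  expR (n%:R / (2 * t n) * (p n - y n) ^+ 2 - n%:R / (2 * s n) * (p n - x n) ^+ 2 + (gf n (t n) (y n) - gf n (s n) (x n))))
 (fun n => expR (pex n)).
Proof.
pose omn n := n%:R * (h n + T * (G n - G0)) / (T * sg n).
pose bn n := k * n%:R * (G0 - G n) / sg n.
pose rt n := T / t n; pose rs n := T / s n.
have c1 : rlo (fun n => Num.sqrt (rt n * rs n)) (fun=> 1).
 apply: rlo_cvg; have -> : 1 = Num.sqrt (1 * 1) :> R by rewrite mulr1 sqrtr1.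
 apply: continuous_cvg; first exact: sqrt_continuous.
 by apply: cvgM; exact: ratio_cvg.
have rb (tau : nat -> R) z : bseq tau -> bseq z -> rlo (fun n => T / tn n (tau n) * (tau n * bn n + z n)) (fun n => 1 * (tau n * b + z n)).
 move=> Bt Bz; apply: rloM; first exact: bseq_cst.
 - exact: bseqD (bseqM _ _ Bt (bseq_cst b)) Bz.
 - exact: rlo_cvg (ratio_cvg _ Bt).
 - exact: rloD _ _ _ _ (rloM _ _ _ _ Bt (bseq_cst b) (rlo_refl _) (rlo_cvg _ _ b_cvg)) (rlo_refl z).
have Bk : bseq (fun n => k * (tau1 n - tau2 n) / 2).
 exact: bseqM _ _ (bseqM _ _ (bseq_cst k) (bseqD _ _ B1 (bseqN _ B2))) (bseq_cst 2^-1).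
have BA tau z : bseq tau -> bseq z -> bseq (fun n => tau n * b + z n) by move=> Bt Bz; exact: bseqD (bseqM _ _ Bt (bseq_cst b)) Bz.
have BA1 tau z (Bt : bseq tau) (Bz : bseq z) := bseqM _ _ (bseq_cst 1) (BA _ _ Bt Bz).
pose L1 n := omn n ^+ 2 * (rt n * rs n) * (k * (tau1 n - tau2 n) / 2).
have e1 : rlo L1 (fun n => om ^+ 2 * (1 * 1) * (k * (tau1 n - tau2 n) / 2)).
 apply: rloM; [exact: bseq_cst|exact: Bk| |exact: rlo_refl].
 apply: rlo_cvg; apply: cvgM; last by apply: cvgM; exact: ratio_cvg.
 by rewrite expr2; under eq_fun do rewrite expr2; exact: cvgM.
pose L2 n := omn n * (rt n * (tau2 n * bn n + v n) - rs n * (tau1 n * bn n + u n)).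
have e2 : rlo L2 (fun n => om * (1 * (tau2 n * b + v n) - 1 * (tau1 n * b + u n))).
 apply: rloM; [exact: bseq_cst|exact: bseqD (BA1 _ _ B2 B4) (bseqN _ (BA1 _ _ B1 B3))|exact: rlo_cvg om_cvg|].
 exact: rloD _ _ _ _ (rb _ _ B2 B4) (rloN _ _ (rb _ _ B1 B3)).
pose L3 n := dl n * ((2 * T)^-1 * (rt n * (tau2 n * bn n + v n) * (tau2 n * bn n + v n) - rs n * (tau1 n * bn n + u n) * (tau1 n * bn n + u n))).
have e3 : rlo L3 (fun n => 0 * ((2 * T)^-1 * (1 * (tau2 n * b + v n) * (tau2 n * b + v n) - 1 * (tau1 n * b + u n) * (tau1 n * b + u n)))).
 have q tau z (Bt : bseq tau) (Bz : bseq z) := rloM _ _ _ _ (BA1 _ _ Bt Bz) (BA _ _ Bt Bz) (rb _ _ Bt Bz)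
   (rloD _ _ _ _ (rloM _ _ _ _ Bt (bseq_cst b) (rlo_refl _) (rlo_cvg _ _ b_cvg)) (rlo_refl z)).
 have qb tau z (Bt : bseq tau) (Bz : bseq z) := bseqM _ _ (BA1 _ _ Bt Bz) (BA _ _ Bt Bz).
 apply: rloM; first exact: bseq_cst.
 - exact: bseqM _ _ (bseq_cst _) (bseqD _ _ (qb _ _ B2 B4) (bseqN _ (qb _ _ B1 B3))).
 - exact: rlo_cvg dl_cvg.
 - apply: rloM; [exact: bseq_cst|exact: bseqD (qb _ _ B2 B4) (bseqN _ (qb _ _ B1 B3))|exact: rlo_refl|].
  exact: rloD _ _ _ _ (q _ _ B2 B4) (rloN _ _ (q _ _ B1 B3)).
have e4 : rlo (fun n => L1 n - L2 n + L3 n) (fun n => pex n).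
 have := rloD _ _ _ _ (rloD _ _ _ _ e1 (rloN _ _ e2)) e3; apply: cvg_ext => n.
 by congr (_ - _); rewrite !mul1r mul0r mulr1 addr0.
have Be : bseq (fun n => pex n).
 exact: bseqD (bseqM _ _ (bseq_cst _) Bk) (bseqN _ (bseqM _ _ (bseq_cst om) (bseqD _ _ (BA _ _ B2 B4) (bseqN _ (BA _ _ B1 B3))))).
have Bx : bseq (fun n => expR (pex n)).
 case: Be => A hA; exists (expR A) => n; rewrite ger0_norm ?expR_ge0// ler_expR.
 exact: le_trans (ler_norm _) (hA n).
have := rloM _ _ _ _ (bseq_cst 1) Bx c1 (rlo_exp _ _ Be e4).
have -> : (fun n => 1 * expR (pex n)) =
 (fun n => expR (pex n)) by apply/funext => n; rewrite mul1r.
apply: rlo_eq; near=> n.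
have n0 : (0 < n)%N by near: n; exact: n_pos.
have nn : n%:R != 0 :> R by rewrite pnatr_eq0 -lt0n.
have s0 := lt0r_neq0 (sg0 n n0).
have tp : 0 < t n by near: n; exact: time_pos.
have sp : 0 < s n by near: n; exact: time_pos.
have tt := lt0r_neq0 tp; have ss := lt0r_neq0 sp; have TT := lt0r_neq0 T0.
congr (_ * _).
 rewrite /rt /rs (_ : T / t n * (T / s n) = T ^+ 2 / (s n * t n)); last by field; rewrite tt ss.
 rewrite sqrtrM ?sqr_ge0// sqrtr_sqr gtr0_norm// sqrtrV ?mulr_ge0 ?ltW//.
 have : Num.sqrt (s n * t n) != 0 by rewrite gt_eqF// sqrtr_gt0 mulr_gt0.
 by rewrite /eps; move=> q0; field; rewrite nn s0 q0.
congr expR; rewrite gauge_exponent//.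
have Et : t n * sg n ^+ 2 = T * sg n ^+ 2 + k * tau2 n * n%:R by rewrite /t /tn /dl; field.
have Es : s n * sg n ^+ 2 = T * sg n ^+ 2 + k * tau1 n * n%:R by rewrite /s /tn /dl; field.
rewrite /L1 /L2 /L3 /omn /bn /rt /rs /h /y /x /dl -/(G n).
move: (t n) (s n) tp sp tt ss Et Es (G n) (lt0r_neq0 k0) => t' s' _ _ tt ss Et Es Gn kk.
have -> : tau2 n = (t' - T) * sg n ^+ 2 / n%:R / k.
 by apply: (mulIf kk); rewrite divfK//; apply: (mulIf nn); rewrite divfK// mulrBl Et; ring.
have -> : tau1 n = (s' - T) * sg n ^+ 2 / n%:R / k.
 by apply: (mulIf kk); rewrite divfK//; apply: (mulIf nn); rewrite divfK// mulrBl Es; ring.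
by field; rewrite ?nn ?s0 ?tt ?ss ?TT ?kk.
Unshelve. all: end_near. Qed.

(** The gauge also turns the Gaussian term into an exact Gaussian whose centre involves n only
    through [bn]; [gauss_lip] then compares it with the limit, the bound |bn - b|/k being uniform in
    the times. *)
Lemma gauss_rlo : rlo
 (fun n => (if t n < s n then Num.sqrt n%:R / Num.sqrt (2 * pi * (s n - t n)) * expR (- (n%:R * (x n - y n) ^+ 2 / (2 * (s n - t n)))) else 0)
   * expR (gf n (t n) (y n) - gf n (s n) (x n)) / sg n)
 (fun n => if tau2 n < tau1 n then expR (- ((u n - v n + (tau1 n - tau2 n) * b) ^+ 2 / (2 * k * (tau1 n - tau2 n)))) /
   Num.sqrt (2 * pi * k * (tau1 n - tau2 n)) else 0).
Proof.
pose bn n := k * n%:R * (G0 - G n) / sg n.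
have c0 : (fun n => `|bn n - b| / k) @ \oo --> (0:R).
 have : (fun n => `|bn n - b|) @ \oo --> `|0 : R| by apply: cvg_norm; exact: rlo_cvg b_cvg.
 rewrite normr0 => /(cvgM0 _ k^-1); apply: cvg_ext => n; exact: mulrC.
apply/norm_cvg0P; apply: squeeze0 c0; near=> n; rewrite normr_ge0 /=.
have n0 : (0 < n)%N by near: n; exact: n_pos.
have np : 0 < n%:R :> R by rewrite ltr0n.
have nn := lt0r_neq0 np.
have sp := sg0 n n0; have s0 := lt0r_neq0 sp.
have d0 : 0 < dl n by rewrite divr_gt0// exprn_gt0.
have E : s n - t n = k * (tau1 n - tau2 n) * dl n by rewrite /s /t /tn; ring.
have ts : (t n < s n) = (tau2 n < tau1 n) by rewrite -subr_gt0 E pmulr_lgt0// pmulr_rgt0// subr_gt0.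
rewrite ts; case: ifPn => [lt|_]; last by rewrite !mul0r subrr normr0 divr_ge0// ltW.
have dt0 : 0 < tau1 n - tau2 n by rewrite subr_gt0.
have kk := lt0r_neq0 k0.
have -> : Num.sqrt n%:R / Num.sqrt (2 * pi * (s n - t n)) * expR (- (n%:R * (x n - y n) ^+ 2 / (2 * (s n - t n)))) *
 expR (gf n (t n) (y n) - gf n (s n) (x n)) / sg n =
 expR (- ((u n - v n + (tau1 n - tau2 n) * bn n) ^+ 2 / (2 * k * (tau1 n - tau2 n)))) / Num.sqrt (2 * pi * k * (tau1 n - tau2 n)).
 have com (a c e e' g : R) : a / c * e * e' / g = (e * e') * (a / (c * g)) by rewrite (invfM c g); ring.
 rewrite com -expRD; congr (expR _ * _).
  have dd := lt0r_neq0 dt0.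
  have -> : x n - y n = (s n - t n) * G0 + (u n - v n) / sg n by rewrite /x /y; ring.
  rewrite /gf /gauge_fun -/(G n) E /bn /dl.
  have -> : x n = y n + ((s n - t n) * G0 + (u n - v n) / sg n) by rewrite /x /y; ring.
  rewrite E /dl.
  have -> : s n = t n + k * (tau1 n - tau2 n) * dl n by rewrite -E; ring.
  rewrite /dl; move: (tau1 n - tau2 n) dd (t n) (y n) (G n) => dt dd t' y' G'.
  by field; rewrite ?nn ?s0 ?dd ?kk.
 rewrite E; rewrite (_ : 2 * pi * (k * (tau1 n - tau2 n) * dl n) = (2 * pi * k * (tau1 n - tau2 n)) * (n%:R / sg n ^+ 2)); last by rewrite /dl; ring.
 rewrite sqrtrM; last by rewrite !mulr_ge0 ?pi_ge0 ?ltW.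
 rewrite (sqrtrM _ (ltW np)) sqrtrV ?sqr_ge0// sqrtr_sqr gtr0_norm//.
 have : Num.sqrt n%:R != 0 :> R by rewrite gt_eqF// sqrtr_gt0.
 have : Num.sqrt (2 * pi * k * (tau1 n - tau2 n)) != 0 by rewrite gt_eqF// sqrtr_gt0 !mulr_gt0 ?pi_gt0.
 by move=> q1 q2; field; rewrite q1 q2 s0.
by apply: gauss_lip => //; ring.
Unshelve. all: end_near. Qed.

(** The common limit theorem: base point and gauge point are independent here, and all information
    on the measures enters through seven limits of moments and offsets. *)
Lemma kernel_limit : clo
 (fun n => rescaled_kernel (tn n) (fun t => xs + t * G0) (sg n) (X n) (xg n) (x0 n) (gamma n) (tau1 n) (tau2 n) (u n) (v n))
 (fun n => (((2 * pi)%:C * 'i%C) ^+ 2)^-1 *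
  ((expR (pex n))%:C *
   L4 (Bfun (v n + k * tau2 n * eta - rho) (b0 - k * tau2 n / 2) a3 a4)
    (fun w => (Bfun (u n + k * tau1 n * eta - rho) (b0 - k * tau1 n / 2) a3 a4 w)^-1))
  - (if tau2 n < tau1 n then expR (- ((u n - v n + (tau1 n - tau2 n) * b) ^+ 2 / (2 * k * (tau1 n - tau2 n)))) /
   Num.sqrt (2 * pi * k * (tau1 n - tau2 n)) else 0)%:C).
Proof.
pose l n := scaled_poles (X n) (p n) (eps n).
pose del n := `|eps n| / D.
pose lt n := lin_coef (X n) (p n) (eps n) (n%:R / (2 * t n)) (y n).
pose ls n := lin_coef (X n) (p n) (eps n) (n%:R / (2 * s n)) (x n).
pose qt n := quad_coef (X n) (p n) (eps n) (n%:R / (2 * t n)).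
pose qs n := quad_coef (X n) (p n) (eps n) (n%:R / (2 * s n)).
pose lt' n := v n + k * tau2 n * eta - rho; pose ls' n := u n + k * tau1 n * eta - rho.
pose qt' n := b0 - k * tau2 n / 2; pose qs' n := b0 - k * tau1 n / 2.
pose c n := n%:R * eps n / (sg n * Num.sqrt (s n * t n)) *
  expR (n%:R / (2 * t n) * (p n - y n) ^+ 2 - n%:R / (2 * s n) * (p n - x n) ^+ 2 + (gf n (t n) (y n) - gf n (s n) (x n))).
pose c' n := expR (pex n).
have [N _ gapN] := gap.
have [MM [M1 [M2 [M3 [M4 M5]]]]] : exists MM, (forall n, `|lt' n| <= MM) /\ (forall n, `|ls' n| <= MM) /\
  (forall n, `|qt' n| <= MM) /\ (forall n, `|qs' n| <= MM) /\ (forall n, `|c' n| <= MM).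
 have BL tau z : bseq tau -> bseq z -> bseq (fun n => z n + k * tau n * eta - rho).
  by move=> Bt Bz; exact: bseqD (bseqD _ _ Bz (bseqM _ _ (bseqM _ _ (bseq_cst k) Bt) (bseq_cst eta))) (bseqN _ (bseq_cst rho)).
 have BQ tau : bseq tau -> bseq (fun n => b0 - k * tau n / 2).
  by move=> Bt; exact: bseqD (bseq_cst _) (bseqN _ (bseqM _ _ (bseqM _ _ (bseq_cst k) Bt) (bseq_cst 2^-1))).
 have Bc : bseq c'.
  have BA tau z : bseq tau -> bseq z -> bseq (fun n => tau n * b + z n) by move=> Bt Bz; exact: bseqD (bseqM _ _ Bt (bseq_cst b)) Bz.
  have Bk : bseq (fun n => k * (tau1 n - tau2 n) / 2).
   exact: bseqM _ _ (bseqM _ _ (bseq_cst k) (bseqD _ _ B1 (bseqN _ B2))) (bseq_cst 2^-1).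
  have [A hA] := bseqD _ _ (bseqM _ _ (bseq_cst (om ^+ 2)) Bk) (bseqN _ (bseqM _ _ (bseq_cst om) (bseqD _ _ (BA _ _ B2 B4) (bseqN _ (BA _ _ B1 B3))))).
  by exists (expR A) => n; rewrite /c' ger0_norm ?expR_ge0// ler_expR; exact: le_trans (ler_norm _) (hA n).
 have [A1 h1] := BL _ _ B2 B4; have [A2 h2] := BL _ _ B1 B3; have [A3 h3] := BQ _ B2; have [A4 h4] := BQ _ B1; have [A5 h5] := Bc.
 exists (Num.max A1 (Num.max A2 (Num.max A3 (Num.max A4 A5)))).
 split; first by move=> n; rewrite le_max h1.
 split; first by move=> n; rewrite !le_max h2 ?orbT.
 split; first by move=> n; rewrite !le_max h3 ?orbT.
 by split => n; rewrite !le_max ?h4 ?h5 ?orbT.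
have ps k' : (0 < k')%N -> \forall n \near \oo, n%:R * eps n ^+ k' * pmom (X n) (p n) k' / k'%:R = (\sum_(e <- l n) e ^+ k') / k'%:R.
 by move=> k0'; near=> n; rewrite /l sum_scaled size_tuple//; near: n; exact: n_pos.
have H1 : forall n, (N <= n)%N -> forall e, e \in l n -> `|e| <= del n.
 move=> n Nn e /mapP[a aX ->]; rewrite /del normrM; apply: ler_wpM2l => //.
 by rewrite normfV lef_pV2 ?posrE//; [exact: gapN|exact: lt_le_trans D0 (gapN n Nn a aX)].
have H2 : forall n, 0 <= del n by move=> n; rewrite divr_ge0// ltW.
have H3 : del @ \oo --> (0:R).
 have : (fun n => `|eps n|) @ \oo --> `|0 : R| by exact: cvg_norm.
 by rewrite normr0 => /(cvgM0 _ D^-1); apply: cvg_ext => n; exact: mulrC.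
have H4 : (fun n => psum3 (l n) - a3) @ \oo --> (0:R) by exact: rlo_eq (ps 3 isT) (rlo_cvg _ _ a3_cvg).
have H5 : (fun n => psum4 (l n) - a4) @ \oo --> (0:R) by exact: rlo_eq (ps 4 isT) (rlo_cvg _ _ a4_cvg).
have alt' : (forall n, 5 <= qt' n /\ 5 <= qs' n) \/ 0 < a4.
 by case: alt => [q|]; [left => n; have [] := q n|right].
have [G1 C1] := perturbed_asymptotics l del lt qt ls qs lt' qt' ls' qs' c c' a3 a4 MM N H1 H2 H3 H4 H5
 (lin_rlo _ _ B2 B4) (quad_rlo _ B2) (lin_rlo _ _ B1 B3) (quad_rlo _ B1) prefactor_rlo
 (fun n => And4 (M1 n) (M2 n) (M3 n) (M4 n)) M5 a40 alt'.
have C2 := cloB _ _ _ _ (cloZ _ _ ((((2 * pi)%:C * 'i%C) ^+ 2)^-1) C1) (clo_real _ _ gauss_rlo).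
apply: eq_clo C2; last by apply: nearW.
near=> n.
have n0 : (0 < n)%N by near: n; exact: n_pos.
have np : 0 < n%:R :> R by rewrite ltr0n.
have tp : 0 < t n by near: n; exact: time_pos.
have sp : 0 < s n by near: n; exact: time_pos.
have [K hK] : exists K, gdom4 K (Afun (lt n) (qt n) (l n)) (fun w => (Afun (ls n) (qs n) (l n) w)^-1) by near: n; exact: G1.
have Nn : (N <= n)%N by near: n; exact: nbhs_infty_ge.
have pX : p n \notin (X n : seq R).
 by apply/negP => pX; have := gapN n Nn (p n) pX; rewrite subrr normr0 leNgt D0.
have e0 : 0 < eps n by rewrite divr_gt0// mulr_gt0// sg0.
rewrite /rescaled_kernel /gauged_kernel /BM_kernel.
rewrite (BM_main n (X n) (x0 n) (gamma n) (s n) (t n) (x n) (y n) (p n) (eps n) K n0 (adm n n0) sp tp pX e0 hK).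
rewrite -/(l n) -/(lt n) -/(qt n) -/(ls n) -/(qs n) -/(s n) -/(t n) -/(x n) -/(y n) -/(gf n (t n) (y n)) -/(gf n (s n) (x n)).
have s0 := lt0r_neq0 (sg0 n n0).
have q0 : Num.sqrt (s n * t n) != 0 by rewrite gt_eqF// sqrtr_gt0 mulr_gt0.
set LL := L4 _ _; set W := (_ * 'i%C) ^+ 2.
rewrite RCM -[in RHS]RCnat /c.
set gg := (if _ then _ else _).
set Ex := gf n (t n) (y n) - gf n (s n) (x n).
rewrite expRD !RCM !RCV !RCM.
have q0' : (Num.sqrt (s n * t n))%:C != 0 :> C by rewrite -nc_eq0 ncC normr_eq0.
have s0' : (sg n)%:C != 0 :> C by rewrite -nc_eq0 ncC normr_eq0.
rewrite (invfM W); move: (W^-1) => W'.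
field; apply/and3P; split; [by rewrite pnatr_eq0 -lt0n|exact: q0'|exact: s0'].
Unshelve. all: end_near. Qed.

End Data.
End PerturbedLimit.

(** * Moments and the Kolmogorov distance *)

Section Kolmogorov.
Context {R : realType}.
Local Notation mR := (measurableTypeR R).
Implicit Types m : {measure set mR -> \bar R}.

Lemma bounded_integrable m (f : R -> R) A : m setT = 1%E -> measurable_fun setT (f : mR -> R) ->
 (forall s, `|f s| <= A) -> m.-integrable setT (EFin \o f).
Proof.
move=> m1 mf fA; apply: measurable_bounded_integrable => //; first by rewrite m1 ltry.
exists A; split; first exact: num_real.
by move=> x Ax s _; exact: le_trans (fA s) (ltW Ax).
Qed.

Lemma Rint_cst m (c : R) : m setT = 1%E -> \int[m]_s c = c.
Proof. by move=> m1; rewrite Rintegral_cst// m1 mulr1. Qed.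

Lemma Rint_indic m (A : set mR) : m setT = 1%E -> measurable A -> \int[m]_s (\1_A s : R) = fine (m A).
Proof. by move=> m1 mA; rewrite /Rintegral integral_indic// setIT. Qed.

Lemma Rint_err m (f g : R -> R) A B e : m setT = 1%E -> measurable_fun setT (f : mR -> R) -> measurable_fun setT (g : mR -> R) ->
 (forall s, `|f s| <= A) -> (forall s, `|g s| <= B) -> (forall s, `|f s - g s| <= e) ->
 `|\int[m]_s f s - \int[m]_s g s| <= e.
Proof.
move=> m1 mf mg fA gB fg.
have i1 := bounded_integrable m f A m1 mf fA; have i2 := bounded_integrable m g B m1 mg gB.
have mfg : measurable_fun setT ((fun s => f s - g s) : mR -> R) by exact: measurable_funB.
rewrite -RintegralB// (le_trans (le_normr_Rintegral _ _))//.
 exact: (bounded_integrable m _ e m1 mfg fg).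
rewrite -[leRHS](Rint_cst m _ m1); apply: le_Rintegral => //.
 apply: (bounded_integrable m _ e m1); first exact: measurableT_comp.
 by move=> s; rewrite normr_id.
by apply: (bounded_integrable m _ `|e| m1); first exact: measurable_cst.
Qed.

(** Written with indicators subtracted from a constant because integrals of indicators of lower sets
    are values of the distribution function. *)
Definition step_fun (c : R) (e : nat -> R) (S : nat -> set R) (n : nat) (s : R) : R :=
 c - \sum_(i < n) e i * \1_(S i) s.

Lemma step_fun_int (c : R) (e : nat -> R) (S : nat -> set R) n : (forall i, measurable (S i : set mR)) ->
 let B := `|c| + \sum_(i < n) `|e i| in
 0 <= B /\ (measurable_fun setT (step_fun c e S n : mR -> R) /\ ((forall s, `|step_fun c e S n s| <= B) /\
 forall m, m setT = 1%E -> \int[m]_s step_fun c e S n s = c - \sum_(i < n) e i * fine (m (S i)))).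
Proof.
move=> mS; elim: n => [|n [i1 [i2 [i3 i4]]]] B.
 have E : step_fun c e S 0 = fun=> c by apply/funext => s; rewrite /step_fun big_ord0 subr0.
 rewrite /B big_ord0 addr0 E; split; first exact: normr_ge0.
 split; first exact: measurable_cst.
 by split=> // m m1; rewrite big_ord0 subr0 Rint_cst.
have E : step_fun c e S n.+1 = (fun s => step_fun c e S n s - e n * \1_(S n) s).
 by apply/funext => s; rewrite /step_fun big_ord_recr /= opprD addrA.
have mI : measurable_fun setT ((fun s => e n * \1_(S n) s) : mR -> R).
 by apply: measurable_funM; [exact: measurable_cst|exact: measurable_indic].
have bI s : `|e n * \1_(S n) s| <= `|e n|.
 by rewrite normrM ler_piMr// indicE; case: (_ \in _); rewrite ?normr1 ?normr0.
rewrite /B big_ord_recr /= addrA; split; first exact: addr_ge0.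
rewrite E; split; first exact: measurable_funB.
split; first by move=> s; rewrite (le_trans (ler_normB _ _))// lerD.
move=> m m1; have ii := bounded_integrable m _ _ m1 mI bI.
have ij := bounded_integrable m _ _ m1 i2 i3.
have iS : m.-integrable setT (EFin \o (\1_(S n) : mR -> R)).
 apply: (bounded_integrable m _ 1 m1); first exact: measurable_indic.
 by move=> s; rewrite indicE; case: (_ \in _); rewrite ?normr1 ?normr0.
rewrite RintegralB// RintegralZl// Rint_indic// i4// big_ord_recr /= opprD addrA; done.
Qed.

Lemma level_approx (dt y : R) n : 0 < dt -> 0 <= y -> y <= dt * n%:R ->
 \sum_(i < n) dt * (dt * i.+1%:R < y)%R%:R <= y <= \sum_(i < n) dt * (dt * i.+1%:R < y)%R%:R + dt.
Proof.
move=> d0 y0 yn; set S := \sum_(i < n) _.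
have : [/\ S <= y, S <= dt * n%:R & dt * n%:R <= S \/ y <= S + dt].
 rewrite /S {S yn}; elim: n => [|n [i1 i2 i3]]; first by rewrite big_ord0 mulr0; split=> //; left.
 rewrite big_ord_recr /=; set S := \sum_(_ < _) _ in i1 i2 i3 *.
 have E : dt * n.+1%:R = dt * n%:R + dt by rewrite -natr1 mulrDr mulr1.
 rewrite E; have [h|h] := ltP (dt * n%:R + dt) y; rewrite ?mulr1 ?mulr0 ?addr0.
  by split; [lra|lra|left; case: i3; lra].
 by split; [lra|lra|right; case: i3; lra].
by case=> h1 h2 h3; apply/andP; split=> //; case: h3; lra.
Qed.

Section Comparison.
Variables (m1 m2 : {measure set mR -> \bar R}) (d : R).
Hypotheses (m11 : m1 setT = 1%E) (m21 : m2 setT = 1%E)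
 (dF : forall x, `|distr_fun m1 x - distr_fun m2 x| <= d).

Let d0 : 0 <= d. Proof. exact: le_trans (dF 0). Qed.

(** A sublevel set of a continuous nondecreasing function is empty, everything or a closed half-line
    ending at its supremum. *)
Lemma down_set_diff (f : R -> R) r : continuous f -> {homo f : x y / x <= y} ->
 `|fine (m1 [set s | f s <= r]) - fine (m2 [set s | f s <= r])| <= d.
Proof.
move=> cf hf; set S := [set s | f s <= r].
have [S0|/set0P S0] := eqVneq S set0; first by rewrite S0 !measure0 subrr normr0.
have [[b Sb]|nb] := pselect (exists b, ubound S b); last first.
 have -> : S = setT.
  apply/seteqP; split => // s _; apply: contrapT => nS; apply: nb; exists s => t St.
  by rewrite leNgt; apply/negP => ts; apply: nS; apply: le_trans (hf _ _ (ltW ts)) St.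
 by rewrite m11 m21 subrr normr0.
have hS : has_sup S by split => //; exists b.
suff -> : S = [set y | y <= sup S] by exact: dF.
apply/seteqP; split => s; first by move=> Ss; apply: ub_le_sup => //; exists b.
rewrite /= le_eqVlt => /predU1P[|lt]; last first.
 have [t St tS] := sup_adherent (ltac:(by rewrite subr_gt0; exact: lt) : 0 < sup S - s) hS.
 by apply: le_trans St; apply: hf; apply: ltW; move: tS; rewrite subKr.
move=> ->; change (f (sup S) <= r); rewrite leNgt; apply/negP => rf.
have : \forall z \near sup S, r < f z by exact: (cvgr_gt (f (sup S)) (cf _) _ rf).
move=> /nbhs_ballP[e /= e0 he].
have [t St tS] := sup_adherent e0 hS.
have : r < f t.
 apply: he; rewrite /ball /= ger0_norm; first lra.
 by rewrite subr_ge0; apply: ub_le_sup => //; exists b.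
by rewrite ltNge; move: St => /= ->.
Qed.

(** Layer by layer: equal steps of height dt with total height A approximate f uniformly, and each
    sublevel set contributes at most [dt * d]. *)
Lemma monotone_diff (f : R -> R) A : 0 < A -> continuous f -> {homo f : x y / x <= y} ->
 (forall s, 0 <= f s <= A) -> `|\int[m1]_s f s - \int[m2]_s f s| <= A * d.
Proof.
move=> A0 cf hf fA.
have mf : measurable_fun setT (f : mR -> R) by exact: continuous_measurable_fun.
have mS r : measurable ([set s | f s <= r] : set mR).
 by rewrite -[X in measurable X]setTI; exact: measurable_fun_le.
apply/ler_addgt0Pr => e e0.
have [M hM] : exists M : nat, A / M.+1%:R <= e / 2.
 exists (Num.trunc (2 * A / e)).+1; rewrite ler_pdivrMr// -ler_pdivrMl ?divr_gt0//.
 rewrite (_ : (e / 2)^-1 * A = 2 * A / e); last by field; rewrite gt_eqF.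
 by rewrite (le_trans (ltW (truncnS_gt _)))// ler_nat.
pose dt := A / M.+1%:R; pose S i := [set s | f s <= dt * i.+1%:R] : set mR.
have dt0 : 0 < dt by rewrite divr_gt0.
have dtA : dt * M.+1%:R = A by rewrite divfK.
pose g s := step_fun A (fun=> dt) S M.+1 s.
have gf s : `|f s - g s| <= e / 2.
 have /andP[f0 f1] := fA s; rewrite -dtA in f1; have := level_approx dt (f s) M.+1 dt0 f0 f1.
 rewrite /g /step_fun; set u := \sum_(i < _) _; set w := \sum_(i < _) _.
 have -> : u = A - w.
  rewrite -dtA mulr_natr -[in dt *+ M.+1](card_ord M.+1) -sumr_const -sumrB; apply: eq_bigr => i _.
  rewrite indicE; have [h|h] := ltP (dt * i.+1%:R) (f s).
   by rewrite memNset ?mulr0 ?mulr1 ?subr0// /S /= leNgt h.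
  by rewrite mem_set// mulr1 mulr0 subrr.
 by move=> h; apply: le_trans hM; rewrite ler_norml; move: h => /andP[]; rewrite -/dt; lra.
have [q1 [q2 [q3 q4]]] := step_fun_int A (fun=> dt) S M.+1 (fun i => mS _).
have E1 := Rint_err m1 f g A _ _ m11 mf q2 (fun s => ltac:(by have /andP[h1 h2] := fA s; rewrite ger0_norm)) q3 gf.
have E2 := Rint_err m2 f g A _ _ m21 mf q2 (fun s => ltac:(by have /andP[h1 h2] := fA s; rewrite ger0_norm)) q3 gf.
have E3 : `|\int[m1]_s g s - \int[m2]_s g s| <= A * d.
 have AB (x a c : R) : x - a - (x - c) = c - a by ring.
 rewrite (q4 m1 m11) (q4 m2 m21) AB -sumrB.
 rewrite -[X in _ <= X * d]dtA mulr_natr -[in dt *+ M.+1](card_ord M.+1) -sumr_const mulr_suml.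
 apply: le_trans (ler_norm_sum _ _ _) _; apply: ler_sum => i _.
 by rewrite -mulrBr normrM gtr0_norm// ler_wpM2l ?(ltW dt0)// distrC; exact: down_set_diff.
have -> : \int[m1]_s f s - \int[m2]_s f s = (\int[m1]_s f s - \int[m1]_s g s) + (\int[m1]_s g s - \int[m2]_s g s)
  - (\int[m2]_s f s - \int[m2]_s g s) by ring.
rewrite (le_trans (ler_normB _ _))// (le_trans (lerD (ler_normD _ _) (lexx _)))//; lra.
Qed.

End Comparison.
Lemma integrable_scale m c (f : R -> R) : m.-integrable setT (EFin \o f) -> m.-integrable setT (EFin \o (fun s => c * f s)).
Proof.
by move=> i; have := integrableZl measurableT c i; apply: eq_integrable.
Qed.

Definition mom m (x : R) (k : nat) : R := \int[m]_s ((x - s) ^+ k)^-1.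

(** The hypothesis is the resolvent identity for a = 1/y and a' = 1/(y + h). Substituting it
    repeatedly gives the remainder in closed form, without derivatives. *)
Lemma inv_sub_taylor (a a' h B : R) k : `|a| <= B -> `|a'| <= B -> a' = a - h * a * a' ->
 `|a' ^+ k - a ^+ k + k%:R * h * a ^+ k.+1| <= k%:R ^+ 2 * B ^+ (k + 2) * h ^+ 2.
Proof.
move=> aB aB' E; have B0 : 0 <= B := le_trans (normr_ge0 _) aB.
have aX j : `|a ^+ j| <= B ^+ j by rewrite normrX lerXn2r ?nnegrE.
have E2 : a' - a + h * a ^+ 2 = h ^+ 2 * (a ^+ 2 * a').
 rewrite {1}E {1}E; ring.
have H2 : 0 <= h ^+ 2 by rewrite sqr_ge0.
elim: k => [|k ih]; first by rewrite !expr0 !mul0r subrr addr0 normr0 expr0n /= !mul0r.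
have -> : a' ^+ k.+1 - a ^+ k.+1 + k.+1%:R * h * a ^+ k.+2 =
  a' * (a' ^+ k - a ^+ k + k%:R * h * a ^+ k.+1) + (a ^+ k * (a' - a + h * a ^+ 2) + k%:R * h ^+ 2 * (a ^+ k.+2 * a')).
 have -> : k%:R * h ^+ 2 * (a ^+ k.+2 * a') = - (k%:R * h * a ^+ k.+1) * (a' - a) by rewrite {2}E !exprS; ring.
 by rewrite -natr1 !exprS; ring.
rewrite E2.
have t1 : `|a' * (a' ^+ k - a ^+ k + k%:R * h * a ^+ k.+1)| <= k%:R ^+ 2 * B ^+ (k + 3) * h ^+ 2.
 rewrite normrM (le_trans (ler_pM _ _ aB' ih))//.
 by rewrite (_ : (k + 3 = (k + 2).+1)%N) ?exprS; [rewrite le_eqVlt; apply/orP; left; apply/eqP; ring|rewrite addnS].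
have t2 : `|a ^+ k * (h ^+ 2 * (a ^+ 2 * a'))| <= B ^+ (k + 3) * h ^+ 2.
 rewrite (_ : a ^+ k * (h ^+ 2 * (a ^+ 2 * a')) = (a ^+ (k + 2) * a') * h ^+ 2); last by rewrite exprD; ring.
 rewrite normrM (ger0_norm H2) ler_wpM2r// normrM (_ : (k + 3 = (k + 2) + 1)%N); last by rewrite -addnA.
 by rewrite (exprD B (k + 2) 1) expr1 ler_pM.
have t3 : `|k%:R * h ^+ 2 * (a ^+ k.+2 * a')| <= k%:R * (B ^+ (k + 3) * h ^+ 2).
 have kh : 0 <= k%:R * h ^+ 2 by rewrite mulr_ge0.
 have zz : `|a ^+ k.+2 * a'| <= B ^+ (k + 3).
  by rewrite normrM (_ : (k + 3 = k.+2 + 1)%N) ; [rewrite (exprD B k.+2 1) expr1 ler_pM|rewrite addn3 addn1].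
 rewrite normrM (ger0_norm kh) (_ : k%:R * (B ^+ (k + 3) * h ^+ 2) = k%:R * h ^+ 2 * B ^+ (k + 3)); last by ring.
 exact: ler_wpM2l.
rewrite (le_trans (ler_normD _ _))// (le_trans (lerD t1 (le_trans (ler_normD _ _) (lerD t2 t3))))//.
rewrite (_ : (k.+1 + 2 = k + 3)%N); last by rewrite addSn -addnS.
have Y : 0 <= B ^+ (k + 3) * h ^+ 2 by rewrite mulr_ge0// exprn_ge0.
have kY : 0 <= (k%:R : R) * (B ^+ (k + 3) * h ^+ 2) by rewrite mulr_ge0.
have -> : k.+1%:R ^+ 2 * B ^+ (k + 3) * h ^+ 2 = (k%:R ^+ 2 * B ^+ (k + 3) * h ^+ 2 +
  (B ^+ (k + 3) * h ^+ 2 + k%:R * (B ^+ (k + 3) * h ^+ 2))) + k%:R * (B ^+ (k + 3) * h ^+ 2).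
 by rewrite -natr1; ring.
by rewrite lerDl.
Qed.

Lemma inv_sub_taylor3 (a a' h B : R) : `|a| <= B -> `|a'| <= B -> a' = a - h * a * a' ->
 `|a' - a + h * a ^+ 2 - h ^+ 2 * a ^+ 3| <= B ^+ 4 * `|h| ^+ 3.
Proof.
move=> aB aB' E; have B0 : 0 <= B := le_trans (normr_ge0 _) aB.
have -> : a' - a + h * a ^+ 2 - h ^+ 2 * a ^+ 3 = - h ^+ 3 * (a ^+ 3 * a').
 by rewrite {1}E {1}E {1}E; ring.
rewrite normrM normrN normrX mulrC ler_wpM2r ?exprn_ge0// normrM normrX [B ^+ 4]exprSr.
by rewrite ler_pM// ?exprn_ge0// lerXn2r ?nnegrE.
Qed.

Section Gap.
Variables (xs D : R).
Hypothesis D0 : 0 < D.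
Let B := 2 / D.
(** The interval is half-open so that its mass is a difference of two values of the distribution
    function. *)
Definition gapped m := m setT = 1%E /\ m (`]xs - D, xs + D]%classic : set mR) = 0%E.
Let near_ (x : R) := `|x - xs| <= D / 2.

(** Cutting the power off inside the gap makes it bounded everywhere and changes it only on a null
    set of a gapped measure. *)
Definition rpow (x : R) (k : nat) (s : R) : R := if s \in `]xs - D, xs + D] then 0 else ((x - s)^-1) ^+ k.

Lemma rpow_bound x k s : near_ x -> `|rpow x k s| <= B ^+ k.
Proof.
move=> nx; have B0 : 0 <= B by rewrite divr_ge0// ltW.
rewrite /rpow; case: ifPn => h; first by rewrite normr0 exprn_ge0.
rewrite normrX lerXn2r ?nnegrE// normfV /B -[2 / D]invf_div lef_pV2 ?posrE ?divr_gt0//.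
 by have := D0; move: nx h; rewrite /near_ in_itv/= ler_norml negb_and -leNgt -ltNge => /andP[a1 a2] /orP[h|h] dd; rewrite ler_normr; apply/orP; [left|right]; lra.
by rewrite normr_gt0; have := D0; move: nx h; rewrite /near_ in_itv/= ler_norml negb_and -leNgt -ltNge => /andP[a1 a2] /orP[h|h] dd; [rewrite gt_eqF//; lra|rewrite lt_eqF//; lra].
Qed.

Lemma measurable_inv_sub (x : R) k : measurable_fun setT ((fun s => ((x - s) ^+ k)^-1) : mR -> R).
Proof.
have -> : (fun s => ((x - s) ^+ k)^-1) = (fun s : mR => ((x - s) * ((x - s) ^+ 2)^-1) ^+ k).
 apply/funext => s; rewrite -exprVn; congr (_ ^+ _).
 by have [->|h] := eqVneq (x - s) 0; [rewrite invr0 mul0r|rewrite expr2 invfM mulrA mulfV// mul1r].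
apply: measurable_funX; apply: measurable_funM; first exact: measurable_funB.
under eq_fun do rewrite -powR_inv1 ?sqr_ge0//.
apply: (measurableT_comp (measurable_powR (-1))).
by apply: measurable_funX; exact: measurable_funB.
Qed.

Lemma measurable_rpow x k : measurable_fun setT (rpow x k : mR -> R).
Proof.
have -> : rpow x k = (fun s => \1_(~` `]xs - D, xs + D]) s * ((x - s) ^+ k)^-1).
 apply/funext => s; rewrite /rpow indicE; case: ifPn => h.
  by rewrite memNset ?mul0r//=; apply.
 by rewrite mem_set ?mul1r ?exprVn//=; exact/negP.
apply: measurable_funM; last exact: measurable_inv_sub.
by apply: measurable_indic; apply: measurableC.
Qed.

Lemma momE m x k : gapped m -> mom m x k = \int[m]_s rpow x k s.
Proof.
move=> [m1 m0]; rewrite /mom /Rintegral; congr fine.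
apply: ae_eq_integral => //.
- by apply/measurable_EFinP; exact: measurable_inv_sub.
- by apply/measurable_EFinP; exact: measurable_rpow.
exists `]xs - D, xs + D]%classic; split => //.
move=> s /= h; apply: contrapT => ns; apply: h => _; rewrite /rpow.
by case: ifPn => [/ns//|_]; rewrite exprVn.
Qed.

Lemma rpow_shift x h s : near_ x -> near_ (x + h) ->
 s \notin `]xs - D, xs + D] -> (x + h - s)^-1 = (x - s)^-1 - h * (x - s)^-1 * (x + h - s)^-1.
Proof.
rewrite /near_ in_itv/= !ler_norml negb_and -leNgt -ltNge => /andP[a1 a2] /andP[b1 b2] c.
have dd := D0.
have n1 : x - s != 0 by case/orP: c => c; [rewrite gt_eqF//; lra|rewrite lt_eqF//; lra].
have n2 : x + h - s != 0 by case/orP: c => c; [rewrite gt_eqF//; lra|rewrite lt_eqF//; lra].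
by field; rewrite ?n1 ?n2.
Qed.

Lemma rpow1_bound x s : near_ x -> s \notin `]xs - D, xs + D] -> `|(x - s)^-1| <= B.
Proof. by move=> nx /negPf h; have := rpow_bound x 1 s nx; rewrite /rpow h !expr1. Qed.

Lemma mom_taylor m x h k : gapped m -> near_ x -> near_ (x + h) ->
 `|mom m (x + h) k - mom m x k + k%:R * h * mom m x k.+1| <= k%:R ^+ 2 * B ^+ (k + 2) * h ^+ 2.
Proof.
move=> gm nx nxh; have [m1 _] := gm; rewrite !momE//.
have i j := bounded_integrable m _ _ m1 (measurable_rpow x j) (rpow_bound x j ^~ nx).
have E : \int[m]_s (rpow x k s - k%:R * h * rpow x k.+1 s) = \int[m]_s rpow x k s - k%:R * h * \int[m]_s rpow x k.+1 s.
 by rewrite RintegralB// ?RintegralZl//; exact: (integrable_scale _ (k%:R * h) _ (i k.+1)).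
rewrite -addrA (_ : - _ + _ = - (\int[m]_s rpow x k s - k%:R * h * \int[m]_s rpow x k.+1 s)); last by rewrite opprB addrC.
rewrite -E; apply: (Rint_err m _ _ _ (B ^+ k + `|k%:R * h| * B ^+ k.+1) _ m1 (measurable_rpow (x + h) k) _ (rpow_bound (x + h) k ^~ nxh)).
- apply: measurable_funB; first exact: measurable_rpow.
 by apply: measurable_funM; [exact: measurable_cst|exact: measurable_rpow].
- move=> s; rewrite (le_trans (ler_normB _ _))// lerD ?rpow_bound// normrM ler_wpM2l ?rpow_bound//.
- move=> s; rewrite /rpow; case: ifPn => c.
  by rewrite mulr0 !subr0 normr0; apply: mulr_ge0 (sqr_ge0 _); apply: mulr_ge0 (sqr_ge0 _) _; rewrite exprn_ge0// divr_ge0// ltW.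
 have := inv_sub_taylor _ _ h B k (rpow1_bound x s nx c) (rpow1_bound _ s nxh c) (rpow_shift x h s nx nxh c).
 by congr (`|_| <= _); ring.
Qed.

Lemma mom_taylor3 m x h : gapped m -> near_ x -> near_ (x + h) ->
 `|mom m (x + h) 1 - mom m x 1 + h * mom m x 2 - h ^+ 2 * mom m x 3| <= B ^+ 4 * `|h| ^+ 3.
Proof.
move=> gm nx nxh; have [m1 _] := gm; rewrite !momE//.
have i j := bounded_integrable m _ _ m1 (measurable_rpow x j) (rpow_bound x j ^~ nx).
have E : \int[m]_s (rpow x 1 s - (h * rpow x 2 s - h ^+ 2 * rpow x 3 s)) =
  \int[m]_s rpow x 1 s - (h * \int[m]_s rpow x 2 s - h ^+ 2 * \int[m]_s rpow x 3 s).
 have j2 := integrable_scale _ h _ (i 2); have j3 := integrable_scale _ (h ^+ 2) _ (i 3).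
 rewrite RintegralB//; last exact: (integrableB _ j2 j3).
 by rewrite RintegralB// ?RintegralZl//; exact: i.
rewrite (_ : _ - _ + _ - _ = \int[m]_s rpow (x + h) 1 s - (\int[m]_s rpow x 1 s - (h * \int[m]_s rpow x 2 s - h ^+ 2 * \int[m]_s rpow x 3 s))); last by ring.
rewrite -E; apply: (Rint_err m _ _ _ (B ^+ 1 + (`|h| * B ^+ 2 + `|h ^+ 2| * B ^+ 3)) _ m1 (measurable_rpow (x + h) 1) _ (rpow_bound (x + h) 1 ^~ nxh)).
- apply: measurable_funB; first exact: measurable_rpow.
 by apply: measurable_funB; apply: measurable_funM; try exact: measurable_cst; exact: measurable_rpow.
- move=> s; rewrite (le_trans (ler_normB _ _))// lerD ?rpow_bound// (le_trans (ler_normB _ _))// !normrM.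
 by apply: lerD; apply: ler_wpM2l; rewrite ?mulr_ge0 ?rpow_bound.
- move=> s; rewrite /rpow; case: ifPn => c.
  by rewrite !mulr0 !subr0 normr0 mulr_ge0 ?exprn_ge0// divr_ge0// ltW.
 have := inv_sub_taylor3 _ _ h B (rpow1_bound x s nx c) (rpow1_bound _ s nxh c) (rpow_shift x h s nx nxh c).
 by congr (`|_| <= _); rewrite !expr1; ring.
Qed.

(** A nonnegative function with zero integral vanishes almost everywhere, but this one vanishes only
    in the gap, which has mass 0 against total mass 1. *)
Lemma mom_pos m k : gapped m -> 0 < mom m xs (2 * k).
Proof.
move=> gm; have [m1 m0] := gm.
have nx : near_ xs by rewrite /near_ subrr normr0 divr_ge0// ltW.
have r0 s : 0 <= rpow xs (2 * k) s.
 by rewrite /rpow; case: ifPn => // _; rewrite exprM exprn_ge0// sqr_ge0.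
rewrite momE// lt_neqAle Rintegral_ge0 ?andbT//.
apply/eqP => z; have i := bounded_integrable m _ _ m1 (measurable_rpow xs (2 * k)) (rpow_bound xs (2 * k) ^~ nx).
have z' : (\int[m]_(s in setT) `|(EFin \o rpow xs (2 * k)) s| = 0)%E.
 transitivity (\int[m]_(s in setT) (rpow xs (2 * k) s)%:E)%E.
  by apply: eq_integral => s _; rewrite /= ger0_norm.
 by rewrite -(fineK (integrable_fin_num measurableT i)); congr EFin.
have [N [mN N0 hN]] := (ae_eq_integral_abs m measurableT (measurable_int m i)).1 z'.
pose I : set mR := `]xs - D, xs + D]%classic.
have mI : measurable I by exact: measurable_itv.
have : (m setT <= m N + m I)%E.
 apply: (@le_trans _ _ (m (N `|` I))); last exact: measureU2.
 apply: le_measure; rewrite ?inE//; first exact: measurableU.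
 move=> s _; have [c|c] := boolP (s \in `]xs - D, xs + D]); first by right.
 left; apply: hN => /= /(_ Logic.I) [] /eqP; apply/negP.
 rewrite /rpow (negPf c) expf_eq0 negb_and orbC invr_eq0 subr_eq0.
 suff -> : xs != s by [].
 by apply: contraNneq c => <-; rewrite in_itv/=; apply/andP; split; have := D0; lra.
by rewrite N0 m1 /I m0 add0e lee_fin ler10.
Qed.

Lemma invX_mono (a c : R) k : 0 < a -> a <= c -> (c ^+ k)^-1 <= (a ^+ k)^-1.
Proof.
move=> a0 ac; have c0 : 0 < c := lt_le_trans a0 ac.
by rewrite lef_pV2 ?posrE ?exprn_gt0// lerXn2r ?nnegrE// ltW.
Qed.

Lemma moment_combination (I1 I2 J1 J2 c e F1 F2 sk A d : R) : (forall y : R, `|sk * - y| = `|y|) ->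
 `|I1 - I2| <= A * d -> `|J1 - J2| <= A * d -> `|e| <= 2 * A -> `|F1 - F2| <= d ->
 `|I1 + (sk * - J1 + (c - e * F1)) - (I2 + (sk * - J2 + (c - e * F2)))| <= 4 * A * d.
Proof.
move=> sg b1 b2 b3 b4.
have -> : I1 + (sk * - J1 + (c - e * F1)) - (I2 + (sk * - J2 + (c - e * F2))) =
 (I1 - I2) + (sk * - (J1 - J2) - e * (F1 - F2)) by ring.
rewrite (le_trans (ler_normD _ _))// (le_trans (lerD b1 (ler_normB _ _)))// sg normrM.
have : `|e| * `|F1 - F2| <= 2 * A * d by apply: ler_pM; rewrite ?normr_ge0.
lra.
Qed.

(** Outside the gap the power is the sum of a monotone function varying on the left only, up to sign
    a monotone function varying on the right only, and one jump placed inside the gap. They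
    contribute 1, 1 and 2 times B^k d. *)
Lemma mom_diff m1 m2 x k (d : R) : gapped m1 -> gapped m2 -> near_ x ->
 (forall y, `|distr_fun m1 y - distr_fun m2 y| <= d) -> `|mom m1 x k - mom m2 x k| <= 4 * B ^+ k * d.
Proof.
move=> g1 g2 nx hd; have dd := D0.
have B0 : 0 < B by rewrite divr_gt0.
have A0 : 0 < B ^+ k by rewrite exprn_gt0.
have /andP[x1 x2] : xs - D / 2 <= x <= xs + D / 2 by move: nx; rewrite /near_ ler_norml => /andP[q1 q2]; apply/andP; split; lra.
have BE : B ^+ k = ((D / 2) ^+ k)^-1 by rewrite -exprVn invf_div.
pose L (s : R) := ((x - Num.min s (xs - D)) ^+ k)^-1.
pose P (s : R) := ((Num.max s (xs + D) - x) ^+ k)^-1.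
pose cL := ((x - (xs - D)) ^+ k)^-1; pose cP := ((xs + D - x) ^+ k)^-1.
have minL s : D / 2 <= x - Num.min s (xs - D).
 by have : Num.min s (xs - D) <= xs - D; [rewrite ge_min lexx orbT|lra].
have maxP s : D / 2 <= Num.max s (xs + D) - x.
 by have : xs + D <= Num.max s (xs + D); [rewrite le_max lexx orbT|lra].
have D2 : 0 < D / 2 by lra.
have bL s : 0 <= L s <= B ^+ k.
 by rewrite BE invr_ge0 exprn_ge0 /= ?invX_mono// (le_trans (ltW D2)).
have bP s : 0 <= B ^+ k - P s <= B ^+ k.
 rewrite subr_ge0 BE invX_mono//= lerBlDr lerDl invr_ge0 exprn_ge0// (le_trans (ltW D2))//.
have hL : {homo L : s t / s <= t}.
 move=> s t st; apply: invX_mono; first exact: lt_le_trans D2 _.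
 by rewrite lerD2l lerN2 le_min !ge_min st lexx !orbT.
have hP : {homo (fun s => B ^+ k - P s) : s t / s <= t}.
 move=> s t st; rewrite lerD2l lerN2; apply: invX_mono; first exact: lt_le_trans D2 _.
 by rewrite lerD2r ge_max !le_max st lexx !orbT.
have cI (g : R -> R) : continuous g -> (forall s, D / 2 <= g s) -> continuous (fun s => (g s ^+ k)^-1).
 move=> cg g0 s; apply: (@cvgV _ _ _ _ (fun s => g s ^+ k)).
  by rewrite expf_neq0// gt_eqF// (lt_le_trans D2).
 by apply: (@continuous_comp _ _ _ g (fun y => y ^+ k)); [exact: cg|exact: exprn_continuous].
have ctL : continuous L.
 apply: cI => // s; apply: cvgB; first exact: cvg_cst.
 exact: (@continuous_min R R id (fun=> xs - D) s cvg_id (cvg_cst _)).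
have ctP' : continuous P.
 apply: (cI (fun s => Num.max s (xs + D) - x) _ maxP) => z; apply: cvgB; last exact: cvg_cst.
 exact: (@continuous_max R R id (fun=> xs + D) z cvg_id (cvg_cst _)).
have ctP : continuous (fun s => B ^+ k - P s).
 by move=> w; apply: cvgB; [exact: cvg_cst|exact: ctP'].
pose c := - cL + (-1) ^+ k * B ^+ k.
pose S (i : nat) : set R := [set s | s <= xs].
pose e (i : nat) := - (cL - (-1) ^+ k * cP).
(* The constant [c] and the jump [e] are fixed by matching the two frozen values [cL] and [cP] on
   the opposite sides of the gap. *)
have gE s : s \notin `]xs - D, xs + D] -> rpow x k s = L s + ((-1) ^+ k * - (B ^+ k - P s) + step_fun c e S 1 s).
 rewrite in_itv/= negb_and -leNgt -ltNge /rpow => h.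
 have -> : (s \in `]xs - D, xs + D]) = false.
  by apply/negP; rewrite in_itv/= => /andP[q1 q2]; case/orP: h; lra.
 rewrite /step_fun big_ord1 indicE /S /e /L /P /c exprVn.
 have PN (y : R) : ((x - y) ^+ k)^-1 = (-1) ^+ k * ((y - x) ^+ k)^-1.
  have -> : (x - y) ^+ k = (-1) ^+ k * (y - x) ^+ k by rewrite -exprMn mulN1r opprB.
  by rewrite invfM; congr (_ * _); rewrite -exprVn invrN1.
 have sg : (-1) ^+ k * (-1) ^+ k = 1 :> R by rewrite -exprMn mulrNN mulr1 expr1n.
 case/orP: h => h.
  rewrite (min_idPl h) mem_set/=; last by lra.
  rewrite (_ : Num.max s (xs + D) = xs + D) -/cP; last by apply/max_idPr; lra.
  by move: (((x - s) ^+ k)^-1) => Y; ring.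
 rewrite (_ : Num.min s (xs - D) = xs - D) -/cL; last by apply/min_idPr; lra.
 rewrite (max_idPl (ltW h)) memNset/=; last by move=> /= q; lra.
 by rewrite PN; ring.
have mS i : measurable (S i : set mR) by rewrite /S -set_itvNyc; exact: measurable_itv.
have [q1 [q2 [q3 q4]]] := step_fun_int c e S 1 mS.
have mL : measurable_fun setT (L : mR -> R) by exact: continuous_measurable_fun.
have mP : measurable_fun setT ((fun s => B ^+ k - P s) : mR -> R) by exact: continuous_measurable_fun.
have nP s : `|(-1) ^+ k * - (B ^+ k - P s)| <= B ^+ k.
 by have /andP[h1 h2] := bP s; rewrite normrM normrX normrN1 expr1n mul1r normrN ger0_norm.
have nL s : `|L s| <= B ^+ k by have /andP[h1 h2] := bL s; rewrite ger0_norm.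
have mP' : measurable_fun setT ((fun s => (-1) ^+ k * - (B ^+ k - P s)) : mR -> R).
 by apply: measurable_funM; [exact: measurable_cst|exact: measurableT_comp].
have M m : gapped m -> mom m x k = \int[m]_s L s + ((-1) ^+ k * - (\int[m]_s (B ^+ k - P s)) + (c - e 0%N * fine (m (S 0%N)))).
 move=> gm; have [mm m0] := gm.
 have i1 := bounded_integrable m _ _ mm mL nL; have i2 := bounded_integrable m _ _ mm mP' nP.
 have i3 := bounded_integrable m _ _ mm q2 q3.
 have i4 : m.-integrable setT (EFin \o (fun s => B ^+ k - P s)).
  by apply: (bounded_integrable m _ (B ^+ k) mm mP) => s; have /andP[h1 h2] := bP s; rewrite ger0_norm.
 rewrite momE//; transitivity (\int[m]_s (L s + ((-1) ^+ k * - (B ^+ k - P s) + step_fun c e S 1 s))).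
  rewrite /Rintegral; congr fine; apply: ae_eq_integral => //.
  - by apply/measurable_EFinP; exact: measurable_rpow.
  - by apply/measurable_EFinP; apply: measurable_funD => //; exact: measurable_funD.
  exists `]xs - D, xs + D]%classic; split => //.
  move=> s /= h; apply: contrapT => ns; apply: h => _; congr EFin; apply: gE; exact/negP.
 rewrite RintegralD//; last exact: (integrableD measurableT i2 i3).
 have z : \int[m]_s ((-1) ^+ k * - (B ^+ k - P s)) = (-1) ^+ k * - \int[m]_s (B ^+ k - P s).
  transitivity (\int[m]_s (- (-1) ^+ k * (B ^+ k - P s))).
   by apply: eq_Rintegral => s _; rewrite mulrN mulNr.
  by rewrite RintegralZl// mulNr mulrN.
 rewrite RintegralD; [|exact: measurableT|exact: i2|exact: i3].
 by rewrite z (q4 m mm) big_ord1.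
have [m11 _] := g1; have [m21 _] := g2.
have b1 := monotone_diff m1 m2 d m11 m21 hd L _ A0 ctL hL bL.
have b2 := monotone_diff m1 m2 d m11 m21 hd (fun s => B ^+ k - P s) _ A0 ctP hP bP.
have b3 : `|fine (m1 (S 0%N)) - fine (m2 (S 0%N))| <= d by exact: hd.
rewrite (M _ g1) (M _ g2).
have cLb : `|cL| <= B ^+ k by rewrite ger0_norm ?BE ?invX_mono ?invr_ge0 ?exprn_ge0//; lra.
have cPb : `|cP| <= B ^+ k by rewrite ger0_norm ?BE ?invX_mono ?invr_ge0 ?exprn_ge0//; lra.
have e0b : `|e 0%N| <= 2 * B ^+ k.
 rewrite /e normrN (le_trans (ler_normB _ _))// normrM normrX normrN1 expr1n mul1r; lra.
have sgn (y : R) : `|(-1) ^+ k * - y| = `|y| by rewrite normrM normrX normrN1 expr1n mul1r normrN.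
exact: moment_combination sgn b1 b2 e0b b3.
Qed.

End Gap.
(** An error quadratic in the increment determines the derivative. *)
Lemma derive1_taylor (f : R -> R) (x l K r : R) : 0 < r ->
 (forall h, `|h| <= r -> `|f (x + h) - f x - h * l| <= K * h ^+ 2) -> derive1 f x = l.
Proof.
move=> r0 H; rewrite derive1E; apply/cvg_lim => //.
apply/cvgrPdist_le => /= e e0.
have K0 : 0 <= K.
 have := H r; rewrite ger0_norm ?(ltW r0)// => /(_ (lexx _)) h; have := le_trans (normr_ge0 _) h.
 by rewrite pmulr_lge0// exprn_gt0.
have e1 : 0 < e / (K + 1) by rewrite divr_gt0// ltr_wpDl.
near=> h.
have h0 : h != 0 by near: h; exact: nbhs_dnbhs_neq.
have hr : `|h| <= r by near: h; apply: dnbhs0_le.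
have he : `|h| <= e / (K + 1) by near: h; apply: dnbhs0_le.
have -> : h *: (1 : R) + x = x + h by rewrite /GRing.scale /= mulr1 addrC.
rewrite distrC (_ : _ - l = h^-1 * (f (x + h) - f x - h * l)); last by rewrite /GRing.scale /=; field.
rewrite normrM normfV ler_pdivrMl ?normr_gt0// (le_trans (H h hr))//.
rewrite -(real_normK (num_real h)) expr2 mulrCA ler_wpM2l//.
move: he; rewrite ler_pdivlMr ?ltr_wpDl// mulrDr mulr1; have := normr_ge0 h; lra.
Unshelve. all: end_near. Qed.

Variables (xs D : R) (m : {measure set mR -> \bar R}).
Hypotheses (D0 : 0 < D) (gm : gapped xs D m).

(** Equality with a multiple of a moment is assumed near xs only, so that the lemma can be iterated
    along the derivatives of [stieltjes]. *)
Lemma derive1_mom k x (f : R -> R) (c : R) : `|x - xs| < D / 2 ->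
 (forall y, `|y - xs| < D / 2 -> f y = c * mom m y k) -> derive1 f x = - (c * k%:R) * mom m x k.+1.
Proof.
move=> nx fE; set B := 2 / D.
have r0 : 0 < (D / 2 - `|x - xs|) / 2 by rewrite divr_gt0// subr_gt0.
apply: (derive1_taylor f x _ (`|c| * (k%:R ^+ 2 * B ^+ (k + 2))) _ r0) => h hr.
have nxh : `|x + h - xs| < D / 2.
 have -> : x + h - xs = (x - xs) + h by ring.
 by rewrite (le_lt_trans (ler_normD _ _))//; lra.
rewrite !fE//.
have -> : c * mom m (x + h) k - c * mom m x k - h * (- (c * k%:R) * mom m x k.+1) =
  c * (mom m (x + h) k - mom m x k + k%:R * h * mom m x k.+1) by ring.
rewrite normrM -[leRHS]mulrA; apply: ler_wpM2l => //; apply: (mom_taylor xs D D0) => //; exact: ltW.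
Qed.

Let xs_near : `|xs - xs| < D / 2. Proof. by rewrite subrr normr0 divr_gt0. Qed.

Let d1 y : `|y - xs| < D / 2 -> derive1 (stieltjes m) y = -1 * mom m y 2.
Proof.
move=> ny; rewrite (derive1_mom 1 y (stieltjes m) 1 ny) ?mul1r// => z _.
by rewrite mul1r.
Qed.

Let d2 y : `|y - xs| < D / 2 -> derive1n 2 (stieltjes m) y = 2 * mom m y 3.
Proof.
move=> ny; change (derive1 (derive1 (stieltjes m)) y = 2 * mom m y 3).
by rewrite (derive1_mom 2 y _ (-1) ny d1); congr (_ * _); ring.
Qed.

Lemma derive1n2_stieltjes : derive1n 2 (stieltjes m) xs = 2 * mom m xs 3.
Proof. exact: d2. Qed.

Lemma derive1n3_stieltjes : derive1n 3 (stieltjes m) xs = - (6 * mom m xs 4).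
Proof.
change (derive1 (derive1n 2 (stieltjes m)) xs = - (6 * mom m xs 4)).
by rewrite (derive1_mom 3 xs _ 2 xs_near d2); ring.
Qed.

End Kolmogorov.

(** * Gaps around the critical point and rates of convergence *)

Section EmpiricalGap.
Context {R : realType}.
Local Notation mR := (measurableTypeR R).
Implicit Types m : {measure set mR -> \bar R}.

Lemma mom_empirical n (X : n.-tuple R) (p : R) k : mom (empirical X) p k = pmom X p k.
Proof. by rewrite /mom emp_int ?/pmom ?size_tuple//; exact: measurable_inv_sub. Qed.

Lemma empiricalE n (X : n.-tuple R) (A : set mR) : empirical X A = ((n%:R^-1)%:E * \sum_(k < n) \d_(X`_k : mR) A)%E.
Proof. by []. Qed.

Lemma empirical_setT n (X : n.-tuple R) : (0 < n)%N -> empirical X setT = 1%E.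
Proof.
move=> n0; rewrite empiricalE; under eq_bigr do rewrite diracT.
by rewrite sumEFin sumr_const card_ord -EFinM mulVf// pnatr_eq0 -lt0n.
Qed.

Lemma empirical_avoid n (X : n.-tuple R) (A : set mR) : (forall a, a \in X -> ~ A a) -> empirical X A = 0%E.
Proof.
move=> h; rewrite empiricalE big1 ?mule0// => k _.
by rewrite diracE memNset//; apply: h; rewrite mem_nth ?size_tuple.
Qed.

Lemma distr_fun_empirical n (X : n.-tuple R) (x : R) : distr_fun (empirical X) x = n%:R^-1 * (count (fun a => a <= x) X)%:R.
Proof.
rewrite /distr_fun empiricalE.
have -> : (\sum_(k < n) \d_(X`_k : mR) ([set y : R | (y <= x)%R] : set mR) = \sum_(k < n) ((X`_k <= x)%R%:R : R)%:E)%E.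
 apply: eq_bigr => k _; rewrite diracE; have [h|h] := boolP (X`_k <= x); first by rewrite mem_set.
 by rewrite memNset//; exact/negP.
rewrite sumEFin -EFinM /=; congr (_ * _).
rewrite -sum1_count natr_sum [RHS]big_mkcond /= (big_nth 0) size_tuple big_mkord.
by apply: eq_bigr => k _; case: ifP.
Qed.

Lemma mem_msupport_empirical n (X : n.-tuple R) a : a \in X -> msupport (empirical X) a.
Proof.
move=> aX U [oU Ua]; have n0 : (0 < n)%N by case: n X aX => // X; rewrite (tuple0 X).
rewrite empiricalE; apply: mule_gt0; first by rewrite lte_fin invr_gt0 ltr0n.
have [k kn ak] := (nthP 0 aX); rewrite size_tuple in kn.
rewrite (bigD1 (Ordinal kn))//=; apply: (@lt_le_trans _ _ 1%E); first exact: lte01.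
rewrite ak diracE mem_set//= leeDl//; apply: sume_ge0 => i _; exact: measure_ge0.
Qed.

Lemma edist_inf_le (A : set R) (D x a : R) : (D%:E <= edist_inf A x)%E -> A a -> D <= `|x - a|.
Proof.
move=> h Aa; apply/ler_addgt0Pr => e e0; rewrite -lee_fin; apply: (le_trans h).
apply: (@le_trans _ _ (edist (x, a))); first by apply: ereal_inf_lbound; exists a.
by apply: edist_fin => /=; [rewrite ltr_wpDl|rewrite /ball /= ltrDl].
Qed.

(** A positive lower limit lies above some D, as do all distances from some rank on; every X_j is in
    the support and hence at least that far. *)
Lemma eventually_gap (X : forall n, n.-tuple R) xs :
 (0 < limn_einf (fun n => edist_inf (msupport (empirical (X n))) xs))%E ->
 exists2 D : R, 0 < D & \forall n \near \oo, forall a, a \in X n -> D <= `|xs - a|.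
Proof.
set u := (fun n => _) => h.
rewrite limn_einf_lim in h.
have [D D0 hD] : exists2 D : R, 0 < D & (D%:E < limn (einfs u))%E.
 move: (limn (einfs u)) h => [r| |] //=; last by exists 1; rewrite ?ltry.
 by rewrite lte_fin => r0; exists (r / 2); rewrite ?lte_fin; lra.
exists D => //.
have [N hN] : exists N, (D%:E < einfs u N)%E.
 apply: contrapT => nh; move: hD; rewrite ltNge => /negP; apply.
 apply: lime_le; first exact: is_cvg_einfs.
 apply: nearW => n; rewrite leNgt; apply/negP => hn; apply: nh; by exists n.
exists N => // n /= Nn a aX; apply: (edist_inf_le (msupport (empirical (X n)))).
 apply: ltW; apply: (lt_le_trans hN); apply: ereal_inf_lbound; exists n => //=.
exact: mem_msupport_empirical.
Qed.

Lemma prob_fin m (A : set mR) : m setT = 1%E -> measurable A -> m A \is a fin_num.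
Proof.
move=> m1 mA; rewrite ge0_fin_numE ?measure_ge0//; apply: (@le_lt_trans _ _ (m setT)); last by rewrite m1 ltry.
by apply: le_measure; rewrite ?inE.
Qed.

Lemma distr_fun_bounds m x : m setT = 1%E -> 0 <= distr_fun m x <= 1.
Proof.
move=> m1; rewrite /distr_fun fine_ge0 ?measure_ge0//=.
rewrite -[leRHS]/(fine 1%E) -m1; apply: fine_le.
- by apply: prob_fin => //; rewrite -set_itvNyc; exact: measurable_itv.
- by rewrite m1.
- by apply: le_measure; rewrite ?inE// -set_itvNyc; exact: measurable_itv.
Qed.

Lemma kolmogorov_dist_ge m m' x : m setT = 1%E -> m' setT = 1%E ->
 `|distr_fun m x - distr_fun m' x| <= kolmogorov_dist m m'.
Proof.
move=> m1 m1'; apply: ub_le_sup; last by exists x.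
exists 1 => _ [y _ <-].
have /andP[a b] := distr_fun_bounds m y m1; have /andP[a' b'] := distr_fun_bounds m' y m1'.
by rewrite ler_norml; apply/andP; split; lra.
Qed.

Lemma measure_itv_distr m a b : m setT = 1%E -> a <= b ->
 m (`]a, b]%classic : set mR) = (distr_fun m b - distr_fun m a)%:E.
Proof.
move=> m1 ab.
have mle x : measurable ([set y | y <= x] : set mR) by rewrite -set_itvNyc; exact: measurable_itv.
have fl x : m [set y | y <= x] \is a fin_num.
 exact: prob_fin.
have E : [set y | y <= b] = ([set y | y <= a] : set mR) `|` (`]a, b]%classic : set mR).
 apply/seteqP; split => y /=.
  by rewrite in_itv/= => yb; have [ya|ay] := leP y a; [left|right].
 by case; [move=> ya; exact: le_trans ab|rewrite in_itv/= => /andP[]].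
have mI : measurable (`]a, b]%classic : set mR) by exact: measurable_itv.
have : m [set y | y <= b] = (m [set y | (y <= a)%R] + m (`]a, b]%classic : set mR))%E.
 rewrite E measureU//; apply/seteqP; split => // y [/= ya]; rewrite in_itv/= => /andP[ay _].
 by move: ay; rewrite ltNge ya.
rewrite /distr_fun => ->.
have fI : m (`]a, b]%classic : set mR) \is a fin_num.
 exact: prob_fin.
by rewrite fineD// addrC addKr fineK.
Qed.

(** For large n the empirical distribution function is constant across the gap, and closeness in the
    Kolmogorov distance forces this on the limit. The half-width D/2 keeps the closed end of the
    interval away from points at distance D. *)
Lemma gapped_of_empirical (X : forall n, n.-tuple R) m xs D : m setT = 1%E -> 0 < D ->
 (\forall n \near \oo, forall a, a \in X n -> D <= `|xs - a|) ->
 (fun n => kolmogorov_dist (empirical (X n)) m) @ \oo --> (0:R) ->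
 gapped xs (D / 2) m /\ \forall n \near \oo, gapped xs (D / 2) (empirical (X n)).
Proof.
move=> m1 D0 gp d0.
have D2 : xs - D / 2 <= xs + D / 2 by lra.
have ge n (n0 : (0 < n)%N) : (forall a, a \in X n -> D <= `|xs - a|) -> gapped xs (D / 2) (empirical (X n)).
 move=> h; split; first exact: empirical_setT.
 apply: empirical_avoid => a aX; rewrite /= in_itv/= => /andP[q1 q2].
 have := h a aX; rewrite ler_normr => /orP[]; lra.
have gE : \forall n \near \oo, gapped xs (D / 2) (empirical (X n)).
 near=> n; apply: ge; first by near: n; exact: nbhs_infty_gt.
 by near: n; exact: gp.
split=> //; split=> //; rewrite measure_itv_distr//; congr EFin; apply/eqP; rewrite -normr_eq0 eq_le normr_ge0 andbT.
apply/ler_addgt0Pr => e e0; rewrite add0r.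
have : \forall n \near \oo, kolmogorov_dist (empirical (X n)) m < e / 2.
 by apply: (cvgr_lt _ d0); rewrite divr_gt0.
move=> de; near \oo => n.
have [g1 g0] : gapped xs (D / 2) (empirical (X n)) by near: n; exact: gE.
have dn : kolmogorov_dist (empirical (X n)) m < e / 2 by near: n; exact: de.
have := kolmogorov_dist_ge _ _ (xs + D / 2) g1 m1; have := kolmogorov_dist_ge _ _ (xs - D / 2) g1 m1.
move: g0; rewrite measure_itv_distr// => -[] /eqP; rewrite subr_eq0 => /eqP ->.
by rewrite !ler_norml => /andP[a1 a2] /andP[a3 a4]; apply/andP; split; lra.
Unshelve. all: end_near. Qed.

(** Every point off the support has a null neighbourhood, on which the distribution function is
    constant. This local statement is globalised on the interval. *)
Lemma gapped_of_support m xs : m setT = 1%E -> (0 < edist_inf (msupport m) xs)%E -> exists2 D, 0 < D & gapped xs D m.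
Proof.
move=> m1 h.
have [D D0 hD] : exists2 D : R, 0 < D & (D%:E <= edist_inf (msupport m) xs)%E.
 move: (edist_inf _ _) h => [r| |] //=; last by exists 1; rewrite ?leey.
 by rewrite lte_fin => r0; exists r.
exists (D / 2); first by lra.
split=> //; rewrite measure_itv_distr//; last by lra.
have lc y : `|xs - y| < D -> \forall z \near y, distr_fun m z = distr_fun m y.
 move=> yD; have ns : ~ msupport m y by move=> /(edist_inf_le _ _ _ _ hD); rewrite leNgt yD.
 have [U [[oU Uy] U0]] : exists U : set R, open_nbhs y U /\ m U = 0%E.
  apply: contrapT => nU; apply: ns => U nb; rewrite lt_neqAle measure_ge0 andbT.
  by apply/eqP => e; apply: nU; exists U.
 have /nbhs_ballP[r /= r0 rU] := open_nbhs_nbhs (conj oU Uy).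
 apply/nbhs_ballP; exists r => //= z; rewrite /ball /= => yz.
 have mU : measurable (U : set mR) by exact: open_measurable.
 have F a b : a <= b -> (forall w, a < w <= b -> `|y - w| < r) -> distr_fun m b = distr_fun m a.
  move=> ab abr; apply/eqP; rewrite -subr_eq0; apply/eqP.
  have : m (`]a, b]%classic : set mR) = 0%E.
   apply/eqP; rewrite eq_le measure_ge0 andbT -U0; apply: le_measure; rewrite ?inE//.
   by move=> w /=; rewrite in_itv/= => wab; apply: rU; exact: abr.
  by rewrite measure_itv_distr// => -[].
 have [zy|/ltW zy] := leP z y.
  by apply/esym; apply: F => // w /andP[w1 w2]; move: yz; rewrite !ltr_norml => /andP[b1 b2]; apply/andP; split; lra.
 by apply: F => // w /andP[w1 w2]; move: yz; rewrite !ltr_norml => /andP[b1 b2]; apply/andP; split; lra.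
have ab : xs - D / 2 <= xs + D / 2 by lra.
have inD y : xs - D / 2 <= y <= xs + D / 2 -> `|xs - y| < D.
 by move=> /andP[a b]; rewrite ltr_norml; apply/andP; split; lra.
(* Locally constant means derivative 0, so the mean value theorem replaces a compactness
   argument. *)
have [||c _ ->] := @MVT_segment R (distr_fun m) (fun=> 0) _ _ ab.
- move=> y; rewrite in_itv/= => /andP[a b].
 have /lc : `|xs - y| < D by apply: inD; rewrite !ltW.
 move=> e; apply: (@near_eq_is_derive _ _ _ (fun=> distr_fun m y)).
  by near=> z; apply/esym; near: z; exact: e.
- apply: continuous_in_subspaceT => y; rewrite inE/= in_itv/= => /inD /lc e.
 apply: cvg_trans (near_eq_cvg _) (cvg_cst (distr_fun m y)); near=> z; apply/esym; near: z; exact: e.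
by rewrite mul0r.
Unshelve. all: end_near. Qed.

Lemma littleo_powR (d : nat -> R) (al : R) : d =o_\oo (fun n => n%:R `^ (- al) : R) ->
 (fun n => n%:R `^ al * d n) @ \oo --> (0:R).
Proof.
move=> /eqoP ho; apply/cvgr0Pnorm_lt => e e0.
have e2 : 0 < e / 2 by lra.
have := ho _ e2 => hn; near=> n.
have n0 : (0 < n)%N by near: n; exact: nbhs_infty_gt.
have np : 0 < n%:R :> R by rewrite ltr0n.
have h : `|d n| <= e / 2 * `|n%:R `^ (- al)| by near: n; exact: hn.
rewrite normrM ger0_norm ?powR_ge0//; apply: (@le_lt_trans _ _ (n%:R `^ al * (e / 2 * n%:R `^ (- al)))).
 by rewrite ler_wpM2l ?powR_ge0// (le_trans h)// ger0_norm ?powR_ge0.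
rewrite mulrCA -powRD; last by rewrite (gt_eqF np) implybT.
by rewrite subrr powRr0 mulr1; lra.
Unshelve. all: end_near. Qed.

Lemma littleo_powR_cvg0 (d : nat -> R) (al : R) : 0 < al -> d =o_\oo (fun n => n%:R `^ (- al) : R) ->
 d @ \oo --> (0:R).
Proof.
move=> al0 ho; have h := littleo_powR _ _ ho; apply/cvgr0Pnorm_lt => e e0.
have h' : \forall n \near \oo, `|n%:R `^ al * d n| < e by exact: cvgr0_norm_lt.
near=> n; have n0 : (0 < n)%N by near: n; exact: nbhs_infty_gt.
have hn : `|n%:R `^ al * d n| < e by near: n; exact: h'.
apply: le_lt_trans hn; rewrite normrM ler_peMl// ger0_norm ?powR_ge0//.
by rewrite /powR gt_eqF ?ltr0n// -[leLHS]expR0 ler_expR; apply: mulr_ge0; [exact: ltW|apply: ln_ge0; rewrite ler1n].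
Unshelve. all: end_near. Qed.

Lemma cvg_near_eq (f g : nat -> R) (l : R) : (\forall n \near \oo, f n = g n) -> f @ \oo --> l -> g @ \oo --> l.
Proof. by move=> e; apply: cvg_trans; exact: near_eq_cvg. Qed.

Lemma cvg_pos_eq (f g : nat -> R) (l : R) : (forall n, (0 < n)%N -> f n = g n) -> f @ \oo --> l -> g @ \oo --> l.
Proof. by move=> e; apply: cvg_near_eq; exists 1%N => // n; exact: e. Qed.

Lemma cvg0_le (f g : nat -> R) : (\forall n \near \oo, `|f n| <= g n) -> g @ \oo --> (0:R) -> f @ \oo --> (0:R).
Proof.
move=> h g0; apply/norm_cvg0P; apply: squeeze0 g0; near=> n; rewrite normr_ge0 /=; near: n; exact: h.
Unshelve. all: end_near. Qed.

Lemma cvg_norm0 (f : nat -> R) : f @ \oo --> (0:R) -> (fun n => `|f n|) @ \oo --> (0:R).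
Proof. by move=> /cvg_norm; rewrite normr0. Qed.

Lemma cvg_const (c : R) : (fun _ : nat => c) @ \oo --> c. Proof. exact: cvg_cst. Qed.

Lemma cvg_mul (f g : nat -> R) (a b : R) : f @ \oo --> a -> g @ \oo --> b -> (fun n => f n * g n) @ \oo --> (a * b : R).
Proof. exact: cvgM. Qed.

Lemma cvg_add (f g : nat -> R) (a b : R) : f @ \oo --> a -> g @ \oo --> b -> (fun n => f n + g n) @ \oo --> (a + b : R).
Proof. exact: cvgD. Qed.

Lemma cvg_sub (f g : nat -> R) (a b : R) : f @ \oo --> a -> g @ \oo --> b -> (fun n => f n - g n) @ \oo --> (a - b : R).
Proof. exact: cvgB. Qed.

Lemma cvg_scale (f : nat -> R) (c a : R) : f @ \oo --> a -> (fun n => c * f n) @ \oo --> (c * a : R).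
Proof. by apply: cvg_mul; exact: cvg_cst. Qed.

(** Fractional powers of n become natural powers of one k-th root, so that exponents can be handled
    by [field]. *)
Definition root (k n : nat) : R := n%:R `^ (k%:R^-1).

Lemma root_exp k n : (0 < k)%N -> root k n ^+ k = n%:R.
Proof. by move=> k0; rewrite -powR_mulrn ?powR_ge0// -powRrM mulVf ?powRr1// pnatr_eq0 -lt0n. Qed.

Lemma powR_root k j n : n%:R `^ (j%:R / k%:R) = root k n ^+ j.
Proof. by rewrite -powR_mulrn ?powR_ge0// -powRrM mulrC. Qed.

Lemma root_gt0 k n : (0 < n)%N -> 0 < root k n.
Proof. by move=> n0; rewrite powR_gt0// ltr0n. Qed.

Lemma rootV_cvg k : (0 < k)%N -> (fun n => (root k n)^-1) @ \oo --> (0:R).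
Proof.
move=> k0; apply/cvgr0Pnorm_lt => e e0.
near=> n; have n0 : (0 < n)%N by near: n; exact: nbhs_infty_gt.
have r0 := root_gt0 k n n0.
rewrite gtr0_norm ?invr_gt0// -[e]invrK ltf_pV2 ?posrE ?invr_gt0//.
rewrite ltNge; apply/negP => h.
have : root k n ^+ k <= e^-1 ^+ k by rewrite lerXn2r ?nnegrE ?invr_ge0// ltW.
rewrite root_exp//; apply/negP; rewrite -ltNge.
by near: n; exact: nbhs_infty_gtr.
Unshelve. all: end_near. Qed.

End EmpiricalGap.

(** * Moments at a moving base point *)

Section MomentAsymptotics.
Context {R : realType}.
Local Notation mR := (measurableTypeR R).
Variables (m : {measure set mR -> \bar R}) (xs D : R) (X : forall n, n.-tuple R) (h : nat -> R).
Hypotheses (D0 : 0 < D) (gm : gapped xs D m) (gX : \forall n \near \oo, gapped xs D (empirical (X n)))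
 (h0 : h @ \oo --> (0:R)).
Let dn n := kolmogorov_dist (empirical (X n)) m.
Let B := 2 / D.
Let nx : `|xs - xs| <= D / 2. Proof. by rewrite subrr normr0 divr_ge0// ltW. Qed.

Let nxh : \forall n \near \oo, `|xs + h n - xs| <= D / 2.
Proof.
have : \forall n \near \oo, `|h n| < D / 2 by apply: cvgr0_norm_lt => //; exact: divr_gt0.
by apply: filterS => n /ltW; rewrite addrAC subrr add0r.
Qed.

(** Any rate [A] that beats the Kolmogorov distance also beats the difference of moments, uniformly
    in the base point near xs. *)
Lemma pmom_close (A : nat -> R) k : (fun n => A n * dn n) @ \oo --> (0:R) ->
 (fun n => A n * (pmom (X n) (xs + h n) k - mom m (xs + h n) k)) @ \oo --> (0:R).
Proof.
move=> Ad; apply: (cvg0_le _ (fun n => 4 * B ^+ k * `|A n * dn n|)); last first.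
 by apply: cvgM0; exact: cvg_norm0.
near=> n.
have gn : gapped xs D (empirical (X n)) by near: n; exact: gX.
have nn : `|xs + h n - xs| <= D / 2 by near: n; exact: nxh.
have hd y : `|distr_fun (empirical (X n)) y - distr_fun m y| <= dn n by apply: kolmogorov_dist_ge; [exact: gn.1|exact: gm.1].
have := mom_diff xs D D0 _ _ (xs + h n) k (dn n) gn gm nn hd; rewrite mom_empirical -/B => q.
have d0 : 0 <= dn n := le_trans (normr_ge0 _) (hd 0).
rewrite !normrM mulrCA; apply: ler_wpM2l; first exact: normr_ge0.
by rewrite (ger0_norm d0).
Unshelve. all: end_near. Qed.

Lemma mom_taylor_cvg (A : nat -> R) k : (fun n => A n * h n ^+ 2) @ \oo --> (0:R) ->
 (fun n => A n * (mom m (xs + h n) k - mom m xs k + k%:R * h n * mom m xs k.+1)) @ \oo --> (0:R).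
Proof.
move=> Ad; apply: (cvg0_le _ (fun n => k%:R ^+ 2 * B ^+ (k + 2) * `|A n * h n ^+ 2|)); last first.
 by apply: cvgM0; exact: cvg_norm0.
near=> n; have nn : `|xs + h n - xs| <= D / 2 by near: n; exact: nxh.
have := mom_taylor xs D D0 m xs (h n) k gm nx nn; rewrite -/B => q.
rewrite (normrM (A n)) (normrM (A n) (h n ^+ 2)) mulrCA; apply: ler_wpM2l; first exact: normr_ge0.
by rewrite (ger0_norm (sqr_ge0 (h n))).
Unshelve. all: end_near. Qed.

Lemma mom_taylor3_cvg (A : nat -> R) : (fun n => A n * h n ^+ 3) @ \oo --> (0:R) ->
 (fun n => A n * (mom m (xs + h n) 1 - mom m xs 1 + h n * mom m xs 2 - h n ^+ 2 * mom m xs 3)) @ \oo --> (0:R).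
Proof.
move=> Ad; apply: (cvg0_le _ (fun n => B ^+ 4 * `|A n * h n ^+ 3|)); last first.
 by apply: cvgM0; exact: cvg_norm0.
near=> n; have nn : `|xs + h n - xs| <= D / 2 by near: n; exact: nxh.
have := mom_taylor3 xs D D0 m xs (h n) gm nx nn; rewrite -/B => q.
rewrite (normrM (A n)) (normrM (A n) (h n ^+ 3)) mulrCA; apply: ler_wpM2l; first exact: normr_ge0.
by rewrite (normrX 3).
Unshelve. all: end_near. Qed.

Lemma mom_cvg k : (fun n => mom m (xs + h n) k) @ \oo --> mom m xs k.
Proof.
have h2 : (fun n => 1 * h n ^+ 2) @ \oo --> (0:R).
 have := cvg_mul _ _ _ _ h0 h0; rewrite mulr0; apply: cvg_ext => n; by rewrite mul1r.
have c1 := mom_taylor_cvg (fun=> 1) k h2.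
have c2 := cvg_sub _ _ _ _ (cvg_const (mom m xs k)) (cvg_mul _ _ _ _ (cvg_scale _ k%:R _ h0) (cvg_const (mom m xs k.+1))).
have := cvg_add _ _ _ _ c1 c2; rewrite mulr0 mul0r subr0 add0r; apply: cvg_ext => n; ring.
Qed.

Lemma pmom_cvg k : dn @ \oo --> (0:R) -> (fun n => pmom (X n) (xs + h n) k) @ \oo --> mom m xs k.
Proof.
move=> d0; have d1 : (fun n => 1 * dn n) @ \oo --> (0:R) by exact: cvgM0.
have := cvg_add _ _ _ _ (pmom_close (fun=> 1) k d1) (mom_cvg k); rewrite add0r; apply: cvg_ext => n; ring.
Qed.

End MomentAsymptotics.

(** * Edge and merging regimes *)

Section Edge.
Context {R : realType}.
Local Notation C := R[i].
Local Notation mR := (measurableTypeR R).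
Definition bounded_params (M : R) (tau1 tau2 u v : nat -> R) : Prop :=
 forall n, [/\ `|tau1 n| <= M, `|tau2 n| <= M, `|u n| <= M & `|v n| <= M].

Lemma edge_limit (m : {measure set mR -> \bar R}) (xs D : R) (X : forall n, n.-tuple R) (x0 : nat -> R) (gamma : nat -> R -> C)
 (M : R) (tau1 tau2 u v : nat -> R) :
 0 < D -> gapped xs D m -> (\forall n \near \oo, gapped xs D (empirical (X n))) ->
 (\forall n \near \oo, forall a, a \in X n -> D <= `|xs - a|) ->
 0 < inv_cube_integral m xs ->
 (fun n => n%:R `^ (2 / 3) * kolmogorov_dist (empirical (X n)) m) @ \oo --> (0:R) ->
 (forall n, (0 < n)%N -> admissible (X n) (x0 n) (gamma n)) ->
 bounded_params M tau1 tau2 u v ->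
 clo (fun n => rescaled_kernel (t_edge m xs n) (x_star m xs) (c2 m xs * n%:R `^ (2 / 3)) (X n) xs (x0 n) (gamma n)
         (tau1 n) (tau2 n) (u n) (v n))
   (fun n => airy_kernel (tau1 n) (tau2 n) (u n) (v n)).
Proof.
move=> D0 gm gX gapX I0 dA adm bp.
have M0 : 0 <= M by have [h _ _ _] := bp 0%N; exact: le_trans h.
have M3p : 0 < mom m xs 3 by exact: I0.
have M2p : 0 < mom m xs 2 by exact: (mom_pos xs D D0 m 1 gm).
pose T := t_cr m xs; have TE : T = (mom m xs 2)^-1 by [].
have T0 : 0 < T by rewrite TE invr_gt0.
(* The threshold of the Airy contours; it also keeps the quadratic coefficients c - tau above 5. *)
pose c := 72 * M + 12; have c0 : 0 < c by rewrite /c; lra.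
have c2E : c2 m xs = T^-1 * (mom m xs 3 `^ (- 3^-1)).
 by rewrite /c2 (derive1n2_stieltjes xs D m D0 gm) mulrAC mulfV ?mul1r.
pose w := mom m xs 3 `^ (- 3^-1).
have w0 : 0 < w by rewrite powR_gt0.
(* With w = T c2 this normalisation turns the third power sum into the coefficient 1/3 of the Airy
   exponent. *)
have w3 : w ^+ 3 * mom m xs 3 = 1.
 by rewrite -powR_mulrn ?powR_ge0// -powRrM mulNr mulVf ?powR_inv1 ?mulVf ?(ltW M3p)// lt0r_neq0.
pose q (n : nat) : R := root 3 n; have q3 n : q n ^+ 3 = n%:R := root_exp 3 n isT.
have qp n : (0 < n)%N -> 0 < q n := root_gt0 3 n.
pose z n := (q n)^-1; have z0 : z @ \oo --> (0:R) := rootV_cvg 3 isT.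
have pw n : n%:R `^ (2 / 3) = q n ^+ 2 := powR_root 3 2 n.
have pw1 n : n%:R `^ 3^-1 = q n by [].
have dA' : (fun n => q n ^+ 2 * kolmogorov_dist (empirical (X n)) m) @ \oo --> (0:R).
 by apply: cvg_ext dA => n; rewrite pw.
pose sg n := c2 m xs * n%:R `^ (2 / 3).
have cp : 0 < c2 m xs by rewrite c2E mulr_gt0 ?invr_gt0.
have Tc : T * c2 m xs = w by rewrite c2E mulrA mulfV ?mul1r// lt0r_neq0.
(* The displacement of the base point is c times eps, as eps equals w/q by [epsE]. *)
pose h n := c * w * z n.
have h0 : h @ \oo --> (0:R) by rewrite -(mulr0 (c * w)); exact: cvg_scale.
have n1 : \forall n \near \oo, (0 < n)%N by exact: nbhs_infty_gt.
have qz n : (0 < n)%N -> q n * z n = 1 by move=> n0; rewrite mulfV// lt0r_neq0// qp.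
have dn0 : (fun n => kolmogorov_dist (empirical (X n)) m) @ \oo --> (0:R).
 have := cvg_mul _ _ _ _ (cvg_mul _ _ _ _ z0 z0) dA'; rewrite mulr0; apply: cvg_pos_eq => n n0.
 by have := qz n n0; rewrite mulrC expr2 => e; rewrite mulrA mulrACA e mulr1 mul1r.
have hz n k : h n ^+ k = (c * w) ^+ k * z n ^+ k by rewrite exprMn.
have zX k : (0 < k)%N -> (fun n => z n ^+ k) @ \oo --> (0:R).
 case: k => // k _; elim: k => [|k ih]; first by apply: cvg_ext z0 => n; rewrite expr1.
 by have := cvg_mul _ _ _ _ z0 ih; rewrite mulr0; apply: cvg_ext => n; rewrite -exprS.
have M1E : mom m xs 1 = \int[m]_s (xs - s)^-1 by [].

have e1 := pmom_close m xs D X h D0 gm gX h0 (fun n => q n ^+ 2) 1 dA'.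
have dq : (fun n => q n * kolmogorov_dist (empirical (X n)) m) @ \oo --> (0:R).
 have := cvg_mul _ _ _ _ z0 dA'; rewrite mulr0; apply: cvg_pos_eq => n n0.
 by rewrite expr2 -mulrA mulrA (mulrC (z n)) qz// mul1r.
have e2 := pmom_close m xs D X h D0 gm gX h0 q 2 dq.
have hh0 : (fun _ : nat => 0 : R) @ \oo --> (0:R) by exact: cvg_const.
have e0 := pmom_close m xs D X (fun=> 0) D0 gm gX hh0 (fun n => q n ^+ 2) 1 dA'.
have r1 : (fun n => q n ^+ 2 * (mom m (xs + h n) 1 - mom m xs 1 + h n * mom m xs 2 - h n ^+ 2 * mom m xs 3)) @ \oo --> (0:R).
 apply: (mom_taylor3_cvg m xs D h D0 gm h0).
 rewrite -(mulr0 ((c * w) ^+ 3)); apply: cvg_pos_eq (cvg_scale _ ((c * w) ^+ 3) _ z0) => n n0.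
 rewrite hz; have := qz n n0; move: (q n) (z n) => a b ab.
 rewrite (_ : a ^+ 2 * _ = (c * w) ^+ 3 * ((a * b) ^+ 2 * b)); last by ring.
 by rewrite ab expr1n mul1r.
have r2 : (fun n => q n * (mom m (xs + h n) 2 - mom m xs 2 + 2%:R * h n * mom m xs 3)) @ \oo --> (0:R).
 apply: (mom_taylor_cvg m xs D h D0 gm h0).
 rewrite -(mulr0 ((c * w) ^+ 2)); apply: cvg_pos_eq (cvg_scale _ ((c * w) ^+ 2) _ z0) => n n0.
 rewrite hz; have := qz n n0; move: (q n) (z n) => a b ab.
 rewrite (_ : a * _ = (c * w) ^+ 2 * ((a * b) * b)); last by ring.
 by rewrite ab mul1r.
have m3 := pmom_cvg m xs D X h D0 gm gX h0 3 dn0.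
have m4 := pmom_cvg m xs D X h D0 gm gX h0 4 dn0.
have epsE n : (0 < n)%N -> T * sg n / n%:R = w * z n.
 by move=> n0; have qn := lt0r_neq0 (qp n n0); rewrite /sg pw mulrA Tc -(q3 n) /z; field; rewrite ?qn.
have dlE n : (0 < n)%N -> n%:R / sg n ^+ 2 = (c2 m xs ^+ 2)^-1 * z n.
 by move=> n0; have qn := lt0r_neq0 (qp n n0); have cn := lt0r_neq0 cp; rewrite /sg pw -(q3 n) /z; field; rewrite ?qn ?cn.
have sgE n : sg n = c2 m xs * q n ^+ 2 by rewrite /sg pw.
have T1 : T^-1 = mom m xs 2 by rewrite TE invrK.
have E1 : (fun n => T * sg n / n%:R) @ \oo --> (0:R).
 rewrite -(mulr0 w); apply: cvg_near_eq (cvg_scale _ w _ z0); near=> n.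
 by rewrite epsE//; near: n; exact: n1.
have E2 : (fun n => n%:R / sg n ^+ 2) @ \oo --> (0:R).
 rewrite -(mulr0 (c2 m xs ^+ 2)^-1); apply: cvg_near_eq (cvg_scale _ _ _ z0); near=> n.
 by rewrite dlE//; near: n; exact: n1.
have E3 : \forall n \near \oo, forall a, a \in X n -> D / 2 <= `|xs + h n - a|.
 have hs : \forall n \near \oo, `|h n| < D / 2 by apply: cvgr0_norm_lt => //; exact: divr_gt0.
 near=> n => a aX; have h1 : `|h n| < D / 2 by near: n; exact: hs.
 have h2 : D <= `|xs - a| by move: a aX; near: n; exact: gapX.
 have -> : xs + h n - a = (xs - a) - - h n by ring.
 by have := lerB_dist (xs - a) (- h n); rewrite normrN; lra.
have E4 : (fun n => T * sg n * ((xs + h n - xs) / T + pmom (X n) (xs + h n) 1 - mom m xs 1)) @ \oo --> c ^+ 2.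
 have := cvg_scale _ w _ (cvg_add _ _ _ _ (cvg_add _ _ _ _ e1 r1) (cvg_const ((c * w) ^+ 2 * mom m xs 3))).
 have wE : w * ((c * w) ^+ 2 * mom m xs 3) = c ^+ 2 * (w ^+ 3 * mom m xs 3) by ring.
 rewrite !add0r wE w3 mulr1.
 apply: cvg_pos_eq => n n0.
 rewrite sgE mulrA Tc T1 (_ : (c * w) ^+ 2 * mom m xs 3 = q n ^+ 2 * (h n ^+ 2 * mom m xs 3)); last first.
  rewrite hz; have := qz n n0; move: (q n) (z n) => a b ab.
  rewrite (_ : a ^+ 2 * _ = (c * w) ^+ 2 * ((a * b) ^+ 2) * mom m xs 3); last by ring.
  by rewrite ab expr1n mulr1.
 by move: (mom m (xs + h n) 1) (pmom _ _ _) => A1 A2; ring.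
have E5 : (fun n => (xs + h n - xs) * n%:R / (T * sg n)) @ \oo --> c.
 apply: cvg_pos_eq (cvg_const c) => n n0.
 have wn := lt0r_neq0 w0; have qn := lt0r_neq0 (qp n n0).
 by rewrite sgE mulrA Tc -(q3 n) /h /z; field; rewrite wn qn.
have E6 : (fun n => T ^+ 2 * sg n ^+ 2 / (2 * n%:R) * (T^-1 - pmom (X n) (xs + h n) 2)) @ \oo --> c.
 have := cvg_scale _ (w ^+ 2 / 2) _ (cvg_sub _ _ _ _ (cvg_const (2 * (c * w * mom m xs 3))) (cvg_add _ _ _ _ e2 r2)).
 have wE : w ^+ 2 / 2 * (2 * (c * w * mom m xs 3)) = c * (w ^+ 3 * mom m xs 3) by field.
 rewrite addr0 subr0 wE w3 mulr1.
 apply: cvg_pos_eq => n n0.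
 have qn := lt0r_neq0 (qp n n0).
 have -> : T ^+ 2 * sg n ^+ 2 / (2 * n%:R) = w ^+ 2 / 2 * q n.
  by rewrite -exprMn sgE mulrA Tc -(q3 n); field; rewrite qn.
 rewrite T1 -[in RHS]mulrA; congr (_ * _).
 rewrite (_ : c * w * mom m xs 3 = q n * (h n * mom m xs 3)); first by ring.
 rewrite /h; have := qz n n0; move: (q n) (z n) => a b ab; have -> : a * (c * w * b * mom m xs 3) = c * w * (a * b) * mom m xs 3 by ring.
 by rewrite ab mulr1.
have E7 : (fun n => n%:R * (T * sg n / n%:R) ^+ 3 * pmom (X n) (xs + h n) 3 / 3) @ \oo --> (1 / 3 : R).
 have := cvg_scale _ (w ^+ 3 / 3) _ m3; rewrite (_ : w ^+ 3 / 3 * mom m xs 3 = 1 / 3); last by rewrite mulrAC w3.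
 apply: cvg_pos_eq => n n0.
 have qn := lt0r_neq0 (qp n n0).
 by rewrite epsE// -(q3 n) /z; field; rewrite qn.
have E8 : (fun n => n%:R * (T * sg n / n%:R) ^+ 4 * pmom (X n) (xs + h n) 4 / 4) @ \oo --> (0:R).
 have := cvg_scale _ (w ^+ 4 / 4) _ (cvg_mul _ _ _ _ z0 m4); rewrite mul0r mulr0.
 apply: cvg_pos_eq => n n0.
 have qn := lt0r_neq0 (qp n n0).
 by rewrite epsE// -(q3 n) /z; field; rewrite qn.
have GE n : stieltjes (empirical (X n)) xs = pmom (X n) xs 1 by rewrite -mom_empirical.
have qe0 : (fun n => q n * (mom m xs 1 - pmom (X n) xs 1)) @ \oo --> (0:R).
 have := cvg_scale _ (-1) _ (cvg_mul _ _ _ _ z0 e0); rewrite mul0r mulr0.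
 apply: cvg_pos_eq => n n0.
 rewrite addr0; have := qz n n0; move: (q n) (z n) => a b ab.
 have E (y : R) : -1 * (b * (a ^+ 2 * y)) = (a * b) * (a * - y) by ring.
 by rewrite E ab mul1r opprB.
have E9 : (fun n => 2 * n%:R * (mom m xs 1 - stieltjes (empirical (X n)) xs) / sg n) @ \oo --> (0:R).
 have := cvg_scale _ (2 / c2 m xs) _ qe0; rewrite mulr0.
 apply: cvg_pos_eq => n n0.
 have qn := lt0r_neq0 (qp n n0); have cn := lt0r_neq0 cp.
 by rewrite GE sgE -(q3 n); move: (pmom _ _ _) => P; field; rewrite cn qn.
have E10 : (fun n => n%:R * (xs + h n - xs + T * (stieltjes (empirical (X n)) xs - mom m xs 1)) / (T * sg n)) @ \oo --> c.
 have := cvg_add _ _ _ _ E5 (cvg_scale _ (- (2^-1)) _ E9); rewrite mulr0 addr0.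
 apply: cvg_pos_eq => n n0.
 have Tn := lt0r_neq0 T0; have s0 : sg n != 0 by rewrite sgE mulf_neq0 ?expf_neq0// lt0r_neq0 ?qp.
 by move: (stieltjes _ _) => P; field; rewrite Tn s0.
have bs (f : nat -> R) : (forall n, `|f n| <= M) -> bseq f by exists M.
have B1 : bseq tau1 by apply: bs => n; have [] := bp n.
have B2 : bseq tau2 by apply: bs => n; have [] := bp n.
have B3 : bseq u by apply: bs => n; have [] := bp n.
have B4 : bseq v by apply: bs => n; have [] := bp n.
have alt : (forall n, 5 <= c - 2 * tau1 n / 2 /\ 5 <= c - 2 * tau2 n / 2) \/ (0:R) < 0.
 left => n; have [h1 h2 _ _] := bp n; move: h1 h2; rewrite !ler_norml /c => /andP[_ h1] /andP[_ h2].
 by split; lra.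
have D20 : 0 < D / 2 by lra.
have sg0 n : (0 < n)%N -> 0 < sg n by move=> n0; rewrite sgE mulr_gt0// exprn_gt0// qp.
have k20 : (0:R) < 2 by rewrite ltr0n.
(* The displacement by c eps gives eta = b0 = om = c and rho = c^2. These are exactly the
   coefficients of the Airy exponent expanded around c, including the exponential prefactor. *)
have := kernel_limit X x0 (fun=> xs) (fun n => xs + h n) sg tau1 tau2 u v gamma xs T (mom m xs 1) 2 c (c ^+ 2) c (1 / 3) 0 0 c (D / 2)
 T0 k20 (lexx 0) D20 adm sg0 E1 E2 E3 E4 E5 E6 E7 E8 E9 E10 B1 B2 B3 B4 alt.
apply: eq_clo; near=> n; have n0 : (0 < n)%N by near: n; exact: n1.
 have tE : t_edge m xs n = (fun tau => T + 2 * tau * (n%:R / sg n ^+ 2)).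
  by apply/funext => tau; rewrite /t_edge -/T dlE// pw1 /z invfM.
 by rewrite tE.
have [h1 h2 h3 h4] := bp n.
have cM : 72 * M + 12 <= c by [].
have A : airy_Sigma_integral (fun zeta => airy_Gamma_integral (fun omega =>
  Cexp (zeta ^+ 3 / 3 - zeta * (v n)%:C - (tau2 n)%:C * zeta ^+ 2
     - omega ^+ 3 / 3 + omega * (u n)%:C + (tau1 n)%:C * omega ^+ 2)
  / (zeta - omega))) =
 (expR (c ^+ 3 / 3 - tau2 n * c ^+ 2 - v n * c - (c ^+ 3 / 3 - tau1 n * c ^+ 2 - u n * c)))%:C *
 L4 (Bfun (v n + 2 * c * tau2 n - c ^+ 2) (c - tau2 n) (1 / 3) 0)
   (fun w => (Bfun (u n + 2 * c * tau1 n - c ^+ 2) (c - tau1 n) (1 / 3) 0 w)^-1).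
 exact: (airy_L4 M c (tau1 n) (tau2 n) (u n) (v n)).
rewrite /airy_kernel A.
have f1 : expR (c ^+ 2 * (2 * (tau1 n - tau2 n) / 2) - c * (tau2 n * 0 + v n - (tau1 n * 0 + u n))) =
 expR (c ^+ 3 / 3 - tau2 n * c ^+ 2 - v n * c - (c ^+ 3 / 3 - tau1 n * c ^+ 2 - u n * c)) by congr expR; field.
have f2 (t y : R) : y + 2 * t * c - c ^+ 2 = y + 2 * c * t - c ^+ 2 by ring.
have f3 (t : R) : c - 2 * t / 2 = c - t by field.
rewrite f1 !f2 !f3; congr (_ - _%:C); case: ifP => // _.
have -> : u n - v n + (tau1 n - tau2 n) * 0 = u n - v n by ring.
have -> : 2 * 2 = 4 :> R by ring.
by have -> : 2 * pi * 2 = 4 * pi :> R by ring.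
Unshelve. all: end_near. Qed.

Section General.
Variables (m : {measure set mR -> \bar R}) (xs D : R).
Hypotheses (D0 : 0 < D) (gm : gapped xs D m).
Let T := t_cr m xs.
Let w := T * c3 m xs.
Let r (n : nat) : R := root 4 n.

Lemma mom_2_gt0 : 0 < mom m xs 2. Proof. exact: (mom_pos xs D D0 m 1 gm). Qed.
Lemma mom_4_gt0 : 0 < mom m xs 4. Proof. exact: (mom_pos xs D D0 m 2 gm). Qed.

Lemma t_crV : T^-1 = mom m xs 2. Proof. by rewrite /T /t_cr invrK. Qed.
Lemma t_cr_gt0 : 0 < T. Proof. by rewrite -invr_gt0 t_crV mom_2_gt0. Qed.

Lemma c3E : c3 m xs = T^-1 * mom m xs 4 `^ (- 4^-1).
Proof.
rewrite /c3 (derive1n3_stieltjes xs D m D0 gm) opprK.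
by rewrite (_ : 6 * mom m xs 4 / 6 = mom m xs 4)//; field.
Qed.

Lemma c3_gt0 : 0 < c3 m xs. Proof. by rewrite c3E; apply: mulr_gt0; [rewrite invr_gt0 t_cr_gt0|apply: powR_gt0; exact: mom_4_gt0]. Qed.
Lemma w_gt0 : 0 < w. Proof. by rewrite mulr_gt0 ?t_cr_gt0 ?c3_gt0. Qed.

Lemma w4 : w ^+ 4 * mom m xs 4 = 1.
Proof.
rewrite /w c3E mulrA mulfV ?mul1r ?lt0r_neq0 ?t_cr_gt0//.
rewrite -powR_mulrn ?powR_ge0// -powRrM mulNr mulVf// powR_inv1 ?ltW ?mom_4_gt0//.
by rewrite mulVf// lt0r_neq0 ?mom_4_gt0.
Qed.

(** Shared by the Pearcey and the transition regimes. The number [a] is produced by a third moment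
    of order n^(-1/4), and [b] by a displacement of the base point of the same order. *)
Lemma merge_limit (X : forall n, n.-tuple R) (x0 xg p tau1 tau2 u v : nat -> R) (gamma : nat -> R -> C) (a b d M : R) :
 0 < d -> (\forall n \near \oo, forall e, e \in X n -> d <= `|p n - e|) ->
 (forall n, (0 < n)%N -> admissible (X n) (x0 n) (gamma n)) -> bounded_params M tau1 tau2 u v ->
 let G0 := mom m xs 1 in let G n := stieltjes (empirical (X n)) (xg n) in
 let h n := p n - xs in let pm n k := pmom (X n) (p n) k in
 (fun n => r n ^+ 3 * (h n / T + pm n 1%N - G0)) @ \oo --> (0:R) ->
 (fun n => h n * r n) @ \oo --> b * w ->
 (fun n => r n ^+ 2 * (T^-1 - pm n 2%N)) @ \oo --> (0:R) ->
 (fun n => r n * pm n 3%N) @ \oo --> a / w ^+ 3 ->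
 (fun n => pm n 4%N) @ \oo --> mom m xs 4 ->
 (fun n => r n * (G0 - G n)) @ \oo --> b * c3 m xs ->
 (fun n => r n * (h n + T * (G n - G0))) @ \oo --> (0:R) ->
 clo (fun n => rescaled_kernel (t_merge m xs n) (x_star m xs) (c3 m xs * n%:R `^ (3 / 4)) (X n) (xg n) (x0 n) (gamma n)
         (tau1 n) (tau2 n) (u n) (v n))
   (fun n => transition_kernel a (tau1 n) (tau2 n) (u n + tau1 n * b) (v n + tau2 n * b)).
Proof.
move=> d0 gapX adm bp G0 G h pm R1 R2 R3 R4 R5 R6 R7.
have T0 := t_cr_gt0; have cp := c3_gt0; have w0 := w_gt0; have Tn := lt0r_neq0 T0; have cn := lt0r_neq0 cp; have wn := lt0r_neq0 w0.
have r4 n : r n ^+ 4 = n%:R := root_exp 4 n isT.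
have rp n : (0 < n)%N -> 0 < r n := root_gt0 4 n.
pose z n := (r n)^-1; have z0 : z @ \oo --> (0:R) := rootV_cvg 4 isT.
have pw n : n%:R `^ (3 / 4) = r n ^+ 3 := powR_root 4 3 n.
pose sg n := c3 m xs * n%:R `^ (3 / 4).
have sgE n : sg n = c3 m xs * r n ^+ 3 by rewrite /sg pw.
have n1 : \forall n \near \oo, (0 < n)%N by exact: nbhs_infty_gt.
have Tc : T * c3 m xs = w by [].
have sqrt_root n : n%:R `^ 2^-1 = r n ^+ 2.
 by rewrite -powR_root; congr (_ `^ _); field.
have epsE n : (0 < n)%N -> T * sg n / n%:R = w * z n.
 by move=> n0; have rn := lt0r_neq0 (rp n n0); rewrite sgE mulrA Tc -(r4 n) /z; field; rewrite ?rn.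
have dlE n : (0 < n)%N -> n%:R / sg n ^+ 2 = (c3 m xs ^+ 2)^-1 * (z n * z n).
 by move=> n0; have rn := lt0r_neq0 (rp n n0); rewrite sgE -(r4 n) /z; field; rewrite ?rn ?cn.
have E1 : (fun n => T * sg n / n%:R) @ \oo --> (0:R).
 rewrite -(mulr0 w); apply: cvg_near_eq (cvg_scale _ w _ z0); near=> n.
 by rewrite epsE//; near: n; exact: n1.
have E2 : (fun n => n%:R / sg n ^+ 2) @ \oo --> (0:R).
 have := cvg_scale _ (c3 m xs ^+ 2)^-1 _ (cvg_mul _ _ _ _ z0 z0); rewrite !mulr0; apply: cvg_near_eq; near=> n.
 by rewrite dlE//; near: n; exact: n1.
have E4 : (fun n => T * sg n * ((p n - xs) / T + pmom (X n) (p n) 1 - mom m xs 1)) @ \oo --> (0:R).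
 by have := cvg_scale _ w _ R1; rewrite mulr0; apply: cvg_ext => n; rewrite sgE (mulrA T) Tc mulrA.
have E5 : (fun n => (p n - xs) * n%:R / (T * sg n)) @ \oo --> b.
 have := cvg_scale _ w^-1 _ R2; rewrite (_ : w^-1 * (b * w) = b); last by field.
 apply: cvg_pos_eq => n n0.
 by have rn := lt0r_neq0 (rp n n0); rewrite sgE (mulrA T) Tc -(r4 n) /h; field; rewrite wn rn.
have E6 : (fun n => T ^+ 2 * sg n ^+ 2 / (2 * n%:R) * (T^-1 - pmom (X n) (p n) 2)) @ \oo --> (0:R).
 have := cvg_scale _ (w ^+ 2 / 2) _ R3; rewrite mulr0.
 apply: cvg_pos_eq => n n0.
 have rn := lt0r_neq0 (rp n n0).
 by rewrite mulrA -(exprMn 2) sgE (mulrA T) Tc -(r4 n); congr (_ * _); field; rewrite rn.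
have E7 : (fun n => n%:R * (T * sg n / n%:R) ^+ 3 * pmom (X n) (p n) 3 / 3) @ \oo --> (a / 3 : R).
 have := cvg_scale _ (w ^+ 3 / 3) _ R4; rewrite (_ : w ^+ 3 / 3 * (a / w ^+ 3) = a / 3); last by field.
 apply: cvg_pos_eq => n n0.
 by have rn := lt0r_neq0 (rp n n0); rewrite epsE// -(r4 n) /z /pm; field; rewrite rn.
have E8 : (fun n => n%:R * (T * sg n / n%:R) ^+ 4 * pmom (X n) (p n) 4 / 4) @ \oo --> (4^-1 : R).
 have := cvg_scale _ (w ^+ 4 / 4) _ R5; rewrite (_ : w ^+ 4 / 4 * mom m xs 4 = 4^-1); last by rewrite mulrAC w4 mul1r.
 apply: cvg_pos_eq => n n0.
 by have rn := lt0r_neq0 (rp n n0); rewrite epsE// -(r4 n) /z /pm; field; rewrite rn.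
have E9 : (fun n => 1 * n%:R * (mom m xs 1 - G n) / sg n) @ \oo --> b.
 have := cvg_scale _ (c3 m xs)^-1 _ R6; rewrite (_ : (c3 m xs)^-1 * (b * c3 m xs) = b); last by field.
 apply: cvg_pos_eq => n n0.
 by have rn := lt0r_neq0 (rp n n0); rewrite sgE -(r4 n) /G0; field; rewrite cn rn.
have E10 : (fun n => n%:R * (p n - xs + T * (G n - mom m xs 1)) / (T * sg n)) @ \oo --> (0:R).
 have := cvg_scale _ w^-1 _ R7; rewrite mulr0.
 apply: cvg_pos_eq => n n0.
 by have rn := lt0r_neq0 (rp n n0); rewrite sgE (mulrA T (c3 m xs)) Tc -(r4 n) /h /G0; field; rewrite wn rn.
have bs (f : nat -> R) : (forall n, `|f n| <= M) -> bseq f by exists M.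
have B1 : bseq tau1 by apply: bs => n; have [] := bp n.
have B2 : bseq tau2 by apply: bs => n; have [] := bp n.
have B3 : bseq u by apply: bs => n; have [] := bp n.
have B4 : bseq v by apply: bs => n; have [] := bp n.
have q4 : (0:R) < 4^-1 by rewrite invr_gt0 ltr0n.
have alt : (forall n, 5 <= 0 - 1 * tau1 n / 2 /\ 5 <= 0 - 1 * tau2 n / 2) \/ (0:R) < 4^-1 by right.
have sg0 n : (0 < n)%N -> 0 < sg n by move=> n0; rewrite sgE mulr_gt0// exprn_gt0// rp.
(* The same b enters as offset of the base point, shifting the double integral, and as drift of the
   gauge, shifting the Gaussian; both amount to replacing u by u + tau b. *)
have := kernel_limit X x0 xg p sg tau1 tau2 u v gamma xs T (mom m xs 1) 1 b 0 0 (a / 3) 4^-1 b 0 d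
 T0 ltr01 (ltW q4) d0 adm sg0 E1 E2 gapX E4 E5 E6 E7 E8 E9 E10 B1 B2 B3 B4 alt.
apply: eq_clo; near=> n; have n0 : (0 < n)%N by near: n; exact: n1.
 have tE : t_merge m xs n = (fun tau => T + 1 * tau * (n%:R / sg n ^+ 2)).
  by apply/funext => tau; rewrite /t_merge -/T dlE// sqrt_root /z mul1r expr2 !invfM.
 by rewrite tE.
rewrite /transition_kernel (transition_L4 a (tau1 n) (tau2 n)).
have f1 : expR (0 ^+ 2 * (1 * (tau1 n - tau2 n) / 2) - 0 * (tau2 n * b + v n - (tau1 n * b + u n))) = 1 :> R.
 by rewrite expr0n /= !mul0r subrr expR0.
have f2 (t y : R) : y + 1 * t * b - 0 = y + t * b by ring.
have f3 (t : R) : 0 - 1 * t / 2 = - (t / 2) by field.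
rewrite f1 !f2 !f3 mul1r; congr (_ - _%:C); case: ifP => // _.
have -> : u n - v n + (tau1 n - tau2 n) * b = u n + tau1 n * b - (v n + tau2 n * b) by ring.
have -> : 2 * 1 = 2 :> R by ring.
by have -> : 2 * pi * 1 = 2 * pi :> R by ring.
Unshelve. all: end_near. Qed.

End General.

(** Base point and gauge point both stay at xs, so a and b are 0 and the distance o(n^(-3/4)) alone
    controls all first and second order defects. *)
Lemma pearcey_limit (m : {measure set mR -> \bar R}) (xs D : R) (X : forall n, n.-tuple R) (x0 : nat -> R) (gamma : nat -> R -> C)
 (M : R) (tau1 tau2 u v : nat -> R) :
 0 < D -> gapped xs D m -> (\forall n \near \oo, gapped xs D (empirical (X n))) ->
 (\forall n \near \oo, forall a, a \in X n -> D <= `|xs - a|) ->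
 inv_cube_integral m xs = 0 ->
 (fun n => n%:R `^ (3 / 4) * kolmogorov_dist (empirical (X n)) m) @ \oo --> (0:R) ->
 (forall n, (0 < n)%N -> admissible (X n) (x0 n) (gamma n)) ->
 bounded_params M tau1 tau2 u v ->
 clo (fun n => rescaled_kernel (t_merge m xs n) (x_star m xs) (c3 m xs * n%:R `^ (3 / 4)) (X n) xs (x0 n) (gamma n)
         (tau1 n) (tau2 n) (u n) (v n))
   (fun n => pearcey_kernel (tau1 n) (tau2 n) (u n) (v n)).
Proof.
move=> D0 gm gX gapX I0 dA adm bp.
pose r (n : nat) : R := root 4 n.
have rp n : (0 < n)%N -> 0 < r n := root_gt0 4 n.
pose z n := (r n)^-1; have z0 : z @ \oo --> (0:R) := rootV_cvg 4 isT.
have n1 : \forall n \near \oo, (0 < n)%N by exact: nbhs_infty_gt.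
have dA' : (fun n => r n ^+ 3 * kolmogorov_dist (empirical (X n)) m) @ \oo --> (0:R).
 by apply: cvg_ext dA => n; rewrite (powR_root 4 3 n).
have hh0 : (fun _ : nat => 0 : R) @ \oo --> (0:R) by exact: cvg_const.
have P3 k : (fun n => r n ^+ 3 * (pmom (X n) xs k - mom m xs k)) @ \oo --> (0:R).
 have := pmom_close m xs D X (fun=> 0) D0 gm gX hh0 (fun n => r n ^+ 3) k dA'.
 by apply: cvg_ext => n; rewrite addr0.
have down (f : nat -> R) j : (fun n => r n ^+ j.+1 * f n) @ \oo --> (0:R) -> (fun n => r n ^+ j * f n) @ \oo --> (0:R).
 move=> hf; have := cvg_mul _ _ _ _ z0 hf; rewrite mulr0; apply: cvg_pos_eq => n n0.
 by rewrite exprS /z -mulrA mulKf// lt0r_neq0// rp.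
have P2 k := down _ _ (P3 k); have P1 k := down _ _ (P2 k); have P0 k := down _ _ (P1 k).
have GE n : stieltjes (empirical (X n)) xs = pmom (X n) xs 1 by rewrite -mom_empirical.
have c := merge_limit m xs D D0 gm X x0 (fun=> xs) (fun=> xs) tau1 tau2 u v gamma 0 0 D M D0 gapX adm bp.
apply: eq_clo (c _ _ _ _ _ _ _); rewrite ?mul0r.
- by apply: nearW.
- by apply: nearW => n; rewrite !mulr0 !addr0.
- by apply: cvg_ext (P3 1%N) => n; rewrite subrr mul0r add0r.
- by apply: cvg_ext hh0 => n; rewrite subrr mul0r.
- have := cvg_scale _ (-1) _ (P2 2%N); rewrite mulr0; apply: cvg_ext => n.
 by rewrite (t_crV m xs) /r; ring.
- apply: cvg_ext (P1 3%N) => n; have -> : mom m xs 3 = 0 by exact: I0.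
 by rewrite subr0 expr1.
- have := cvg_add _ _ _ _ (P0 4%N) (cvg_const (mom m xs 4)); rewrite add0r; apply: cvg_ext => n.
 by rewrite expr0 mul1r subrK.
- have := cvg_scale _ (-1) _ (P1 1%N); rewrite mulr0; apply: cvg_ext => n.
 by rewrite GE expr1 /r; ring.
- have := cvg_scale _ (t_cr m xs) _ (P1 1%N); rewrite mulr0; apply: cvg_ext => n.
 by rewrite GE expr1 subrr add0r mulrCA.
Qed.

End Edge.

(** * Quantile approximation *)

Section Quantile.
Context {R : realType}.
Local Notation mR := (measurableTypeR R).
Variable P : probability mR R.

(** The measure is viewed as the law of the identity, which gives access to the limits and
    right-continuity of distribution functions. *)
Let idTR : mR -> R := idfun.
#[local] HB.instance Definition _ := @isMeasurableFun.Build _ _ _ _ idTR (@measurable_id _ _ setT).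
Let F (x : R) : R := distr_fun P x.

Let cdfE x : cdf (idTR : {RV P >-> R}) x = (F x)%:E.
Proof.
have -> : cdf (idTR : {RV P >-> R}) x = P [set y | y <= x].
 have -> : [set y | y <= x] = idTR @^-1` `]-oo, x] by apply/seteqP; split => y /=; rewrite in_itv.
 by [].
by rewrite /F /distr_fun fineK// fin_num_measure// -set_itvNyc; exact: measurable_itv.
Qed.

Lemma distr_fun_mono x y : x <= y -> F x <= F y.
Proof. by move=> xy; rewrite -lee_fin -!cdfE; exact: cdf_nondecreasing. Qed.

Lemma distr_fun_top r : r < 1 -> exists x, r < F x.
Proof.
move=> r1; have h : F x @[x --> +oo%R] --> (1 : R).
 have := cvg_cdfy1 (idTR : {RV P >-> R}).
 have -> : cdf (idTR : {RV P >-> R}) = EFin \o F by apply/funext => x; exact: cdfE.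
 by move/fine_cvgP => [].
have hh : \forall x \near +oo%R, r < F x by exact: (cvgr_gt _ h).
by near (pinfty_nbhs R) => x; exists x; near: x; exact: hh.
Unshelve. all: end_near. Qed.

Lemma distr_fun_bot r : 0 < r -> exists x, F x < r.
Proof.
move=> r1; have h : F x @[x --> -oo%R] --> (0:R).
 have := cvg_cdfNy0 (idTR : {RV P >-> R}).
 have -> : cdf (idTR : {RV P >-> R}) = EFin \o F by apply/funext => x; exact: cdfE.
 by move/fine_cvgP => [].
have hh : \forall x \near -oo%R, F x < r by exact: (cvgr_lt _ h).
by near (ninfty_nbhs R) => x; exists x; near: x; exact: hh.
Unshelve. all: end_near. Qed.

Lemma distr_fun_right x e : 0 < e -> exists2 y, x < y & F y < F x + e.
Proof.
move=> e0; have h : F y @[y --> x^'+] --> F x.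
 have := @cdf_right_continuous _ _ _ P (idTR : {RV P >-> R}) x.
 have -> : cdf (idTR : {RV P >-> R}) = EFin \o F by apply/funext => z; exact: cdfE.
 by move/fine_cvgP => [].
have hh : \forall y \near x^'+, F y < F x + e by apply: (cvgr_lt _ h); rewrite ltrDl.
near x^'+ => y; exists y => //; near: y; exact: hh.
Unshelve. all: end_near. Qed.

Definition quantile (r : R) : R := inf [set x | r <= F x].

(** The Galois connection between quantile and distribution function; right-continuity is what makes
    the infimum attained. *)
Lemma quantile_le r x : 0 < r -> r < 1 -> (quantile r <= x) = (r <= F x).
Proof.
move=> r0 r1; set S := [set x | r <= F x].
have [y0 y0r] := distr_fun_top r r1; have [y1 y1r] := distr_fun_bot r r0.
have hi : has_inf S.
 split; first by exists y0; exact: ltW.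
 exists y1 => y Sy; rewrite leNgt; apply/negP => yy.
 by have := lt_le_trans y1r Sy; rewrite ltNge distr_fun_mono ?ltW.
apply/idP/idP => h; last by apply: ge_inf => //; exact: hi.2.
apply/ler_addgt0Pr => e e0; have [y xy Fy] := distr_fun_right x e e0.
have [z Sz zy] := inf_adherent (ltac:(by rewrite subr_gt0; exact: xy) : 0 < y - x) hi.
have zy' : z <= y by apply: ltW; apply: (lt_le_trans zy); rewrite -/S -/(quantile r); lra.
exact: le_trans (le_trans Sz (distr_fun_mono _ _ zy')) (ltW Fy).
Qed.

Lemma quantile_mono r s : 0 < r -> r <= s -> s < 1 -> quantile r <= quantile s.
Proof.
move=> r0 rs s1; rewrite quantile_le//; last exact: le_lt_trans s1.
by apply: (le_trans rs); rewrite -quantile_le// (lt_le_trans r0).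
Qed.

(** Dividing by n + 1 keeps all levels strictly between 0 and 1, where quantiles are finite. *)
Definition level (n j : nat) : R := j.+1%:R / n.+1%:R.

Lemma level_bounds n j : (j < n)%N -> 0 < level n j /\ level n j < 1.
Proof. by move=> jn; split; [rewrite divr_gt0|rewrite ltr_pdivrMr// mul1r ltr_nat]. Qed.

Definition quantile_points n : n.-tuple R := [tuple quantile (level n j) | j < n].

Lemma mem_quantile_points n a : a \in quantile_points n -> exists2 r, 0 < r < 1 & a = quantile r.
Proof.
move=> /mapP[j _ ->]; have [a0 a1] := level_bounds n j (ltn_ord j).
by exists (level n j) => //; rewrite a0 a1.
Qed.

Lemma sorted_quantile_points n : sorted <=%R (quantile_points n).
Proof.
apply/(sortedP 0) => i; rewrite size_tuple => i1.
have i0 := ltnW i1.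
rewrite -(tnth_nth 0 _ (Ordinal i0)) -(tnth_nth 0 _ (Ordinal i1)) !tnth_mktuple /=.
have [a0 _] := level_bounds n i i0; have [_ b1] := level_bounds n i.+1 i1.
by apply: quantile_mono => //; rewrite ler_pM2r ?invr_gt0// ler_nat.
Qed.

Lemma count_levels (y : R) n : 0 <= y -> y <= n.+1%:R ->
 let c := (\sum_(j < n) (j.+1%:R <= y)%R%:R : R) in c <= y /\ y <= c + 1.
Proof.
move=> y0 yn c.
have : [/\ c <= y, c <= n%:R & n%:R <= c \/ y <= c + 1].
 rewrite /c {c yn}; elim: n => [|n [i1 i2 i3]]; first by rewrite big_ord0; split=> //; left.
 rewrite big_ord_recr /=; move: (\sum_(_ < _) _) i1 i2 i3 => S i1 i2 i3; rewrite -natr1.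
 have [h|h] := leP (n%:R + 1) y; rewrite ?addr0.
  by split; [rewrite mulr1n; lra|rewrite mulr1n; lra|left; rewrite mulr1n; case: i3; lra].
 by rewrite ?mulr0n ?addr0; split; [lra|lra|right; case: i3; lra].
by move: yn; rewrite -natr1 => yn [h1 h2 h3]; split=> //; case: h3; lra.
Qed.

(** The number c of points up to x satisfies c <= (n + 1) F(x) <= c + 1; normalising by n instead of
    n + 1 keeps the error within 1/n. *)
Lemma distr_quantile_points n x : (0 < n)%N ->
 `|distr_fun (empirical (quantile_points n)) x - F x| <= n%:R^-1.
Proof.
move=> n0; rewrite distr_fun_empirical.
have np : 0 < n%:R :> R by rewrite ltr0n.
have /andP[F0 F1] := distr_fun_bounds P x (probability_setT P).
pose y := n.+1%:R * F x.
have y0 : 0 <= y by rewrite mulr_ge0.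
have y1 : y <= n.+1%:R by rewrite ler_piMr.
have cE : (count (fun a => a <= x) (quantile_points n))%:R = \sum_(j < n) (j.+1%:R <= y)%R%:R :> R.
 rewrite count_map -sum1_count natr_sum big_mkcond big_enum /=; apply: eq_bigr => j _.
 have [a0 a1] := level_bounds n j (ltn_ord j).
 rewrite quantile_le// /level ler_pdivrMr// mulrC -/y; by case: ifP.
rewrite cE; have [c1 c2] := count_levels y n y0 y1; move: (\sum_(j < n) _) c1 c2 => c c1 c2.
have Fy : F x = y / n.+1%:R by rewrite /y mulrAC mulfV ?mul1r// pnatr_eq0.
rewrite Fy; have n1 : n.+1%:R = n%:R + 1 :> R by rewrite natr1.
rewrite n1 in y1 *; move: (n%:R) np y1 => N N0 y1.
have N1 : 0 < N + 1 by lra.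
have -> : N^-1 * c - y / (N + 1) = (c * (N + 1) - y * N) / (N * (N + 1)) by field; rewrite !lt0r_neq0.
have -> : N^-1 = (N + 1) / (N * (N + 1)) by field; rewrite !lt0r_neq0.
have Z : 0 < (N * (N + 1))^-1 by rewrite invr_gt0 mulr_gt0.
rewrite normrM (gtr0_norm Z) ler_pM2r//.
have q1 : c * N <= y * N by rewrite ler_pM2r.
have q2 : y * N <= (c + 1) * N by rewrite ler_pM2r.
have c0 : - 1 <= c by lra.
by rewrite ler_norml !mulrDr !mulr1; apply/andP; split; lra.
Qed.

(** The distribution function has equal values at both ends of the gap, so a quantile not beyond the
    right end is already below the left end. *)
Lemma quantile_gap (xs D r : R) : 0 < D -> gapped xs D P -> 0 < r -> r < 1 -> D <= `|xs - quantile r|.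
Proof.
move=> D0 [P1 PD] r0 r1.
have e : F (xs + D) = F (xs - D).
 by move: PD; rewrite (measure_itv_distr P _ _ P1)//; [move=> [] /eqP; rewrite subr_eq0 => /eqP|lra].
have h : (quantile r <= xs + D) = (quantile r <= xs - D) by rewrite !quantile_le// e.
have [q|q] := leP (quantile r) (xs + D).
 by move: q; rewrite h => q; rewrite ler_normr; apply/orP; left; lra.
by rewrite ler_normr; apply/orP; right; lra.
Qed.

End Quantile.

(** * Weak convergence of affine images of quantile points *)

Section WeakConvergence.
Context {R : realType}.
Local Notation mR := (measurableTypeR R).
Implicit Types m : {measure set mR -> \bar R}.

(** Only x is confined to the segment: the affine image of a point of the segment may leave it. *)
Lemma uniform_on_segment (h : R -> R) K e : continuous h -> 0 < e ->
 exists2 dl, 0 < dl & forall x y, `|x| <= K -> `|x - y| < dl -> `|h x - h y| < e.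
Proof.
move=> ch e0.
have cK : near_covering `[- K, K] by apply/compact_near_coveringP; exact: segment_compact.
have H : forall x, `[- K, K]%classic x -> \forall x' \near x & i \near (0:R)^'+, forall y, `|x' - y| < i -> `|h x' - h y| < e.
 move=> x _; have e2 : 0 < e / 2 by rewrite divr_gt0.
 have /nbhs_ballP[d /= d0 hd] : \forall y \near x, `|h x - h y| < e / 2 by apply: (@cvgr_dist_lt _ _ _ _ _ h (h x) (ch x)).
 exists (ball x (d / 2), [set i | i < d / 2]) => /=.
  split; first by apply: nbhsx_ballx; rewrite divr_gt0.
  by apply: nbhs_right_lt; rewrite divr_gt0.
 move=> [x' i] /= [xx' id] y x'y.
 have h1 : `|h x - h x'| < e / 2 by apply: hd; rewrite /ball /=; move: xx'; rewrite /ball /=; lra.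
 have h2 : `|h x - h y| < e / 2.
  apply: hd; rewrite /ball /= -(subrKA x') (le_lt_trans (ler_normD _ _))//; move: xx'; rewrite /ball /=; lra.
 rewrite (_ : h x' - h y = (h x - h y) - (h x - h x')); last by ring.
 by rewrite (le_lt_trans (ler_normB _ _))//; lra.
have hn := cK _ (0:R)^'+ (fun dl x => forall y, `|x - y| < dl -> `|h x - h y| < e) _ H.
have [dl [dl0 hdl]] : exists dl : R, 0 < dl /\ (`[- K, K]%classic `<=` fun x => forall y, `|x - y| < dl -> `|h x - h y| < e).
 near (0:R)^'+ => dl; exists dl; split => //; near: dl; exact: hn.
by exists dl => // x y xK; apply: hdl; rewrite /= in_itv/= -ler_norml.
Unshelve. all: end_near. Qed.

(** The step function takes values of h everywhere, including outside the segment, so it inherits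
    the bound on h. *)
Lemma step_uniform (h : R -> R) K dl e : 0 < K -> 0 < dl ->
 (forall x y, `|x| <= K -> `|x - y| < dl -> `|h x - h y| < e) ->
 exists c (ee a : nat -> R) N, forall s, exists y,
  step_fun c ee (fun i => [set t | t <= a i]) N s = h y /\ (- K < s <= K -> `|h s - h y| < e).
Proof.
move=> K0 d0 U.
have [N hN] : exists N : nat, 2 * K / N.+1%:R < dl.
 exists (Num.trunc (2 * K / dl)).+1; rewrite ltr_pdivrMr// -ltr_pdivrMl// mulrC.
 by rewrite (lt_le_trans (truncnS_gt _))// ler_nat.
pose eta := 2 * K / N.+1%:R; pose a (i : nat) := - K + i%:R * eta.
have eta0 : 0 < eta by rewrite divr_gt0// mulr_gt0.
have aS i : a i.+1 = a i + eta by rewrite /a -natr1; ring.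
have am i j : (i <= j)%N -> a i <= a j by move=> ij; rewrite lerD2l ler_pM2r// ler_nat.
have main n s : exists y, step_fun (h (a n)) (fun i => h (a i.+1) - h (a i)) (fun i => [set t | t <= a i]) n s = h y /\
  (- K < s <= a n -> s <= y <= s + eta).
 elim: n => [|n [y [gy hy]]].
  exists (a 0%N); split; first by rewrite /step_fun big_ord0 subr0.
  by rewrite /a mul0r addr0 => /andP[s1 s2]; have := lt_le_trans s1 s2; rewrite ltxx.
 have [sa|sa] := leP s (a n).
  exists y; split; last by move=> /andP[s1 _]; apply: hy; rewrite s1.
  by rewrite -gy /step_fun big_ord_recr /= [X in _ * X]indicE mem_set//= mulr1; move: (\sum_(i < n) _) => S; ring.
 exists (a n.+1); split; last by move=> /andP[_ s2]; rewrite s2 aS /=; lra.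
 rewrite /step_fun big1 ?subr0// => i _; rewrite indicE memNset ?mulr0//=.
 by move=> sai; have := le_lt_trans (le_trans sai (am i n (ltn_ord i))) sa; rewrite ltxx.
exists (h (a N.+1)), (fun i => h (a i.+1) - h (a i)), a, N.+1 => s.
have aN : a N.+1 = K by rewrite /a /eta mulrCA mulfV ?mulr1; [ring|rewrite pnatr_eq0].
have [y [gy hy]] := main N.+1 s; exists y; split=> //; rewrite aN in hy => sK.
have /andP[y1 y2] := hy sK; move: sK => /andP[s1 s2].
apply: U; first by rewrite ler_norml s2 andbT ltW.
by rewrite distrC ger0_norm ?subr_ge0//; apply: (le_lt_trans _ hN); rewrite -/eta; lra.
Qed.

Lemma Rint_err_off m (f g : R -> R) B e (A : set mR) : m setT = 1%E -> 0 <= B -> 0 <= e ->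
 measurable_fun setT (f : mR -> R) -> measurable_fun setT (g : mR -> R) -> measurable A ->
 (forall s, `|f s| <= B) -> (forall s, `|g s| <= B) -> (forall s, ~ A s -> `|f s - g s| <= e) ->
 `|\int[m]_s f s - \int[m]_s g s| <= e + 2 * B * fine (m A).
Proof.
move=> m1 B0 e0 mf mg mA fB gB fg.
have i1 := bounded_integrable m f B m1 mf fB; have i2 := bounded_integrable m g B m1 mg gB.
have mfg : measurable_fun setT ((fun s => f s - g s) : mR -> R) by exact: measurable_funB.
have fg2 s : `|f s - g s| <= 2 * B by rewrite (le_trans (ler_normB _ _))//; have := fB s; have := gB s; lra.
have ind s : 0 <= (\1_A s : R) <= 1 by rewrite indicE; case: (_ \in _) => /=; rewrite ?ler01 ?lexx.
have iA : m.-integrable setT (EFin \o (\1_A : mR -> R)).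
 apply: (bounded_integrable m _ 1 m1); first exact: measurable_indic.
 by move=> s; have /andP[h1 h2] := ind s; rewrite ger0_norm.
have iA' := integrable_scale m (2 * B) _ iA.
have ie : m.-integrable setT (EFin \o (fun _ : mR => e)).
 by apply: (bounded_integrable m _ `|e| m1); first exact: measurable_cst.
rewrite -RintegralB// (le_trans (le_normr_Rintegral _ _))//.
 exact: (bounded_integrable m _ _ m1 mfg fg2).
have -> : e + 2 * B * fine (m A) = \int[m]_s (e + 2 * B * \1_A s).
 by rewrite RintegralD// RintegralZl// Rint_indic// Rint_cst.
apply: le_Rintegral => //.
- apply: (bounded_integrable m _ (2 * B) m1); first exact: measurableT_comp.
 by move=> s; rewrite normr_id.
- exact: (integrableD measurableT ie iA').
move=> s _; have [As|As] := pselect (A s).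
 by rewrite indicE mem_set// mulr1; have := fg2 s; lra.
by rewrite indicE memNset// mulr0 addr0; exact: fg.
Qed.

Lemma measure_outside m K : 0 <= K -> m setT = 1%E ->
 fine (m (~` `]- K, K]%classic : set mR)) = 1 - (distr_fun m K - distr_fun m (- K)).
Proof.
move=> K0 m1; have KK : - K <= K by lra.
have mI : measurable (`]- K, K]%classic : set mR) by exact: measurable_itv.
have := measure_itv_distr m (- K) K m1 KK; set I := `]- K, K]%classic => mIE.
have fI : m (~` I) \is a fin_num.
 by apply: prob_fin => //; exact: measurableC.
have : m setT = (m I + m (~` I))%E.
 by rewrite -measureU//; [rewrite setUv|exact: measurableC|rewrite setICr].
rewrite m1 mIE -(fineK fI) -EFinD => -[] ->; ring.
Qed.

(** Integrals of a step function are controlled by the distribution functions at finitely many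
    points. The test function is replaced by such a step function on a large segment, the affine
    distortion being small there and the mass outside small for both measures. *)
Lemma quantile_affine_weak (P : probability mR R) (A lam : nat -> R) : A @ \oo --> (0:R) -> lam @ \oo --> (1 : R) ->
 weakly_converges (fun n => empirical (map_tuple (fun q => A n + lam n * q) (quantile_points P n))) P.
Proof.
move=> A0 l1 h ch [B0 [_ hB0]].
have [B [Bp hB]] : exists B, 0 < B /\ forall s, `|h s| <= B.
 exists (`|B0| + 1); split; first by rewrite ltr_wpDl.
 by move=> s; apply: hB0 => //; rewrite ltr_pwDr// ler_norm.
have P1 := probability_setT P.
have mh := continuous_measurable_fun ch.
apply/cvgrPdist_lt => e e0.
(* The errors collected below stay under (12 B + 4) e1. *)
pose e1 := e / (16 * (B + 1)).
have e1p : 0 < e1 by rewrite divr_gt0// mulr_gt0//; lra.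
have e1E : (16 * B + 16) * e1 = e by rewrite /e1; field; rewrite gt_eqF//; lra.
have [K [K0 FK FNK]] : exists K, [/\ 0 < K, 1 - e1 < distr_fun P K & distr_fun P (- K) < e1].
 have [x1 hx1] : exists x, 1 - e1 < distr_fun P x by apply: distr_fun_top; lra.
 have [x2 hx2] := distr_fun_bot P e1 e1p.
 exists (`|x1| + `|x2| + 1); have n1 := normr_ge0 x1; have n2 := normr_ge0 x2; split; first by lra.
  by apply: (lt_le_trans hx1); apply: distr_fun_mono; have := ler_norm x1; lra.
 by apply: le_lt_trans hx2; apply: distr_fun_mono; have := ler_norm (- x2); rewrite normrN; lra.
have [dl dl0 U] := uniform_on_segment h K e1 ch e1p.
have [c [ee [a [N hg]]]] := step_uniform h K dl e1 K0 dl0 U.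
set g := step_fun c ee _ N in hg.
have mS i : measurable ([set t | t <= a i] : set mR) by rewrite -set_itvNyc; exact: measurable_itv.
have [q1 [q2 [q3 q4]]] := step_fun_int c ee (fun i => [set t | t <= a i]) N mS.
have gB s : `|g s| <= B by have [y [-> _]] := hg s; exact: hB.
pose I : set mR := ~` `]- K, K]%classic.
have mI : measurable I by apply: measurableC; exact: measurable_itv.
have inI s : ~ I s -> - K < s <= K by move=> /contrapT; rewrite /= in_itv.
pose nu n := empirical (quantile_points P n).
pose SE := \sum_(i < N) `|ee i|.
have c1 : \forall n \near \oo, `|A n| < dl / 2 by apply: cvgr0_norm_lt => //; rewrite divr_gt0.
have c2 : \forall n \near \oo, `|lam n - 1| < dl / (2 * (K + 1)).
 apply: (cvgr0_norm_lt _ (rlo_cvg _ _ l1)); rewrite divr_gt0// mulr_gt0//; lra.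
have iv : (fun n => (n%:R)^-1) @ \oo --> (0:R) by apply: (cvg_ext _ _ _ _ (rootV_cvg 1 isT)) => n; rewrite -[n%:R](root_exp 1 n isT) expr1.
have c3 : \forall n \near \oo, SE * n%:R^-1 < e1.
 by have := cvg_scale _ SE _ iv; rewrite mulr0 => q; apply: (cvgr_lt _ q).
have c4 : \forall n \near \oo, n%:R^-1 < e1 by apply: (cvgr_lt _ iv).
near=> n.
have n0 : (0 < n)%N by near: n; exact: nbhs_infty_gt.
have nu1 : nu n setT = 1%E by exact: empirical_setT.
have h1 : `|A n| < dl / 2 by near: n; exact: c1.
have h2 : `|lam n - 1| < dl / (2 * (K + 1)) by near: n; exact: c2.
have h3 : SE * n%:R^-1 < e1 by near: n; exact: c3.
have h4 : n%:R^-1 < e1 by near: n; exact: c4.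
pose hn s := h (A n + lam n * s).
have mhn : measurable_fun setT (hn : mR -> R).
 by apply: (measurableT_comp mh); apply: measurable_funD => //; exact: measurable_funM.
have hE : \int[empirical (map_tuple (fun q => A n + lam n * q) (quantile_points P n))]_x h x = \int[nu n]_x hn x.
 by rewrite !emp_int//= big_map.
rewrite hE.
have dF x := distr_quantile_points P n x n0.
have B00 : 0 <= B := ltW Bp.
have e3 : `|\int[P]_s h s - \int[P]_s g s| <= e1 + 2 * B * fine (P I).
 apply: Rint_err_off => //; first exact: ltW.
 by move=> s /inI sK; have [y [-> hy]] := hg s; exact: ltW (hy sK).
have e4 : `|\int[nu n]_s hn s - \int[nu n]_s g s| <= 2 * e1 + 2 * B * fine (nu n I).
 apply: Rint_err_off => //; [lra|by move=> s; exact: hB|].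
 move=> s /inI sK; have [y [-> hy]] := hg s; have hs := hy sK; move: sK => /andP[s1 s2].
 have sK : `|s| <= K by rewrite ler_norml s2 andbT ltW.
 have cl : `|s - (A n + lam n * s)| < dl.
  rewrite (_ : s - _ = - (A n + (lam n - 1) * s)); last by ring.
  rewrite normrN (le_lt_trans (ler_normD _ _))// normrM.
  have : `|lam n - 1| * `|s| <= dl / (2 * (K + 1)) * (K + 1) by apply: ler_pM => //; [exact: ltW|lra].
  have -> : dl / (2 * (K + 1)) * (K + 1) = dl / 2 by field; rewrite gt_eqF//; lra.
  by lra.
 have := U s _ sK cl; rewrite -/(hn s).
 rewrite (_ : hn s - h y = (h s - h y) - (h s - hn s)); last by ring.
 by move=> h5; rewrite (le_trans (ler_normB _ _))//; lra.
have e5 : `|\int[nu n]_s g s - \int[P]_s g s| <= SE * n%:R^-1.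
 rewrite (q4 _ nu1) (q4 _ P1).
 rewrite (_ : _ - _ = \sum_(i < N) ee i * (fine (P [set t | t <= a i]) - fine (nu n [set t | t <= a i]))); last first.
  under [in RHS]eq_bigr do rewrite mulrBr.
  by rewrite sumrB; move: (\sum_(i < N) _) (\sum_(i < N) _) => S1 S2; ring.
 apply: le_trans (ler_norm_sum _ _ _) _; rewrite /SE mulr_suml; apply: ler_sum => i _.
 by rewrite normrM ler_wpM2l// distrC; exact: dF.
have e6 : fine (P I) < 2 * e1 by rewrite measure_outside// ?ltW//; lra.
have e7 : fine (nu n I) < 4 * e1.
 rewrite measure_outside// ?ltW//; have := dF K; have := dF (- K); rewrite !ler_norml => /andP[z1 z2] /andP[z3 z4].
 by move: z1 z2 z3 z4; rewrite -/(nu n); lra.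
have e8 : B * fine (P I) <= B * (2 * e1) by rewrite ler_wpM2l// ltW.
have e9 : B * fine (nu n I) <= B * (4 * e1) by rewrite ler_wpM2l// ltW.
rewrite (_ : _ - _ = (\int[P]_s h s - \int[P]_s g s) - (\int[nu n]_s g s - \int[P]_s g s) - (\int[nu n]_s hn s - \int[nu n]_s g s)); last by ring.
rewrite (le_lt_trans (ler_normB _ _))// (le_lt_trans (lerD (ler_normB _ _) (lexx _)))//.
have e10 : B * e1 * 16 + 16 * e1 = e by rewrite -e1E; ring.
have e11 : 0 < B * e1 by rewrite mulr_gt0.
have e12 : B * (2 * e1) = 2 * (B * e1) by ring.
have e13 : B * (4 * e1) = 4 * (B * e1) by ring.
have e14 : B * e1 * 16 = 16 * (B * e1) by ring.
move: e8 e9 e10; rewrite e12 e13 e14 => e8 e9 e10.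
have e15 : 2 * B * fine (P I) = 2 * (B * fine (P I)) by ring.
have e16 : 2 * B * fine (nu n I) = 2 * (B * fine (nu n I)) by ring.
move: e3 e4; rewrite e15 e16 => e3 e4; lra.
Unshelve. all: end_near. Qed.

End WeakConvergence.

(** * The transition regime *)

Section TransitionCase.
Context {R : realType}.
Local Notation C := R[i].
Local Notation mR := (measurableTypeR R).
Variables (P : probability mR R) (xs D a : R).
Hypotheses (D0 : 0 < D) (gm : gapped xs D P) (I0 : inv_cube_integral P xs = 0).
Let T := t_cr P xs.
Let w := T * c3 P xs.
Let r (n : nat) : R := root 4 n.
Let G0 := mom P xs 1.
(** The third moment vanishes at xs and has derivative -3 times the fourth; this displacement makes
    it a/(w^3 r) to leading order, because w^4 times the fourth moment is 1. *)
Definition tr_theta n := - (a * w / 3) * (r n)^-1.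
Let th := tr_theta.
Let N k n := mom P (xs + th n) k.
(** The dilation that restores the second moment 1/T at the displaced base point. *)
Definition tr_lam n := Num.sqrt (T * N 2 n).
Let lam := tr_lam.
(** The translation for which (p - xs)/T plus the first moment equals [G0], up to the quantile
    error. *)
Definition tr_shift n := - (lam n * th n) + T * (G0 - N 1 n / lam n).
Definition tr_points n : n.-tuple R := map_tuple (fun q => xs + tr_shift n - lam n * xs + lam n * q) (quantile_points P n).
Definition tr_base n := xs + tr_shift n + lam n * th n.
(** The gauge point is the base point as soon as that is not one of the X_j; the alternative, larger
    than all of them, serves the finitely many other n. *)
Definition tr_gauge n := if tr_base n \in tr_points n then \sum_(e <- tr_points n) `|e| + 1 else tr_base n.
Let X := tr_points.
Let p := tr_base.
Let Q k n := pmom (quantile_points P n) (xs + th n) k.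

Lemma tr_gauge_notin n : tr_gauge n \notin tr_points n.
Proof.
rewrite /tr_gauge; case: ifPn => // _; apply/negP => h.
have : \sum_(e <- tr_points n) `|e| + 1 <= \sum_(e <- tr_points n) `|e|.
 rewrite [leRHS](big_rem _ h) /=; apply: le_trans (ler_norm _) _; rewrite lerDl.
 by apply: sumr_ge0 => i _; exact: normr_ge0.
by rewrite gerDl ler10.
Qed.

Lemma sorted_tr_points n : sorted <=%R (tr_points n).
Proof.
have h : {homo (fun q => xs + tr_shift n - lam n * xs + lam n * q) : x y / x <= y}.
 by move=> x y xy; rewrite lerD2l ler_wpM2l// sqrtr_ge0.
rewrite sorted_map; apply: sub_sorted (sorted_quantile_points P n) => x y; exact: h.
Qed.

Let T0 : 0 < T. Proof. exact: (t_cr_gt0 P xs D D0 gm). Qed.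
Let w0 : 0 < w. Proof. exact: (w_gt0 P xs D D0 gm). Qed.
Let TM : T * mom P xs 2 = 1. Proof. by rewrite -(t_crV P xs) mulfV// lt0r_neq0. Qed.
Let M3 : mom P xs 3 = 0. Proof. exact: I0. Qed.
Let n1 : \forall n \near \oo, (0 < n)%N. Proof. exact: nbhs_infty_gt. Qed.
Let rp n : (0 < n)%N -> 0 < r n. Proof. exact: root_gt0. Qed.
Let z0 : (fun n => (r n)^-1) @ \oo --> (0:R). Proof. exact: rootV_cvg. Qed.
Let rz n : (0 < n)%N -> r n * (r n)^-1 = 1. Proof. by move=> n0; rewrite mulfV// lt0r_neq0// rp. Qed.

Let th0 : th @ \oo --> (0:R).
Proof. by have := cvg_scale _ (- (a * w / 3)) _ z0; rewrite mulr0. Qed.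

Let rth2 : (fun n => r n * th n ^+ 2) @ \oo --> (0:R).
Proof.
have := cvg_scale _ ((a * w / 3) ^+ 2) _ z0; rewrite mulr0; apply: cvg_near_eq; near=> n.
have n0 : (0 < n)%N by near: n; exact: n1.
rewrite /th /tr_theta; have := rz n n0; move: (r n) (r n)^-1 => x y xy.
have -> : x * (- (a * w / 3) * y) ^+ 2 = (a * w / 3) ^+ 2 * (x * y * y) by ring.
by rewrite xy mul1r.
Unshelve. all: end_near. Qed.

Let rthc (c : R) : (fun n => r n * (th n * c)) @ \oo --> - (a * w / 3) * c.
Proof.
apply: cvg_pos_eq (cvg_const _) => n n0.
rewrite /th /tr_theta; have := rz n n0; move: (r n) (r n)^-1 => x y xy.
have -> : x * (- (a * w / 3) * y * c) = - (a * w / 3) * c * (x * y) by ring.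
by rewrite xy mulr1.
Qed.

Let gq : \forall n \near \oo, gapped xs D (empirical (quantile_points P n)).
Proof.
near=> n; have n0 : (0 < n)%N by near: n; exact: n1.
have [_ PD] := gm; split; first exact: empirical_setT.
have P1 := probability_setT P; have D2 : xs - D <= xs + D by have := D0; lra.
apply: empirical_avoid => q /mem_quantile_points[s /andP[s0 s1] ->] /=; rewrite in_itv/= => /andP[q1 q2].
move: PD; rewrite (measure_itv_distr P _ _ P1 D2) => -[] /eqP; rewrite subr_eq0 => /eqP e.
by move: q2; rewrite quantile_le// e -quantile_le// leNgt q1.
Unshelve. all: end_near. Qed.

Let kd : (fun n => r n ^+ 3 * kolmogorov_dist (empirical (quantile_points P n)) P) @ \oo --> (0:R).
Proof.
apply: (cvg0_le _ (fun n => (r n)^-1) _ z0); near=> n; have n0 : (0 < n)%N by near: n; exact: n1.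
have q0 : 0 <= kolmogorov_dist (empirical (quantile_points P n)) P.
 exact: le_trans (normr_ge0 _) (kolmogorov_dist_ge _ _ 0 (empirical_setT n _ n0) (probability_setT P)).
have q1 : kolmogorov_dist (empirical (quantile_points P n)) P <= n%:R^-1.
 apply: sup_le_ub; first by exists `|distr_fun (empirical (quantile_points P n)) 0 - distr_fun P 0|; exists 0.
 by move=> _ [x _ <-]; exact: distr_quantile_points.
have r0 := rp n n0; have rn := lt0r_neq0 r0.
rewrite ger0_norm ?mulr_ge0 ?exprn_ge0 ?(ltW r0)// (le_trans (ler_wpM2l (exprn_ge0 3 (ltW r0)) q1))//.
have -> : n%:R = r n ^+ 4 :> R by rewrite /r root_exp.
by rewrite le_eqVlt; apply/orP; left; apply/eqP; field; rewrite rn.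
Unshelve. all: end_near. Qed.

Let down (f : nat -> R) j : (fun n => r n ^+ j.+1 * f n) @ \oo --> (0:R) -> (fun n => r n ^+ j * f n) @ \oo --> (0:R).
Proof.
move=> hf; have := cvg_mul _ _ _ _ z0 hf; rewrite mulr0; apply: cvg_pos_eq => n n0.
by rewrite exprS -mulrA mulKf// lt0r_neq0// rp.
Qed.

Let Q3 k : (fun n => r n ^+ 3 * (Q k n - N k n)) @ \oo --> (0:R).
Proof. exact: (pmom_close P xs D (quantile_points P) th D0 gm gq th0 _ k kd). Qed.
Let Q2 k := down _ _ (Q3 k).
Let Q1 k : (fun n => r n * (Q k n - N k n)) @ \oo --> (0:R).
Proof. by apply: cvg_ext (down _ _ (Q2 k)) => n; rewrite expr1. Qed.

Let NC k : N k @ \oo --> mom P xs k. Proof. exact: (mom_cvg P xs D th D0 gm th0). Qed.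

Let lam1 : lam @ \oo --> (1 : R).
Proof.
have : (fun n => Num.sqrt (T * N 2 n)) @ \oo --> Num.sqrt (T * mom P xs 2).
 by apply: continuous_cvg; [exact: sqrt_continuous|exact: cvg_scale].
by rewrite TM sqrtr1.
Qed.

Let lamp : \forall n \near \oo, 1 / 2 < lam n. Proof. by apply: (cvgr_gt _ lam1); lra. Qed.
Let lamn : \forall n \near \oo, lam n != 0.
Proof. by apply: filterS lamp => n lp; rewrite lt0r_neq0//; lra. Qed.
Let lamsq : \forall n \near \oo, lam n ^+ 2 = T * N 2 n.
Proof.
have h : \forall n \near \oo, 0 < N 2 n by apply: (cvgr_gt _ (NC 2)); exact: (mom_2_gt0 P xs D D0 gm).
by apply: filterS h => n h; rewrite sqr_sqrtr// mulr_ge0 ?ltW.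
Qed.

Let lamV k : (fun n => (lam n ^+ k)^-1) @ \oo --> (1 : R).
Proof.
have : (fun n => lam n ^+ k) @ \oo --> (1 : R).
 elim: k => [|k ih]; first by apply: cvg_ext (cvg_const 1) => n; rewrite expr0.
 by have := cvg_mul _ _ _ _ lam1 ih; rewrite mulr1; apply: cvg_ext => n; rewrite -exprS.
by move=> h; rewrite -(invr1 R); apply: cvgV => //; exact: oner_neq0.
Qed.

(** The affine map sends xs + th to the base point, so moments there are exact multiples of moments
    of the quantile points. *)
Let pmE n k : pmom (X n) (p n) k = (lam n ^+ k)^-1 * Q k n.
Proof.
rewrite /Q /pmom !size_tuple big_map [RHS]mulrCA; congr (_ * _); rewrite mulr_sumr; apply: eq_bigr => q _.
by rewrite -invfM -exprMn; congr ((_ ^+ _)^-1); rewrite /p /tr_base; ring.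
Qed.

Let hE n : p n - xs = T * (G0 - N 1 n / lam n). Proof. by rewrite /p /tr_base /tr_shift; ring. Qed.

(** The first-order term of the second moment is the vanishing third moment, so the dilation differs
    from 1 by o(n^(-1/4)). *)
Let rlam : (fun n => r n * (lam n - 1)) @ \oo --> (0:R).
Proof.
have c1 := mom_taylor_cvg P xs D th D0 gm th0 r 2 rth2.
have c2 : (fun n => (lam n + 1)^-1) @ \oo --> (1 + 1 : R)^-1.
 by apply: cvgV; [rewrite lt0r_neq0// addr_gt0|exact: (cvg_add _ _ _ _ lam1 (cvg_const 1))].
have := cvg_mul _ _ _ _ c2 (cvg_scale _ T _ c1); rewrite !mulr0; apply: cvg_near_eq; near=> n.
have l2 : lam n ^+ 2 = T * N 2 n by near: n; exact: lamsq.
have lp : 1 / 2 < lam n by near: n; exact: lamp.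
have ln : lam n + 1 != 0 by rewrite lt0r_neq0//; lra.
rewrite M3 mulr0 addr0 -/(N 2 n).
have E : T * (r n * (N 2 n - mom P xs 2)) = r n * (lam n ^+ 2 - 1) by rewrite l2 -TM; ring.
by rewrite E; field; rewrite ln.
Unshelve. all: end_near. Qed.

Let rN1 : (fun n => r n * (G0 - N 1 n)) @ \oo --> - (a * w / 3) * mom P xs 2.
Proof.
have c1 := mom_taylor_cvg P xs D th D0 gm th0 r 1 rth2.
have := cvg_sub _ _ _ _ (rthc (mom P xs 2)) c1; rewrite subr0; apply: cvg_ext => n.
by rewrite -/(N 1 n) /G0; ring.
Qed.

(** Origin of the constant b = - a/3: to leading order the base point moves by th, as T times the
    second moment is 1. *)
Let hr : (fun n => (p n - xs) * r n) @ \oo --> (- (a / 3)) * w.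
Proof.
have c := cvg_mul _ _ _ _ (cvg_scale _ T _ (lamV 1)) (cvg_add _ _ _ _ (cvg_mul _ _ _ _ rlam (cvg_const G0)) rN1).
have e : T * 1 * (0 * G0 + - (a * w / 3) * mom P xs 2) = - (a / 3) * w.
 have -> : T * 1 * (0 * G0 + - (a * w / 3) * mom P xs 2) = - (a / 3) * w * (T * mom P xs 2) by field.
 by rewrite TM mulr1.
rewrite e in c; apply: cvg_near_eq c; near=> n.
have ln : lam n != 0 by near: n; exact: lamn.
by rewrite hE expr1; field; rewrite ln.
Unshelve. all: end_near. Qed.

Let gapX : \forall n \near \oo, forall e, e \in X n -> D / 4 <= `|p n - e|.
Proof.
have h1 : \forall n \near \oo, `|th n| < D / 2 by apply: cvgr0_norm_lt => //; have := D0; lra.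
near=> n => e /mapP[q /mem_quantile_points[s /andP[s0 s1] qE] ->].
have lp : 1 / 2 < lam n by near: n; exact: lamp.
have t2 : `|th n| < D / 2 by near: n; exact: h1.
have -> : p n - (xs + tr_shift n - lam n * xs + lam n * q) = lam n * ((xs - q) - - th n) by rewrite /p /tr_base; ring.
have g := quantile_gap P xs D s D0 gm s0 s1; rewrite -qE in g.
have k : D / 2 <= `|xs - q - - th n| by have := lerB_dist (xs - q) (- th n); rewrite normrN; lra.
have l0 : 0 < lam n by lra.
rewrite normrM (gtr0_norm l0) (_ : D / 4 = 1 / 2 * (D / 2)); last by field.
by apply: ler_pM; rewrite ?(ltW lp)//; have := D0; lra.
Unshelve. all: end_near. Qed.

(** Eventually all points are at distance D/4 from the base point, which is therefore the gauge
    point. *)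
Let gE : \forall n \near \oo, stieltjes (empirical (X n)) (tr_gauge n) = (lam n)^-1 * Q 1 n.
Proof.
near=> n; have pX : p n \notin X n.
 apply/negP => pX; have g : forall e, e \in X n -> D / 4 <= `|p n - e| by near: n; exact: gapX.
 by have := g _ pX; rewrite subrr normr0; have := D0; lra.
have -> : tr_gauge n = p n by rewrite /tr_gauge (negPf pX).
have -> : stieltjes (empirical (X n)) (p n) = mom (empirical (X n)) (p n) 1 by [].
by rewrite mom_empirical pmE expr1.
Unshelve. all: end_near. Qed.

Lemma transition_limit (x0 : nat -> R) (gamma : nat -> R -> C) (M : R) (tau1 tau2 u v : nat -> R) :
 (forall n, (0 < n)%N -> admissible (tr_points n) (x0 n) (gamma n)) -> bounded_params M tau1 tau2 u v ->
 clo (fun n => rescaled_kernel (t_merge P xs n) (x_star P xs) (c3 P xs * n%:R `^ (3 / 4)) (tr_points n) (tr_gauge n)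
         (x0 n) (gamma n) (tau1 n) (tau2 n) (u n) (v n))
   (fun n => transition_kernel a (tau1 n) (tau2 n) (u n + tau1 n * (- (a / 3))) (v n + tau2 n * (- (a / 3)))).
Proof.
move=> adm bp; have D4 : 0 < D / 4 by have := D0; lra.
have Tn := lt0r_neq0 T0; have wn := lt0r_neq0 w0.
apply: (merge_limit P xs D D0 gm X x0 tr_gauge p tau1 tau2 u v gamma a (- (a / 3)) (D / 4) M D4 gapX adm bp).
(* By the choice of the translation only the quantile error, of order 1/n, is left against the rate
   n^(3/4). *)
- have := cvg_mul _ _ _ _ (lamV 1) (Q3 1); rewrite mulr0; apply: cvg_near_eq; near=> n.
 have ln : lam n != 0 by near: n; exact: lamn.
 by rewrite pmE hE -/T -/G0 -/(r n) !expr1; field; rewrite ?Tn ?ln.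
- exact: hr.
- have := cvg_scale _ (-1) _ (cvg_mul _ _ _ _ (lamV 2) (Q2 2)); rewrite !mulr0; apply: cvg_near_eq; near=> n.
 have ln : lam n != 0 by near: n; exact: lamn.
 have l2 : lam n ^+ 2 = T * N 2 n by near: n; exact: lamsq.
 have N2 : N 2 n = lam n ^+ 2 / T by rewrite l2 mulrAC mulfV ?mul1r.
 by rewrite pmE -/T -/(r n) N2; field; rewrite ?Tn ?ln.
(* Third moment at the displaced base point: -3 th times the fourth moment at xs, which gives a. *)
- have c1 := mom_taylor_cvg P xs D th D0 gm th0 r 3 rth2.
 have c2 := cvg_sub _ _ _ _ (cvg_add _ _ _ _ (Q1 3) c1) (cvg_scale _ 3 _ (rthc (mom P xs 4))).
 have := cvg_mul _ _ _ _ (lamV 3) c2.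
 have -> : 1 * (0 + 0 - 3 * (- (a * w / 3) * mom P xs 4)) = a / w ^+ 3.
  have -> : 1 * (0 + 0 - 3 * (- (a * w / 3) * mom P xs 4)) = a / w ^+ 3 * (w ^+ 4 * mom P xs 4) by field.
  by rewrite (w4 P xs D D0 gm) mulr1.
 apply: cvg_ext => n; rewrite pmE M3 -/(N 3 n) -/(r n); ring.
- have c := cvg_mul _ _ _ _ (lamV 4) (cvg_add _ _ _ _ (down _ _ (down _ _ (down _ _ (Q3 4)))) (NC 4)).
 by rewrite add0r mul1r in c; apply: cvg_ext c => n; rewrite pmE expr0 mul1r subrK.
- have c := cvg_sub _ _ _ _ (cvg_scale _ T^-1 _ hr) (cvg_mul _ _ _ _ (lamV 1) (Q1 1)).
 have e : T^-1 * (- (a / 3) * w) - 1 * 0 = - (a / 3) * c3 P xs by rewrite /w; field.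
 rewrite e in c; apply: cvg_near_eq c; near=> n.
 have ln : lam n != 0 by near: n; exact: lamn.
 have g : stieltjes (empirical (X n)) (tr_gauge n) = (lam n)^-1 * Q 1 n by near: n; exact: gE.
 by rewrite g hE -/G0 -/(r n) !expr1; field; rewrite ?Tn ?ln.
- have := cvg_scale _ T _ (cvg_mul _ _ _ _ (lamV 1) (Q1 1)); rewrite !mulr0; apply: cvg_near_eq; near=> n.
 have ln : lam n != 0 by near: n; exact: lamn.
 have g : stieltjes (empirical (X n)) (tr_gauge n) = (lam n)^-1 * Q 1 n by near: n; exact: gE.
 by rewrite g hE -/G0 -/T -/(r n) !expr1; field; rewrite ?Tn ?ln.
Unshelve. all: end_near. Qed.

Lemma tr_points_weak : weakly_converges (fun n => empirical (tr_points n)) P.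
Proof.
apply: quantile_affine_weak; last exact: lam1.
have c := cvg_add _ _ _ _ (cvg_mul _ _ _ _ (cvg_scale _ T _ (lamV 1)) (cvg_sub _ _ _ _ (cvg_mul _ _ _ _ lam1 (cvg_const G0)) (NC 1)))
 (cvg_sub _ _ _ _ (cvg_scale _ xs _ (cvg_sub _ _ _ _ (cvg_const 1) lam1)) (cvg_mul _ _ _ _ lam1 th0)).
have e : T * 1 * (1 * G0 - mom P xs 1) + (xs * (1 - 1) - 1 * 0) = 0 by rewrite /G0; ring.
rewrite e in c; apply: cvg_near_eq c; near=> n.
have ln : lam n != 0 by near: n; exact: lamn.
by rewrite /tr_shift expr1; field; rewrite ln.
Unshelve. all: end_near. Qed.

End TransitionCase.

(** * Uniform convergence on compacts and conclusion *)

Section Uniformity.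
Context {R : realType}.
Local Notation C := R[i].
Implicit Types (K : nat -> R -> R -> R -> R -> C) (L : R -> R -> R -> R -> C).

(** By choice: at each n where the bound fails, parameters witnessing the failure are selected, and
    bounded ones otherwise. Asymptotic equality along this single sequence excludes failures for
    large n. *)
Lemma unif_compact_of_sequences K L :
 (forall M tau1 tau2 u v, bounded_params M tau1 tau2 u v ->
  clo (fun n => K n (tau1 n) (tau2 n) (u n) (v n)) (fun n => L (tau1 n) (tau2 n) (u n) (v n))) ->
 cvg_unif_compact K L.
Proof.
move=> H T U cT cU e e0.
have [B1 [_ hB1]] := compact_bounded cT; have [B2 [_ hB2]] := compact_bounded cU.
pose M := `|B1| + `|B2| + 1.
have T1 t : T t -> `|t| <= M by move=> Tt; apply: hB1 => //; rewrite /M; have := ler_norm B1; have := normr_ge0 B2; lra.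
have U1 t : U t -> `|t| <= M by move=> Tt; apply: hB2 => //; rewrite /M; have := ler_norm B2; have := normr_ge0 B1; lra.
have M0 : `|0 : R| <= M by rewrite normr0 /M; have := normr_ge0 B2; have := normr_ge0 B1; lra.
pose bad n (q : R * R * R * R) := [/\ T q.1.1.1, T q.1.1.2, U q.1.2 & U q.2] /\
 e <= nc (K n q.1.1.1 q.1.1.2 q.1.2 q.2 - L q.1.1.1 q.1.1.2 q.1.2 q.2).
have /boolp.choice[f hf] : forall n : nat, exists x : R * R * R * R,
  [/\ `|x.1.1.1| <= M, `|x.1.1.2| <= M, `|x.1.2| <= M & `|x.2| <= M] /\ ((exists q, bad n q) -> bad n x).
 move=> n.
 have [[q bq]|nb] := pselect (exists q, bad n q); last by exists (0, 0, 0, 0).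
 exists q; split=> // ; have [[t1 t2 u1 v1] _] := bq; split; [exact: T1|exact: T1|exact: U1|exact: U1].
have := H M (fun n => (f n).1.1.1) (fun n => (f n).1.1.2) (fun n => (f n).1.2) (fun n => (f n).2) (fun n => (hf n).1).
move=> c; have hc := clo_nc0 _ (clo_sub0 _ _ c).
have : \forall n \near \oo, nc (K n (f n).1.1.1 (f n).1.1.2 (f n).1.2 (f n).2 - L (f n).1.1.1 (f n).1.1.2 (f n).1.2 (f n).2) < e.
 exact: (cvgr_lt _ hc).
apply: filterS => n hn t1 t2 u v Tt1 Tt2 Uu Uv; rewrite ltNge; apply/negP => b.
have [_ bf] := hf n; have [_] := bf (ex_intro _ (t1, t2, u, v) (conj (And4 Tt1 Tt2 Uu Uv) b)).
by rewrite leNgt hn.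
Qed.

End Uniformity.

Theorem corollary1p4 (R : realType) (mu : probability (measurableTypeR R) R)
    (xs : R) :
  [/\ forall X : forall n : nat, n.-tuple R,
        (forall n, sorted <=%R (X n)) ->
        weakly_converges (fun n => empirical (X n)) mu ->
        0 < inv_cube_integral mu xs ->
        (0 < limn_einf (fun n => edist_inf (msupport (empirical (X n))) xs))%E ->
        (fun n => kolmogorov_dist (empirical (X n)) mu)
          =o_\oo (fun n => n%:R `^ (- (2 / 3)) : R) ->
        forall (x0 : nat -> R) (gamma : nat -> R -> R[i]),
        (forall n, (0 < n)%N -> admissible (X n) (x0 n) (gamma n)) ->
        cvg_unif_compact
          (fun n => rescaled_kernel (t_edge mu xs n) (x_star mu xs)
                      (c2 mu xs * n%:R `^ (2 / 3)) (X n) xs (x0 n) (gamma n))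
          airy_kernel,
      forall X : forall n : nat, n.-tuple R,
        (forall n, sorted <=%R (X n)) ->
        weakly_converges (fun n => empirical (X n)) mu ->
        inv_cube_integral mu xs = 0 ->
        (0 < limn_einf (fun n => edist_inf (msupport (empirical (X n))) xs))%E ->
        (fun n => kolmogorov_dist (empirical (X n)) mu)
          =o_\oo (fun n => n%:R `^ (- (3 / 4)) : R) ->
        forall (x0 : nat -> R) (gamma : nat -> R -> R[i]),
        (forall n, (0 < n)%N -> admissible (X n) (x0 n) (gamma n)) ->
        cvg_unif_compact
          (fun n => rescaled_kernel (t_merge mu xs n) (x_star mu xs)
                      (c3 mu xs * n%:R `^ (3 / 4)) (X n) xs (x0 n) (gamma n))
          pearcey_kernel
    & forall a : R,
        inv_cube_integral mu xs = 0 ->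
        (0 < edist_inf (msupport mu) xs)%E ->
        0 <= a ->
        exists (X : forall n : nat, n.-tuple R) (xg : nat -> R) (b : R),
          [/\ forall n, sorted <=%R (X n),
              weakly_converges (fun n => empirical (X n)) mu,
              forall n, xg n \notin X n
            & forall (x0 : nat -> R) (gamma : nat -> R -> R[i]),
              (forall n, (0 < n)%N -> admissible (X n) (x0 n) (gamma n)) ->
              cvg_unif_compact
                (fun n => rescaled_kernel (t_merge mu xs n) (x_star mu xs)
                            (c3 mu xs * n%:R `^ (3 / 4)) (X n) (xg n)
                            (x0 n) (gamma n))
                (fun tau1 tau2 u v => transition_kernel a tau1 tau2
                                        (u + tau1 * b) (v + tau2 * b))]].
Proof.
have mu1 : mu setT = 1%E := probability_setT mu.
(* Common input of the first two parts: the gap of the X_j passes to [mu] with half the width, and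
   the rate of the Kolmogorov distance is put in multiplicative form. *)
have gaps (al : R) (X : forall n, n.-tuple R) : 0 < al ->
    (0 < limn_einf (fun n => edist_inf (msupport (empirical (X n))) xs))%E ->
    (fun n => kolmogorov_dist (empirical (X n)) mu) =o_\oo (fun n => n%:R `^ (- al) : R) ->
    exists D, [/\ 0 < D, gapped xs D mu, \forall n \near \oo, gapped xs D (empirical (X n)),
      \forall n \near \oo, forall a, a \in X n -> D <= `|xs - a| &
      (fun n => n%:R `^ al * kolmogorov_dist (empirical (X n)) mu) @ \oo --> (0:R)].
  move=> al0 li ho; have [D D0 gX] := eventually_gap X xs li.
  have [gm gE] := gapped_of_empirical X mu xs D mu1 D0 gX (littleo_powR_cvg0 _ _ al0 ho).
  exists (D / 2); split=> //; [by rewrite divr_gt0| |exact: littleo_powR].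
  by apply: filterS gX => n h a /h; lra.
split.
- move=> X _ _ I0 li ho x0 gamma adm.
  have [|D [D0 gm gE gX dA]] := gaps _ X _ li ho; first by rewrite divr_gt0.
  apply: unif_compact_of_sequences => M t1 t2 u v bp.
  exact: (edge_limit mu xs D X x0 gamma M t1 t2 u v D0 gm gE gX I0 dA adm bp).
- move=> X _ _ I0 li ho x0 gamma adm.
  have [|D [D0 gm gE gX dA]] := gaps _ X _ li ho; first by rewrite divr_gt0.
  apply: unif_compact_of_sequences => M t1 t2 u v bp.
  exact: (pearcey_limit mu xs D X x0 gamma M t1 t2 u v D0 gm gE gX I0 dA adm bp).
- move=> a I0 sd a0; have [D D0 gm] := gapped_of_support mu xs mu1 sd.
  exists (tr_points mu xs a), (tr_gauge mu xs a), (- (a / 3)); split.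
  + exact: sorted_tr_points.
  + exact: (tr_points_weak mu xs D a D0 gm).
  + exact: tr_gauge_notin.
  + move=> x0 gamma adm; apply: unif_compact_of_sequences => M t1 t2 u v bp.
    exact: (transition_limit mu xs D a D0 gm I0 x0 gamma M t1 t2 u v adm bp).
Qed.
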